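(* There is an absolute constant $C$ such that the following holds. Let $k\in\{1,2,3,4\}$, $0<\alpha<1$ and $\epsilon>0$. Then there exists $K=K(\alpha,\epsilon)$ such that for any $N\ge1$ and any $A\subseteq[N]$ with $|A|\ge\alpha N$ there exists $\mu:\mathbb{Z}\to\mathbb{R}^+$ with $|\mathbb{E}_{d\in[-N,N]}\mu(d)-1|\le C\epsilon$, $\sup_{d\in[-N,N]}\mu(d)\le K$, and $$\mathbb{E}_{n\in[N];d\in[-N,N]}1_A(n)1_A(n+d)\cdots1_A(n+(k-1)d)\mu(d)\ge\alpha^k-C\epsilon.$$
   Context: $[N]=\{1,\dots,N\}$, $[-N,N]$ is the set of integers in that interval, $\mathbb{E}_{a\in S}=\frac1{|S|}\sum_{a\in S}$, and $1_A$ is the indicator of $A$ (zero outside $A$). *)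

(* Defs.v *)
From Stdlib Require Import Reals ZArith.
Open Scope R_scope.

Fixpoint sumZ_from (a : Z) (n : nat) (f : Z -> R) : R :=
  match n with
  | O => 0
  | S n' => f a + sumZ_from (a + 1)%Z n' f
  end.

Definition sumZ (a b : Z) (f : Z -> R) : R :=
  sumZ_from a (Z.to_nat (b - a + 1)) f.

Definition avgZ (a b : Z) (f : Z -> R) : R :=
  sumZ a b f / IZR (b - a + 1).

Definition ind (A : Z -> bool) (x : Z) : R := if A x then 1 else 0.

Fixpoint approd (A : Z -> bool) (n d : Z) (k : nat) : R :=
  match k with
  | O => 1
  | S k' => approd A n d k' * ind A (n + Z.of_nat k' * d)
  end.

Definition cardN (A : Z -> bool) (N : Z) : R := sumZ 1 N (ind A).

(* Main.v *)
Require Import Defs.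
From Stdlib Require Import Reals ZArith.
From Stdlib Require Import Lra Lia.
Open Scope R_scope.


(* The interval is embedded in a cyclic group whose order is coprime to all small integers, and
   the weight mu is the self-convolution of a smooth weight on a Bohr set adapted to A.

   If f has large U^3 norm, the large values of |A_f(t, xi)|, where A_f(t, .) is the Fourier
   transform of n |-> f(n + t) conj f(n), are shown by dependent random choice and Croot--Sisask
   almost periodicity to contain the graph of a map that is linear on a Bohr set; Cauchy--Schwarz
   makes the associated bilinear phase symmetric, and f correlates with a function that is
   locally a quadratic phase.  An energy increment, with polynomial truncation, then writes 1_A
   as u + (L^2-small) + (U^3-uniform), where u is a bounded combination of such functions, and a
   von Neumann inequality reduces the count for 1_A to the one for u.

   For u, the Bohr set is shrunk until every relevant monomial in its phases has a second order
   part that is either almost trivial or uniformly distributed.  A product of four phases along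
   x, x + d, x + 2d, x + 3d survives the averaging only if the second order parts are
   b^-1, b^3, b^-3, b for some b.  Grouping phases with the same b, the count becomes the average
   over x of a sum of |u_b|^2 |u_{b^3}|^2, which is at least u_1^4, and Jensen's inequality applied
   to the local average u_1 of u gives the power of the density.  With fewer than four terms
   only b = 1 survives. *)


(** All constants must be independent of the group, so every lemma fixes ranks and radii before the
    group is given. Coprimality to small integers serves three ends: division by 2 turns a bilinear
    form into a quadratic phase, multiplication by 1, 2, 3 is injective in the von Neumann argument,
    and an element all of whose small multiples lie in a set of bounded size must vanish, which
    makes the spectral relation a function. The self-convolution has two merits: its Fourier
    transform is absolutely summable, so inserting mu costs a bounded factor, and its steps are sums
    a + b of independent a and b, whose cross terms can be tested for uniform distribution. This mu
    depends on the complexity of u, so the uniform part must be small in terms of that complexity;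
    an arbitrary growth function in the decomposition, paid for by the L^2-small part, resolves the
    circularity. The exponents -1, 3, -3, 1 reflect that third differences of x^2 vanish: (x+3d)^2 -
    3(x+2d)^2 + 3(x+d)^2 - x^2 = 0. *)

(** * Cosines and sines of multiples of 2 PI / M *)

Section Circle.
Definition ecos (M n : nat) := cos (2 * PI * INR n / INR M).
Definition esin (M n : nat) := sin (2 * PI * INR n / INR M).

Lemma angle_add M a b : 2 * PI * INR (a + b) / INR M = 2 * PI * INR a / INR M + 2 * PI * INR b / INR M.
Proof. rewrite plus_INR. unfold Rdiv. ring. Qed.

Lemma ecos_add M a b : ecos M (a + b) = ecos M a * ecos M b - esin M a * esin M b.
Proof. unfold ecos, esin. rewrite angle_add. apply cos_plus. Qed.

Lemma esin_add M a b : esin M (a + b) = esin M a * ecos M b + ecos M a * esin M b.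
Proof. unfold ecos, esin. rewrite angle_add. apply sin_plus. Qed.

Lemma angle_period M j : (0 < M)%nat -> 2 * PI * INR (j * M) / INR M = 0 + 2 * INR j * PI.
Proof. intros H. rewrite mult_INR. field. apply not_0_INR. lia. Qed.

Lemma ecos_period M j : (0 < M)%nat -> ecos M (j * M) = 1.
Proof. intros H. unfold ecos. rewrite angle_period; trivial. rewrite cos_period. apply cos_0. Qed.

Lemma esin_period M j : (0 < M)%nat -> esin M (j * M) = 0.
Proof. intros H. unfold esin. rewrite angle_period; trivial. rewrite sin_period. apply sin_0. Qed.

(** On the second half of the circle the angle is reflected to 2 PI minus itself; both halves then
    follow from the monotonicity of cosine on [0, PI]. *)
Lemma ecos_far M y d : (0 < M)%nat -> 0 < d <= 1 / 2 -> d * INR M <= INR y <= (1 - d) * INR M ->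
  ecos M y <= cos (2 * PI * d).
Proof.
intros H [d0 d1] [h1 h2]. assert (M0 : 0 < INR M) by (apply lt_0_INR; lia).
assert (P0 := PI_RGT_0). unfold ecos. set (t := INR y / INR M).
assert (t1 : d <= t) by (unfold t; apply Rmult_le_reg_r with (INR M); [lra|]; unfold Rdiv; rewrite Rmult_assoc, Rinv_l; lra).
assert (t2 : t <= 1 - d) by (unfold t; apply Rmult_le_reg_r with (INR M); [lra|]; unfold Rdiv; rewrite Rmult_assoc, Rinv_l; lra).
replace (2 * PI * INR y / INR M) with (2 * PI * t) by (unfold t, Rdiv; ring).
assert (K : forall z, 0 <= z <= 1 / 2 -> 0 <= 2 * PI * z <= PI) by (intros z hz; split; nra).
destruct (Rle_dec t (1 / 2)) as [h|h].
- apply cos_decr_1; [apply K; lra|apply K; lra|apply K; lra|apply K; lra|].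
  apply Rmult_le_compat_l; lra.
- replace (2 * PI * t) with (2 * PI - 2 * PI * (1 - t)) by ring.
  rewrite cos_minus, cos_2PI, sin_2PI, Rmult_0_l, Rplus_0_r, Rmult_1_l.
  apply cos_decr_1; [apply K; lra|apply K; lra|apply K; lra|apply K; lra|].
  apply Rmult_le_compat_l; lra.
Qed.

Lemma cos_lt1 d : 0 < d <= 1 / 2 -> cos (2 * PI * d) < 1.
Proof.
intros [d0 d1]. assert (P0 := PI_RGT_0). rewrite <- cos_0. apply cos_decreasing_1; nra.
Qed.

(** Puts a residue that is nonzero mod M into the range of [ecos_far], with d half the grid spacing,
    so that a nontrivial character value is seen to differ from 1. *)
Lemma middle_bounds M y : (0 < y)%nat -> (y < M)%nat ->
  0 < / (2 * INR M) <= 1 / 2 /\ / (2 * INR M) * INR M <= INR y <= (1 - / (2 * INR M)) * INR M.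
Proof.
intros h1 h2. assert (M1 : 1 <= INR M) by (replace 1 with (INR 1) by reflexivity; apply le_INR; lia).
assert (y1 : 1 <= INR y) by (replace 1 with (INR 1) by reflexivity; apply le_INR; lia).
assert (yM : INR y + 1 <= INR M) by (rewrite <- S_INR; apply le_INR; lia).
assert (E : / (2 * INR M) * INR M = 1 / 2) by (field; lra).
split; [split|].
- apply Rinv_0_lt_compat; lra.
- replace (1 / 2) with (/ 2) by field. apply Rinv_le_contravar; lra.
- rewrite Rmult_minus_distr_r, E. lra.
Qed.

Lemma esin_cos M n : ecos M n * ecos M n + esin M n * esin M n = 1.
Proof. unfold ecos, esin. generalize (sin2_cos2 (2 * PI * INR n / INR M)). unfold Rsqr. lra. Qed.
End Circle.

Module PopularDifferences.
From HB Require Import structures.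
From mathcomp Require Import all_boot all_order all_algebra.
From mathcomp Require Import complex.
From mathcomp Require Import boolp reals Rstruct.
From mathcomp Require Import ring lra zify.
Require Import Defs.
Set Implicit Arguments.
Unset Strict Implicit.
Unset Printing Implicit Defensive.
Import Order.TTheory GRing.Theory Num.Theory.
Local Close Scope R_scope.
Local Open Scope ring_scope.
Local Open Scope complex_scope.
Local Notation Re := complex.Re.
Local Notation Im := complex.Im.

(** * Modulus, Cauchy-Schwarz and weighted averages *)

Section Modulus.
Variable R : realType.
Local Notation C := R[i].
(** The library norm of [C] takes values in [C]; this real-valued version (see [nmE]) keeps all
    estimates inside the ordered field [R]. *)
Definition nm (z : C) : R := Num.sqrt (Re z ^+ 2 + Im z ^+ 2).
Definition cj (z : C) : C := conjc z.
Lemma nmE z : `|z| = (nm z)%:C. Proof. exact: normc_def. Qed.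
Lemma nm_ge0 z : 0 <= nm z. Proof. exact: sqrtr_ge0. Qed.
Lemma nmM x y : nm (x * y) = nm x * nm y.
Proof. by apply: complexI; rewrite -nmE normrM !nmE rmorphM. Qed.
Lemma nmD x y : nm (x + y) <= nm x + nm y.
Proof. by rewrite -lecR rmorphD /= -!nmE ler_normD. Qed.
Lemma nmN x : nm (- x) = nm x.
Proof. by apply: complexI; rewrite -!nmE normrN. Qed.
Lemma nm0 : nm 0 = 0. Proof. by apply: complexI; rewrite -nmE normr0. Qed.
Lemma nm1 : nm 1 = 1. Proof. by apply: complexI; rewrite -nmE normr1. Qed.
Lemma nmBC (x y : C) : nm (x - y) = nm (y - x).
Proof. by rewrite -nmN opprB. Qed.
Lemma nmX x n : nm (x ^+ n) = nm x ^+ n.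
Proof. by elim: n => [|n IH]; rewrite ?expr0 ?nm1 // !exprS nmM IH. Qed.
Lemma nm_cj x : nm (cj x) = nm x.
Proof. by apply: complexI; rewrite -!nmE normcJ. Qed.
Lemma nmR (x : R) : nm x%:C = `|x|.
Proof. by rewrite /nm /= expr0n /= addr0 sqrtr_sqr. Qed.
Lemma nm_sum (I : Type) (r : seq I) (P : pred I) (F : I -> C) :
  nm (\sum_(i <- r | P i) F i) <= \sum_(i <- r | P i) nm (F i).
Proof.
elim/big_rec2 : _ => [|i y x _ H]; first by rewrite nm0.
by apply: (le_trans (nmD _ _)); rewrite lerD2l.
Qed.
Lemma nm_prod (I : Type) (r : seq I) (P : pred I) (F : I -> C) :
  nm (\prod_(i <- r | P i) F i) = \prod_(i <- r | P i) nm (F i).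
Proof. by elim/big_rec2 : _ => [|i y x _ H]; rewrite ?nm1 // nmM H. Qed.
Lemma nm_sqr z : (nm z ^+ 2)%:C = z * cj z.
Proof. by rewrite rmorphXn /= -nmE sqr_normc. Qed.
Lemma Re_le z : Re z <= nm z.
Proof.
rewrite /nm; apply: (le_trans (ler_norm _)); rewrite -sqrtr_sqr.
by rewrite ler_sqrt ?addr_ge0 ?sqr_ge0 // lerDl sqr_ge0.
Qed.
Lemma Re_ge z : - nm z <= Re z.
Proof. by rewrite lerNl -nmN; apply: le_trans (Re_le _); case: z. Qed.
Lemma ReD (x y : C) : Re (x + y) = Re x + Re y. Proof. by case: x y => [? ?] [? ?]. Qed.
Lemma ReN (x : C) : Re (- x) = - Re x. Proof. by case: x. Qed.
Lemma ReZ (a : R) (x : C) : Re (a%:C * x) = a * Re x.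
Proof. by case: x => u v /=; rewrite mul0r subr0. Qed.
Lemma Re_sum (I : Type) (r : seq I) (P : pred I) (F : I -> C) :
  Re (\sum_(i <- r | P i) F i) = \sum_(i <- r | P i) Re (F i).
Proof. by elim/big_rec2 : _ => [//|i y x _ H]; rewrite ReD H. Qed.
Lemma Re_cj (x : C) : Re (cj x) = Re x. Proof. by case: x. Qed.
Lemma nm_eq0 z : (nm z == 0) = (z == 0).
Proof. by rewrite -(normr_eq0 z) nmE -[0 in RHS](rmorph0 (real_complex R)) (inj_eq (@complexI R)). Qed.
Lemma cjB x y : cj (x - y) = cj x - cj y. Proof. exact: rmorphB. Qed.
Lemma cjM x y : cj (x * y) = cj x * cj y. Proof. exact: rmorphM. Qed.
Lemma cj1 : cj 1 = 1. Proof. exact: rmorph1. Qed.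
Lemma cj0 : cj 0 = 0. Proof. exact: rmorph0. Qed.
Lemma cjK : involutive cj. Proof. exact: conjcK. Qed.
Lemma cjR (x : R) : cj x%:C = x%:C. Proof. exact: conjc_real. Qed.
Lemma cj_sum (I : Type) (r : seq I) (P : pred I) (F : I -> C) :
  cj (\sum_(i <- r | P i) F i) = \sum_(i <- r | P i) cj (F i).
Proof. exact: rmorph_sum. Qed.
Lemma nm_tri (x y : C) : nm x <= nm y + nm (x - y).
Proof. by rewrite -{1}[x](subrK y) addrC nmD. Qed.
Lemma nm_dist (x y z : C) : nm (x - z) <= nm (x - y) + nm (y - z).
Proof. by have -> : x - z = (x - y) + (y - z); [ring | exact: nmD]. Qed.
Lemma unit_cj z : nm z = 1 -> z * cj z = 1.
Proof. by move=> H; rewrite -nm_sqr H expr1n. Qed.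
Lemma nm_le1M x y : nm x <= 1 -> nm y <= 1 -> nm (x * y) <= 1.
Proof. by move=> hx hy; rewrite nmM mulr_ile1 ?nm_ge0. Qed.
Lemma nm_unitM x y : nm x = 1 -> nm y = 1 -> nm (x * y) = 1.
Proof. by move=> hx hy; rewrite nmM hx hy mulr1. Qed.
Lemma nm_unitX x n : nm x = 1 -> nm (x ^+ n) = 1.
Proof. by move=> hx; rewrite nmX hx expr1n. Qed.
Lemma nm_mul_dist (a b c d : C) : nm a <= 1 -> nm d <= 1 ->
  nm (a * b - c * d) <= nm (a - c) + nm (b - d).
Proof.
move=> ha hd; have -> : a * b - c * d = a * (b - d) + (a - c) * d; first by ring.
apply: (le_trans (nmD _ _)); rewrite !nmM [leRHS]addrC; apply: lerD.
  by rewrite ler_piMl ?nm_ge0.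
by rewrite ler_piMr ?nm_ge0.
Qed.
Lemma CS_real (I : finType) (P : pred I) (a b : I -> R) :
  (\sum_(i | P i) a i * b i) ^+ 2 <= (\sum_(i | P i) a i ^+ 2) * (\sum_(i | P i) b i ^+ 2).
Proof.
set A := \sum_(i | P i) a i ^+ 2; set B := \sum_(i | P i) b i ^+ 2; set S := \sum_(i | P i) _.
have A0 : 0 <= A by apply: sumr_ge0 => i _; exact: sqr_ge0.
(* Positivity of this quadratic in t, a sum of squares, gives the inequality at t = S / A; the case
   A = 0 is separate. *)
have key (t : R) : 0 <= A * t ^+ 2 - 2 * t * S + B.
  have -> : A * t ^+ 2 - 2 * t * S + B = \sum_(i | P i) (a i * t - b i) ^+ 2.
    rewrite /A /B /S mulr_suml mulr_sumr -sumrN -!big_split /=.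
    by apply: eq_bigr => i _; ring.
  by apply: sumr_ge0 => i _; exact: sqr_ge0.
have [A00|An0] := eqVneq A 0.
  have S0 : S = 0.
    rewrite /S big1 // => i Pi.
    have /eqP : \sum_(i | P i) a i ^+ 2 = 0 by [].
    rewrite psumr_eq0 => [/allP /(_ i (mem_index_enum _))|j _]; last exact: sqr_ge0.
    by rewrite Pi sqrf_eq0 /= => /eqP ->; rewrite mul0r.
  by rewrite S0 A00 mul0r expr0n.
have Ap : 0 < A by rewrite lt_def An0.
have := key (S / A).
have -> : A * (S / A) ^+ 2 - 2 * (S / A) * S + B = (A * B - S ^+ 2) / A by field.
by rewrite pmulr_lge0 ?invr_gt0 // subr_ge0.
Qed.
Lemma CS_complex (I : finType) (P : pred I) (a b : I -> C) :
  nm (\sum_(i | P i) a i * b i) ^+ 2 <=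
  (\sum_(i | P i) nm (a i) ^+ 2) * (\sum_(i | P i) nm (b i) ^+ 2).
Proof.
apply: le_trans (CS_real P (fun i => nm (a i)) (fun i => nm (b i))).
rewrite lerXn2r ?nnegrE ?nm_ge0 ?sumr_ge0 // => [i _|]; first by rewrite mulr_ge0 ?nm_ge0.
by apply: (le_trans (nm_sum _ _ _)); apply: ler_sum => i _; rewrite nmM.
Qed.
Definition prob (I : finType) (s : I -> R) := (forall x, 0 <= s x) /\ \sum_x s x = 1.
Lemma jensen2 (I : finType) (s : I -> R) (F : I -> R) : prob s ->
  (\sum_x s x * F x) ^+ 2 <= \sum_x s x * F x ^+ 2.
Proof.
move=> [s0 s1].
have H := CS_real xpredT (fun x => Num.sqrt (s x)) (fun x => Num.sqrt (s x) * F x).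
have E1 : \sum_x Num.sqrt (s x) * (Num.sqrt (s x) * F x) = \sum_x s x * F x.
  by apply: eq_bigr => x _; rewrite mulrA -expr2 sqr_sqrtr.
have E2 : \sum_x Num.sqrt (s x) ^+ 2 = 1 by rewrite -s1; apply: eq_bigr => x _; rewrite sqr_sqrtr.
have E3 : \sum_x (Num.sqrt (s x) * F x) ^+ 2 = \sum_x s x * F x ^+ 2.
  by apply: eq_bigr => x _; rewrite exprMn sqr_sqrtr.
by move: H; rewrite E1 E2 E3 mul1r.
Qed.
(** Pigeonhole for a weighted average. That the chosen point has positive weight matters: it places
    the point in the support, where Bohr norms are controlled. *)
Lemma wavg_ex (I : finType) (s : I -> R) (F : I -> R) c : prob s ->
  c <= \sum_x s x * F x -> exists x, 0 < s x /\ c <= F x.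
Proof.
move=> [s0 s1] H; apply: contrapT => /forallNP Hn.
have HF x : 0 < s x -> F x < c.
  by move=> sx; have := Hn x; move/not_andP => [//|] /negP; rewrite -ltNge.
have [x sx] : exists x, 0 < s x.
  apply: contrapT => /forallNP Hs; have : \sum_x s x = 0.
    by rewrite big1 // => i _; apply/eqP; rewrite eq_le s0 andbT leNgt; apply/negP/Hs.
  by rewrite s1 => /eqP; rewrite oner_eq0.
have : \sum_y s y * F y < \sum_y s y * c.
  rewrite [ltLHS](bigD1 x) //= [ltRHS](bigD1 x) //=; apply: ltr_leD; first by rewrite ltr_pM2l // HF.
  apply: ler_sum => y _; have [->|sy] := eqVneq (s y) 0; first by rewrite !mul0r.
  by apply: ler_wpM2l => //; apply/ltW/HF; rewrite lt_def sy s0.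
by rewrite -mulr_suml s1 mul1r => H2; have := le_lt_trans H H2; rewrite ltxx.
Qed.
Lemma wavg_le (I : finType) (s : I -> R) (F : I -> R) c : prob s ->
  (forall x, s x != 0 -> F x <= c) -> \sum_x s x * F x <= c.
Proof.
move=> [s0 s1] H; apply: (@le_trans _ _ (\sum_x s x * c)); last by rewrite -mulr_suml s1 mul1r.
apply: ler_sum => x _; have [->|sx] := eqVneq (s x) 0; first by rewrite !mul0r.
by apply: ler_wpM2l => //; exact: H.
Qed.
Lemma wnm (I : finType) (s : I -> R) (F : I -> C) : (forall x, 0 <= s x) ->
  nm (\sum_x (s x)%:C * F x) <= \sum_x s x * nm (F x).
Proof.
move=> s0; apply: (le_trans (nm_sum _ _ _)); apply: ler_sum => x _.
by rewrite nmM nmR ger0_norm.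
Qed.
Lemma wnm_le (I : finType) (s : I -> R) (F : I -> C) c : prob s ->
  (forall x, s x != 0 -> nm (F x) <= c) -> nm (\sum_x (s x)%:C * F x) <= c.
Proof. by move=> sp H; apply: (le_trans (wnm _ sp.1)); exact: wavg_le. Qed.
Lemma wnm_dist (I : finType) (s : I -> R) (F F' : I -> C) c : prob s ->
  (forall x, s x != 0 -> nm (F x - F' x) <= c) ->
  nm (\sum_x (s x)%:C * F x - \sum_x (s x)%:C * F' x) <= c.
Proof.
move=> sp H; rewrite -sumrB; under eq_bigr do rewrite -mulrBr.
exact: wnm_le.
Qed.
End Modulus.
Arguments nm {R} z : simpl never.
Arguments cj {R} z : simpl never.

(** * Bohr sets and Fourier analysis *)

(** A finite abelian group identified with its dual by a symmetric nondegenerate bicharacter, so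
    that points and frequencies share one type. *)
Record env (R : realType) := Env {
  gp :> finZmodType;
  ch : gp -> gp -> R[i];
  chDl : forall x y z, ch (x + y) z = ch x z * ch y z;
  chC : forall x y, ch x y = ch y x;
  ch_nm : forall x y, nm (ch x y) = 1;
  ch_orth0 : forall y, y != 0 -> \sum_x ch x y = 0 }.
Arguments ch {R e} x y.

Lemma pigeonhole (T U : finType) (S : {set T}) (f : T -> U) : S != set0 ->
  exists u, (#|S| <= #|U| * #|S :&: [set x | f x == u]|)%N /\ S :&: [set x | f x == u] != set0.
Proof.
move=> /set0Pn [x0 x0S].
pose F u := #|S :&: [set x | f x == u]|.
case: (@arg_maxnP U (f x0) xpredT F isT) => u _ Hu.
have Hc : (#|S| <= #|U| * F u)%N.
  have -> : #|S| = (\sum_v F v)%N.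
    rewrite -sum1_card (partition_big f xpredT) //=; apply: eq_bigr => v _.
    by rewrite sum1_card /F; apply: eq_card => x; rewrite !inE unfold_in.
  by rewrite -sum_nat_const; apply: leq_sum => v _; exact: Hu.
exists u; split => //; apply/negP => /eqP H0; move: Hc; rewrite /F H0 cards0 muln0 leqn0 cards_eq0.
by move/eqP => S0; rewrite S0 inE in x0S.
Qed.

Section Env.
Variables (R : realType).
Local Notation C := R[i].
Section One.
Variable X : env R.
Definition q : R := #|X|%:R.
Lemma q_gt0 : 0 < q.
Proof. by rewrite ltr0n; apply/card_gt0P; exists 0. Qed.
Lemma q_neq0 : q != 0. Proof. by rewrite gt_eqF ?q_gt0. Qed.
Lemma chDr (x y z : X) : ch x (y + z) = ch x y * ch x z.
Proof. by rewrite chC chDl !(chC x). Qed.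
Lemma ch_unit (x y : X) : ch x y * cj (ch x y) = 1.
Proof. by rewrite unit_cj // ch_nm. Qed.
Lemma ch_neq0 (x y : X) : ch x y != 0.
Proof. by rewrite -nm_eq0 ch_nm oner_eq0. Qed.
Lemma ch0l (x : X) : ch 0 x = 1.
Proof. by apply: (mulfI (ch_neq0 0 x)); rewrite -chDl addr0 mulr1. Qed.
Lemma ch0r (x : X) : ch x 0 = 1. Proof. by rewrite chC ch0l. Qed.
Lemma chNl (x y : X) : ch (- x) y = cj (ch x y).
Proof. by apply: (mulfI (ch_neq0 x y)); rewrite -chDl subrr ch0l ch_unit. Qed.
Lemma chNr (x y : X) : ch x (- y) = cj (ch x y).
Proof. by rewrite chC chNl chC. Qed.
Lemma chBr (x y z : X) : ch x (y - z) = ch x y * cj (ch x z).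
Proof. by rewrite chDr chNr. Qed.
Lemma chMnr (x y : X) n : ch x (y *+ n) = ch x y ^+ n.
Proof. by elim: n => [|n IH]; rewrite ?mulr0n ?ch0r // mulrS chDr IH exprS. Qed.
Lemma ch_orth (y : X) : \sum_(x : X) ch x y = if y == 0 then q%:C else 0.
Proof.
case: eqP => [->|/eqP]; last exact: ch_orth0.
under eq_bigr do rewrite ch0r.
by rewrite sumr_const rmorph_nat.
Qed.
Lemma sum_shift (V : zmodType) (h : X) (F : X -> V) : \sum_x F (x + h) = \sum_x F x.
Proof.
by rewrite [RHS](reindex (fun x : X => x + h)) //; exists (fun x => x - h) => x _; rewrite ?addrK ?subrK.
Qed.
Lemma sum_opp (V : zmodType) (F : X -> V) : \sum_x F (- x) = \sum_x F x.
Proof.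
by rewrite [RHS](reindex (fun x : X => - x)) //; exists (fun x => - x) => x _; rewrite opprK.
Qed.
Definition ft (F : X -> C) (xi : X) : C := \sum_x F x * cj (ch xi x).
Lemma plancherel (F G : X -> C) : \sum_xi ft F xi * cj (ft G xi) = q%:C * \sum_x F x * cj (G x).
Proof.
transitivity (\sum_x \sum_y F x * cj (G y) * \sum_xi ch xi (y - x)).
  rewrite /ft; transitivity (\sum_xi \sum_x \sum_y F x * cj (G y) * ch xi (y - x)).
    apply: eq_bigr => xi _; rewrite mulr_suml; apply: eq_bigr => x _.
    rewrite cj_sum mulr_sumr; apply: eq_bigr => y _.
    by rewrite cjM cjK chBr; ring.
  rewrite exchange_big; apply: eq_bigr => x _; rewrite exchange_big; apply: eq_bigr => y _.
  by rewrite mulr_sumr.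
rewrite mulr_sumr; apply: eq_bigr => x _; rewrite (bigD1 x) //= [X in _ + X]big1 ?addr0 => [|y yx].
  by rewrite ch_orth subrr eqxx mulrC.
by rewrite ch_orth subr_eq0 (negbTE yx) mulr0.
Qed.
Lemma parseval (F : X -> C) : \sum_xi nm (ft F xi) ^+ 2 = q * \sum_x nm (F x) ^+ 2.
Proof.
apply: complexI; rewrite rmorphM /= !rmorph_sum /=.
under eq_bigr do rewrite nm_sqr.
by rewrite plancherel; congr (_ * _); apply: eq_bigr => x _; rewrite nm_sqr.
Qed.
Lemma ft_inv (F : X -> C) x : \sum_xi ft F xi * ch xi x = q%:C * F x.
Proof.
have H := plancherel F (fun y => (y == x)%:R).
have E xi : ft (fun y => (y == x)%:R) xi = cj (ch xi x).
  by rewrite /ft (bigD1 x) //= eqxx mul1r big1 ?addr0 // => y /negbTE ->; rewrite mul0r.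
have E2 : \sum_xi ft F xi * ch xi x = \sum_xi ft F xi * cj (ft (fun y => (y == x)%:R) xi).
  by apply: eq_bigr => xi _; rewrite E cjK.
rewrite E2 H; congr (_ * _); rewrite (bigD1 x) //= eqxx cj1 mulr1 big1 ?addr0 // => y /negbTE ->.
by rewrite cj0 mulr0.
Qed.

(** A subadditive symmetric function whose balls are the Bohr sets with frequency list G. Working
    with it instead of with sets leaves the radii free to vary. *)
Definition nB (G : seq X) (x : X) : R := \big[Num.max/0]_(xi <- G) nm (1 - ch xi x).
Lemma nB_ge0 G x : 0 <= nB G x.
Proof. by rewrite /nB; elim/big_rec: _ => // i y _ H; rewrite le_max H orbT. Qed.
Lemma nB_leP G x r : 0 <= r -> reflect (forall xi, xi \in G -> nm (1 - ch xi x) <= r) (nB G x <= r).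
Proof.
move=> r0; apply: (iffP idP); rewrite /nB; elim: G => [//|g G IH]; rewrite ?big_nil ?big_cons //.
  rewrite ge_max => /andP [H1 H2] xi; rewrite inE => /orP [/eqP -> //|]; exact: IH.
move=> H; rewrite ge_max H ?mem_head //=; apply: IH => xi xG; apply: H.
by rewrite inE xG orbT.
Qed.
Lemma nB_mem G x xi : xi \in G -> nm (1 - ch xi x) <= nB G x.
Proof. by apply/nB_leP; rewrite ?nB_ge0. Qed.
Lemma nB0 G : nB G 0 = 0.
Proof.
apply/eqP; rewrite eq_le nB_ge0 andbT; apply/nB_leP => // xi _.
by rewrite ch0r subrr nm0.
Qed.
Lemma nBN G x : nB G (- x) = nB G x.
Proof.
rewrite /nB; apply: eq_bigr => xi _.
by rewrite -[RHS]nm_cj cjB cj1 chNr.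
Qed.
Lemma nm1M (a b : C) : nm a = 1 -> nm (1 - a * b) <= nm (1 - a) + nm (1 - b).
Proof.
move=> ha; have -> : 1 - a * b = (1 - a) + a * (1 - b) by ring.
by apply: (le_trans (nmD _ _)); rewrite (nmM a) ha mul1r.
Qed.
Lemma nBD G x y : nB G (x + y) <= nB G x + nB G y.
Proof.
apply/nB_leP; first by rewrite addr_ge0 ?nB_ge0.
move=> xi xG; rewrite chDr; apply: (le_trans (nm1M _ (ch_nm _ _))).
by apply: lerD; apply: nB_mem.
Qed.
Lemma nBB G x y : nB G (x - y) <= nB G x + nB G y.
Proof. by rewrite -(nBN G y) nBD. Qed.
Lemma nBMn G x n : nB G (x *+ n) <= n%:R * nB G x.
Proof.
elim: n => [|n IH]; first by rewrite mulr0n nB0 mul0r.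
rewrite mulrS; apply: (le_trans (nBD _ _ _)); apply: (@le_trans _ _ (nB G x + n%:R * nB G x)).
  by rewrite lerD2l.
by rewrite -natr1 mulrDl mul1r addrC.
Qed.
Lemma nB_sub (G G' : seq X) x : {subset G <= G'} -> nB G x <= nB G' x.
Proof. by move=> H; apply/nB_leP; rewrite ?nB_ge0 // => xi /H; exact: nB_mem. Qed.

(** The L^1-Lipschitz clause plays the part that regular Bohr sets usually play: averages against s
    are stable under small shifts. *)
Definition wt (K : R) (G : seq X) (r : R) (s : X -> R) :=
  [/\ prob s, forall x, s x != 0 -> nB G x <= r, forall x, s x <= K / q &
      forall h, \sum_x `|s (x - h) - s x| <= K * nB G h].
Lemma wt_shift K G r s (F : X -> C) h : wt K G r s -> (forall x, nm (F x) <= 1) ->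
  nm (\sum_x (s x)%:C * F (x + h) - \sum_x (s x)%:C * F x) <= K * nB G h.
Proof.
move=> [_ _ _ Hs] HF.
rewrite -[X in nm (X - _)](sum_shift (- h)) -sumrB.
under eq_bigr do rewrite subrK -mulrBl -rmorphB /=.
apply: (le_trans (nm_sum _ _ _)); apply: le_trans (Hs h); apply: ler_sum => x _.
by rewrite nmM nmR ler_piMr.
Qed.
End One.

(** The unit disc is split by rounding n (Re z + 1) and n (Im z + 1); each lies in [0, 2n], hence 2n
    + 1 values per coordinate. *)
Lemma cells n : (0 < n)%N -> exists (U : finType) (f : C -> U), forall z z',
  nm z <= 1 -> nm z' <= 1 -> f z = f z' -> nm (z - z') <= 2 / n%:R.
Proof.
move=> n0; pose g (x : R) : 'I_((2 * n).+1) := inord (Num.truncn (n%:R * (x + 1))).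
have n0R : 0 < n%:R :> R by rewrite ltr0n.
have Hg (x y : R) : `|x| <= 1 -> `|y| <= 1 -> g x = g y -> `|x - y| <= 1 / n%:R.
  rewrite !ler_norml => /andP [x1 x2] /andP [y1 y2] /(congr1 (@nat_of_ord _)).
  have B (t : R) : -1 <= t -> t <= 1 -> (Num.truncn (n%:R * (t + 1)) < (2 * n).+1)%N /\
      ((Num.truncn (n%:R * (t + 1)))%:R <= n%:R * (t + 1) < (Num.truncn (n%:R * (t + 1))).+1%:R).
    move=> t1 t2; have t0 : 0 <= n%:R * (t + 1) by rewrite mulr_ge0 ?ler0n //; lra.
    have H := truncn_itv t0; split => //.
    rewrite ltnS -(ler_nat R); case/andP: H => H _; apply: (le_trans H); rewrite natrM mulrC ler_pM2r //; lra.
  case: (B x x1 x2) => Bx1 /andP [Bx2 Bx3]; case: (B y y1 y2) => By1 /andP [By2 By3].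
  rewrite !inordK // => E; rewrite E in Bx2 Bx3; move: Bx3 By3; rewrite -natr1 => Bx3 By3.
  have H1 : n%:R * (x - y) <= 1 by nra.
  have H2 : -1 <= n%:R * (x - y) by nra.
  by rewrite -mulNr ler_pdivrMr // ler_pdivlMr // [_ * n%:R]mulrC H1 H2.
exists ('I_((2 * n).+1) * 'I_((2 * n).+1))%type, (fun z => (g (Re z), g (Im z))) => z z' hz hz' [E1 E2].
have HR (t : C) : nm t <= 1 -> `|Re t| <= 1.
  by move=> ht; rewrite ler_norml; apply/andP; split; [have := Re_ge t|have := Re_le t]; lra.
have HI (t : C) : nm t <= 1 -> `|Im t| <= 1.
  move=> ht; rewrite -sqrtr_sqr -sqrtr1 ler_sqrt //.
  have : nm t ^+ 2 <= 1 by rewrite expr_le1 ?nm_ge0.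
  by rewrite /nm sqr_sqrtr ?addr_ge0 ?sqr_ge0 // => H; have := sqr_ge0 (Re t); lra.
have A1 := Hg _ _ (HR _ hz) (HR _ hz') E1.
have A2 := Hg _ _ (HI _ hz) (HI _ hz') E2.
have -> : z - z' = (Re z - Re z')%:C + 'i%C * (Im z - Im z')%:C.
  by case: z z' {hz hz' E1 E2 A1 A2} => [a b] [c d] /=; simpc.
apply: (le_trans (nmD _ _)); rewrite nmM !nmR.
have -> : nm 'i%C = 1 :> R by rewrite /nm /= expr0n expr1n add0r sqrtr1.
by rewrite mul1r; lra.
Qed.

Lemma cells_r (r : R) : 0 < r -> exists (U : finType) (f : C -> U), forall z z',
  nm z <= 1 -> nm z' <= 1 -> f z = f z' -> nm (z - z') <= r.
Proof.
move=> r0; pose n := (Num.truncn (2 / r)).+1.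
have [U [f H]] := @cells n isT; exists U, f => z z' h h' E.
apply: (le_trans (H _ _ h h' E)).
rewrite ler_pdivrMr ?ltr0n // mulrC -ler_pdivrMr //; apply/ltW.
by have /andP [] := truncn_itv (divr_ge0 (ler0n R 2) (ltW r0)).
Qed.

(** One frequency at a time, pigeonhole keeps at least a 1/|U| fraction of the points, on which that
    character is nearly constant. Translating the final set by one of its points puts it inside the
    Bohr ball. *)
Lemma bohr_dens (D : nat) (r : R) : 0 < r -> exists c : R, 0 < c /\ forall (X : env R) (G : seq X),
  (size G <= D)%N -> c * q X <= #|[set x | nB G x <= r]|%:R.
Proof.
move=> r0; have [U [f Hf]] := cells_r r0.
have U0 : (0 < #|U|)%N by apply/card_gt0P; exists (f 0).
exists ((#|U|%:R ^+ D)^-1); split; first by rewrite invr_gt0 exprn_gt0 ?ltr0n.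
move=> X G sG.
have [S [S0 SS Sc]] : exists S : {set X}, [/\ S != set0, (#|X| <= #|U| ^ size G * #|S|)%N &
    forall x y xi, x \in S -> y \in S -> xi \in G -> nm (ch xi x - ch xi y) <= r].
  elim: G {sG} => [|g G [S [S0 SS Sc]]].
    exists setT; split => //; first by apply/set0Pn; exists 0; rewrite inE.
    by rewrite cardsT mul1n.
  have [u [H1 H2]] := pigeonhole (fun x => f (ch g x)) S0.
  exists (S :&: [set x | f (ch g x) == u]); split => //.
    by rewrite /= expnSr -mulnA; apply: (leq_trans SS); rewrite leq_mul2l H1 orbT.
  move=> x y xi; rewrite !inE => /andP [xS /eqP xu] /andP [yS /eqP yu] /orP [/eqP ->|]; last exact: Sc.
  by apply: Hf; rewrite ?ch_nm // xu yu.
case/set0Pn: S0 => y0 y0S.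
rewrite mulrC ler_pdivrMr ?exprn_gt0 ?ltr0n //.
rewrite -natrX -natrM ler_nat; apply: (leq_trans SS); rewrite mulnC; apply: leq_mul; last by rewrite leq_pexp2l.
rewrite -(card_imset (mem S) (addIr (- y0))); apply: subset_leq_card; apply/subsetP => _ /imsetP [x xS ->].
rewrite inE; apply/nB_leP; first exact: ltW.
move=> xi xG; rewrite chBr.
have -> : 1 - ch xi x * cj (ch xi y0) = cj (ch xi y0) * (ch xi y0 - ch xi x).
  by rewrite mulrBr [cj _ * ch xi y0]mulrC ch_unit mulrC.
by rewrite nmM nm_cj ch_nm mul1r Sc.
Qed.

Lemma bump_ex (D : nat) (r : R) : 0 < r -> exists K : R, 1 <= K /\ forall (X : env R) (G : seq X),
  (size G <= D)%N -> exists s, wt K G r s.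
Proof.
move=> r0; have r20 : 0 < r / 2 by lra.
have [c [c0 Hc]] := bohr_dens D r20.
(* The summands serve 1 <= K, the sup bound and the Lipschitz bound respectively. *)
exists (1 + 2 / c + 2 / (c * r)); split.
  by rewrite -addrA lerDl addr_ge0 // divr_ge0 ?mulr_ge0 ?ltW.
move=> X G sG; have q0 := q_gt0 X.
(* A tent in the Bohr norm: at least 1/2 on the ball of radius r/2, which has density at least c,
   and 1/r-Lipschitz by subadditivity. *)
pose t (x : X) := Num.max 0 (1 - nB G x / r); pose T := \sum_x t x.
have t0 x : 0 <= t x by rewrite /t le_max lexx.
have Tl : c * q X / 2 <= T.
  rewrite /T (bigID (mem [set x | nB G x <= r / 2])) /=.
  apply: (@le_trans _ _ (\sum_(x in [set x | nB G x <= r / 2]) 1 / 2)); last first.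
    apply: ler_wpDr; first by apply: sumr_ge0.
    apply: ler_sum => x; rewrite inE => Hx; rewrite /t le_max; apply/orP; right.
    have : nB G x / r <= 1 / 2 by rewrite ler_pdivrMr //; lra.
    lra.
  rewrite sumr_const -[leRHS]mulr_natl; have := Hc X G sG; set N := #|_|%:R; lra.
have T0 : 0 < T by apply: lt_le_trans Tl; rewrite divr_gt0 // mulr_gt0.
have Ti : T^-1 <= 2 / c / q X.
  by rewrite -[leRHS]invrK lef_pV2 ?posrE ?invr_gt0 ?divr_gt0 // !invfM !invrK [_ * c]mulrC; lra.
exists (fun x => t x / T); split.
- split; first by move=> x; rewrite divr_ge0 // ltW.
  by rewrite -mulr_suml mulfV // gt_eqF.
- move=> x; rewrite mulf_eq0 negb_or => /andP [tx _]; rewrite leNgt; apply/negP => H.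
  have : 1 < nB G x / r by rewrite ltr_pdivlMr // mul1r.
  by move=> H2; move/negP: tx; apply; apply/eqP; rewrite /t; apply/max_idPl; lra.
- move=> x; have t1 : t x <= 1 by rewrite /t ge_max ler01 /= gerBl divr_ge0 ?nB_ge0 // ltW.
  apply: (@le_trans _ _ (1 * T^-1)); first by rewrite ler_wpM2r // invr_ge0 ltW.
  rewrite mul1r; apply: (le_trans Ti); rewrite ler_wpM2r ?invr_ge0 ?(ltW q0) //.
  have : 0 <= 2 / (c * r) by rewrite divr_ge0 ?mulr_ge0 ?ltW.
  lra.
move=> h; have L x : `|t (x - h) - t x| <= nB G h / r.
  have A y z : nB G y <= nB G z + nB G h -> t z - t y <= nB G h / r.
    move=> H; rewrite lerBlDr /t ge_max; apply/andP; split.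
      by rewrite addr_ge0 ?divr_ge0 ?nB_ge0 ?(ltW r0) // le_max lexx.
    have : 1 - nB G y / r <= Num.max 0 (1 - nB G y / r) by rewrite le_max lexx orbT.
    have : nB G y / r <= nB G z / r + nB G h / r by rewrite -mulrDl ler_wpM2r // invr_ge0 ltW.
    lra.
  rewrite ler_norml; apply/andP; split; last by apply: A; have := nBD G (x - h) h; rewrite subrK.
  by rewrite lerNl opprB; apply: A; exact: nBB.
apply: (@le_trans _ _ (\sum_(x : X) nB G h / r * T^-1)).
  apply: ler_sum => x _; rewrite -mulrBl normrM [X in _ * X]ger0_norm ?invr_ge0 ?(ltW T0) //.
  by rewrite ler_wpM2r ?invr_ge0 ?(ltW T0).
rewrite sumr_const -[leLHS]mulr_natl -/(q X).
apply: (@le_trans _ _ (q X * (nB G h / r * (2 / c / q X)))).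
  by rewrite ler_pM2l // ler_wpM2l // divr_ge0 ?nB_ge0 // ltW.
have -> : q X * (nB G h / r * (2 / c / q X)) = 2 / (c * r) * nB G h.
  by field; rewrite !gt_eqF.
rewrite ler_wpM2r ?nB_ge0 //.
have : 0 <= 2 / c by rewrite divr_ge0 // ltW.
lra.
Qed.
End Env.

(** * Bilinear phases *)

Section P2.
Variable R : realType.
Local Notation C := R[i].

Lemma ft_corr (X : env R) (F1 F2 : X -> C) xi :
  ft (fun y => \sum_z F1 (z + y) * cj (F2 z)) xi = ft F1 xi * cj (ft F2 xi).
Proof.
rewrite /ft; transitivity (\sum_z \sum_y F1 (y + z) * cj (ch xi (y + z)) * (cj (F2 z) * ch xi z)).
  under eq_bigr do rewrite mulr_suml; rewrite exchange_big /=.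
  apply: eq_bigr => z _; apply: eq_bigr => y _.
  rewrite chDr cjM [z + y]addrC; have := ch_unit xi z.
  by move: (ch xi z) (cj _) => u v h; ring: h.
rewrite cj_sum mulr_sumr; apply: eq_bigr => z _.
by rewrite cjM cjK -mulr_suml (sum_shift z (fun y => F1 y * cj (ch xi y))).
Qed.

(** The number of representations of x is a Fourier series whose coefficients are the fourth powers
    of the transform of 1_S in modulus. The zero frequency contributes n^4. The large spectrum G, of
    bounded size by Parseval, satisfies Re (ch xi x) >= 1/2 and contributes nonnegatively; the other
    frequencies are too small to cancel n^4. *)
Lemma bogolyubov (sg : R) : 0 < sg -> exists D : nat, forall (X : env R) (S : {set X}),
  sg * q X <= #|S|%:R -> exists G : seq X, (size G <= D)%N /\ forall x, nB G x <= 1 / 2 ->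
  exists a b c d, [/\ a \in S, b \in S, c \in S & d \in S] /\ x = (a - b) + (c - d).
Proof.
move=> sg0; exists (Num.truncn (2 / sg ^+ 2)).+1 => X S HS.
have q0 := q_gt0 X; set n : R := #|S|%:R in HS *.
have n0 : 0 < n by apply: lt_le_trans HS; rewrite mulr_gt0.
pose F (x : X) : C := (x \in S)%:R.
have cF x : cj (F x) = F x by rewrite /F; case: (x \in S); rewrite ?cj1 ?cj0.
have nF : \sum_x nm (F x) ^+ 2 = n.
  rewrite /n -sum1_card natr_sum [RHS]big_mkcond /=; apply: eq_bigr => x _.
  by rewrite /F; case: (x \in S); rewrite ?nm1 ?nm0 ?expr1n ?expr0n.
have F0 : nm (ft F 0) = n.
  rewrite /ft; under eq_bigr do rewrite ch0l cj1 mulr1.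
  rewrite /F -[RHS]ger0_norm ?ltW // -nmR /n -sum1_card natr_sum rmorph_sum /= [in RHS]big_mkcond.
  by congr nm; apply: eq_bigr => x _; case: (x \in S).
have PF := parseval F; rewrite nF in PF.
pose G := [seq xi <- enum X | sg / 2 * n ^+ 2 <= nm (ft F xi) ^+ 2].
exists G; split.
  have H : (size G)%:R * (sg / 2 * n ^+ 2) <= q X * n.
    rewrite -PF (bigID (mem G)) /=; apply: ler_wpDr; first by apply: sumr_ge0 => i _; exact: sqr_ge0.
    have <- : #|G| = size G by apply/card_uniqP; rewrite filter_uniq ?enum_uniq.
    rewrite mulr_natl -sumr_const.
    by apply: ler_sum => xi; rewrite mem_filter => /andP [].
  rewrite -(ler_nat R) -natr1; apply/ltW.
  apply: (@le_lt_trans _ _ (2 / sg ^+ 2)).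
    rewrite ler_pdivlMr ?exprn_gt0 //.
    have H2 : (size G)%:R * (sg / 2 * n) <= q X by rewrite -(ler_pM2r n0); lra.
    have : (size G)%:R * (sg / 2) * (sg * q X) <= q X.
      by apply: le_trans H2; rewrite -mulrA ler_wpM2l // ler_wpM2l //; lra.
    by move=> H3; rewrite -(ler_pM2r q0); lra.
  have /andP [_] := truncn_itv (divr_ge0 (ler0n R 2) (sqr_ge0 sg)).
  by rewrite natr1.
move=> x Hx; pose G1 (y : X) : C := \sum_z F (z + y) * cj (F z).
have G1r y : cj (G1 y) = G1 y.
  by rewrite /G1 cj_sum; apply: eq_bigr => z _; rewrite cjM cjK cF cF.
have fG xi : ft G1 xi = (nm (ft F xi) ^+ 2)%:C by rewrite ft_corr nm_sqr.
have fG' xi : ft (fun y => G1 (x - y)) xi = (nm (ft F xi) ^+ 2)%:C * cj (ch xi x).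
  rewrite -[(_)%:C]cjR -fG /ft cj_sum mulr_suml -(sum_opp (fun y : X => G1 (x - y) * _)).
  rewrite -(sum_shift (- x)); apply: eq_bigr => y _.
  by rewrite opprK addrC subrK opprB chBr !cjM !cjK G1r; ring.
have Pl := plancherel G1 (fun y => G1 (x - y)).
apply: contrapT => Hno.
(* The convolution of [G1] with itself at x counts representations, so it vanishes if there are
   none. *)
have Z : \sum_y G1 y * cj (G1 (x - y)) = 0.
  apply: big1 => y _; apply/eqP; rewrite G1r mulf_eq0; apply/negP => /negP.
  rewrite negb_or => /andP [H1 H2]; apply: Hno.
  have K w : G1 w != 0 -> exists a b, [/\ a \in S, b \in S & w = a - b].
    move=> Hw; apply: contrapT => Hn; move/eqP: Hw; apply; apply: big1 => z _.
    apply/eqP; rewrite cF /F mulf_eq0; apply/negP => /negP; rewrite negb_or.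
    case A : (z + w \in S); last by rewrite eqxx.
    case B : (z \in S); last by rewrite eqxx andbF.
    by move=> _; apply: Hn; exists (z + w), z; split => //; rewrite addrC addKr.
  have [a [b [aS bS E1]]] := K _ H1; have [c [d [cS dS E2]]] := K _ H2.
  by exists a, b, c, d; split => //; rewrite -E1 -E2 addrC subrK.
rewrite Z mulr0 in Pl.
have : Re (\sum_xi ft G1 xi * cj (ft (fun y => G1 (x - y)) xi)) = 0 by rewrite Pl.
under eq_bigr do rewrite fG fG' cjM cjK cjR mulrA -rmorphM /=.
rewrite Re_sum; under eq_bigr do rewrite ReZ.
rewrite (bigD1 0) //= F0 ch0l /= mulr1 => E.
have : - (sg / 2 * n ^+ 2 * (q X * n)) <= \sum_(i | i != 0) nm (ft F i) ^+ 2 * nm (ft F i) ^+ 2 * Re (ch i x).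
  rewrite -PF mulr_sumr -sumrN [leLHS](bigD1 0) //= -[leRHS]add0r; apply: lerD.
    by rewrite oppr_le0 !mulr_ge0 ?sqr_ge0 //; lra.
  apply: ler_sum => xi _; have A0 := sqr_ge0 (nm (ft F xi)).
  have B0 : 0 <= sg / 2 * n ^+ 2 by rewrite mulr_ge0 ?sqr_ge0 //; lra.
  have R1 := Re_ge (ch xi x); rewrite ch_nm in R1.
  case: (boolP (xi \in G)) => xiG.
    have : 1 / 2 <= Re (ch xi x).
      have := le_trans (nB_mem x xiG) Hx; have := Re_le (1 - ch xi x).
      by rewrite ReD ReN /=; lra.
    move=> R2; apply: (@le_trans _ _ 0); first by rewrite oppr_le0 mulr_ge0.
    by apply: mulr_ge0; [exact: mulr_ge0|lra].
  have A1 : nm (ft F xi) ^+ 2 <= sg / 2 * n ^+ 2.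
    by move: xiG; rewrite mem_filter mem_enum andbT -ltNge => /ltW.
  have A2 : nm (ft F xi) ^+ 2 * nm (ft F xi) ^+ 2 <= sg / 2 * n ^+ 2 * nm (ft F xi) ^+ 2 by rewrite ler_wpM2r.
  have A3 : 0 <= nm (ft F xi) ^+ 2 * nm (ft F xi) ^+ 2 by rewrite mulr_ge0.
  nra.
move=> H; have {}H : n ^+ 2 * n ^+ 2 <= sg / 2 * n ^+ 2 * (q X * n) by lra.
have : sg / 2 * n ^+ 2 * (q X * n) < n ^+ 2 * n ^+ 2.
  rewrite [sg / 2 * _]mulrC -!mulrA ltr_pM2l ?exprn_gt0 // expr2 !mulrA ltr_pM2r //.
  by have := ler_wpM2l (ltW n0) HS; have := mulr_gt0 n0 n0; lra.
by rewrite ltNge H.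
Qed.

(** Pigeonhole gives a dense set on which th is nearly constant, so th is within 2 eps of 1 on its
    difference set. A Bohr set inside the sums of two such differences adds two of these errors and
    one additivity defect, in all 5 eps. *)
Lemma approx_hom_kill (D : nat) (r eps : R) : 0 < r -> 0 < eps -> exists D' : nat,
  forall (X : env R) (G : seq X) (th : X -> C), (size G <= D)%N -> (forall x, nm (th x) = 1) ->
  (forall a b, nB G a <= r -> nB G b <= r -> nm (th (a + b) - th a * th b) <= eps) ->
  exists G' : seq X, (size G' <= D')%N /\ forall x, nB G' x <= 1 / 2 -> nm (th x - 1) <= 5 * eps.
Proof.
move=> r0 e0; have r4 : 0 < r / 4 by lra.
have [c [c0 Hc]] := bohr_dens D r4; have [U [f Hf]] := cells_r e0.
have U0 : (0 < #|U|)%N by apply/card_gt0P; exists (f 0).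
have sg0 : 0 < c / #|U|%:R by rewrite divr_gt0 // ltr0n.
have [D' HD'] := bogolyubov sg0; exists D' => X G th sG th1 Hth.
pose S0 := [set x : X | nB G x <= r / 4].
have S00 : S0 != set0 by apply/set0Pn; exists 0; rewrite inE nB0; lra.
have [u [H1 H2]] := pigeonhole (fun x => f (th x)) S00.
pose S := S0 :&: [set x | f (th x) == u].
have [|G' [sG' HG']] := HD' X S.
  rewrite mulrAC ler_pdivrMr ?ltr0n // mulrC [leRHS]mulrC -natrM.
  apply: (le_trans _ (_ : (#|S0|%:R : R) <= _)); last by rewrite ler_nat.
  by rewrite mulrC; exact: Hc.
exists G'; split => // x /HG' [a [b [d [e [[aS bS dS eS] ->]]]]].
have K s s' : s \in S -> s' \in S -> nB G (s - s') <= r / 2 /\ nm (th (s - s') - 1) <= 2 * eps.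
  rewrite !inE => /andP [s1 /eqP s2] /andP [s3 /eqP s4]; split; first by apply: (le_trans (nBB _ _ _)); clear -s1 s3; lra.
  have A := Hth (s - s') s'; rewrite subrK in A.
  have {}A : nm (th s - th (s - s') * th s') <= eps by apply: A; [apply: (le_trans (nBB _ _ _))|]; clear -s1 s3 r0; lra.
  have B : nm (th s - th s') <= eps by apply: Hf; rewrite ?th1 // s2 s4.
  have -> : nm (th (s - s') - 1) = nm (th (s - s') * th s' - th s').
    by rewrite -[in RHS](mul1r (th s')) mulrA mulr1 -mulrBl nmM th1 mulr1.
  apply: (le_trans (nm_dist _ (th s) _)); rewrite nmBC; lra.
have [A1 A2] := K _ _ aS bS; have [B1 B2] := K _ _ dS eS.
apply: (le_trans (nm_dist _ (th (a - b) * th (d - e)) _)).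
have T1 : nm (th (a - b + (d - e)) - th (a - b) * th (d - e)) <= eps by apply: Hth; clear -A1 B1 r0; lra.
have T2 : nm (th (a - b) * th (d - e) - 1) <= nm (th (a - b) - 1) + nm (th (d - e) - 1).
  by rewrite -[X in _ - X](mulr1 1); apply: nm_mul_dist; rewrite ?th1 ?nm1.
lra.
Qed.

(** A bicharacter on a Bohr ball only; outside the ball just the modulus is controlled. *)
Definition bim (X : env R) (G : seq X) (r : R) (B : X -> X -> C) := 
  [/\ forall a b, nm (B a b) = 1,
      forall a b c, nB G a <= r -> nB G b <= r -> nB G c <= r -> B (a + b) c = B a c * B b c &
      forall a b c, nB G a <= r -> nB G b <= r -> nB G c <= r -> B c (a + b) = B c a * B c b].

(** Squaring eliminates psi. Shifting m by b multiplies the average of B m (d - d') by B b (d - d')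
    while the Lipschitz weight hardly notices, so this factor is near 1 for a dense set of d;
    Bogolyubov then spreads it to a Bohr set. *)
Lemma trivialise (D : nat) (K r eta eps : R) : 0 < K -> 0 < r -> 0 < eta -> 0 < eps ->
  exists (D' : nat) (r' : R), 0 < r' /\ forall (X : env R) (G : seq X) B s s' psi,
  (size G <= D)%N -> bim G r B -> wt K G (r / 8) s -> prob s' -> (forall x, s' x <= K / q X) ->
  (forall x, s' x != 0 -> nB G x <= r / 8) -> (forall x, nm (psi x) <= 1) ->
  eta <= \sum_m s m * nm (\sum_d (s' d)%:C * (psi d * B m d)) ->
  exists G' : seq X, [/\ {subset G <= G'}, (size G' <= D')%N &
    forall a b, nB G' a <= r' -> nB G' b <= r' -> nm (B a b - 1) <= eps].
Proof.
move=> K0 r0 eta0 e0.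
have sg0 : 0 < eta ^+ 2 / (2 * K) by rewrite divr_gt0 ?exprn_gt0 // mulr_gt0.
have [D' HD'] := bogolyubov sg0.
pose rho := Num.min (r / 8) (eps * eta ^+ 2 / (8 * K)).
have rho0 : 0 < rho by rewrite lt_min !divr_gt0 ?mulr_gt0 ?exprn_gt0.
exists (D + D')%N, (Num.min rho (1 / 2)); split; first by rewrite lt_min rho0; lra.
move=> X G B s s' psi sG [B1 Bl Br] ws ps' s'K s's psi1 Hb.
have q0 := q_gt0 X; have [ps ss sK sL] := ws.
(* Jensen in m, then expansion of the square: the phases combine to B m (d - d') and psi is bounded
   out. *)
have H2 : eta ^+ 2 <= \sum_d' s' d' * \sum_d s' d * nm (\sum_m (s m)%:C * B m (d - d')).
  apply: (@le_trans _ _ ((\sum_m s m * nm (\sum_d (s' d)%:C * (psi d * B m d))) ^+ 2)).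
    rewrite lerXn2r ?nnegrE ?(ltW eta0) // (le_trans (ltW eta0)) //.
  apply: (le_trans (jensen2 _ ps)).
  have E : (\sum_m s m * nm (\sum_d (s' d)%:C * (psi d * B m d)) ^+ 2)%:C =
     \sum_d' \sum_d (s' d' * s' d)%:C * (psi d * cj (psi d') * \sum_m (s m)%:C * (B m d * cj (B m d'))).
    rewrite rmorph_sum /=; transitivity (\sum_m \sum_d' \sum_d (s' d' * s' d)%:C * (psi d * cj (psi d') * ((s m)%:C * (B m d * cj (B m d'))))).
      apply: eq_bigr => m _; rewrite rmorphM /= nm_sqr cj_sum mulrA mulr_sumr; apply: eq_bigr => d' _.
      rewrite !cjM cjR mulr_sumr mulr_suml; apply: eq_bigr => d _.
      by rewrite rmorphM /=; ring.
    rewrite exchange_big; apply: eq_bigr => d' _; rewrite exchange_big; apply: eq_bigr => d _.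
    by rewrite !mulr_sumr.
  have := Re_le (\sum_m s m * nm (\sum_d (s' d)%:C * (psi d * B m d)) ^+ 2)%:C.
  rewrite {2}E /= => /le_trans -> //; apply: (le_trans (nm_sum _ _ _)); apply: ler_sum => d' _.
  rewrite mulr_sumr; apply: (le_trans (nm_sum _ _ _)); apply: ler_sum => d _.
  rewrite [leRHS]mulrA nmM nmR ger0_norm ?mulr_ge0 ?ps'.1 //.
  have [Z|nZ] := eqVneq (s' d' * s' d) 0; first by rewrite Z !mul0r.
  move: nZ; rewrite mulf_eq0 negb_or => /andP [nz' nz].
  apply: ler_wpM2l; first by rewrite mulr_ge0 ?ps'.1.
  rewrite nmM (_ : nm (psi d * cj (psi d')) * _ <= _) //; apply: le_trans (ler_piMl _ _) _ => //; rewrite ?nm_ge0 //.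
    by apply: nm_le1M; rewrite ?nm_cj.
  rewrite le_eqVlt; apply/orP; left; apply/eqP; congr nm; apply: eq_bigr => m _.
  have [->|nm'] := eqVneq (s m) 0; first by rewrite !mul0r.
  congr (_ * _); have hd := s's _ nz; have hd' := s's _ nz'; have hm := ss _ nm'.
  have : B m d = B m (d - d') * B m d'.
    rewrite -Br ?subrK //; clear -hd hd' hm r0; first by apply: (le_trans (nBB _ _ _)); lra.
      by lra.
    by lra.
  by move=> ->; rewrite -mulrA unit_cj ?B1 // mulr1.
have [d' [d'0 Hd']] := wavg_ex ps' H2.
have d'n : s' d' != 0 by rewrite gt_eqF.
pose W d := nm (\sum_m (s m)%:C * B m (d - d')).
(* The d for which the average over m stays large; since s' has density at most K, they make up a
   proportion at least eta^2 / (2 K) of the group. *)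
pose S := [set d : X | (s' d != 0) && (eta ^+ 2 / 2 <= W d)].
have W1 d : W d <= 1 by apply: wnm_le => // m _; rewrite B1.
have HS : eta ^+ 2 / (2 * K) * q X <= #|S|%:R.
  have L : eta ^+ 2 <= eta ^+ 2 / 2 + \sum_(d in S) K / q X.
    apply: (le_trans Hd'); rewrite (bigID (mem S)) /= addrC; apply: lerD.
      apply: (@le_trans _ _ (\sum_(d | d \notin S) s' d * (eta ^+ 2 / 2))).
        apply: ler_sum => d; rewrite inE negb_and negbK -ltNge => /orP [/eqP ->|/ltW H]; first by rewrite !mul0r.
        by rewrite ler_wpM2l ?ps'.1.
      rewrite -mulr_suml ler_piMl //; first by rewrite divr_ge0 ?sqr_ge0.
      rewrite -ps'.2 [leRHS](bigID (mem S)) /= lerDr; apply: sumr_ge0 => i _; exact: ps'.1.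
    apply: ler_sum => d _; apply: (@le_trans _ _ (s' d * 1)); last by rewrite mulr1.
    by rewrite ler_wpM2l ?ps'.1 ?W1.
  move: L; rewrite sumr_const -[X in _ <= _ + X]mulr_natl => L.
  have : eta ^+ 2 / 2 <= #|S|%:R * (K / q X) by clear -L; lra.
  rewrite mulrA ler_pdivlMr // => L2.
  by rewrite mulrAC ler_pdivrMr ?mulr_gt0 //; clear -L2; lra.
have [Gb [sGb HGb]] := HD' X S HS.
exists (G ++ Gb); split; first by move=> x xG; rewrite mem_cat xG.
  by rewrite size_cat leq_add.
move=> b x hb hx; move: hb hx; rewrite !le_min => /andP [/andP [hb1 hb2] _] /andP [_ hx].
have sb : nB G b <= nB (G ++ Gb) b by apply: nB_sub => y yG; rewrite mem_cat yG.
have {}hb1 := le_trans sb hb1; have {}hb2 := le_trans sb hb2.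
have {}hx : nB Gb x <= 1 / 2 by apply: le_trans hx; apply: nB_sub => y yG; rewrite mem_cat yG orbT.
have [t1 [t2 [t3 [t4 [[S1 S2 S3 S4] Ex]]]]] := HGb x hx.
have hS d : d \in S -> nB G (d - d') <= r / 4 /\ nm (B b (d - d') - 1) <= eps / 4.
  rewrite inE => /andP [dn Wd]; have hd := s's _ dn; have hd' := s's _ d'n.
  have ht : nB G (d - d') <= r / 4 by apply: (le_trans (nBB _ _ _)); clear -hd hd'; lra.
  split => //.
  have Sh : nm (\sum_m (s m)%:C * B (m + b) (d - d') - \sum_m (s m)%:C * B m (d - d')) <= K * nB G b.
    by apply: (wt_shift (F := fun m => B m (d - d')) b ws) => m; rewrite B1.
  have E : \sum_m (s m)%:C * B (m + b) (d - d') = B b (d - d') * \sum_m (s m)%:C * B m (d - d').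
    rewrite mulr_sumr; apply: eq_bigr => m _; have [->|mn] := eqVneq (s m) 0; first by rewrite !(mul0r,mulr0).
    have := ss _ mn; clear -Bl ht hb1 r0 => hm.
    rewrite Bl; [by ring| | |]; clear -ht hb1 r0 hm; lra.
  rewrite E -[X in _ - X]mul1r -mulrBl nmM in Sh.
  have Sh2 : nm (B b (d - d') - 1) * (eta ^+ 2 / 2) <= eps * eta ^+ 2 / 8.
    apply: le_trans (_ : _ <= nm (B b (d - d') - 1) * W d) _; first by rewrite ler_wpM2l ?nm_ge0.
    apply: (le_trans Sh); apply: (le_trans (ler_wpM2l (ltW K0) hb2)).
    by rewrite le_eqVlt; apply/orP; left; apply/eqP; field; rewrite gt_eqF.
  have e2 : 0 < eta ^+ 2 by rewrite exprn_gt0.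
  by rewrite -(ler_pM2r e2); lra.
have hd2 t t' : t \in S -> t' \in S -> nB G (t - t') <= r / 2 /\ nm (B b (t - t') - 1) <= eps / 2.
  move=> /hS [h1 h2] /hS [h3 h4].
  have E : t - t' = (t - d') - (t' - d') by rewrite opprB addrA subrK.
  have N : nB G (t - t') <= r / 2 by rewrite E; apply: (le_trans (nBB _ _ _)); clear -h1 h3; lra.
  split => //.
  have Eq : B b (t - d') = B b (t - t') * B b (t' - d').
    by rewrite -Br ?addrA ?subrK //; clear -N h3 hb1 r0; lra.
  have -> : nm (B b (t - t') - 1) = nm (B b (t - d') - B b (t' - d')).
    by rewrite Eq -[X in _ = nm (_ - X)]mul1r -mulrBl nmM B1 mulr1.
  apply: (le_trans (nm_dist _ 1 _)); rewrite (nmBC 1); clear -h2 h4; lra.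
have [N1 M1] := hd2 _ _ S1 S2; have [N2 M2] := hd2 _ _ S3 S4.
rewrite Ex Br; try (by clear -N1 N2 hb1 r0; lra).
rewrite -[X in _ - X](mulr1 1); apply: (le_trans (nm_mul_dist _ _ _ _)); rewrite ?B1 ?nm1 //; clear -M1 M2; lra.
Qed.
End P2.

(** * Almost periodicity of overlaps *)

Section Combi.
Variables (R : realType) (P : finZmodType).
Local Notation b2r b := (((b%R) : bool)%:R : R).

Lemma b2r_ge0 b : 0 <= b2r b. Proof. exact: ler0n. Qed.
Lemma cardE_sum (A : {set P}) (Q : pred P) : (#|A :&: [set x | Q x]|%:R : R) = \sum_(x in A) b2r (Q x).
Proof.
rewrite -sum1_card natr_sum [LHS]big_mkcond [RHS]big_mkcond /=; apply: eq_bigr => x _.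
by rewrite !inE; case: (x \in A); case: (Q x).
Qed.
Lemma wCS (I : finType) (Q : pred I) (g x : I -> R) : (forall i, 0 <= g i) ->
  (\sum_(i | Q i) g i * x i) ^+ 2 <= (\sum_(i | Q i) g i) * \sum_(i | Q i) g i * x i ^+ 2.
Proof.
move=> g0; have H := CS_real Q (fun i => Num.sqrt (g i)) (fun i => Num.sqrt (g i) * x i).
have E1 : \sum_(i | Q i) Num.sqrt (g i) * (Num.sqrt (g i) * x i) = \sum_(i | Q i) g i * x i.
  by apply: eq_bigr => i _; rewrite mulrA -expr2 sqr_sqrtr.
have E2 : \sum_(i | Q i) Num.sqrt (g i) ^+ 2 = \sum_(i | Q i) g i by apply: eq_bigr => i _; rewrite sqr_sqrtr.
have E3 : \sum_(i | Q i) (Num.sqrt (g i) * x i) ^+ 2 = \sum_(i | Q i) g i * x i ^+ 2.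
  by apply: eq_bigr => i _; rewrite exprMn sqr_sqrtr.
by move: H; rewrite E1 E2 E3.
Qed.
Lemma sum_const_in (A : {set P}) (c : R) : \sum_(x in A) c = #|A|%:R * c.
Proof. by rewrite sumr_const mulr_natl. Qed.

Definition common (S S' : {set P}) v w : R := \sum_(x in S) b2r (v - x \in S') * b2r (w - x \in S').

(* A is the neighbourhood of a random x in S. *)
Lemma dependent_random_choice (S S' : {set P}) (th e0 : R) : 0 < th -> 0 < e0 -> S != set0 ->
  th * #|S|%:R ^+ 2 <= \sum_(v in S) \sum_(w in S) b2r (v - w \in S') ->
  exists A : {set P}, [/\ A \subset S, th ^+ 2 / 2 * #|S|%:R ^+ 2 <= #|A|%:R ^+ 2 :> R &
    \sum_(v in A) \sum_(w in A) b2r (common S S' v w < e0 * th ^+ 2 / 2 * #|S|%:R) <= e0 * #|A|%:R ^+ 2].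
Proof.
move=> th0 e00 S0 H; set n : R := #|S|%:R in H *; set lam := e0 * th ^+ 2 / 2.
have n0 : 0 < n by rewrite ltr0n card_gt0.
pose a x : R := \sum_(v in S) b2r (v - x \in S').
pose bad x : R := \sum_(v in S) \sum_(w in S) b2r (v - x \in S') * b2r (w - x \in S') * b2r (common S S' v w < lam * n).
have Ha : th * n ^+ 2 <= \sum_(x in S) a x by rewrite exchange_big.
have Ha2 : th ^+ 2 * n ^+ 3 <= \sum_(x in S) a x ^+ 2.
  have C1 : (\sum_(x in S) a x) ^+ 2 <= n * \sum_(x in S) a x ^+ 2.
    have := CS_real (fun x => x \in S) (fun=> 1) a.
    by rewrite expr1n sum_const_in mulr1; under eq_bigr do rewrite mul1r.
  have C2 : (th * n ^+ 2) ^+ 2 <= (\sum_(x in S) a x) ^+ 2.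
    by rewrite lerXn2r ?nnegrE ?mulr_ge0 ?sqr_ge0 ?(ltW th0) // (le_trans _ Ha) // mulr_ge0 ?sqr_ge0 ?(ltW th0).
  by rewrite -(ler_pM2l n0); apply: le_trans C1; apply: le_trans C2; rewrite le_eqVlt; apply/orP; left; apply/eqP; ring.
have Hb : \sum_(x in S) bad x <= lam * n * n ^+ 2.
  rewrite exchange_big /=; apply: (@le_trans _ _ (\sum_(v in S) \sum_(w in S) lam * n)); last first.
    by under eq_bigr do rewrite sum_const_in; rewrite sum_const_in -/n le_eqVlt; apply/orP; left; apply/eqP; ring.
  apply: ler_sum => v _; rewrite exchange_big /=; apply: ler_sum => w _.
  rewrite -mulr_suml -/(common S S' v w); case: ltP => h; first by rewrite mulr1 ltW.
  by rewrite mulr0 mulr_ge0 ?mulr_ge0 ?sqr_ge0 ?(ltW n0) ?(ltW e00) //; lra.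
(* Averaging the combination |A|^2 - bad / e0 over x secures a large A and few bad pairs with one
   choice of x. *)
have [x xS Hx] : exists2 x, x \in S & th ^+ 2 / 2 * n ^+ 2 <= a x ^+ 2 - bad x / e0.
  apply: contrapT => Hn; have : \sum_(x in S) (a x ^+ 2 - bad x / e0) < \sum_(x in S) th ^+ 2 / 2 * n ^+ 2.
    apply: ltr_sum => [|x xS]; first by case/set0Pn: S0 => x xS; apply/hasP; exists x; rewrite ?mem_index_enum.
    by rewrite ltNge; apply/negP => h; apply: Hn; exists x.
  rewrite sumrB sum_const_in -/n -mulr_suml => h.
  have : (\sum_(x in S) bad x) / e0 <= lam * n * n ^+ 2 / e0 by rewrite ler_pM2r ?invr_gt0.
  have -> : lam * n * n ^+ 2 / e0 = th ^+ 2 / 2 * n ^+ 3 by rewrite /lam; field; rewrite gt_eqF.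
  by move: h; clear -Ha2 => h h2; lra.
pose A := S :&: [set v | v - x \in S'].
have cA : #|A|%:R = a x by rewrite cardE_sum.
have bad0 : 0 <= bad x by apply: sumr_ge0 => v _; apply: sumr_ge0 => w _; rewrite !mulr_ge0 ?b2r_ge0.
exists A; split; first exact: subsetIl.
  by rewrite cA (le_trans Hx) // gerBl divr_ge0 // ltW.
have bA : \sum_(v in A) \sum_(w in A) b2r (common S S' v w < lam * n) = bad x.
  rewrite /bad [LHS]big_mkcond [RHS]big_mkcond /=; apply: eq_bigr => v _; rewrite !inE.
  case: (v \in S) => //=; case: (v - x \in S') => //=; last by rewrite big1 // => i _; rewrite !mul0r.
  rewrite [LHS]big_mkcond [RHS]big_mkcond /=; apply: eq_bigr => w _; rewrite !inE.
  by case: (w \in S) => //=; case: (w - x \in S'); rewrite ?mul1r ?mulr0 ?mul0r.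
rewrite bA cA -ler_pdivrMl //.
have : 0 <= th ^+ 2 / 2 * n ^+ 2 by rewrite mulr_ge0 ?sqr_ge0 // divr_ge0 ?sqr_ge0.
by move=> h; have := le_trans h Hx; rewrite [e0^-1 * _]mulrC subr_ge0.
Qed.

(** Divided by |W|^m this is the expectation over m independent samples from W, without a
    probability space. *)
Fixpoint lsum (W : {set P}) m (F : seq P -> R) : R :=
  if m is m'.+1 then \sum_(v in W) lsum W m' (fun l => F (v :: l)) else F [::].
Lemma lsum_le W m F G : (forall l, size l = m -> F l <= G l) -> lsum W m F <= lsum W m G.
Proof.
elim: m F G => [|m IH] F G H /=; first exact: H.
by apply: ler_sum => v _; apply: IH => l sl; apply: H; rewrite /= sl.
Qed.
Lemma lsum_const W m c : lsum W m (fun=> c) = #|W|%:R ^+ m * c.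
Proof.
elim: m => [|m IH] /=; first by rewrite mul1r.
by rewrite IH sum_const_in exprS mulrA.
Qed.
Lemma lsum_sum (I : finType) (Q : pred I) W m (F : I -> seq P -> R) :
  \sum_(i | Q i) lsum W m (F i) = lsum W m (fun l => \sum_(i | Q i) F i l).
Proof.
elim: m F => [//|m IH] F /=; rewrite exchange_big /=.
by apply: eq_bigr => v _; rewrite IH.
Qed.
Lemma lsumD W m F G : lsum W m (fun l => F l + G l) = lsum W m F + lsum W m G.
Proof.
elim: m F G => [//|m IH] F G /=; rewrite -big_split /=.
by apply: eq_bigr => v _; rewrite IH.
Qed.
Lemma lsumZ W m c F : lsum W m (fun l => c * F l) = c * lsum W m F.
Proof.
elim: m F => [//|m IH] F /=; rewrite mulr_sumr.
by apply: eq_bigr => v _; rewrite IH.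
Qed.
(** The variance of a sum of m independent centred samples; the offset c is what makes the induction
    on m close. *)
Lemma lsum_var (W : {set P}) m (h : P -> R) c : W != set0 -> \sum_(v in W) h v = 0 ->
  lsum W m (fun l => (c + \sum_(v <- l) h v) ^+ 2) =
  #|W|%:R ^+ m * (c ^+ 2 + m%:R / #|W|%:R * \sum_(v in W) h v ^+ 2).
Proof.
move=> W0 h0; have n0 : (#|W|%:R : R) != 0 by rewrite pnatr_eq0 cards_eq0.
elim: m c => [|m IH] c /=; first by rewrite big_nil !mul0r !addr0 mul1r.
under eq_bigr => v _.
  rewrite (_ : (fun l => (c + \sum_(v0 <- v :: l) h v0) ^+ 2) = (fun l => ((c + h v) + \sum_(v0 <- l) h v0) ^+ 2)).
    rewrite IH; over.
  by apply/funext => l; rewrite big_cons addrA.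
rewrite -mulr_sumr big_split /= sum_const_in.
have -> : \sum_(v in W) (c + h v) ^+ 2 = #|W|%:R * c ^+ 2 + \sum_(v in W) h v ^+ 2.
  transitivity (\sum_(v in W) (c ^+ 2 + (2 * c) * h v + h v ^+ 2)); first by apply: eq_bigr => v _; ring.
  rewrite !big_split /= [X in _ + X + _](_ : _ = 0) ?addr0 ?sum_const_in //.
  by rewrite -mulr_sumr h0 mulr0.
rewrite -(natr1 m); move: (\sum_(v in W) _) (#|W|%:R) n0 (m%:R) => Sg n n0 m'.
by rewrite [n ^+ m.+1]exprS; field.
Qed.
Lemma lsum_has (W : {set P}) m (Q : pred P) : W != set0 ->
  lsum W m (fun l => b2r (has Q l)) <= #|W|%:R ^+ m * (m%:R / #|W|%:R * \sum_(v in W) b2r (Q v)).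
Proof.
move=> W0; have n0 : 0 < (#|W|%:R : R) by rewrite ltr0n card_gt0.
elim: m => [|m IH] /=; first by rewrite !mul0r mulr0.
apply: (@le_trans _ _ (\sum_(v in W) (lsum W m (fun=> b2r (Q v)) + lsum W m (fun l => b2r (has Q l))))).
  apply: ler_sum => v _; rewrite -lsumD; apply: lsum_le => l _.
  by case: (Q v) => //=; rewrite ?add0r // lerDl b2r_ge0.
rewrite big_split /= sum_const_in; under eq_bigr do rewrite lsum_const.
rewrite -mulr_sumr; apply: (le_trans (lerD (lexx _) (ler_wpM2l (ltW n0) IH))).
by rewrite le_eqVlt; apply/orP; left; apply/eqP; rewrite exprS -(natr1 m); move: (\sum_(v in W) _) (#|W|%:R) n0 (m%:R) => Sg n n0 m'; field; rewrite gt_eqF.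
Qed.
(** Translation by -t embeds the samples from W whose translates stay in V into the samples from V.
    Thus the good samples of every t live in one common space. *)
Lemma lsum_change (W V : {set P}) m (t : P) (F : seq P -> R) : (forall l, 0 <= F l) ->
  lsum W m (fun l => F [seq v - t | v <- l] * b2r (all (mem V) [seq v - t | v <- l])) <= lsum V m F.
Proof.
elim: m F => [|m IH] F F0 /=; first by rewrite mulr1.
have G0 z : 0 <= lsum V m (fun l => F (z :: l)).
  have : lsum V m (fun=> 0) <= lsum V m (fun l => F (z :: l)) by apply: lsum_le.
  by rewrite lsum_const mulr0.
apply: (@le_trans _ _ (\sum_(v in W) b2r (v - t \in V) * lsum V m (fun l => F (v - t :: l)))).
  apply: ler_sum => v _; case vV : (v - t \in V); last first.
    rewrite mul0r; under eq_fun do rewrite /= mulr0.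
    by rewrite lsum_const mulr0.
  by rewrite mul1r /=; apply: IH.
apply: (@le_trans _ _ (\sum_v b2r (v - t \in V) * lsum V m (fun l => F (v - t :: l)))).
  rewrite [leLHS]big_mkcond /=; apply: ler_sum => v _; case: (v \in W) => //.
  by rewrite mulr_ge0 ?b2r_ge0.
rewrite [leRHS]big_mkcond /= (reindex (fun v => v + t)) /=; last by exists (fun v => v - t) => v _; rewrite ?addrK ?subrK.
by apply: ler_sum => v _; rewrite addrK; case: (v \in V); rewrite ?mul1r ?mul0r.
Qed.

(** The convolution of 1_A with its reflection, over |A|; equally the average of x -> 1_A (x + v)
    over v in A, which is what gets sampled. *)
Definition overlap (A : {set P}) (x : P) : R := #|A|%:R^-1 * \sum_(y in A) b2r (x + y \in A).
Definition pdist (A : {set P}) (s : P) : R := \sum_x (overlap A (x - s) - overlap A x) ^+ 2.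

Lemma sumP_shift (V : nmodType) (h : P) (F : P -> V) : \sum_x F (x + h) = \sum_x F x.
Proof.
by rewrite [RHS](reindex (fun x : P => x + h)) //; exists (fun x => x - h) => x _; rewrite ?addrK ?subrK.
Qed.

(* Croot--Sisask: approximate overlap by an average of m random translates; the sample of a
   shifted copy of A mostly lands in V, so that one sample serves many shifts. *)
Lemma almost_periods (A V : {set P}) (m : nat) (K : R) : A != set0 -> (0 < m)%N -> 0 < K ->
  #|V|%:R <= K * #|A|%:R ->
  \sum_(v in A) \sum_(w in A) b2r (v - w \notin V) <= (8 * m%:R)^-1 * #|A|%:R ^+ 2 ->
  #|A|%:R / (8 * K ^+ m) <= #|[set s | pdist A s <= 16 * #|A|%:R / m%:R]|%:R.
Proof.
move=> A0 m0 K0 HV Hbad; set n : R := #|A|%:R in HV Hbad *.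
have n0 : 0 < n by rewrite ltr0n card_gt0.
have m0R : 0 < m%:R :> R by rewrite ltr0n.
pose bad t := \sum_(y in A) b2r (y - t \notin V).
(* By Markov, for at least half of the t in A, translation by -t sends all but a 1 / (4 m) fraction
   of A into V. *)
pose A1 := A :&: [set t | bad t <= n / (4 * m%:R)].
have HA1 : n / 2 <= #|A1|%:R.
  have E : \sum_(t in A) bad t <= (8 * m%:R)^-1 * n ^+ 2 by rewrite exchange_big.
  have L : \sum_(t in A) (1 - b2r (bad t <= n / (4 * m%:R))) * (n / (4 * m%:R)) <= \sum_(t in A) bad t.
    apply: ler_sum => t _; case: (leP (bad t)) => h; last by rewrite subr0 mul1r ltW.
    by rewrite subrr mul0r; apply: sumr_ge0 => i _; exact: b2r_ge0.
  rewrite -mulr_suml sumrB sum_const_in mulr1 -/n -cardE_sum -/A1 in L.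
  have := le_trans L E; rewrite -ler_pdivlMr ?divr_gt0 ?mulr_gt0 //.
  have -> : (8 * m%:R)^-1 * n ^+ 2 / (n / (4 * m%:R)) = n / 2 by field; rewrite !gt_eqF.
  by clear; lra.
pose F (x : P) : R := b2r (x \in A).
(* The squared L^2 error, times m^2, of sampling the t-shift of [overlap]; the leading 0 is the
   offset of [lsum_var]. *)
pose dev t (z : seq P) : R := \sum_x (0 + \sum_(v <- z) (F (x + v) - overlap A (x - t))) ^+ 2.
have dev0 t z : 0 <= dev t z by apply: sumr_ge0 => x _; exact: sqr_ge0.
have PhiS x : \sum_(v in A) (F (x + v) - overlap A x) = 0.
  by rewrite sumrB sum_const_in /overlap mulrA mulfV ?mul1r ?subrr // gt_eqF.
have Hdev t : lsum A m (fun l => dev t [seq v - t | v <- l]) <= n ^+ m * (m%:R * n).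
  rewrite -lsum_sum.
  have E x : lsum A m (fun l => (0 + \sum_(v <- [seq v - t | v <- l]) (F (x + v) - overlap A (x - t))) ^+ 2) =
     n ^+ m * (m%:R / n * \sum_(v in A) (F (x - t + v) - overlap A (x - t)) ^+ 2).
    under eq_fun => l. rewrite big_map.
      under eq_bigr do rewrite addrCA addrC. over.
    by rewrite lsum_var // expr0n add0r.
  under eq_bigr do rewrite E.
  rewrite -!mulr_sumr ler_pM2l ?exprn_gt0 // -mulrA ler_pM2l // ler_pdivrMl // exchange_big /=.
  rewrite -[leRHS]sum_const_in exchange_big /= (sumP_shift (- t) (fun x => \sum_(v in A) (F (x + v) - overlap A x) ^+ 2)).
  apply: (@le_trans _ _ (\sum_x \sum_(v in A) F (x + v))).
    apply: ler_sum => x _.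
    have -> : \sum_(v in A) F (x + v) = \sum_(v in A) (F (x + v) - overlap A x) ^+ 2 + n * overlap A x ^+ 2.
      transitivity (\sum_(v in A) ((F (x + v) - overlap A x) ^+ 2 + (2 * overlap A x) * (F (x + v) - overlap A x) + overlap A x ^+ 2)).
        apply: eq_bigr => v _; have : F (x + v) = F (x + v) ^+ 2 by rewrite /F; case: (_ \in _); rewrite ?expr1n ?expr0n.
        by move: (F _) (overlap _ _) => u w hu; rewrite [LHS]hu; ring.
      rewrite !big_split /= [X in _ + X + _](_ : _ = 0) ?addr0 ?sum_const_in //.
      by rewrite -mulr_sumr PhiS mulr0.
    by rewrite lerDl mulr_ge0 ?sqr_ge0 ?(ltW n0).
  rewrite exchange_big /=; apply: ler_sum => v _.
  by rewrite (sumP_shift v F) /F /n -sum1_card natr_sum [leRHS]big_mkcond /=; apply: ler_sum => x _; case: (x \in A).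
(* A sample is lost with probability at most 1/4 to leaving V and at most 1/4 to a large
   deviation. *)
have Hgood t : t \in A1 -> n ^+ m / 2 <=
   lsum A m (fun l => b2r (dev t [seq v - t | v <- l] <= 4 * m%:R * n) * b2r (all (mem V) [seq v - t | v <- l])).
  rewrite !inE => /andP [_ ht].
  have U : lsum A m (fun l => b2r (has (fun v => v - t \notin V) l)) <= n ^+ m / 4.
    apply: (le_trans (lsum_has _ _ A0)); rewrite -/n ler_pM2l ?exprn_gt0 //.
    apply: (le_trans (ler_wpM2l _ ht)); first by rewrite divr_ge0 ?ler0n ?(ltW n0).
    by rewrite le_eqVlt; apply/orP; left; apply/eqP; field; rewrite !gt_eqF.
  have D : lsum A m (fun l => (4 * m%:R * n)^-1 * dev t [seq v - t | v <- l]) <= n ^+ m / 4.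
    rewrite lsumZ ler_pdivrMl ?mulr_gt0 //; apply: (le_trans (Hdev t)).
    by rewrite le_eqVlt; apply/orP; left; apply/eqP; field.
  have T : lsum A m (fun=> 1) <= lsum A m (fun l => b2r (dev t [seq v - t | v <- l] <= 4 * m%:R * n) * b2r (all (mem V) [seq v - t | v <- l]) + (b2r (has (fun v => v - t \notin V) l) + (4 * m%:R * n)^-1 * dev t [seq v - t | v <- l])).
    apply: lsum_le => l _.
    have p0 : 0 <= (4 * m%:R * n)^-1 * dev t [seq v - t | v <- l] by rewrite mulr_ge0 // invr_ge0 ltW // !mulr_gt0.
    case: (leP (dev t _)) => h; last first.
      rewrite mul0r add0r; apply: ler_wpDl; first exact: b2r_ge0.
      by rewrite mulrC ler_pdivlMr ?mulr_gt0 // mul1r ltW.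
    rewrite mul1r all_map addrA; apply: ler_wpDr => //.
    have -> : has (fun v => v - t \notin V) l = ~~ all (preim (fun v => v - t) (mem V)) l by rewrite -has_predC.
    by case: (all _ _) => /=; rewrite ?addr0 ?add0r.
  rewrite lsum_const mulr1 !lsumD -/n in T; move: T U D; clear; lra.
have Tot : n / 2 * (n ^+ m / 2) <= lsum V m (fun z => \sum_(t in A1) b2r (dev t z <= 4 * m%:R * n)).
  apply: (@le_trans _ _ (\sum_(t in A1) n ^+ m / 2)).
    by rewrite sum_const_in ler_pM2r ?divr_gt0 ?exprn_gt0.
  rewrite -lsum_sum; apply: ler_sum => t tA1; apply: (le_trans (Hgood t tA1)).
  by apply: (@lsum_change A V m t (fun z => b2r (dev t z <= 4 * m%:R * n))) => l; exact: b2r_ge0.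
set c := n / (8 * K ^+ m).
have [z [sz Hz]] : exists z, size z = m /\ c < \sum_(t in A1) b2r (dev t z <= 4 * m%:R * n).
  apply: contrapT => Hn.
  have : lsum V m (fun z => \sum_(t in A1) b2r (dev t z <= 4 * m%:R * n)) <= lsum V m (fun=> c).
    by apply: lsum_le => z sz; rewrite leNgt; apply/negP => h; apply: Hn; exists z.
  rewrite lsum_const => h; have := le_trans Tot h.
  have : #|V|%:R ^+ m * c <= (K * n) ^+ m * c.
    rewrite ler_wpM2r ?divr_ge0 ?mulr_ge0 ?exprn_ge0 ?(ltW n0) ?(ltW K0) //.
    by rewrite lerXn2r // ?nnegrE ?ler0n // mulr_ge0 ?ltW.
  have -> : (K * n) ^+ m * c = n * n ^+ m / 8.
    by rewrite exprMn /c; field; rewrite ?expf_neq0 // gt_eqF.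
  have : 0 < n * n ^+ m by rewrite mulr_gt0 ?exprn_gt0.
  clear; lra.
(* All t in [Tz] are served by the same sample z, so their shifts of [overlap] are close to one
   another and each t - t0 is an almost period. *)
rewrite -cardE_sum in Hz; set Tz := A1 :&: _ in Hz.
have [t0 t0T] : exists t, t \in Tz.
  apply/set0Pn; apply/negP => /eqP E; rewrite E cards0 ltNge in Hz; move/negP: Hz; apply.
  by rewrite divr_ge0 ?mulr_ge0 ?exprn_ge0 ?ltW.
apply: (le_trans (ltW Hz)); rewrite -(card_imset (mem Tz) (addIr (- t0))) ler_nat.
apply: subset_leq_card; apply/subsetP => _ /imsetP [t tT ->]; rewrite inE.
have dv s : s \in Tz -> dev s z <= 4 * m%:R * n by rewrite !inE => /andP [_].
have {}dt := dv t tT; have dt0 := dv t0 t0T.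
have E : m%:R ^+ 2 * pdist A (t - t0) <= 2 * dev t z + 2 * dev t0 z.
  rewrite /pdist -(sumP_shift (- t0)) /dev !mulr_sumr -big_split /=; apply: ler_sum => x _.
  have -> : x - t0 - (t - t0) = x - t by rewrite opprB addrA subrK.
  set a := 0 + \sum_(v <- z) _; set b := 0 + \sum_(v <- z) _.
  have -> : m%:R ^+ 2 * (overlap A (x - t) - overlap A (x - t0)) ^+ 2 = (b - a) ^+ 2.
    rewrite -exprMn /a /b !add0r -sumrB; congr (_ ^+ 2).
    under eq_bigr do rewrite opprB addrC addrA subrK.
    by rewrite big_const_seq count_predT sz iter_addr addr0 mulr_natl.
  by have := sqr_ge0 (a + b); clear; nra.
rewrite ler_pdivlMr // -(ler_pM2l m0R); move: E dt dt0; clear; rewrite expr2 => E dt dt0.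
by apply: le_trans (_ : _ <= m%:R * m%:R * pdist A (t - t0)) _; [rewrite le_eqVlt; apply/orP; left; apply/eqP; ring|lra].
Qed.
End Combi.

(** * The inverse theorem for the U^3 norm *)

HB.instance Definition _ (X : finZmodType) := Finite.on (X * X)%type.

Section Spectrum.
Variables (R : realType) (X : env R).
Local Notation C := R[i].
Local Notation P := (X * X)%type.
Local Notation q := (q X).
Local Notation b2r b := (((b%R) : bool)%:R : R).

Lemma sum_pair (V : nmodType) (F : P -> V) : \sum_v F v = \sum_t \sum_xi F (t, xi).
Proof. by rewrite pair_bigA; apply: eq_bigr => -[]. Qed.

(* The symplectic character of the phase space X * X. *)
Definition om (v w : P) : C := ch v.1 w.2 * cj (ch v.2 w.1).
Lemma om_nm v w : nm (om v w) = 1.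
Proof. by rewrite nmM nm_cj !ch_nm mulr1. Qed.
Lemma omB v w w' : om v (w - w') = om v w * cj (om v w').
Proof. by rewrite /om /= !chBr !cjM !cjK; ring. Qed.
Lemma om_orth w : \sum_v om v w = if w == 0 then (q ^+ 2)%:C else 0.
Proof.
rewrite sum_pair /om /=; under eq_bigr do rewrite -mulr_sumr -cj_sum.
rewrite -mulr_suml !ch_orth; case: w => a b /=; rewrite -pair_eqE /= [a == 0]eq_sym [b == 0]eq_sym.
by case: (0 == a); case: (0 == b); rewrite /= ?cj0 ?mulr0 ?mul0r // cjR -rmorphM -expr2.
Qed.
Lemma om_parseval (F : P -> R) :
  \sum_w nm (\sum_x (F x)%:C * om w x) ^+ 2 = q ^+ 2 * \sum_x F x ^+ 2.
Proof.
apply: complexI; rewrite rmorphM /= !rmorph_sum /=.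
transitivity (\sum_x \sum_y (F x * F y)%:C * \sum_w om w (x - y)).
  transitivity (\sum_w \sum_x \sum_y (F x * F y)%:C * om w (x - y)).
    apply: eq_bigr => w _; rewrite nm_sqr cj_sum mulr_suml; apply: eq_bigr => x _.
    by rewrite mulr_sumr; apply: eq_bigr => y _; rewrite omB cjM cjR rmorphM /=; ring.
  rewrite exchange_big; apply: eq_bigr => x _; rewrite exchange_big; apply: eq_bigr => y _.
  by rewrite mulr_sumr.
rewrite mulr_sumr; apply: eq_bigr => x _; rewrite (bigD1 x) //= [X in _ + X]big1 ?addr0 => [|y yx].
  by rewrite om_orth subrr eqxx mulrC expr2.
by rewrite om_orth subr_eq0 eq_sym (negbTE yx) mulr0.
Qed.

(* Af f (t, .) is the Fourier transform of the derivative of f in direction t; hence U3 f is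
   the eighth power of the Gowers U^3 norm. *)
Definition Af (f : X -> C) (v : P) : C := (q^-1)%:C * \sum_n f (n + v.1) * cj (f n) * cj (ch v.2 n).
Definition gf (f : X -> C) (v : P) : R := nm (Af f v) ^+ 2.
Definition U3 (f : X -> C) : R := q^-1 * \sum_v gf f v ^+ 2.

Variable f : X -> C.
Hypothesis f1 : forall x, nm (f x) <= 1.
Let D (t n : X) : C := f (n + t) * cj (f n).
Lemma Af_ft t xi : Af f (t, xi) = (q^-1)%:C * ft (D t) xi. Proof. by []. Qed.
Lemma D1 t n : nm (D t n) <= 1. Proof. by apply: nm_le1M; rewrite ?nm_cj. Qed.
Lemma gf_ge0 v : 0 <= gf f v. Proof. exact: sqr_ge0. Qed.
Lemma gf_fibre t : \sum_xi gf f (t, xi) <= 1.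
Proof.
under eq_bigr do rewrite /gf Af_ft nmM nmR exprMn.
rewrite -mulr_sumr parseval real_normK ?num_real //.
have q0 := q_gt0 X; rewrite exprVn ler_pdivrMl ?exprn_gt0 // mulr1 expr2 ler_pM2l //.
rewrite [leRHS](_ : _ = \sum_(n : X) 1); last by rewrite sumr_const.
apply: ler_sum => n _.
by rewrite expr_le1 ?nm_ge0 // D1.
Qed.
Lemma gf_sum : \sum_v gf f v <= q.
Proof.
rewrite sum_pair; apply: (@le_trans _ _ (\sum_(t : X) 1)); first by apply: ler_sum => t _; exact: gf_fibre.
by rewrite sumr_const.
Qed.
Lemma gf_le1 v : gf f v <= 1.
Proof.
case: v => t xi; apply: le_trans (gf_fibre t); rewrite (bigD1 xi) //= lerDl.
by apply: sumr_ge0 => i _; exact: gf_ge0.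
Qed.
(* Moyal's identity: |A_f|^2 is its own symplectic Fourier transform. *)
Lemma gf_self w : \sum_v (gf f v)%:C * om v w = q%:C * (gf f w)%:C.
Proof.
case: w => s eta.
have H1 t : \sum_xi (gf f (t, xi))%:C * cj (ch xi s) = (q^-1)%:C * \sum_n D t n * cj (D t (n + s)).
  have E xi : (gf f (t, xi))%:C * cj (ch xi s) = (q^-1 * q^-1)%:C * (ft (fun n => D t (n - s)) xi * cj (ft (D t) xi)).
    rewrite /gf nm_sqr Af_ft cjM cjR rmorphM /=.
    have -> : ft (fun n => D t (n - s)) xi = ft (D t) xi * cj (ch xi s).
      rewrite /ft mulr_suml -(sum_shift s); apply: eq_bigr => n _.
      by rewrite addrK chDr cjM; ring.
    by ring.
  under eq_bigr do rewrite E; rewrite -mulr_sumr plancherel mulrA -rmorphM /= mulfVK ?q_neq0 //.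
  by congr (_ * _); rewrite -(sum_shift s); apply: eq_bigr => n _; rewrite addrK.
rewrite sum_pair /om /=.
have E2 t : \sum_xi (gf f (t, xi))%:C * (ch t eta * cj (ch xi s)) =
   (q^-1)%:C * \sum_n ch t eta * (D t n * cj (D t (n + s))).
  rewrite -mulr_sumr mulrCA -H1 mulr_sumr; apply: eq_bigr => xi _; ring.
under eq_bigr do rewrite E2; rewrite -mulr_sumr exchange_big /=.
pose Z := \sum_n f (n + s) * cj (f n) * cj (ch eta n).
have E3 n : \sum_t ch t eta * (D t n * cj (D t (n + s))) = f (n + s) * cj (f n) * cj (ch eta n) * cj Z.
  rewrite -(sum_shift (- n)) /Z cj_sum mulr_sumr; apply: eq_bigr => y _.
  have E4 : n + (y - n) = y by rewrite addrC subrK.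
  have E5 : n + s + (y - n) = y + s by rewrite addrAC E4.
  rewrite /D E4 E5 !cjM !cjK chDl chNl (chC y) (chC n).
  by ring.
under eq_bigr do rewrite E3; rewrite -mulr_suml -/Z /gf nm_sqr.
have -> : Af f (s, eta) = (q^-1)%:C * Z by [].
have qq : q%:C * (q^-1)%:C = 1 :> C by rewrite -rmorphM mulfV ?q_neq0.
by rewrite cjM cjR -[LHS]mul1r -qq; ring.
Qed.
(* Since its Fourier transform gf is nonnegative, gf is positive definite. *)
Lemma gf_pd (I : finType) (Q : pred I) (rho : I -> R) (tau : I -> P) :
  \sum_w gf f w * nm (\sum_(i | Q i) (rho i)%:C * om w (tau i)) ^+ 2 =
  q * \sum_(i | Q i) \sum_(j | Q j) rho i * rho j * gf f (tau i - tau j).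
Proof.
apply: complexI; rewrite rmorphM /= !rmorph_sum /=.
transitivity (\sum_(i | Q i) \sum_(j | Q j) (rho i * rho j)%:C * \sum_w (gf f w)%:C * om w (tau i - tau j)).
  transitivity (\sum_w \sum_(i | Q i) \sum_(j | Q j) (rho i * rho j)%:C * ((gf f w)%:C * om w (tau i - tau j))).
    apply: eq_bigr => w _; rewrite rmorphM /= (nm_sqr (\sum_(j | Q j) _)) cj_sum mulr_suml mulr_sumr; apply: eq_bigr => i _.
    by rewrite !mulr_sumr; apply: eq_bigr => j _; rewrite omB cjM cjR rmorphM /=; ring.
  rewrite exchange_big; apply: eq_bigr => i _; rewrite exchange_big; apply: eq_bigr => j _.
  by rewrite mulr_sumr.
rewrite mulr_sumr; apply: eq_bigr => i _; rewrite rmorph_sum mulr_sumr; apply: eq_bigr => j _.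
by rewrite gf_self !rmorphM /=; ring.
Qed.
(** Obtained by summing [gf_self] over V and taking absolute values of the transform of 1_V. *)
Lemma gf_large_sum (V : {set P}) eta : (forall v, v \in V -> eta <= gf f v) ->
  q * eta * #|V|%:R <= \sum_w gf f w * nm (\sum_(v in V) om w v).
Proof.
move=> HV; apply: (@le_trans _ _ (Re (\sum_w (gf f w)%:C * \sum_(v in V) om w v))).
  have -> : \sum_w (gf f w)%:C * \sum_(v in V) om w v = \sum_(v in V) (q * gf f v)%:C.
    under eq_bigr do rewrite mulr_sumr; rewrite exchange_big /=; apply: eq_bigr => v _.
    by rewrite gf_self -rmorphM.
  rewrite Re_sum /= -mulrA -mulr_sumr ler_pM2l ?q_gt0 // mulrC -sum_const_in; exact: ler_sum.
apply: (le_trans (Re_le _)); apply: (le_trans (nm_sum _ _ _)); apply: ler_sum => w _.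
by rewrite nmM nmR ger0_norm ?gf_ge0.
Qed.
(** Cauchy-Schwarz with weight [gf] turns the previous bound into one for the square of the
    transform of 1_V, which [gf_pd] evaluates as a sum over differences. This is the source of
    additive structure in the large spectrum. *)
Lemma gf_differences (V : {set P}) eta : 0 <= eta -> (forall v, v \in V -> eta <= gf f v) ->
  (eta * #|V|%:R) ^+ 2 <= \sum_(v in V) \sum_(w in V) gf f (v - w).
Proof.
move=> e0 HV; have q0 := q_gt0 X; have H1 := gf_large_sum HV.
have H2 := wCS xpredT (fun w => nm (\sum_(v in V) om w v)) gf_ge0.
have E : \sum_w gf f w * nm (\sum_(v in V) om w v) ^+ 2 = q * \sum_(v in V) \sum_(w in V) gf f (v - w).
  rewrite (_ : \sum_(v in V) _ = \sum_(i in V) \sum_(j in V) 1 * 1 * gf f (id i - id j)).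
    rewrite -(gf_pd (fun v => v \in V) (fun=> 1) id); apply: eq_bigr => w _.
    by congr (_ * nm _ ^+ 2); apply: eq_bigr => v _; rewrite mul1r.
  by apply: eq_bigr => i _; apply: eq_bigr => j _; rewrite !mul1r.
rewrite E in H2.
have S0 : 0 <= \sum_(v in V) \sum_(w in V) gf f (v - w).
  by apply: sumr_ge0 => v _; apply: sumr_ge0 => w _; exact: gf_ge0.
have H4 : (q * eta * #|V|%:R) ^+ 2 <= q * (q * \sum_(v in V) \sum_(w in V) gf f (v - w)).
  apply: le_trans (_ : _ <= (\sum_w gf f w) * (q * \sum_(v in V) \sum_(w in V) gf f (v - w))) _.
    apply: le_trans H2; rewrite lerXn2r ?nnegrE //.
      by rewrite !mulr_ge0 ?(ltW q0).
    by rewrite (le_trans _ H1) // !mulr_ge0 ?(ltW q0).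
  by apply: ler_wpM2r gf_sum; rewrite mulr_ge0 // ltW.
by rewrite -(ler_pM2l (mulr_gt0 q0 q0)); move: H4; rewrite -!mulrA !exprMn expr2 -!mulrA.
Qed.
End Spectrum.

(** * Almost periods of a set of large spectrum *)

Section Periods.
Variables (R : realType) (P : finZmodType) (A : {set P}).
Local Notation Phi := (@overlap R P A).
Local Notation N2 := (@pdist R P A).
Local Notation b2r b := (((b%R) : bool)%:R : R).
Lemma sum_mem (B : {set P}) : \sum_x b2r (x \in B) = #|B|%:R.
Proof. by rewrite -sum1_card natr_sum [RHS]big_mkcond /=; apply: eq_bigr => x _; case: (x \in B). Qed.
Lemma sum_mem_shift (B : {set P}) y : \sum_x b2r (x + y \in B) = #|B|%:R.
Proof. by rewrite (sumP_shift y (fun x => b2r (x \in B))) sum_mem. Qed.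
Lemma N2_ge0 s : 0 <= N2 s.
Proof. by apply: sumr_ge0 => x _; exact: sqr_ge0. Qed.
Lemma N2_opp s : N2 (- s) = N2 s.
Proof.
rewrite /pdist -(sumP_shift (- s)); apply: eq_bigr => x _.
by rewrite opprK subrK -[RHS]sqrrN opprB.
Qed.
Lemma N2_add s t : N2 (s + t) <= 2 * N2 s + 2 * N2 t.
Proof.
have E : N2 s = \sum_x (Phi (x - t - s) - Phi (x - t)) ^+ 2.
  by rewrite (sumP_shift (- t) (fun x => (Phi (x - s) - Phi x) ^+ 2)).
rewrite E /pdist !mulr_sumr -big_split /=; apply: ler_sum => x _.
rewrite opprD addrA [x - s - t]addrAC.
move: (Phi _) (Phi (x - t)) (Phi x) => a b c; have := sqr_ge0 (a - b - (b - c)); clear; nra.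
Qed.
Lemma N2_nat s j : N2 (s *+ j) <= 4 ^+ j * N2 s.
Proof.
have n0 := N2_ge0 s.
elim: j => [|j IH].
  by rewrite mulr0n mul1r /pdist big1 // => x _; rewrite subr0 subrr expr0n.
rewrite mulrS; apply: (le_trans (N2_add _ _)); rewrite exprS.
have : N2 s <= 4 ^+ j * N2 s by rewrite ler_peMl // exprn_ege1 //; lra.
by move: IH; clear; move: (N2 (s *+ j)) (4 ^+ j) (N2 s) => a b c; lra.
Qed.
Lemma Phi_ge0 x : 0 <= Phi x.
Proof. by rewrite mulr_ge0 ?invr_ge0 ?ler0n //; apply: sumr_ge0 => i _; exact: ler0n. Qed.
Hypothesis A0 : A != set0.
Let n0 : 0 < #|A|%:R :> R. Proof. by rewrite ltr0n card_gt0. Qed.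
Lemma Phi_sum : \sum_x Phi x = #|A|%:R.
Proof.
rewrite -mulr_sumr exchange_big /=; under eq_bigr do rewrite sum_mem_shift.
by rewrite sum_const_in mulKf // gt_eqF.
Qed.
Lemma N2_inner s : N2 s = 2 * \sum_x Phi x ^+ 2 - 2 * \sum_x Phi (x - s) * Phi x.
Proof.
have E : \sum_x Phi x ^+ 2 = \sum_x Phi (x - s) ^+ 2.
  by rewrite (sumP_shift (- s) (fun x => Phi x ^+ 2)).
have -> : 2 * \sum_x Phi x ^+ 2 = \sum_x Phi x ^+ 2 + \sum_x Phi (x - s) ^+ 2 by rewrite -E; ring.
rewrite mulr_sumr -sumrN -!big_split /=; apply: eq_bigr => x _; ring.
Qed.
End Periods.

Section Periods2.
Variables (R : realType) (X : env R) (A : {set X * X}).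
Local Notation P := (X * X)%type.
Local Notation Phi := (@overlap R _ A).
Local Notation N2 := (@pdist R _ A).
Local Notation q := (q X).
Local Notation b2r b := (((b%R) : bool)%:R : R).
Hypothesis A0 : A != set0.
Let n0 : 0 < #|A|%:R :> R. Proof. by rewrite ltr0n card_gt0. Qed.

(** For an almost period s, [overlap] and its s-shift have inner product at least c1 |A| / 2. Over a
    vertical fibre these inner products add up to at most |A| / eta, because A has at most 1 / eta
    points in each fibre. *)
Lemma period_fibre eta c1 : 0 < eta -> 0 < c1 ->
  (forall t, \sum_xi b2r ((t, xi) \in A) <= eta^-1) -> c1 * #|A|%:R <= \sum_x Phi x ^+ 2 ->
  forall a, (#|[set xi | N2 (a, xi) <= c1 * #|A|%:R]|%:R : R) <= 2 / (eta * c1).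
Proof.
move=> e0 c0 Hf HP a; set S := [set xi | _].
have E : \sum_(xi in S) (c1 * #|A|%:R / 2) <= \sum_xi \sum_x Phi (x - (a, xi)) * Phi x.
  rewrite [leRHS](bigID (mem S)) /=; apply: ler_wpDr.
    by apply: sumr_ge0 => i _; apply: sumr_ge0 => j _; rewrite mulr_ge0 ?Phi_ge0.
  by apply: ler_sum => xi; rewrite inE N2_inner // => H; move: HP H; clear -n0 A0; lra.
have U : \sum_xi \sum_x Phi (x - (a, xi)) * Phi x <= #|A|%:R / eta.
  rewrite exchange_big /= -(Phi_sum R A0) mulr_suml; apply: ler_sum => x _.
  rewrite -mulr_suml mulrC; apply: ler_wpM2l; first exact: Phi_ge0.
  rewrite -mulr_sumr exchange_big /= ler_pdivrMl // -sum_const_in; apply: ler_sum => y _.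
  case: x y => x1 x2 [y1 y2]; apply: le_trans (Hf (x1 - a + y1)).
  rewrite le_eqVlt; apply/orP; left; apply/eqP.
  rewrite -[RHS](sum_shift (x2 + y2)) -[RHS]sum_opp; apply: eq_bigr => xi _.
  by congr (_%:R); congr (nat_of_bool (_ \in A)); congr pair; rewrite /= addrC addrA [RHS]addrC; congr (_ + _); rewrite addrC.
move: (le_trans E U); rewrite sumr_const -[leLHS]mulr_natl => H.
have : #|S|%:R * (eta * c1) * #|A|%:R <= 2 * #|A|%:R.
  by move: H; rewrite ler_pdivlMr //; clear -n0 A0; lra.
by rewrite ler_pM2r // ler_pdivlMr ?mulr_gt0.
Qed.

(** Parseval for the difference of [overlap] and its shift: the transform of [overlap] is the
    squared modulus of that of 1_A over |A|, and the shift multiplies it by om w s. *)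
Lemma period_om s : \sum_w nm (\sum_(v in A) om w v) ^+ 4 * nm (1 - om w s) ^+ 2 =
  q ^+ 2 * #|A|%:R ^+ 2 * N2 s.
Proof.
have E w : \sum_x (Phi x)%:C * om w x = (#|A|%:R^-1 * nm (\sum_(v in A) om w v) ^+ 2)%:C.
  rewrite rmorphM /= nm_sqr /overlap.
  under eq_bigr => x _ do rewrite rmorphM /= -mulrA rmorph_sum /= mulr_suml.
  rewrite -mulr_sumr; congr (_ * _); rewrite exchange_big /= cj_sum mulr_sumr; apply: eq_bigr => y _.
  rewrite mulr_suml -(sumP_shift (- y)) [RHS]big_mkcond /=; apply: eq_bigr => x _.
  by rewrite subrK omB; case: (x \in A); rewrite ?mul1r ?mul0r.
have E2 w : nm (\sum_x (Phi (x - s) - Phi x)%:C * om w x) ^+ 2 =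
   #|A|%:R^-1 ^+ 2 * (nm (\sum_(v in A) om w v) ^+ 4 * nm (1 - om w s) ^+ 2).
  have -> : \sum_x (Phi (x - s) - Phi x)%:C * om w x = (om w s - 1) * \sum_x (Phi x)%:C * om w x.
    rewrite mulrBl mul1r mulr_sumr -[X in _ = X - _](sumP_shift (- s)) -sumrB; apply: eq_bigr => x _.
    have Ow : om w x = om w s * om w (x - s) by rewrite omB mulrCA unit_cj ?om_nm // mulr1.
    by rewrite rmorphB mulrBl Ow; congr (_ - _); rewrite mulrCA.
  rewrite E nmM nmR nmBC ger0_norm; last by rewrite mulr_ge0 ?invr_ge0 ?ler0n ?sqr_ge0.
  by move: (nm (1 - om w s)) (nm (\sum_(v in A) om w v)) (#|A|%:R^-1) => u v a; ring.
have := om_parseval (fun x => Phi (x - s) - Phi x).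
under eq_bigr do rewrite E2; rewrite -mulr_sumr -/(N2 s) => H.
rewrite [RHS]mulrAC -H mulrC mulrA -exprMn mulfV ?gt_eqF // expr1n mul1r //.
Qed.

Variable f : X -> R[i].
Hypothesis f1 : forall x, nm (f x) <= 1.

(** The differences of A meet the set where gf >= eta^2 / 2 often, and that set has at most 2 q /
    eta^2 elements; Cauchy-Schwarz on it bounds the L^2 norm of [overlap] from below. *)
Lemma Phi_energy eta : 0 < eta -> (forall v, v \in A -> eta <= gf f v) ->
  eta ^+ 6 / 8 * #|A|%:R ^+ 2 / q <= \sum_x Phi x ^+ 2.
Proof.
move=> e0 HA; have q0 := q_gt0 X.
pose S' := [set v | eta ^+ 2 / 2 <= gf f v].
have cS' : #|S'|%:R <= 2 / eta ^+ 2 * q.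
  have : eta ^+ 2 / 2 * #|S'|%:R <= q.
    apply: le_trans (gf_sum f1); rewrite mulrC -sum_const_in [leRHS](bigID (mem S')) /=.
    apply: ler_wpDr; first by apply: sumr_ge0 => i _; exact: gf_ge0.
    by apply: ler_sum => v; rewrite inE.
  by move=> H; rewrite mulrAC ler_pdivlMr ?exprn_gt0 //; move: H; clear -n0 A0 f1; lra.
have D := gf_differences f1 (ltW e0) HA.
have B : eta ^+ 2 / 2 * #|A|%:R ^+ 2 <= \sum_(v in A) \sum_(w in A) b2r (v - w \in S').
  have : \sum_(v in A) \sum_(w in A) gf f (v - w) <= \sum_(v in A) \sum_(w in A) (b2r (v - w \in S') + eta ^+ 2 / 2).
    apply: ler_sum => v _; apply: ler_sum => w _; case: (boolP (v - w \in S')).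
      by move=> _; apply: (le_trans (gf_le1 f1 _)); rewrite lerDl divr_ge0 ?sqr_ge0.
    by rewrite inE -ltNge add0r => /ltW.
  under [X in _ <= X -> _]eq_bigr do rewrite big_split /= sum_const_in.
  rewrite big_split /= sum_const_in => H; move: (le_trans D H); rewrite exprMn; clear -n0 A0 f1; lra.
have Q : eta ^+ 2 / 2 * #|A|%:R <= \sum_(x in S') Phi x.
  have -> : \sum_(x in S') Phi x = #|A|%:R^-1 * \sum_(v in A) \sum_(w in A) b2r (v - w \in S').
    rewrite -mulr_sumr; congr (_ * _); rewrite exchange_big [RHS]exchange_big /=; apply: eq_bigr => y _.
    rewrite [LHS]big_mkcond [RHS]big_mkcond /= -[RHS](sumP_shift y).
    by apply: eq_bigr => x _; rewrite addrK; case: (x + y \in A); case: (x \in S').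
  by rewrite ler_pdivlMl //; move: B; rewrite expr2; clear -n0 A0 f1; lra.
have CS : (\sum_(x in S') Phi x) ^+ 2 <= #|S'|%:R * \sum_(x in S') Phi x ^+ 2.
  have := CS_real (fun x => x \in S') (fun=> 1) Phi.
  by rewrite expr1n sum_const_in mulr1; under eq_bigr do rewrite mul1r.
have T : \sum_(x in S') Phi x ^+ 2 <= \sum_x Phi x ^+ 2.
  by rewrite [leRHS](bigID (mem S')) /= lerDl; apply: sumr_ge0 => i _; exact: sqr_ge0.
have L : (eta ^+ 2 / 2 * #|A|%:R) ^+ 2 <= 2 / eta ^+ 2 * q * \sum_x Phi x ^+ 2.
  apply: le_trans (_ : _ <= (\sum_(x in S') Phi x) ^+ 2) _.
    rewrite lerXn2r ?nnegrE // ?(le_trans _ Q) //; rewrite mulr_ge0 ?divr_ge0 ?sqr_ge0 // ltW //.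
  apply: (le_trans CS); apply: ler_pM => //; first by apply: sumr_ge0 => i _; exact: sqr_ge0.
have e2 : 0 < eta ^+ 2 by rewrite exprn_gt0.
rewrite ler_pdivrMr // -(ler_pM2l (_ : 0 < 2 / eta ^+ 2)) ?divr_gt0 //.
rewrite [_ * q]mulrC [leRHS]mulrA; apply: le_trans L; move: (#|A|%:R) => n.
by rewrite le_eqVlt; apply/orP; left; apply/eqP; field; rewrite gt_eqF.
Qed.

(* On the part of the spectrum where the Fourier transform of A is large, the characters
   indexed by the graph of phi are nearly constant, so gf has mass along that graph. *)
Lemma graph_mass eta t cA (s : X -> R) (phi : X -> X) : 0 < eta -> 0 <= t -> 0 < cA ->
  (forall v, v \in A -> eta <= gf f v) -> cA * q <= #|A|%:R -> prob s ->
  (forall a, s a != 0 -> N2 (a, phi a) <= t * #|A|%:R) ->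
  256 * t <= eta ^+ 6 * cA ->
  eta ^+ 2 / 16 <= \sum_a \sum_b s a * s b * gf f (a - b, phi a - phi b).
Proof.
move=> e0 t0 c0 HA HcA ps Hs Ht; have q0 := q_gt0 X.
pose h w := nm (\sum_(v in A) om w v); set n : R := #|A|%:R in HcA *.
pose rho w := \sum_a (s a)%:C * om w (a, phi a).
have hn w : h w <= n.
  apply: (le_trans (nm_sum _ _ _)); under eq_bigr do rewrite om_nm.
  by rewrite sum_const_in mulr1.
(* The large spectrum of A; the frequencies outside it account for at most half of the bound q eta
   |A|. *)
pose W := [set w | eta / 2 * n <= h w].
have I1 : q * eta * n <= \sum_w gf f w * h w by exact: gf_large_sum.
have I2 : q * eta / 2 <= \sum_(w in W) gf f w.
  have U : \sum_w gf f w * h w <= n * (\sum_(w in W) gf f w) + eta / 2 * n * q.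
    rewrite (bigID (mem W)) /=; apply: lerD.
      rewrite mulr_sumr; apply: ler_sum => w _; rewrite mulrC; apply: ler_wpM2r => //; exact: gf_ge0.
    apply: (@le_trans _ _ (eta / 2 * n * \sum_w gf f w)); last by apply: ler_wpM2l (gf_sum f1); rewrite mulr_ge0 ?divr_ge0 ?(ltW e0) ?(ltW n0).
    rewrite mulr_sumr [leRHS](bigID (mem W)) /=; apply: ler_wpDl.
      by apply: sumr_ge0 => i _; rewrite mulr_ge0 ?gf_ge0 // mulr_ge0 ?divr_ge0 ?(ltW e0) ?(ltW n0).
    by apply: ler_sum => w; rewrite inE -ltNge => /ltW H; rewrite [leLHS]mulrC; apply: ler_wpM2r H; exact: gf_ge0.
  by rewrite -(ler_pM2l n0); move: (le_trans I1 U); clear -n0 A0 f1; lra.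
(* Since the graph of phi consists of almost periods, |1 - rho|^2 is small on average with weight
   h^4; on W, where h is bounded below, rho is therefore close to 1 in L^2. *)
have I3 : \sum_w h w ^+ 4 * nm (1 - rho w) ^+ 2 <= q ^+ 2 * n ^+ 2 * (t * n).
  apply: (@le_trans _ _ (\sum_a s a * (q ^+ 2 * n ^+ 2 * N2 (a, phi a)))).
    under [leRHS]eq_bigr do rewrite -period_om mulr_sumr.
    rewrite exchange_big /=; apply: ler_sum => w _.
    under [leRHS]eq_bigr do rewrite mulrCA; rewrite -mulr_sumr ler_wpM2l ?exprn_ge0 ?nm_ge0 //.
    apply: le_trans (jensen2 _ ps); rewrite lerXn2r ?nnegrE ?nm_ge0 ?sumr_ge0 // => [a _|].
      by rewrite mulr_ge0 ?nm_ge0 ?ps.1.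
    have -> : 1 - rho w = \sum_a (s a)%:C * (1 - om w (a, phi a)).
      under [RHS]eq_bigr do rewrite mulrBr mulr1; rewrite sumrB -rmorph_sum /= ps.2 //.
    exact: (wnm _ ps.1).
  apply: wavg_le => // a sa; apply: ler_wpM2l; last exact: Hs.
  by rewrite mulr_ge0 ?exprn_ge0 // ltW.
have I4 : \sum_(w in W) nm (1 - rho w) ^+ 2 <= q * (16 * t / (eta ^+ 4 * cA)).
  have L : (eta / 2 * n) ^+ 4 * \sum_(w in W) nm (1 - rho w) ^+ 2 <= q ^+ 2 * n ^+ 2 * (t * n).
    apply: le_trans I3; rewrite mulr_sumr [leRHS](bigID (mem W)) /=; apply: ler_wpDr.
      by apply: sumr_ge0 => i _; rewrite mulr_ge0 ?exprn_ge0 ?nm_ge0.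
    apply: ler_sum => w; rewrite inE => H; rewrite ler_wpM2r ?sqr_ge0 // lerXn2r ?nnegrE ?nm_ge0 //.
    by rewrite mulr_ge0 ?divr_ge0 // ltW.
  have p4 : 0 < (eta / 2 * n) ^+ 4 by rewrite exprn_gt0 // mulr_gt0 // divr_gt0.
  rewrite -(ler_pM2l p4); apply: (le_trans L).
  have -> : (eta / 2 * n) ^+ 4 * (q * (16 * t / (eta ^+ 4 * cA))) = n ^+ 3 * q * t * (n / cA).
    by field; rewrite !gt_eqF ?exprn_gt0.
  have -> : q ^+ 2 * n ^+ 2 * (t * n) = n ^+ 3 * q * t * q by ring.
  apply: ler_wpM2l; first by rewrite !mulr_ge0 ?exprn_ge0 // ltW.
  by rewrite ler_pdivlMr // mulrC.
have I5 : (\sum_(w in W) gf f w * nm (1 - rho w)) ^+ 2 <= (q * eta / 4) ^+ 2.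
  apply: (le_trans (wCS _ _ (gf_ge0 f))).
  apply: le_trans (_ : _ <= q * (q * (16 * t / (eta ^+ 4 * cA)))) _.
    apply: ler_pM; [by apply: sumr_ge0 => i _; exact: gf_ge0 | by apply: sumr_ge0 => i _; rewrite mulr_ge0 ?gf_ge0 ?sqr_ge0 | | ].
      apply: le_trans (gf_sum f1); rewrite [leRHS](bigID (mem W)) /= lerDl; apply: sumr_ge0 => i _; exact: gf_ge0.
    apply: le_trans I4; apply: ler_sum => w _; rewrite ler_piMl ?sqr_ge0 ?gf_le1 //.
  have -> : (q * eta / 4) ^+ 2 = q * (q * (eta ^+ 2 / 16)) by field.
  rewrite !ler_pM2l // ler_pdivrMr ?mulr_gt0 ?exprn_gt0 //.
  have e6 : eta ^+ 6 = eta ^+ 2 * eta ^+ 4 by rewrite -exprD.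
  by move: Ht; rewrite e6; clear -n0 A0 f1; lra.
have I6 : \sum_(w in W) gf f w * nm (1 - rho w) <= q * eta / 4.
  by rewrite -(@ler_pXn2r _ 2%N) // nnegrE ?sumr_ge0 ?divr_ge0 ?mulr_ge0 ?(ltW e0) ?(ltW q0) // => i _; rewrite mulr_ge0 ?gf_ge0 ?nm_ge0.
have I7 : q * eta / 4 <= \sum_w gf f w * nm (rho w).
  apply: (@le_trans _ _ (\sum_(w in W) gf f w * nm (rho w))); last first.
    by rewrite [leRHS](bigID (mem W)) /= lerDl; apply: sumr_ge0 => i _; rewrite mulr_ge0 ?gf_ge0 ?nm_ge0.
  have : \sum_(w in W) gf f w <= \sum_(w in W) gf f w * nm (rho w) + \sum_(w in W) gf f w * nm (1 - rho w).
    rewrite -big_split /=; apply: ler_sum => w _; rewrite -mulrDr ler_peMr ?gf_ge0 //.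
    by rewrite -[X in X <= _](@nm1 R) -{1}(subrK (rho w) 1) addrC nmD.
  by move: I2 I6; clear -n0 A0 f1; lra.
(* A last Cauchy-Schwarz and positive definiteness turn the mass of |rho| into a sum over pairs on
   the graph. *)
have I8 := wCS xpredT (fun w => nm (rho w)) (gf_ge0 f).
have I9 := gf_pd f xpredT s (fun a => (a, phi a)).
rewrite -/rho I9 in I8.
have S0 : 0 <= \sum_a \sum_b s a * s b * gf f (a - b, phi a - phi b).
  by apply: sumr_ge0 => a _; apply: sumr_ge0 => b _; apply: mulr_ge0 (gf_ge0 _ _); apply: mulr_ge0; exact: ps.1.
have : (q * eta / 4) ^+ 2 <= q * (q * \sum_a \sum_b s a * s b * gf f (a - b, phi a - phi b)).
  apply: le_trans (_ : _ <= (\sum_w gf f w * nm (rho w)) ^+ 2) _.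
    by rewrite lerXn2r ?nnegrE // ?(le_trans _ I7) // divr_ge0 ?mulr_ge0 ?(ltW e0) ?(ltW q0).
  apply: (le_trans I8); apply: ler_wpM2r; last exact: (gf_sum f1).
  by rewrite mulr_ge0 // ltW.
have -> : (q * eta / 4) ^+ 2 = q * (q * (eta ^+ 2 / 16)) by field.
by rewrite !ler_pM2l.
Qed.
End Periods2.

Definition torsion_free (R : realType) (J : nat) (X : env R) :=
  forall (x : X) (j : nat), (0 < j <= J)%N -> x *+ j = 0 -> x = 0.

Ltac pos := repeat first [ done | apply: divr_gt0 | apply: mulr_gt0 | apply: exprn_gt0 | rewrite invr_gt0 ].

Lemma ler_sqr_imp (R : realType) (a b : R) : 0 <= b -> a ^+ 2 <= b ^+ 2 -> a <= b.
Proof. by move=> b0 h; rewrite leNgt; apply/negP => hb; move: h; rewrite leNgt => /negP; apply; rewrite ltr_pXn2r ?nnegrE ?(le_trans b0 (ltW hb)). Qed.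

(** * From a large U^3 norm to a locally linear spectral map *)

Section Graph.
Variable R : realType.
Local Notation C := R[i].
Local Notation b2r b := (((b%R) : bool)%:R : R).

(** Dropping the condition x in S bounds the common count by a function of v - w whose total is
    |S'|^2; hence few differences reach lam. *)
Lemma large_common (P : finZmodType) (S S' : {set P}) (lam : R) :
  0 < lam -> exists V : {set P}, #|V|%:R * lam <= #|S'|%:R ^+ 2 /\
  forall v w, v - w \notin V -> common R S S' v w < lam.
Proof.
move=> l0; pose c u := \sum_(y in S') b2r (y - u \in S').
exists [set u | lam <= c u]; split.
  apply: (@le_trans _ _ (\sum_u c u)).
    rewrite -sum_const_in [leRHS](bigID (mem [set u | lam <= c u])) /=; apply: ler_wpDr.
      by apply: sumr_ge0 => u _; apply: sumr_ge0 => y _; exact: ler0n.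
    by apply: ler_sum => u; rewrite inE.
  rewrite exchange_big expr2 /= -sum_const_in; apply: ler_sum => y _.
  rewrite le_eqVlt; apply/orP; left; apply/eqP; rewrite -[RHS](sum_mem_shift R S' y).
  rewrite [RHS](reindex (fun x : P => - x)) /=; last by exists (fun x => - x) => x _; rewrite opprK.
  by apply: eq_bigr => x _; rewrite addrC.
move=> v w; rewrite inE -ltNge; apply: le_lt_trans; rewrite /common /c.
rewrite [leLHS]big_mkcond [leRHS]big_mkcond /= [leRHS](reindex (fun x => v - x)) /=; last first.
  by exists (fun y => v - y) => x _; rewrite opprB addrC subrK.
apply: ler_sum => x _; have -> : v - x - (v - w) = w - x by rewrite opprB addrC addrA subrK.
by case: (x \in S); case: (v - x \in S'); case: (w - x \in S'); rewrite ?mul1r ?mul0r ?mulr0.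
Qed.

Lemma ex_pos_nat (x : R) : exists n : nat, (0 < n)%N /\ x <= n%:R.
Proof.
have [x0|x0] := leP 0 x; last by exists 1%N; split => //; rewrite ltW // (lt_le_trans x0).
exists (Num.truncn x).+1; split => //; apply: ltW.
by have /andP [] := truncn_itv x0.
Qed.

(** The almost periods are closed under addition with bounded loss and, by torsion-freeness, only 0
    lies over 0. They therefore form a graph, additive wherever Bogolyubov places a Bohr set in sums
    and differences of its projection. *)
Lemma linear_spectrum (delta : R) : 0 < delta -> exists (D J : nat) (c0 : R), 0 < c0 /\
  forall X : env R, torsion_free J X -> forall f : X -> C, (forall x, nm (f x) <= 1) ->
  delta <= U3 f -> exists (G : seq X) (phi : X -> X), [/\ (size G <= D)%N,
    forall a b, nB G a <= 1 / 4 -> nB G b <= 1 / 4 -> phi (a + b) = phi a + phi b &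
    forall s, prob s -> (forall x, s x != 0 -> nB G x <= 1 / 2) ->
      c0 <= \sum_a \sum_b s a * s b * gf f (a - b, phi a - phi b)].
Proof.
move=> d0; pose eta := delta / 2; have e0 : 0 < eta by rewrite divr_gt0.
pose th := eta ^+ 2 / 2; have th0 : 0 < th by pos.
pose cA := th * delta / 4; have cA0 : 0 < cA by pos.
pose c1 := eta ^+ 6 / 8 * cA; have c10 : 0 < c1 by pos.
have [J [J0 HJ]] := ex_pos_nat (2 / (eta * c1)).
(* Up to J multiples of an almost period lose a factor 4^J, hence [rho0]; comparing sums of points
   of the graph loses 256, hence the first bound on [t]. The second is the smallness required by
   [graph_mass]. *)
pose rho0 := c1 / 4 ^+ J; have r0 : 0 < rho0 by pos.
pose t := Num.min (rho0 / 256) (eta ^+ 6 * cA / (256 * 16)).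
have t0 : 0 < t by rewrite lt_min; apply/andP; split; pos.
have [m [m0 Hm]] := ex_pos_nat (16 / t).
have m0R : 0 < m%:R :> R by rewrite ltr0n.
pose e1 := (8 * m%:R)^-1 : R; have e10 : 0 < e1 by pos.
pose K := 4 / eta ^+ 4 * (4 / (e1 * th ^+ 2 * delta)) / cA.
have K0 : 0 < K by pos.
pose cT := cA / (8 * K ^+ m); have cT0 : 0 < cT by pos.
have [D HD] := bogolyubov cT0.
exists D, J.+1, (eta ^+ 2 / 16); split; first by pos.
move=> X tf f f1 HU; have q0 := q_gt0 X; set q := q X in q0 *.
pose S := [set v | eta <= gf f v]; pose S' := [set v | th <= gf f v].
have HS : delta / 2 * q <= #|S|%:R.
  have : delta * q <= \sum_v gf f v ^+ 2 by move: HU; rewrite /U3 ler_pdivlMl // mulrC.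
  have : \sum_v gf f v ^+ 2 <= #|S|%:R + eta * q.
    apply: (@le_trans _ _ (\sum_(v in S) 1 + eta * \sum_v gf f v)); last first.
      by rewrite sum_const_in mulr1 lerD2l ler_pM2l // gf_sum.
    rewrite (bigID (mem S)) /=; apply: lerD.
      by apply: ler_sum => v _; rewrite expr_le1 ?gf_ge0 ?gf_le1.
    rewrite mulr_sumr [leRHS](bigID (mem S)) /=; apply: ler_wpDl.
      by apply: sumr_ge0 => i _; rewrite mulr_ge0 ?gf_ge0 // ltW.
    by apply: ler_sum => v; rewrite inE -ltNge => /ltW h; rewrite expr2; apply: ler_wpM2r h; exact: gf_ge0.
  by rewrite /eta; clear; lra.
have S0 : S != set0.
  apply/negP => /eqP E; move: HS; rewrite E cards0 leNgt => /negP; apply.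
  by pos.
have n0 : 0 < #|S|%:R :> R by rewrite ltr0n card_gt0.
have HSe v : v \in S -> eta <= gf f v by rewrite inE.
have Hpairs : th * #|S|%:R ^+ 2 <= \sum_(v in S) \sum_(w in S) b2r (v - w \in S').
  have D1 := gf_differences f1 (ltW e0) HSe.
  have : \sum_(v in S) \sum_(w in S) gf f (v - w) <= \sum_(v in S) \sum_(w in S) (b2r (v - w \in S') + th).
    apply: ler_sum => v _; apply: ler_sum => w _; case: (boolP (v - w \in S')).
      by move=> _; apply: (le_trans (gf_le1 f1 _)); rewrite lerDl ltW.
    by rewrite inE -ltNge add0r => /ltW.
  under [X in _ <= X -> _]eq_bigr do rewrite big_split /= sum_const_in.
  by rewrite big_split /= sum_const_in => H; move: (le_trans D1 H); rewrite exprMn /th; clear; lra.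
have [A [AS HA Hbad]] := dependent_random_choice th0 e10 S0 Hpairs.
have HAS v : v \in A -> eta <= gf f v by move/(subsetP AS); exact: HSe.
set n : R := #|A|%:R in HA Hbad.
have Hn : cA * q <= n.
  have h1 : th / 2 * #|S|%:R <= n.
    apply: ler_sqr_imp; first exact: ler0n.
    apply: le_trans HA; rewrite (exprMn 2 (th / 2)); apply: ler_wpM2r; first exact: sqr_ge0.
    by have := sqr_ge0 th; clear; lra.
  apply: le_trans h1; have -> : cA * q = th / 2 * (delta / 2 * q) by rewrite /cA; field.
  by rewrite ler_pM2l //; pos.
have nA0 : 0 < n by apply: lt_le_trans Hn; pos.
have A0 : A != set0 by rewrite -card_gt0 -(ltr0n R).
have l0 : 0 < e1 * th ^+ 2 / 2 * #|S|%:R by pos.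
have [V [HV1 HV2]] := large_common S S' l0.
have HV : #|V|%:R <= K * n.
  have cS' : #|S'|%:R <= 2 / eta ^+ 2 * q.
    have : th * #|S'|%:R <= q.
      apply: le_trans (gf_sum f1); rewrite mulrC -sum_const_in [leRHS](bigID (mem S')) /=.
      apply: ler_wpDr; first by apply: sumr_ge0 => i _; exact: gf_ge0.
      by apply: ler_sum => v; rewrite inE.
    by move=> H; rewrite mulrAC ler_pdivlMr ?exprn_gt0 //; move: H; rewrite /th; clear; lra.
  have h1 : #|V|%:R * (e1 * th ^+ 2 / 2 * (delta / 2 * q)) <= (2 / eta ^+ 2 * q) ^+ 2.
    apply: le_trans (_ : _ <= #|S'|%:R ^+ 2) _; last by rewrite lerXn2r // nnegrE ?ler0n // (le_trans _ cS').
    apply: le_trans HV1; rewrite ler_wpM2l ?ler0n // ler_wpM2l // divr_ge0 // mulr_ge0 ?exprn_ge0 ?ltW //.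
  have p0 : 0 < e1 * th ^+ 2 / 2 * (delta / 2 * q) by pos.
  apply: (@le_trans _ _ (K * (cA * q))); last by rewrite ler_pM2l.
  rewrite -(ler_pM2r p0); apply: (le_trans h1); rewrite le_eqVlt; apply/orP; left; apply/eqP.
  by rewrite /K; field; rewrite !gt_eqF.
have Hbad' : \sum_(v in A) \sum_(w in A) b2r (v - w \notin V) <= (8 * m%:R)^-1 * n ^+ 2.
  apply: le_trans Hbad; apply: ler_sum => v _; apply: ler_sum => w _.
  by case: (boolP (v - w \in V)) => //= /HV2 ->.
have AP := almost_periods A0 m0 K0 HV Hbad'; rewrite -/n in AP.
have HPhi : c1 * n <= \sum_x overlap R A x ^+ 2.
  apply: le_trans (Phi_energy A0 f1 e0 HAS); rewrite -/n /c1 ler_pdivlMr // expr2.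
  have -> : eta ^+ 6 / 8 * cA * n * q = eta ^+ 6 / 8 * (n * (cA * q)) by ring.
  by rewrite ler_pM2l; [rewrite ler_pM2l|pos].
have Hfib a : (#|[set xi | pdist R A (a, xi) <= c1 * n]|%:R : R) <= 2 / (eta * c1).
  apply: period_fibre => // x; rewrite -[leRHS]mulr1 ler_pdivlMl //.
  have -> : eta * \sum_xi b2r ((x, xi) \in A) = \sum_xi eta * b2r ((x, xi) \in A) by rewrite mulr_sumr.
  apply: le_trans (gf_fibre f1 x); apply: ler_sum => xi _.
  by case: (boolP ((x, xi) \in A)) => [/HAS h|_]; rewrite ?mulr1 // mulr0 gf_ge0.
(* Otherwise the multiples of xi by 0, ..., J would be J + 1 distinct points of one fibre, which
   holds at most J. *)
have Hzero xi : pdist R A (0, xi) <= rho0 * n -> xi = 0.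
  move=> h; apply: contrapT => xn; pose g (j : 'I_J.+1) := xi *+ j.
  have ginj : injective g.
    move=> i j; wlog: i j / (i <= j)%N => [W|ij E].
      by case/orP: (leq_total i j) => h' e; [|apply/esym]; apply: W.
    apply/val_inj/eqP; rewrite /= eqn_leq ij leqNgt; apply/negP => lt; apply: xn.
    apply: (tf xi (j - i)%N); first by rewrite subn_gt0 lt /= (leq_trans (leq_subr _ _)) // ltnW.
    by rewrite mulrnBr // -/(g j) -/(g i) -E subrr.
  have := Hfib 0; rewrite leNgt => /negP; apply; apply: (le_lt_trans HJ); rewrite ltr_nat.
  rewrite -[J]/(J.+1.-1) -[X in (X.-1 < _)%N](card_ord J.+1) prednK ?card_ord // -[X in (X <= _)%N](card_ord J.+1).
  rewrite -(card_imset predT ginj); apply: subset_leq_card; apply/subsetP => _ /imsetP [j _ ->]; rewrite inE.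
  have -> : (0, g j) = (0, xi) *+ j :> X * X.
    rewrite /g; elim: (nat_of_ord j) => [|k IH]; first by [].
    by rewrite !mulrS -IH; congr pair; rewrite /= addr0.
  apply: (le_trans (N2_nat R A _ _)); apply: (@le_trans _ _ (4 ^+ J * (rho0 * n))).
    apply: ler_pM => //; rewrite ?exprn_ge0 ?N2_ge0 //.
    by apply: ler_weXn2l; [rewrite ler1n|rewrite -ltnS ltn_ord].
  by rewrite mulrA /rho0 mulrCA mulfV ?mulr1 // gt_eqF // exprn_gt0.
have Huniq a xi xi' u : pdist R A (a, xi) <= u * n -> pdist R A (a, xi') <= u * n -> 4 * u <= rho0 -> xi = xi'.
  move=> h h' hu; apply/eqP; rewrite -subr_eq0; apply/eqP; apply: Hzero.
  have -> : (0, xi - xi') = (a, xi) + - (a, xi') :> X * X by congr pair; rewrite /= subrr.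
  apply: (le_trans (N2_add _ _ _ _)); rewrite N2_opp.
  have : 4 * u * n <= rho0 * n by rewrite ler_pM2r.
  by move: h h'; clear; lra.
have t1 : 256 * t <= rho0 by rewrite mulrC -ler_pdivlMr // ge_min lexx.
pose T := [set s : X * X | pdist R A s <= t * n].
have HT : cT * q <= #|T|%:R.
  apply: (@le_trans _ _ (n / (8 * K ^+ m))).
    by rewrite /cT mulrAC ler_pM2r //; pos.
  apply: (le_trans AP); rewrite ler_nat; apply: subset_leq_card; apply/subsetP => x; rewrite !inE => h.
  apply: (le_trans h); rewrite mulrAC ler_pM2r // ler_pdivrMr // mulrC -ler_pdivrMr //.
pose B := [set x.1 | x in T].
have HB : cT * q <= #|B|%:R.
  apply: (le_trans HT); rewrite ler_nat /B card_in_imset // => -[a xi] [b xi']; rewrite !inE /= => h h' E.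
  by rewrite -E in h' *; congr pair; apply: (Huniq a _ _ t) => //; move: t1 t0; clear; lra.
have [G [sG HG]] := HD X B HB.
(* Sums of four almost periods lose a factor 16. Outside the Bohr set the value of phi is
   arbitrary. *)
have Hex x : exists xi, nB G x <= 1 / 2 -> pdist R A (x, xi) <= 16 * t * n.
  have [h|h] := boolP (nB G x <= 1 / 2); last by exists 0 => h'; case/negP: h.
  have [a [b [c [d [[aB bB cB dB] ->]]]]] := HG x h.
  move: aB bB cB dB => /imsetP [a' a'T ->] /imsetP [b' b'T ->] /imsetP [c' c'T ->] /imsetP [d' d'T ->].
  exists (a'.2 - b'.2 + (c'.2 - d'.2)) => _.
  have -> : (a'.1 - b'.1 + (c'.1 - d'.1), a'.2 - b'.2 + (c'.2 - d'.2)) = (a' - b') + (c' - d') by [].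
  move: a'T b'T c'T d'T; rewrite !inE => ha hb hc hd.
  apply: (le_trans (N2_add _ _ _ _)).
  have h1 := N2_add R A a' (- b'); have h2 := N2_add R A c' (- d'); rewrite !N2_opp in h1 h2.
  by move: ha hb hc hd h1 h2; clear; lra.
have [phi Hphi] := choice Hex.
exists G, phi; split => //.
  move=> a b ha hb.
  have hab : nB G (a + b) <= 1 / 2 by apply: (le_trans (nBD _ _ _)); move: ha hb; clear; lra.
  have ha2 : nB G a <= 1 / 2 by move: ha; clear; lra.
  have hb2 : nB G b <= 1 / 2 by move: hb; clear; lra.
  apply: (Huniq (a + b) _ _ (64 * t)); last by move: t1; clear; lra.
    by apply: (le_trans (Hphi _ hab)); rewrite ler_pM2r //; move: t0; clear; lra.
  have -> : (a + b, phi a + phi b) = (a, phi a) + (b, phi b) by [].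
  apply: (le_trans (N2_add _ _ _ _)).
  have h1 := Hphi _ ha2; have h2 := Hphi _ hb2; have h3 := mulr_gt0 t0 nA0.
  by move: h1 h2 h3; rewrite -!mulrA; move: (t * n) => u; clear; lra.
move=> s ps ss; apply: (graph_mass A0 f1 e0 _ cA0 HAS Hn ps (t := 16 * t)).
- by rewrite mulr_ge0 // ltW.
- by move=> a /ss; exact: Hphi.
by rewrite mulrA mulrC -ler_pdivlMr ?mulr_gt0 // ge_min lexx orbT.
Qed.
End Graph.

(** * From a linear spectral map to correlation with a local quadratic phase *)

Section Inverse.
Variable R : realType.
Local Notation C := R[i].

(* w is, near every point x, a constant times a quadratic phase whose second order
   part B does not depend on x, up to an error L * nB G m at displacement m. *)
Definition quad (X : env R) (G : seq X) (L : R) (w : X -> C) (B : X -> X -> C) :=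
  [/\ bim G L^-1 B, forall x, nm (w x) <= 1 &
    forall x, exists (c : C) (th : X -> C), [/\ nm c <= 1, forall m, nm (th m) = 1,
      forall a b, nB G a <= L^-1 -> nB G b <= L^-1 -> th (a + b) = th a * th b * B a b &
      forall m, nB G m <= L^-1 -> nm (w (x + m) - c * th m) <= L * nB G m]].

Lemma half_ex (X : env R) J : (1 < J)%N -> torsion_free J X -> exists h : X -> X,
  (forall x, h x + h x = x) /\ (forall x y, h (x + y) = h x + h y).
Proof.
move=> J1 tf; have inj : injective (fun x : X => x + x).
  move=> x y E; apply/eqP; rewrite -subr_eq0; apply/eqP; apply: (tf _ 2%N) => //.
  by rewrite mulrnBl !mulr2n E subrr.
have K := injF_bij inj; case: K => h h1 h2.
exists h; split; first exact: h2.
by move=> x y; apply: inj; rewrite h2 addrACA !h2.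
Qed.

(** The sum inside [gf] is translation invariant, so an average over m from s1 can be inserted for
    free. The points b and x are then frozen by pigeonhole, and F gathers factors that do not
    involve a. *)
Lemma star_local (X : env R) (f : X -> C) (phi : X -> X) c0 s s1 :
  (forall x, nm (f x) <= 1) -> prob s -> prob s1 ->
  c0 <= \sum_a \sum_b s a * s b * gf f (a - b, phi a - phi b) ->
  exists (y : X) (F : X -> C), (forall m, nm (F m) <= 1) /\
  c0 <= \sum_a s a * nm (\sum_m (s1 m)%:C * (f (y + (m + a)) * F m * cj (ch (phi a) m))) ^+ 2.
Proof.
move=> f1 ps ps1 H; have q0 := q_gt0 X.
have H1 : c0 <= \sum_b s b * \sum_a s a * gf f (a - b, phi a - phi b).
  apply: (le_trans H); rewrite exchange_big /= le_eqVlt; apply/orP; left; apply/eqP.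
  by apply: eq_bigr => b _; rewrite mulr_sumr; apply: eq_bigr => a _; ring.
have [b [_ Hb]] := wavg_ex ps H1.
have pu : prob (fun _ : X => (q X)^-1).
  split; first by move=> _; rewrite invr_ge0 ltW.
  by rewrite sumr_const -[LHS]mulr_natl mulfV // q_neq0.
pose F x m := cj (f (x + m)) * ch (phi b) (x + m).
pose T x a := \sum_m (s1 m)%:C * (f (x - b + (m + a)) * F x m * cj (ch (phi a) m)).
have E a : gf f (a - b, phi a - phi b) <= \sum_x (q X)^-1 * nm (T x a) ^+ 2.
  have -> : gf f (a - b, phi a - phi b) = nm (\sum_x ((q X)^-1)%:C * (cj (ch (phi a) x) * T x a)) ^+ 2.
    rewrite /gf /Af -mulr_sumr; congr (nm (_ * _) ^+ 2).
    transitivity (\sum_m (s1 m)%:C * \sum_n f (n + (a - b)) * cj (f n) * cj (ch (phi a - phi b) n)).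
      by rewrite -mulr_suml -rmorph_sum ps1.2 mul1r.
    under [RHS]eq_bigr do rewrite mulr_sumr; rewrite exchange_big /=; apply: eq_bigr => m _.
    rewrite -[X in _ * X](sum_shift m) mulr_sumr; apply: eq_bigr => n _.
    have -> : n - b + (m + a) = n + m + (a - b) by rewrite addrACA [- b + a]addrC.
    rewrite /F chDl chNl [ch (phi a) (n + m)]chDr !cjM cjK; ring.
  have := jensen2 (fun x => nm (T x a)) pu.
  apply: le_trans; rewrite lerXn2r ?nnegrE ?nm_ge0 ?sumr_ge0 // => [x _|].
    by rewrite mulr_ge0 ?nm_ge0 ?pu.1.
  apply: (le_trans (wnm _ pu.1)); apply: ler_sum => x _.
  by rewrite nmM nm_cj ch_nm mul1r.
have H2 : c0 <= \sum_x (q X)^-1 * \sum_a s a * nm (T x a) ^+ 2.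
  apply: (le_trans Hb); under [leRHS]eq_bigr do rewrite mulr_sumr; rewrite exchange_big /=.
  apply: ler_sum => a _; apply: (le_trans (ler_wpM2l (ps.1 a) (E a))).
  by rewrite mulr_sumr; apply: ler_sum => x _; rewrite mulrCA.
have [x [_ Hx]] := wavg_ex pu H2.
exists (x - b), (F x); split => // m.
by apply: nm_le1M; rewrite ?nm_cj ?ch_nm.
Qed.

Lemma nm_sqr_dist (x y : C) : nm x <= 1 -> nm y <= 1 -> nm x ^+ 2 <= nm y ^+ 2 + 2 * nm (x - y).
Proof.
move=> x1 y1; have := nm_tri x y; have := nm_ge0 x; have := nm_ge0 y.
have := nm_ge0 (x - y); move: (nm x) (nm y) (nm (x - y)) x1 y1 => a b c; clear => a1 b1 c0 b0 a0 h.
have h1 : 0 <= (c - (a - b)) * (a + b) by apply: mulr_ge0; lra.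
have h2 : 0 <= c * (2 - (a + b)) by apply: mulr_ge0; lra.
lra.
Qed.

(** Expanding the square gives pairs m, m'. The shift a -> a - m - m' makes each factor of f depend
    on a and only one of m, m'. What still couples m and m' is the commutator S, which [trivialise]
    forces to be near 1. *)
Lemma symmetric_spectrum (D : nat) (c0 eps : R) : 0 < c0 -> 0 < eps ->
  exists (D' : nat) (r' : R), 0 < r' /\ forall (X : env R) (f : X -> C) (G : seq X) (phi : X -> X),
  (forall x, nm (f x) <= 1) -> (size G <= D)%N ->
  (forall a b, nB G a <= 1 / 4 -> nB G b <= 1 / 4 -> phi (a + b) = phi a + phi b) ->
  (forall s, prob s -> (forall x, s x != 0 -> nB G x <= 1 / 2) ->
      c0 <= \sum_a \sum_b s a * s b * gf f (a - b, phi a - phi b)) ->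
  exists G' : seq X, [/\ {subset G <= G'}, (size G' <= D')%N &
    forall a b, nB G' a <= r' -> nB G' b <= r' -> nm (ch (phi b) a * cj (ch (phi a) b) - 1) <= eps].
Proof.
move=> c00 e0; have r16 : 0 < 1 / 16 :> R by pos.
have [K0 [K01 HK0]] := bump_ex D r16.
pose r1 := Num.min (1 / 64) (c0 / (4 * K0)).
have K00 : 0 < K0 by apply: lt_le_trans K01.
have r10 : 0 < r1 by rewrite lt_min; apply/andP; split; pos.
have [K1 [K11 HK1]] := bump_ex D r10.
have K10 : 0 < K1 by apply: lt_le_trans K11.
have r80 : 0 < 8 * r1 by pos.
have c20 : 0 < c0 / 2 by pos.
have [D' [r' [r'0 HT]]] := trivialise D K10 r80 c20 e0.
exists D', r'; split => // X f G phi f1 sG phiD Hs.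
have [s ws] := HK0 X G sG; have [s1 ws1] := HK1 X G sG.
have [ps ss _ _] := ws; have [ps1 ss1 s1K _] := ws1.
have h1 : r1 <= 1 / 64 by rewrite ge_min lexx.
have h2 : r1 <= c0 / (4 * K0) by rewrite ge_min lexx orbT.
have q4 : 0 <= 1 / 4 :> R by clear; lra.
have phi0 : phi 0 = 0.
  by apply: (addIr (phi 0)); rewrite -phiD ?nB0 // !add0r.
have phiN a : nB G a <= 1 / 4 -> phi (- a) = - phi a.
  by move=> ha; apply: (addIr (phi a)); rewrite -phiD ?nBN // !addNr phi0.
have Hs' : c0 <= \sum_a \sum_b s a * s b * gf f (a - b, phi a - phi b).
  by apply: Hs => // x /ss; clear; lra.
have [y [F [F1 HF]]] := star_local f1 ps ps1 Hs'.
pose H z := f (y + z); have H1 z : nm (H z) <= 1 by exact: f1.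
pose Psi m m' a := H (m + a) * cj (H (m' + a)) * cj (ch (phi a) (m - m')).
have Psi1 m m' a : nm (Psi m m' a) <= 1.
  by apply: nm_le1M; [apply: nm_le1M; rewrite ?nm_cj | rewrite nm_cj ch_nm].
have E1 : (\sum_a s a * nm (\sum_m (s1 m)%:C * (f (y + (m + a)) * F m * cj (ch (phi a) m))) ^+ 2)%:C =
   \sum_m (s1 m)%:C * \sum_m' (s1 m')%:C * (F m * cj (F m') * \sum_a (s a)%:C * Psi m m' a).
  rewrite rmorph_sum /=; transitivity (\sum_a \sum_m \sum_m' (s1 m)%:C * ((s1 m')%:C * (F m * cj (F m') * ((s a)%:C * Psi m m' a)))).
    apply: eq_bigr => a _; rewrite rmorphM /= nm_sqr cj_sum mulr_suml mulr_sumr; apply: eq_bigr => m _.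
    rewrite !mulr_sumr; apply: eq_bigr => m' _; rewrite /Psi /H chBr !cjM !cjK cjR; ring.
  rewrite exchange_big; apply: eq_bigr => m _; rewrite exchange_big mulr_sumr; apply: eq_bigr => m' _.
  by rewrite -mulr_sumr -mulr_sumr -mulr_sumr.
pose al a m := F m * cj (H (a - m)) * cj (ch (phi a) m) * ch (phi m) m.
pose be a m := cj (F m) * H (a - m) * ch (phi a) m * cj (ch (phi m) m).
pose S a b := ch (phi b) a * cj (ch (phi a) b).
have al1 a m : nm (al a m) <= 1.
  by apply: nm_le1M; rewrite ?ch_nm //; apply: nm_le1M; rewrite ?nm_cj ?ch_nm //; apply: nm_le1M; rewrite ?nm_cj.
have be1 a m : nm (be a m) <= 1.
  by apply: nm_le1M; rewrite ?nm_cj ?ch_nm //; apply: nm_le1M; rewrite ?ch_nm //; apply: nm_le1M; rewrite ?nm_cj.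
(* The a-average shifted by -m - m', at a cost of c0 / 2 because s is Lipschitz. *)
pose Y := \sum_m (s1 m)%:C * \sum_m' (s1 m')%:C * (F m * cj (F m') * \sum_a (s a)%:C * Psi m m' (a + (- m - m'))).
have E2 : c0 <= nm Y + c0 / 2.
  apply: (le_trans HF); set Z := \sum_a _; apply: (le_trans (Re_le Z%:C)); rewrite /Z E1.
  apply: (le_trans (nm_tri _ Y)); rewrite lerD2l.
  apply: wnm_dist => // m sm; apply: wnm_dist => // m' sm'.
  rewrite -mulrBr nmM; apply: le_trans (ler_piMl (nm_ge0 _) _) _; first by apply: nm_le1M; rewrite ?nm_cj.
  rewrite nmBC; apply: (le_trans (wt_shift _ ws (Psi1 m m'))).
  have : nB G (- m - m') <= 2 * r1.
    by apply: (le_trans (nBB _ _ _)); rewrite nBN; have := ss1 _ sm; have := ss1 _ sm'; clear; lra.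
  move=> h; apply: (@le_trans _ _ (K0 * (2 * (c0 / (4 * K0))))).
    by rewrite ler_pM2l //; move: h h2; clear; lra.
  by rewrite le_eqVlt; apply/orP; left; apply/eqP; field; rewrite gt_eqF.
have E3 : Y = \sum_a (s a)%:C * \sum_m (s1 m)%:C * (al a m * \sum_m' (s1 m')%:C * (be a m' * S m m')).
  transitivity (\sum_m \sum_m' \sum_a (s1 m)%:C * ((s1 m')%:C * ((s a)%:C * (al a m * be a m' * S m m')))).
    apply: eq_bigr => m _; rewrite mulr_sumr; apply: eq_bigr => m' _; rewrite !mulr_sumr; apply: eq_bigr => a _.
    have [->|sm] := eqVneq (s1 m) 0; first by rewrite !mul0r.
    have [->|sm'] := eqVneq (s1 m') 0; first by rewrite !(mul0r, mulr0).
    have [->|sa] := eqVneq (s a) 0; first by rewrite !(mul0r, mulr0).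
    congr (_ * (_ * _)); rewrite mulrCA; congr (_ * _); rewrite /Psi.
    have hm := ss1 _ sm; have hm' := ss1 _ sm'; have ha := ss _ sa.
    have -> : m + (a + (- m - m')) = a - m' by rewrite addrCA [m + _]addrA subrr add0r.
    have -> : m' + (a + (- m - m')) = a - m by rewrite addrCA [- m - m']addrC [m' + _]addrA subrr add0r.
    rewrite phiD; last 2 first.
    - by move: ha; clear; lra.
    - by apply: (le_trans (nBB _ _ _)); rewrite nBN; move: hm hm' h1; clear; lra.
    have hm4 : nB G m <= 1 / 4 by move: hm h1; clear; lra.
    have hm4' : nB G m' <= 1 / 4 by move: hm' h1; clear; lra.
    have -> : phi (- m - m') = - phi m - phi m' by rewrite phiD ?phiN ?nBN.
    rewrite /al /be /S !chDl !chNl !chBr !cjM !cjK; ring.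
  under eq_bigr do rewrite exchange_big /=; rewrite exchange_big; apply: eq_bigr => a _.
  rewrite mulr_sumr; apply: eq_bigr => m _; rewrite mulrCA !mulr_sumr; apply: eq_bigr => m' _.
  by ring.
have E4 : c0 / 2 <= \sum_a s a * \sum_m s1 m * nm (\sum_m' (s1 m')%:C * (be a m' * S m m')).
  apply: (@le_trans _ _ (nm Y)); first by move: E2; clear; lra.
  rewrite E3; apply: (le_trans (wnm _ ps.1)); apply: ler_sum => a _; apply: ler_wpM2l; first exact: ps.1.
  apply: (le_trans (wnm _ ps1.1)); apply: ler_sum => m _; apply: ler_wpM2l; first exact: ps1.1.
  by rewrite nmM ler_piMl ?nm_ge0.
have [a [_ Ha]] := wavg_ex ps E4.
have e8 : 8 * r1 / 8 = r1 by rewrite mulrAC mulfV ?mul1r // pnatr_eq0.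
apply: (HT X G S s1 s1 (be a)) => //.
- split.
  + by move=> u v; rewrite /S nm_unitM ?nm_cj ?ch_nm.
  + move=> u v w hu hv hw.
    have hu4 : nB G u <= 1 / 4 by move: hu h1; clear; lra.
    have hv4 : nB G v <= 1 / 4 by move: hv h1; clear; lra.
    by rewrite /S phiD // chDl chDr cjM; ring.
  + move=> u v w hu hv hw.
    have hu4 : nB G u <= 1 / 4 by move: hu h1; clear; lra.
    have hv4 : nB G v <= 1 / 4 by move: hv h1; clear; lra.
    by rewrite /S phiD // chDl chDr cjM; ring.
- by rewrite e8.
- by move=> x sx; rewrite e8; exact: ss1.
Qed.

(** The symmetrised phase is integrated to th and divided out of f near y. Were all Fourier
    coefficients of the result small, Parseval would contradict the lower bound of [star_local]; a
    large coefficient supplies the linear twist in w. *)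
Lemma inverse_U3 (delta : R) : 0 < delta -> exists (D J : nat) (L c : R),
  [/\ 1 <= L, 0 < c & forall X : env R, torsion_free J X -> forall f : X -> C,
  (forall x, nm (f x) <= 1) -> delta <= U3 f -> exists (G : seq X) w B,
  [/\ (size G <= D)%N, quad G L w B & c * q X <= nm (\sum_x f x * cj (w x))]].
Proof.
move=> d0; have [D1 [J [c0 [c00 HL]]]] := linear_spectrum d0.
have e0 : 0 < c0 / 16 by pos.
have [D2 [r2 [r20 HS]]] := symmetric_spectrum D1 c00 e0.
pose r3 := Num.min r2 (1 / 16).
have r30 : 0 < r3 by rewrite lt_min r20; pos.
have r32 : r3 <= r2 by rewrite ge_min lexx.
have r33 : r3 <= 1 / 16 by rewrite ge_min lexx orbT.
have r60 : 0 < r3 / 16 by pos.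
have [K [K1 HK]] := bump_ex (D2 + D2) r60.
have K0 : 0 < K by apply: lt_le_trans K1.
(* From m1 <= 1 and m1 <= c0 follows m1^2 / 4 < c0 / 2, the final contradiction. *)
pose m1 := Num.min 1 c0; have m10 : 0 < m1 by rewrite lt_min c00 ltr01.
pose c := m1 / (2 * K).
have cp : 0 < c by rewrite /c; pos.
exists (D2 + D2)%N, (maxn 2 J), (8 / r3), c; split => //.
  by rewrite ler_pdivlMr // mul1r; move: r33; clear; lra.
move=> X tf f f1 HU; have q0 := q_gt0 X.
have tfJ : torsion_free J X by move=> x j /andP [j0 jJ]; apply: tf; rewrite j0 leq_max jJ orbT.
have [G1 [phi [sG1 phiD Hs]]] := HL X tfJ f f1 HU.
have [G2 [G12 sG2 Hsym]] := HS X f G1 phi f1 sG1 phiD Hs.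
have mx : (1 < maxn 2 J)%N by rewrite leq_max.
have [h [hK hD]] := half_ex mx tf.
have ch_half xi x : ch (h xi) x = ch xi (h x).
  by rewrite -{1}(hK x) chDr -chDl hK.
(* Adjoining the halved frequencies controls the halves of points, since ch (h xi) x = ch xi (h
   x). *)
pose G := G2 ++ [seq h xi | xi <- G2].
have GA x : nB G2 x <= nB G x by apply: nB_sub => xi; rewrite mem_cat => ->.
have GB x : nB G2 (h x) <= nB G x.
  apply/nB_leP; first exact: nB_ge0.
  move=> xi xG; rewrite -ch_half; apply: nB_mem; rewrite mem_cat; apply/orP; right; exact: map_f.
have G1A x : nB G1 x <= nB G x by apply: le_trans (GA x); exact: nB_sub.
have G1B x : nB G1 (h x) <= nB G x by apply: le_trans (GB x); exact: nB_sub.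
have sG : (size G <= D2 + D2)%N by rewrite size_cat size_map leq_add.
pose b x y := ch (phi (h x)) (h y).
have phi4 x : nB G x <= r3 -> nB G1 (h x) <= 1 / 4.
  by move=> hx; apply: (le_trans (G1B x)); move: hx r33; clear; lra.
have bDl x y z : nB G x <= r3 -> nB G y <= r3 -> b (x + y) z = b x z * b y z.
  by move=> hx hy; rewrite /b hD phiD ?chDl // phi4.
have bDr x y z : b x (y + z) = b x y * b x z by rewrite /b hD chDr.
have b1 x y : nm (b x y) = 1 by rewrite /b ch_nm.
(* With both arguments of b halved, ch (phi a) m is the fourth power of b a m, and approximate
   symmetry replaces two of the four factors by b m a. The resulting B is exactly symmetric and is
   the second order part of th. *)
pose B x y := (b x y * b y x) ^+ 2.
pose th x := b x x ^+ 2.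
have th1 x : nm (th x) = 1 by rewrite /th nm_unitX.
have B1 x y : nm (B x y) = 1 by rewrite /B nm_unitX // nm_unitM.
have BDl x y z : nB G x <= r3 -> nB G y <= r3 -> B (x + y) z = B x z * B y z.
  by move=> hx hy; rewrite /B bDl // bDr; ring.
have BDr x y z : nB G x <= r3 -> nB G y <= r3 -> B z (x + y) = B z x * B z y.
  by move=> hx hy; rewrite /B bDl // bDr; ring.
have thD x y : nB G x <= r3 -> nB G y <= r3 -> th (x + y) = th x * th y * B x y.
  by move=> hx hy; rewrite /th bDl // !bDr /B; ring.
have HB m a : nB G m <= r3 -> nB G a <= r3 -> nm (ch (phi a) m - B m a) <= c0 / 8.
  move=> hm ha.
  have E : ch (phi a) m = (b a m * b a m) ^+ 2.
    by rewrite /b -chDr hK expr2 -chDl -phiD ?phi4 // hK.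
  have hS : nm (b a m * cj (b m a) - 1) <= c0 / 16.
    by apply: Hsym; [apply: (le_trans (GB m)) | apply: (le_trans (GB a))]; apply: le_trans r32.
  rewrite E /B.
  have -> : (b a m * b a m) ^+ 2 - (b m a * b a m) ^+ 2 =
     b a m ^+ 2 * (b m a ^+ 2) * ((b a m * cj (b m a)) ^+ 2 - 1).
    have u := unit_cj (b1 m a); move: (b m a) (b a m) (cj (b m a)) u => y x z u.
    rewrite mulrBr mulr1; congr (_ - _); last by ring.
    by transitivity (x ^+ 4 * (y * z) ^+ 2); [rewrite u expr1n mulr1; ring|ring].
  rewrite nmM nm_unitM ?nm_unitX // mul1r.
  have -> : (b a m * cj (b m a)) ^+ 2 - 1 = (b a m * cj (b m a)) * (b a m * cj (b m a)) - 1 * 1 by rewrite expr2 mulr1.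
  apply: (le_trans (nm_mul_dist _ _ _ _)); rewrite ?nm1 ?nmM ?nm_cj ?b1 ?mulr1 //.
  by move: hS; clear; lra.
have [s ws] := HK X G sG; have [ps ss sK _] := ws.
have le16 u : nB G u <= r3 / 16 -> nB G u <= r3 by move: r30; clear; lra.
have Hs' : c0 <= \sum_a \sum_b s a * s b * gf f (a - b, phi a - phi b).
  by apply: Hs => // x /ss hx; apply: (le_trans (G1A x)); move: hx r33; clear; lra.
have [y [F [F1 HF]]] := star_local f1 ps ps Hs'.
pose rho := r3 / 8; have rho0 : 0 < rho by rewrite /rho; pos.
(* A Lipschitz cutoff, 1 within rho and 0 beyond 2 rho, so that w is locally quadratic at every base
   point. *)
pose chi x := Num.max 0 (Num.min 1 (2 - nB G x / rho)).
have chi01 x : 0 <= chi x <= 1 by rewrite /chi le_max lexx ge_max ge_min ler01 lexx.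
have chi1 x : nB G x <= rho -> chi x = 1.
  move=> hx; have : nB G x / rho <= 1 by rewrite ler_pdivrMr // mul1r.
  by move=> h1; rewrite /chi (min_idPl _) ?max_r //; move: h1; clear; lra.
have chi0 x : 2 * rho <= nB G x -> chi x = 0.
  move=> hx; have : 2 <= nB G x / rho by rewrite ler_pdivlMr.
  by move=> h1; rewrite /chi max_l // ge_min; apply/orP; right; move: h1; clear; lra.
have chiL x m : `|chi (x + m) - chi x| <= nB G m / rho.
  have A u v : nB G u <= nB G v + nB G m -> chi v - chi u <= nB G m / rho.
    move=> hu; have hu' : nB G u / rho <= nB G v / rho + nB G m / rho by rewrite -mulrDl ler_wpM2r // invr_ge0 ltW.
    have n0 : 0 <= nB G m / rho by rewrite divr_ge0 ?nB_ge0 // ltW.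
    rewrite /chi; move: (nB G u / rho) (nB G v / rho) (nB G m / rho) hu' n0 => a d e; clear => h1 h2.
    rewrite lerBlDr ge_max; apply/andP; split; first by apply: addr_ge0 => //; rewrite le_max lexx.
    rewrite -lerBlDl le_max; apply/orP; right; rewrite le_min; apply/andP; split.
      by have : Num.min 1 (2 - d) <= 1 by [rewrite ge_min lexx]; lra.
    by have : Num.min 1 (2 - d) <= 2 - d by [rewrite ge_min lexx orbT]; lra.
  rewrite ler_norml; apply/andP; split.
    by rewrite lerNl opprB; apply: A; exact: nBD.
  by apply: A; have := nBB G (x + m) m; rewrite addrK.
pose H z := f (y + z) * cj (th z) * (chi z)%:C.
pose F2 m := cj ((s m)%:C * (F m * th m)).
have HF2 : c0 / 2 <= \sum_a s a * nm (\sum_m H (m + a) * cj (F2 m)) ^+ 2.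
  have : \sum_a s a * nm (\sum_m (s m)%:C * (f (y + (m + a)) * F m * cj (ch (phi a) m))) ^+ 2 <=
     \sum_a s a * (nm (\sum_m H (m + a) * cj (F2 m)) ^+ 2 + c0 / 4); last first.
    under [X in _ <= X -> _]eq_bigr do rewrite mulrDr.
    rewrite big_split /= -[X in _ <= _ + X -> _]mulr_suml ps.2 mul1r => h1; have := le_trans HF h1.
    by rewrite -lerBlDr; apply: le_trans; move: c00; clear; lra.
  apply: ler_sum => a _; have [->|sa] := eqVneq (s a) 0; first by rewrite !mul0r.
  apply: ler_wpM2l; first exact: ps.1.
  have ha := ss _ sa.
  have E1 : nm (\sum_m H (m + a) * cj (F2 m)) = nm (\sum_m (s m)%:C * (f (y + (m + a)) * F m * cj (B m a))).
    rewrite -[LHS]mulr1 -(th1 a) -nmM mulrC mulr_sumr; congr nm; apply: eq_bigr => m _.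
    rewrite /F2 cjK /H; have [->|sm] := eqVneq (s m) 0; first by rewrite !(mul0r, mulr0).
    have hm := ss _ sm.
    rewrite chi1; last by apply: (le_trans (nBD _ _ _)); rewrite /rho; move: ha hm; clear; lra.
    rewrite thD ?le16 //.
    rewrite rmorph1 (cjM (th m * th a)) (cjM (th m)); have u := unit_cj (th1 a); have u' := unit_cj (th1 m).
    transitivity ((th a * cj (th a)) * (th m * cj (th m)) * ((s m)%:C * (f (y + (m + a)) * F m * cj (B m a)))); first by ring.
    by rewrite u u' !mul1r.
  rewrite E1; set Y := (X in _ <= nm X ^+ 2 + _); apply: (le_trans (@nm_sqr_dist _ Y _ _)).
  - by apply: wnm_le => // m _; apply: nm_le1M; rewrite ?nm_cj ?ch_nm //; apply: nm_le1M.
  - by apply: wnm_le => // m _; apply: nm_le1M; rewrite ?nm_cj ?B1 //; apply: nm_le1M.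
  rewrite lerD2l; apply: (@le_trans _ _ (2 * (c0 / 8))); last by clear; lra.
  rewrite ler_pM2l //; apply: wnm_dist => // m sm; have hm := ss _ sm.
  rewrite -mulrBr -cjB nmM nm_cj; apply: le_trans (ler_piMl (nm_ge0 _) _) _; first by apply: nm_le1M.
  by apply: HB; exact: le16.
apply: contrapT => Hno.
have Hxi xi : nm (ft H xi) <= c * q X.
  rewrite leNgt; apply/negP => hxi; apply: Hno.
  pose w n := (chi (n - y))%:C * th (n - y) * ch xi (n - y).
  exists G, w, B; split => //; last first.
    apply: (le_trans (ltW hxi)); rewrite le_eqVlt; apply/orP; left; apply/eqP; congr nm.
    rewrite /ft -(sum_shift (- y)); apply: eq_bigr => n _.
    rewrite /H /w [y + _]addrC subrK !cjM cjR; ring.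
  have iL : (8 / r3)^-1 = rho by rewrite invf_div.
  rewrite /quad iL; split.
  - split => // u v t hu hv ht; [apply: BDl|apply: BDr]; move: hu hv; rewrite /rho; move: r30; clear; lra.
  - move=> x; apply: nm_le1M; rewrite ?ch_nm //; apply: nm_le1M; rewrite ?th1 // nmR ger0_norm.
      by have /andP [] := chi01 (x - y).
    by have /andP [] := chi01 (x - y).
  move=> x; have rho8 : 8 * rho = r3 by rewrite /rho mulrC mulfVK // pnatr_eq0.
  have le1 u : nB G u <= rho -> nB G u <= r3 by move: rho8 rho0; clear; lra.
  (* Far from y the cutoff vanishes around x and the local constant is 0; near y the local phase
     acquires the linear factors ch xi m and B (x - y) m. *)
  have [hy|hy] := leP (nB G (x - y)) (3 * rho); last first.
    exists 0, th; split; rewrite ?nm0 //.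
      by move=> u v hu hv; apply: thD; move: hu hv rho8 rho0; clear; lra.
    move=> m hm; rewrite mul0r subr0 /w addrAC chi0 ?mul0r ?nm0.
      by rewrite mulr_ge0 ?nB_ge0 // divr_ge0 // ltW.
    have := nBB G (x - y + m) m; rewrite addrK => h1; move: h1 hm hy rho0; clear; lra.
  exists ((chi (x - y))%:C * th (x - y) * ch xi (x - y)), (fun m => th m * ch xi m * B (x - y) m); split.
  - apply: nm_le1M; rewrite ?ch_nm //; apply: nm_le1M; rewrite ?th1 // nmR ger0_norm.
      by have /andP [] := chi01 (x - y).
    by have /andP [] := chi01 (x - y).
  - by move=> m; rewrite !nm_unitM ?ch_nm.
  - move=> u v hu hv; rewrite thD ?le1 // BDr ?le1 // chDr; ring.
  move=> m hm; rewrite /w.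
  have -> : x + m - y = (x - y) + m by rewrite addrAC.
  have hy3 : nB G (x - y) <= r3 by move: hy rho8 rho0; clear; lra.
  rewrite (thD (x - y) m hy3 (le1 _ hm)) (chDr xi (x - y) m).
  have -> : (chi (x - y + m))%:C * (th (x - y) * th m * B (x - y) m) * (ch xi (x - y) * ch xi m) -
    (chi (x - y))%:C * th (x - y) * ch xi (x - y) * (th m * ch xi m * B (x - y) m) =
    (chi (x - y + m) - chi (x - y))%:C * (th (x - y) * th m * B (x - y) m * ch xi (x - y) * ch xi m).
    by rewrite rmorphB /=; ring.
  rewrite nmM !nm_unitM ?ch_nm // mulr1 nmR; apply: (le_trans (chiL _ _)).
  by rewrite /rho invf_div mulrC.
have P1 : \sum_a nm (\sum_m H (m + a) * cj (F2 m)) ^+ 2 <= c ^+ 2 * q X ^+ 2 * (K / q X).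
  rewrite -(ler_pM2l q0) -parseval; under eq_bigr do rewrite ft_corr nmM nm_cj exprMn.
  apply: (@le_trans _ _ (\sum_xi (c * q X) ^+ 2 * nm (ft F2 xi) ^+ 2)).
    apply: ler_sum => xi _; apply: ler_wpM2r; first exact: sqr_ge0.
    by rewrite lerXn2r ?nnegrE ?nm_ge0 // mulr_ge0 // ltW.
  rewrite -mulr_sumr parseval exprMn mulrCA ler_pM2l //; apply: ler_wpM2l; first by apply: mulr_ge0; exact: sqr_ge0.
  apply: (@le_trans _ _ (\sum_x s x * (K / q X))); last by rewrite -mulr_suml ps.2 mul1r.
  apply: ler_sum => x _; rewrite /F2 nm_cj nmM nmR ger0_norm ?ps.1 // exprMn expr2 -mulrA.
  apply: ler_wpM2l; first exact: ps.1.
  apply: le_trans (sK x); rewrite ler_piMr ?ps.1 // expr_le1 ?nm_ge0 // nmM th1 mulr1; exact: F1.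
have : c0 / 2 <= K / q X * (c ^+ 2 * q X ^+ 2 * (K / q X)).
  apply: (le_trans HF2); apply: le_trans (ler_wpM2l _ P1); last by rewrite divr_ge0 // ltW.
  by rewrite mulr_sumr; apply: ler_sum => a _; rewrite ler_wpM2r ?sqr_ge0.
have -> : K / q X * (c ^+ 2 * q X ^+ 2 * (K / q X)) = m1 ^+ 2 / 4.
  by rewrite /c; field; rewrite !gt_eqF.
have m11 : m1 <= 1 by rewrite ge_min lexx.
have m12 : m1 <= c0 by rewrite ge_min lexx orbT.
have : m1 ^+ 2 <= 1 * c0 by rewrite expr2; apply: ler_pM => //; exact: ltW.
by move: c00; clear; lra.
Qed.
End Inverse.

(** * Regularity *)

Section Structured.
Variable R : realType.
Local Notation C := R[i].

Lemma add_cj_Re (x : C) : x + cj x = (2 * Re x)%:C.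
Proof. by rewrite /cj addcJ rmorphM /= rmorph_nat. Qed.

Lemma quad_mono (X : env R) (G G' : seq X) (L L' : R) w B : {subset G <= G'} -> 0 < L -> L <= L' ->
  quad G L w B -> quad G' L' w B.
Proof.
move=> sG L0 LL [[B1 Bl Br] w1 H].
have iL : L'^-1 <= L^-1 by rewrite lef_pV2 ?posrE // (lt_le_trans L0).
have le u : nB G' u <= L'^-1 -> nB G u <= L^-1.
  by move=> h; apply: (le_trans (nB_sub _ sG)); apply: (le_trans h).
split => //.
  by split => // a b c ha hb hc; [apply: Bl|apply: Br]; exact: le.
move=> x; have [c [th [c1 th1 thD Hx]]] := H x; exists c, th; split => //.
  by move=> a b ha hb; apply: thD; exact: le.
move=> m hm; apply: (le_trans (Hx m (le _ hm))); apply: ler_pM; rewrite ?nB_ge0 //; first exact: ltW.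
exact: nB_sub.
Qed.

Lemma quad_one (X : env R) (G : seq X) (L : R) : 0 < L -> quad G L (fun _ => 1) (fun _ _ => 1).
Proof.
move=> L0; split; rewrite ?nm1 //.
  by split => // *; rewrite ?nm1 ?mulr1.
move=> x; exists 1, (fun _ => 1); split; rewrite ?nm1 ?mulr1 // => m _.
by rewrite subrr nm0 mulr_ge0 ?nB_ge0 // ltW.
Qed.

Lemma quad_conj (X : env R) (G : seq X) (L : R) w B : quad G L w B ->
  quad G L (fun x => cj (w x)) (fun a b => cj (B a b)).
Proof.
move=> [[B1 Bl Br] w1 H]; split; last 1 first.
- move=> x; have [c [th [c1 th1 thD Hx]]] := H x; exists (cj c), (fun m => cj (th m)); split.
  + by rewrite nm_cj.
  + by move=> m; rewrite nm_cj.
  + by move=> a b ha hb; rewrite thD // !cjM.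
  + by move=> m hm; rewrite -cjM -cjB nm_cj; exact: Hx.
- split; first by move=> a b; rewrite nm_cj.
    by move=> a b c ha hb hc; rewrite Bl // cjM.
  by move=> a b c ha hb hc; rewrite Br // cjM.
- by move=> x; rewrite nm_cj.
Qed.

Lemma quad_mul (X : env R) (G : seq X) (L L' : R) w B w' B' : 0 < L -> 0 < L' ->
  quad G L w B -> quad G L' w' B' -> quad G (L + L') (fun x => w x * w' x) (fun a b => B a b * B' a b).
Proof.
move=> L0 L0' [[B1 Bl Br] w1 H] [[B1' Bl' Br'] w1' H'].
have S0 : 0 < L + L' by rewrite addr_gt0.
have i1 u : nB G u <= (L + L')^-1 -> nB G u <= L^-1.
  by move=> h; apply: (le_trans h); rewrite lef_pV2 ?posrE // lerDl ltW.
have i2 u : nB G u <= (L + L')^-1 -> nB G u <= L'^-1.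
  by move=> h; apply: (le_trans h); rewrite lef_pV2 ?posrE // lerDr ltW.
split.
- split; first by move=> a b; exact: nm_unitM.
    move=> a b c ha hb hc; rewrite (Bl a b c) ?i1 // (Bl' a b c) ?i2 //; ring.
  move=> a b c ha hb hc; rewrite (Br a b c) ?i1 // (Br' a b c) ?i2 //; ring.
- by move=> x; exact: nm_le1M.
move=> x; have [c [th [c1 th1 thD Hx]]] := H x; have [c' [th' [c1' th1' thD' Hx']]] := H' x.
exists (c * c'), (fun m => th m * th' m); split.
- exact: nm_le1M.
- by move=> m; exact: nm_unitM.
- move=> a b ha hb; rewrite (thD a b) ?i1 // (thD' a b) ?i2 //; ring.
move=> m hm; have -> : c * c' * (th m * th' m) = (c * th m) * (c' * th' m) by ring.
apply: (le_trans (nm_mul_dist _ _ _ _)) => //.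
  by apply: nm_le1M; rewrite ?th1'.
by rewrite mulrDl lerD ?Hx ?Hx' ?i1 ?i2.
Qed.

(** A single integer bounds rank, number of terms, coefficients and Lipschitz constant, so closure
    under sums and products costs a function of the integers alone, not of the group. *)
Definition cstr (n : nat) (X : env R) (u : X -> C) :=
  (0 < n)%N /\ exists (G : seq X) (I : finType) (a : I -> C) (w : I -> X -> C) (B : I -> X -> X -> C),
  [/\ (size G <= n)%N, (#|I| <= n)%N, forall i, nm (a i) <= n%:R,
      forall i, quad G n%:R (w i) (B i) & forall x, u x = \sum_i a i * w i x].

Lemma cstr_mono n m (X : env R) (u : X -> C) : (n <= m)%N -> cstr n u -> cstr m u.
Proof.
move=> nm' [n0 [G [I [a [w [B [h1 h2 h3 h4 h5]]]]]]]; split; first exact: leq_trans nm'.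
exists G, I, a, w, B; split => //; try exact: leq_trans nm'.
  by move=> i; apply: (le_trans (h3 i)); rewrite ler_nat.
by move=> i; apply: quad_mono (h4 i); rewrite ?ltr0n ?ler_nat.
Qed.

Lemma cstr_ext n (X : env R) (u v : X -> C) : u =1 v -> cstr n u -> cstr n v.
Proof.
move=> E [n0 [G [I [a [w [B [h1 h2 h3 h4 h5]]]]]]]; split => //; exists G, I, a, w, B; split => // x.
by rewrite -E.
Qed.

Lemma cstr_quad n (X : env R) (G : seq X) L w B (c : C) : (0 < n)%N -> (size G <= n)%N -> 0 < L -> L <= n%:R ->
  nm c <= n%:R -> quad G L w B -> cstr n (fun x => c * w x).
Proof.
move=> n0 h1 L0 h2 h3 h4; split => //; exists G, unit, (fun _ => c), (fun _ => w), (fun _ => B); split => //.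
- by rewrite card_unit.
- by move=> _; apply: quad_mono h4.
by move=> x; rewrite big_const card_unit /= addr0.
Qed.

Lemma cstr_cst n (X : env R) (c : C) : (0 < n)%N -> nm c <= n%:R -> cstr n (fun _ : X => c).
Proof.
move=> n0 hc; apply: (@cstr_ext _ _ (fun x => c * 1)); first by move=> x; rewrite mulr1.
by apply: (@cstr_quad _ _ [::] n%:R _ _ _ _ _ _ _ _ (@quad_one X [::] n%:R _)); rewrite ?ltr0n.
Qed.

Lemma cstr_conj n (X : env R) (u : X -> C) : cstr n u -> cstr n (fun x => cj (u x)).
Proof.
move=> [n0 [G [I [a [w [B [h1 h2 h3 h4 h5]]]]]]]; split => //.
exists G, I, (fun i => cj (a i)), (fun i x => cj (w i x)), (fun i a b => cj (B i a b)); split => //.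
- by move=> i; rewrite nm_cj.
- by move=> i; exact: quad_conj.
by move=> x; rewrite h5 cj_sum; apply: eq_bigr => i _; rewrite cjM.
Qed.

Lemma cstr_add n m (X : env R) (u v : X -> C) : cstr n u -> cstr m v -> cstr (n + m) (fun x => u x + v x).
Proof.
move=> [n0 [G [I [a [w [B [h1 h2 h3 h4 h5]]]]]]] [m0 [G' [I' [a' [w' [B' [h1' h2' h3' h4' h5']]]]]]].
split; first by rewrite addn_gt0 n0.
exists (G ++ G'), (I + I')%type, (fun k => match k with inl i => a i | inr i => a' i end),
  (fun k => match k with inl i => w i | inr i => w' i end),
  (fun k => match k with inl i => B i | inr i => B' i end); split.
- by rewrite size_cat leq_add.
- by rewrite card_sum leq_add.
- case=> i; first by apply: (le_trans (h3 i)); rewrite ler_nat leq_addr.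
  by apply: (le_trans (h3' i)); rewrite ler_nat leq_addl.
- case=> i; first apply: quad_mono (h4 i); last apply: quad_mono (h4' i).
  + by move=> y; rewrite mem_cat => ->.
  + by rewrite ltr0n.
  + by rewrite ler_nat leq_addr.
  + by move=> y; rewrite mem_cat => ->; rewrite orbT.
  + by rewrite ltr0n.
  + by rewrite ler_nat leq_addl.
by move=> x; rewrite h5 h5' big_sumType.
Qed.

Lemma cstr_mul n m (X : env R) (u v : X -> C) : cstr n u -> cstr m v -> 
  cstr (n + m + n * m) (fun x => u x * v x).
Proof.
move=> [n0 [G [I [a [w [B [h1 h2 h3 h4 h5]]]]]]] [m0 [G' [I' [a' [w' [B' [h1' h2' h3' h4' h5']]]]]]].
split; first by rewrite !addn_gt0 n0.
exists (G ++ G'), (I * I')%type, (fun k => a k.1 * a' k.2), (fun k x => w k.1 x * w' k.2 x),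
  (fun k x y => B k.1 x y * B' k.2 x y); split.
- by rewrite size_cat (leq_trans (leq_add h1 h1')) // leq_addr.
- by rewrite card_prod (leq_trans (leq_mul h2 h2')) // leq_addl.
- case=> i j /=; rewrite nmM; apply: (@le_trans _ _ (n * m)%:R).
    by rewrite natrM; apply: ler_pM; rewrite ?nm_ge0.
  by rewrite ler_nat leq_addl.
- case=> i j /=; apply: (@quad_mono _ (G ++ G') _ (n%:R + m%:R)) => //.
  + by rewrite -natrD ltr0n addn_gt0 n0.
  + by rewrite -natrD ler_nat leq_addr.
  apply: quad_mul; rewrite ?ltr0n //.
    by apply: quad_mono (h4 i); rewrite ?ltr0n // => y; rewrite mem_cat => ->.
  by apply: quad_mono (h4' j); rewrite ?ltr0n // => y; rewrite mem_cat => ->; rewrite orbT.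
by move=> x; rewrite h5 h5' big_distrlr pair_big; apply: eq_bigr => -[i j] _ /=; ring.
Qed.

Definition str n (X : env R) (u : X -> R) := cstr n (fun x => (u x)%:C).

(** Structured functions form an algebra, so polynomials may be applied to them at a cost
    independent of the group; this is why truncation has to be polynomial. *)
Lemma str_poly (p : {poly R}) n : exists m, forall (X : env R) (u : X -> R), str n u -> str m (fun x => p.[u x]).
Proof.
elim/poly_ind: p => [|p c [m IH]].
  exists 1%N => X u _; apply: (@cstr_ext _ _ (fun _ => 0)); first by move=> x; rewrite horner0.
  by apply: cstr_cst; rewrite ?nm0 ?ler01.
pose k := (Num.truncn `|c|).+1.
have hk : `|c| <= k%:R by rewrite ltW // truncnS_gt.
exists (m + n + m * n + k)%N => X u hu; have h1 := cstr_add (cstr_mul (IH X u hu) hu) (@cstr_cst k X c%:C isT _).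
apply: cstr_ext (h1 _); last by rewrite nmR.
by move=> x /=; rewrite hornerMXaddC rmorphD rmorphM.
Qed.

Lemma abs_poly (e : R) : 0 < e -> exists p : {poly R}, forall y, `|y| <= 1 -> `|p.[y] - `|y| | <= e.
Proof.
(* The iteration P + (y^2 - P^2) / 2 increases to |y| on [-1, 1], with error at most 2 / (n + 1). *)
move=> e0; pose P := fix P n : {poly R} := if n is n'.+1 then P n' + 2^-1%:P * ('X ^+ 2 - P n' ^+ 2) else 0.
have H y n : `|y| <= 1 -> 0 <= (P n).[y] /\ (P n).[y] <= `|y| /\ n.+1%:R * (`|y| - (P n).[y]) <= 2.
  move=> y1; elim: n => [|n [h1 [h2 h3]]]; first by rewrite /= horner0 subr0 mul1r; split => //; split => //; lra.
  rewrite /= !hornerE.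
  have -> : y ^+ 2 = `|y| ^+ 2 by rewrite real_normK ?num_real.
  move: (normr_ge0 y) y1 h1 h2 h3; rewrite -(natr1 n.+1) -[2^-1]/(2^-1 : R).
  move: n.+1%:R (ler0n R n.+1) (P n).[y] `|y| => a a0 p t t0 t1 p0 pt h3.
  have d2 : 2^-1 = 1 / 2 :> R by rewrite div1r.
  rewrite d2; have g1 : 0 <= (t - p) * (t + p) by rewrite mulr_ge0 ?subr_ge0 // addr_ge0.
  have g2 : 0 <= (t - p) * (1 - (t + p) / 2) by rewrite mulr_ge0 ?subr_ge0 //; move: pt t1; clear; lra.
  split; first by have -> : t ^+ 2 - p ^+ 2 = (t - p) * (t + p) by [ring]; move: g1 p0; clear; lra.
  split; first by move: g2; have -> : (t - p) * (1 - (t + p) / 2) = t - p - (t ^+ 2 - p ^+ 2) / 2 by [field]; clear; lra.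
  pose d := t - p; have -> : t - (p + 1 / 2 * (t ^+ 2 - p ^+ 2)) = d - d * (t + p) / 2 by rewrite /d; lra.
  have d0 : 0 <= d by rewrite subr_ge0.
  have d1 : d <= 1 by rewrite /d; lra.
  have a1 : 0 <= a + 1 by apply: addr_ge0.
  apply: (@le_trans _ _ ((a + 1) * (d - d * d / 2))).
    apply: ler_wpM2l => //; rewrite lerD2l lerN2 ler_wpM2r ?invr_ge0 ?ler0n //.
    by apply: ler_wpM2l => //; rewrite /d; lra.
  have h4 : 0 <= (2 - a * d) * (1 - d / 2) by apply: mulr_ge0; rewrite ?subr_ge0 //; move: d1; clear; lra.
  have h5 := sqr_ge0 d.
  have -> : (a + 1) * (d - d * d / 2) = 2 - (2 - a * d) * (1 - d / 2) + d - d - d ^+ 2 / 2 by field.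
  by move: h4 h5; clear; lra.
pose n := Num.truncn (2 / e); exists (P n) => y hy; have [h1 [h2 h3]] := H y n hy.
rewrite distrC ger0_norm ?subr_ge0 //.
have : 2 / e < n.+1%:R by rewrite truncnS_gt.
rewrite ltr_pdivrMr // => h4; have n0 : 0 < n.+1%:R :> R by rewrite ltr0n.
by rewrite -(ler_pM2l n0); apply: (le_trans h3); exact: ltW.
Qed.

(** Truncation to [0, 1], written with absolute values so that [abs_poly] applies. *)
Definition clip (y : R) := (`|y| + 1 - `|y - 1|) / 2.
Lemma clip01 y : 0 <= clip y <= 1.
Proof. by rewrite /clip; case: (ger0P y) => h1; case: (ger0P (y - 1)) => h2; lra. Qed.
Lemma clip_dist a y : 0 <= a <= 1 -> (a - clip y) ^+ 2 <= (a - y) ^+ 2.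
Proof.
move=> /andP [a0 a1]; rewrite -(real_normK (num_real (a - y))) -(real_normK (num_real (a - clip y))).
rewrite lerXn2r ?nnegrE ?normr_ge0 // /clip.
case: (ger0P y) => h1; case: (ger0P (y - 1)) => h2; case: (ger0P (a - y)) => h3;
  rewrite ler_norml; apply/andP; split; lra.
Qed.

Lemma clip_poly (e : R) : 0 < e -> exists p : {poly R}, forall y, `|y| <= 4 -> `|p.[y] - clip y| <= e.
Proof.
move=> e0; have e5 : 0 < e / 5 by lra.
have [p Hp] := abs_poly e5.
(* The factor 5 rescales both y and y - 1 into [-1, 1] when |y| <= 4. *)
exists (2^-1%:P * (5%:R%:P * (p \Po (5%:R^-1%:P * 'X)) + 1 - 5%:R%:P * (p \Po (5%:R^-1%:P * ('X - 1))))) => y hy.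
have S z : `|z| <= 5 -> `|5 * p.[5^-1 * z] - `|z| | <= e.
  move=> hz; have h5 : `|5^-1 * z| <= 1.
    by rewrite normrM gtr0_norm ?invr_gt0 // mulrC ler_pdivrMr // mul1r.
  have := Hp _ h5; rewrite (normrM _ z) (gtr0_norm (_ : 0 < 5^-1)) ?invr_gt0 // => h.
  have -> : 5 * p.[5^-1 * z] - `|z| = 5 * (p.[5^-1 * z] - 5^-1 * `|z|) by field.
  by rewrite normrM gtr0_norm //; move: h; clear; lra.
rewrite /clip !hornerE !horner_comp !hornerE.
have y5 : `|y| <= 5 by lra.
have y5' : `|y - 1| <= 5.
  by move: hy; rewrite !ler_norml; lra.
have := S _ y5; have := S _ y5'; rewrite !ler_norml.
by move: (p.[_]) (p.[_]) `|y| `|y - 1| => a b c d; clear; lra.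
Qed.
End Structured.

Section Regularity.
Variable R : realType.
Local Notation C := R[i].

Definition energy (X : env R) (f u : X -> R) := (q X)^-1 * \sum_x (f x - u x) ^+ 2.
(** Polynomial truncation is only approximate, so the natural range [0, 1] is relaxed to [-e, 2]. *)
Definition admissible (e : R) n (X : env R) (u : X -> R) := str n u /\ forall x, - e <= u x <= 2.
(** Division by 3 makes the difference 1-bounded when f takes values in [0, 1], u is admissible and
    e <= 1. *)
Definition U3dist (X : env R) (f u : X -> R) := U3 (fun x => ((f x - u x) / 3)%:C).

Lemma torsion_free_leq J J' (X : env R) : (J <= J')%N -> torsion_free J' X -> torsion_free J X.
Proof. by move=> h tf x j /andP [j0 j1]; apply: tf; rewrite j0 (leq_trans j1). Qed.

(** Moving u by c times the real part of the rotated phase gains 6 c^2 in energy from a correlation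
    of at least c, against c^2 from the square of the move and 3 c^2 from the error of truncation;
    exact truncation only helps. *)
Lemma energy_step (e d : R) : 0 < e -> e <= 1 -> 0 < d -> exists (J : nat) (c : R), 0 < c /\
  forall n, exists m, forall (X : env R), torsion_free J X -> forall f u : X -> R,
  (forall x, 0 <= f x <= 1) -> admissible e n u -> d <= U3dist f u ->
  exists v, admissible e m v /\ energy f v + c <= energy f u.
Proof.
move=> e0 e1 d0; have [D [J [L [c [L1 c0 H]]]]] := inverse_U3 d0.
pose e' := Num.min e (c ^+ 2); have c20 : 0 < c ^+ 2 by rewrite exprn_gt0.
have e'0 : 0 < e' by rewrite lt_min e0.
have [p Hp] := clip_poly e'0.
exists J, (c ^+ 2); split => // n.
pose N := (D + Num.truncn L).+1; pose M := (n + (N + N))%N.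
have [m Hm] := str_poly p M; exists m => X tf f u f01 [su u2] hU; have q0 := q_gt0 X.
pose h x := (f x - u x) / 3.
have h1 x : nm (h x)%:C <= 1.
  by rewrite nmR /h; move: (f01 x) (u2 x) e1; clear; rewrite ler_norml => /andP [? ?] /andP [? ?] ?; apply/andP; split; lra.
have [G [w [B [sG qw hS]]]] := H X tf _ h1 hU.
have w1 x : nm (w x) <= 1 by case: qw.
move: hS; set S := \sum_x _ => hS.
have S0 : 0 < nm S by apply: lt_le_trans hS; rewrite mulr_gt0.
have SC : nm S <= q X.
  apply: (le_trans (nm_sum _ _ _)); apply: (@le_trans _ _ (\sum_(x : X) 1)); last by rewrite sumr_const.
  by apply: ler_sum => x _; apply: nm_le1M => //; rewrite nm_cj.
have c1 : c <= 1 by rewrite -(ler_pM2r q0) mul1r (le_trans hS).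
(* A unimodular rotation that makes the correlation of h with rho equal to nm S. *)
pose la := ((nm S)^-1)%:C * S.
have la1 : nm la = 1 by rewrite nmM nmR ger0_norm ?invr_ge0 ?nm_ge0 // mulVf // gt_eqF.
pose rho x := Re (la * w x).
have rho1 x : `|rho x| <= 1.
  have hw : nm (la * w x) <= 1 by rewrite nmM la1 mul1r.
  by rewrite ler_norml (le_trans _ (Re_ge _)) ?lerN2 // (le_trans (Re_le _)).
have hrho : \sum_x h x * rho x = nm S.
  have -> : \sum_x h x * rho x = Re (cj la * S).
    rewrite -Re_cj cjM cjK /S cj_sum mulr_sumr Re_sum; apply: eq_bigr => x _.
    by rewrite cjM cjK cjR /rho -ReZ; congr Re; ring.
  have -> : cj la * S = (nm S)%:C.
    rewrite /la cjM cjR -mulrA [cj S * S]mulrC -nm_sqr -rmorphM /=; congr (_%:C).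
    by rewrite expr2 mulKf // gt_eqF.
  by [].
pose v0 x := u x + c * rho x.
have sv0 : str M v0.
  have qw' : cstr N (fun x => ((c / 2)%:C * la) * w x).
    apply: cstr_quad qw; rewrite ?(lt_le_trans ltr01 L1) //.
    - by rewrite (leq_trans sG) // /N leqW // leq_addr.
    - apply: (le_trans (ltW (truncnS_gt L))); by rewrite ler_nat /N ltnS leq_addl.
    rewrite nmM la1 mulr1 nmR ger0_norm; last by rewrite divr_ge0 // ltW.
    by apply: (@le_trans _ _ 1); [move: c1 c0; clear; lra|rewrite ler1n].
  apply: cstr_ext (cstr_add su (cstr_add qw' (cstr_conj qw'))) => x /=.
  rewrite -mulrA cjM cjR -mulrDr add_cj_Re -rmorphM -rmorphD /=; congr (_%:C).
  by rewrite /v0 /rho; congr (_ + _); field.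
pose v x := p.[v0 x].
have vc x : `|v x - clip (v0 x)| <= e'.
  apply: Hp; have := rho1 x; have /andP := u2 x; rewrite /v0 !ler_norml.
  move: (u x) (rho x) e1 c0 c1 => a b e1 c0' c1' [a1 a2] /andP [b1 b2].
  have h2 : c * b <= 1 by apply: (@le_trans _ _ c) => //; rewrite ler_piMr // ltW.
  have h3 : - 1 <= c * b.
    by rewrite lerNl -mulrN; apply: (@le_trans _ _ c) => //; rewrite ler_piMr ?(ltW c0') // lerNl.
  by apply/andP; split; move: e1 a1 a2 h2 h3; clear; lra.
have e'e : e' <= e by rewrite ge_min lexx.
have e'c : e' <= c ^+ 2 by rewrite ge_min lexx orbT.
exists v; split.
  split; first exact: Hm.
  move=> x; have := vc x; have := clip01 (v0 x); rewrite ler_norml => /andP [] h2 h3 /andP [] h4 h5.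
  by move: h2 h3 h4 h5 e'e e1; clear; move=> *; apply/andP; split; lra.
have pt x : (f x - v x) ^+ 2 <= (f x - u x) ^+ 2 - 6 * c * (h x * rho x) + c ^+ 2 + 3 * c ^+ 2.
  have h4 := clip_dist (v0 x) (f01 x); have h5 := vc x; have h6 := clip01 (v0 x); have h7 := f01 x.
  have E : (f x - v0 x) ^+ 2 <= (f x - u x) ^+ 2 - 6 * c * (h x * rho x) + c ^+ 2.
    have -> : (f x - v0 x) ^+ 2 = (f x - u x) ^+ 2 - 6 * c * (h x * rho x) + c ^+ 2 * rho x ^+ 2.
      by rewrite /v0 /h; field.
    rewrite lerD2l ler_piMr ?(ltW c20) // -(real_normK (num_real (rho x))) expr_le1 ?normr_ge0 //.
  have e'1 : e' <= 1 by apply: le_trans e1.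
  have -> : (f x - v x) ^+ 2 = (f x - clip (v0 x)) ^+ 2 - 2 * (f x - clip (v0 x)) * (v x - clip (v0 x)) + (v x - clip (v0 x)) ^+ 2 by ring.
  set a := f x - clip (v0 x); set b := v x - clip (v0 x).
  have a1 : `|a| <= 1 by rewrite /a ler_norml; move: h6 h7 => /andP [? ?] /andP [? ?]; apply/andP; split; lra.
  have h8 : `|a * b| <= e' by rewrite normrM -[e']mul1r; apply: ler_pM.
  have h9 : b ^+ 2 <= e'.
    rewrite -(real_normK (num_real b)) expr2; apply: (@le_trans _ _ (1 * e')); last by rewrite mul1r.
    by apply: ler_pM => //; apply: le_trans e'1.
  move: h8; rewrite ler_norml => /andP [h8 _].
  move: h4 E h8 h9 e'c; rewrite -/a -[2 * a * b]mulrA; move: (a * b) (a ^+ 2) (b ^+ 2) ((f x - v0 x) ^+ 2) => ? ? ? ?; clear; lra.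
rewrite -(ler_pM2l q0) /energy mulrDr !mulVKf ?gt_eqF //.
apply: (@le_trans _ _ (\sum_x ((f x - u x) ^+ 2 - 6 * c * (h x * rho x) + c ^+ 2 + 3 * c ^+ 2) + q X * c ^+ 2)).
  by rewrite lerD2r; apply: ler_sum => x _.
have -> : \sum_x ((f x - u x) ^+ 2 - 6 * c * (h x * rho x) + c ^+ 2 + 3 * c ^+ 2) =
    \sum_x (f x - u x) ^+ 2 - 6 * c * nm S + q X * (4 * c ^+ 2).
  have E4 : q X * (4 * c ^+ 2) = \sum_(x : X) (4 * c ^+ 2) by rewrite sumr_const /q mulr_natl.
  rewrite -hrho E4 mulr_sumr -sumrB -big_split /=; apply: eq_bigr => x _.
  by move: ((f x - u x) ^+ 2) (6 * c * (h x * rho x)) (c ^+ 2) => a b z; clear; lra.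
have : c * c * q X <= c * nm S by rewrite -mulrA ler_pM2l.
have -> : q X * (4 * c ^+ 2) = 4 * (c * c * q X) by ring.
have -> : q X * c ^+ 2 = c * c * q X by ring.
have -> : 6 * c * nm S = 6 * (c * nm S) by ring.
have : 0 <= c * c * q X by rewrite !mulr_ge0 // ltW.
by move: (c * c * q X) (c * nm S) (\sum_x _) => a b z; clear; lra.
Qed.

Lemma adm_mono (e : R) n m (X : env R) (u : X -> R) : (n <= m)%N -> admissible e n u -> admissible e m u.
Proof. by move=> h [su hu]; split => //; exact: cstr_mono su. Qed.

Lemma energy_ge0 (X : env R) (f u : X -> R) : 0 <= energy f u.
Proof. by rewrite mulr_ge0 ?invr_ge0 ?(ltW (q_gt0 X)) // sumr_ge0 // => x _; exact: sqr_ge0. Qed.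

Lemma energy_le (e : R) n (X : env R) (f u : X -> R) : e <= 1 -> (forall x, 0 <= f x <= 1) -> admissible e n u ->
  energy f u <= 4.
Proof.
move=> e1 f01 [_ hu]; have q0 := q_gt0 X; rewrite ler_pdivrMl //.
apply: (@le_trans _ _ (\sum_(x : X) 4)); last by rewrite sumr_const -[leLHS]mulr_natl.
apply: ler_sum => x _; rewrite -(real_normK (num_real _)).
have -> : 4 = 2 ^+ 2 :> R by ring.
rewrite lerXn2r ?nnegrE ?normr_ge0 // ler_norml.
by move: (f01 x) (hu x) => /andP [? ?] /andP [? ?]; apply/andP; split; lra.
Qed.

(** The energy starts at most 4 and drops by c at each step, which bounds the number of steps and
    hence the complexity. *)
Lemma uniform_part (e d : R) : 0 < e -> e <= 1 -> 0 < d -> exists J, forall n, exists m,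
  forall (X : env R), torsion_free J X -> forall f u : X -> R,
  (forall x, 0 <= f x <= 1) -> admissible e n u ->
  exists v, [/\ admissible e m v, energy f v <= energy f u & U3dist f v < d].
Proof.
move=> e0 e1 d0; have [J [c [c0 H]]] := energy_step e0 e1 d0; exists J.
have IH k : forall n, exists m, forall (X : env R), torsion_free J X -> forall f u : X -> R,
  (forall x, 0 <= f x <= 1) -> admissible e n u -> energy f u < k%:R * c ->
  exists v, [/\ admissible e m v, energy f v <= energy f u & U3dist f v < d].
  elim: k => [|k IH] n.
    by exists 0%N => X _ f u _ _; rewrite mul0r ltNge energy_ge0.
  have [m1 H1] := H n; have [m2 H2] := IH m1.
  exists (n + m2)%N => X tf f u f01 au Hu.
  have [hU|hU] := ltP (U3dist f u) d.
    by exists u; split => //; apply: adm_mono au; rewrite leq_addr.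
  have [v [av Hv]] := H1 X tf f u f01 au hU.
  have Hv' : energy f v < k%:R * c by move: Hv Hu; rewrite -natr1 mulrDl mul1r; move: (k%:R * c); clear; move=> ? ? ?; lra.
  have [v' [av' Ev' Uv']] := H2 X tf f v f01 av Hv'.
  exists v'; split => //; first by apply: adm_mono av'; rewrite leq_addl.
  by apply: (le_trans Ev'); move: Hv c0; clear; lra.
pose k := (Num.truncn (4 / c)).+1 => n.
have [m Hm] := IH k n; exists m => X tf f u f01 au; apply: Hm => //.
apply: (le_lt_trans (energy_le e1 f01 au)); rewrite -ltr_pdivrMr //.
exact: truncnS_gt.
Qed.

(** Here v is uniform relative to the complexity of u. If u and v are far apart in L^2, the
    parallelogram law makes their midpoint closer to f by e / 4 in energy, and it becomes the new u;
    this happens boundedly often. *)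
Lemma regularity (e : R) (F : nat -> R) : 0 < e -> e <= 1 -> (forall n, 0 < F n) ->
  exists N J, forall (X : env R), torsion_free J X -> forall f : X -> R, (forall x, 0 <= f x <= 1) ->
  exists n (u v : X -> R), [/\ (n <= N)%N, admissible e n u, forall x, - e <= v x <= 2,
    energy u v <= e & U3dist f v < F n].
Proof.
move=> e0 e1 F0.
have IH k : forall n, exists N J, forall (X : env R), torsion_free J X -> forall f u : X -> R,
  (forall x, 0 <= f x <= 1) -> admissible e n u -> energy f u < k%:R * (e / 4) ->
  exists n' (u' v : X -> R), [/\ (n' <= N)%N, admissible e n' u', forall x, - e <= v x <= 2,
    energy u' v <= e & U3dist f v < F n'].
  elim: k => [|k IH] n.
    by exists 0%N, 0%N => X _ f u _ _; rewrite mul0r ltNge energy_ge0.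
  have [J1 H1] := uniform_part e0 e1 (F0 n); have [m1 {}H1] := H1 n.
  pose h : {poly R} := 2^-1%:P * 'X.
  have [m2 H2] := str_poly h (n + m1)%N.
  have [N [J2 H3]] := IH m2.
  exists (n + N)%N, (J1 + J2)%N => X tf f u f01 au Hu.
  have tf1 := torsion_free_leq (leq_addr J2 J1) tf; have tf2 := torsion_free_leq (leq_addl J1 J2) tf.
  have [v [av Ev Uv]] := H1 X tf1 f u f01 au.
  have [hc|hc] := leP (energy u v) e.
    by exists n, u, v; split => //; [rewrite leq_addr|case: av].
  pose w x := (u x + v x) / 2.
  have aw : admissible e m2 w.
    split.
      apply: cstr_ext (H2 X (fun x => u x + v x) _) => [x|].
        by rewrite /h !hornerE /w mulrC.
      by apply: cstr_ext (cstr_add au.1 av.1) => x; rewrite /= rmorphD.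
    move=> x; rewrite /w; move: (au.2 x) (av.2 x) => /andP [? ?] /andP [? ?].
    by apply/andP; split; lra.
  have Ew : energy f w = 2^-1 * energy f u + 2^-1 * energy f v - 4^-1 * energy u v.
    rewrite /energy; have sc (a b : R) (S : X -> R) : a * (b * \sum_x S x) = b * \sum_x a * S x.
      by rewrite -mulr_sumr mulrCA.
    rewrite !sc -mulrDr -mulrBr -big_split -sumrB /=; congr (_ * _); apply: eq_bigr => x _; by rewrite /w; field.
  have Hw : energy f w < k%:R * (e / 4).
    by rewrite Ew; move: Hu hc Ev; rewrite -natr1 mulrDl mul1r; move: (k%:R * (e / 4)); clear; move=> ? ? ? ?; lra.
  have [n' [u' [v' [h1 h2 h3 h4 h5]]]] := H3 X tf2 f w f01 aw Hw.
  by exists n', u', v'; split => //; apply: leq_trans (leq_addl _ _).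
pose k := (Num.truncn (4 / (e / 4))).+1.
have [N [J H]] := IH k 1%N; exists N, J => X tf f f01.
have a0 : admissible e 1 (fun _ : X => 0).
  split; last by move=> x; move: e0; clear; move=> ?; apply/andP; split; lra.
  by apply: cstr_cst; rewrite // nmR normr0.
apply: (H X tf f _ f01 a0); apply: (le_lt_trans (energy_le e1 f01 a0)).
have e40 : 0 < e / 4 by move: e0; clear; lra.
by rewrite -ltr_pdivrMr //; exact: truncnS_gt.
Qed.
End Regularity.

(** * The von Neumann inequality *)

Section VonNeumann.
Variables (R : realType) (X : env R).
Local Notation C := R[i].
Local Notation q := (q X).

Lemma ch_mulz (xi d : X) (n : int) : ch xi (d *~ n) = ch (xi *~ n) d.
Proof.
case: n => n; first by rewrite -!pmulrn chMnr (chC (xi *+ n)) chMnr chC.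
by rewrite !NegzE !mulrNz chNr chNl -!pmulrn chMnr (chC (xi *+ n.+1)) chMnr chC.
Qed.

Hypothesis tf : torsion_free 3 X.

Lemma mulz_inj (n : int) : (0 < `|n| <= 3)%N -> injective (fun x : X => x *~ n).
Proof.
move=> hn x y /eqP; rewrite -subr_eq0 -mulrzBl => /eqP E; apply/eqP; rewrite -subr_eq0; apply/eqP.
apply: (tf hn); case: n hn E => n hn; first by rewrite -pmulrn.
by rewrite NegzE mulrNz -pmulrn => /eqP; rewrite oppr_eq0 => /eqP.
Qed.

Lemma count_mulz (n : int) (c : X) : (0 < `|n| <= 3)%N -> \sum_(x : X) ((x *~ n == c)%:R : R) <= 1.
Proof.
move=> hn; case: (pickP (fun x : X => x *~ n == c)) => [x0 /eqP E|H]; last first.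
  by rewrite big1 // => x _; rewrite H.
rewrite (bigD1 x0) //= E eqxx big1 ?addr0 // => x hx; case: eqP => // Ex; case/eqP: hx.
by apply: (mulz_inj hn); rewrite Ex.
Qed.

(** After expanding G and H in characters, summation over d keeps only frequencies with p a + r b =
    0, so one determines the other. Parseval and the arithmetic-geometric mean then bound the sum by
    the largest coefficient of F. *)
Lemma three_term (F G H : X -> C) (p r : int) : (0 < `|p| <= 3)%N -> (0 < `|r| <= 3)%N ->
  (forall x, nm (G x) <= 1) -> (forall x, nm (H x) <= 1) ->
  exists xi, nm (\sum_y \sum_d F y * (G (y + d *~ p) * H (y + d *~ r))) <= q * nm (ft F xi).
Proof.
move=> hp hr G1 H1; have q0 := q_gt0 X.
have [xi _ Hxi] := @arg_maxP _ _ _ (0 : X) xpredT (fun xi => nm (ft F xi)) isT.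
exists xi; rewrite -(ler_pM2l q0) -(ler_pM2l q0).
set S := \sum_y _; set M := nm (ft F xi).
have q1 : nm (q%:C) = q by rewrite nmR gtr0_norm.
have E : q%:C * (q%:C * S) = q%:C * \sum_a \sum_b ((a *~ p + b *~ r == 0)%:R * (ft G a * ft H b * ft F (- (a + b)))).
  rewrite /S mulr_sumr mulr_sumr.
  transitivity (\sum_y \sum_d \sum_a \sum_b ft G a * ft H b * (F y * ch (a + b) y * ch (a *~ p + b *~ r) d)).
    apply: eq_bigr => y _; rewrite !mulr_sumr; apply: eq_bigr => d _.
    transitivity (F y * ((q%:C * G (y + d *~ p)) * (q%:C * H (y + d *~ r)))); first by ring.
    rewrite -!ft_inv big_distrlr mulr_sumr; apply: eq_bigr => a _; rewrite mulr_sumr; apply: eq_bigr => b _.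
    rewrite -[LHS]/(F y * ((ft G a * ch a (y + d *~ p)) * (ft H b * ch b (y + d *~ r)))).
    by rewrite !chDr !ch_mulz !chDl; ring.
  transitivity (\sum_a \sum_b \sum_y \sum_d ft G a * ft H b * (F y * ch (a + b) y * ch (a *~ p + b *~ r) d)).
    under eq_bigr do rewrite exchange_big /=.
    rewrite exchange_big /=; apply: eq_bigr => a _.
    under eq_bigr do rewrite exchange_big /=.
    by rewrite exchange_big.
  rewrite mulr_sumr; apply: eq_bigr => a _; rewrite mulr_sumr; apply: eq_bigr => b _.
  transitivity (ft G a * ft H b * ((\sum_y F y * ch (a + b) y) * (\sum_d ch (a *~ p + b *~ r) d))).
    move: (ft G a * ft H b) => g; rewrite mulr_suml [RHS]mulr_sumr; apply: eq_bigr => y _.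
    by rewrite mulr_sumr [RHS]mulr_sumr.
  have -> : \sum_y F y * ch (a + b) y = ft F (- (a + b)).
    by apply: eq_bigr => y _; rewrite chNl cjK.
  under [X in _ * (_ * X) = _]eq_bigr do rewrite chC.
  by rewrite ch_orth; case: (_ == 0); rewrite ?mul1r ?mul0r ?mulr0 //; ring.
have -> : q * (q * nm S) = nm (q%:C * (q%:C * S)) by rewrite !nmM q1.
rewrite E nmM q1 ler_pM2l //; apply: (le_trans (nm_sum _ _ _)).
pose x a := nm (ft G a) ^+ 2; pose z a := nm (ft H a) ^+ 2.
have bx (W : X -> C) : (forall x, nm (W x) <= 1) -> \sum_a nm (ft W a) ^+ 2 <= q * q.
  move=> W1; rewrite parseval ler_pM2l //; apply: (@le_trans _ _ (\sum_(x : X) 1)); last by rewrite sumr_const.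
  by apply: ler_sum => y _; rewrite expr_le1 // nm_ge0.
apply: (@le_trans _ _ (\sum_a \sum_b (a *~ p + b *~ r == 0)%:R * (M / 2 * (x a + z b)))).
  apply: ler_sum => a _; apply: (le_trans (nm_sum _ _ _)); apply: ler_sum => b _.
  case: (_ == 0); rewrite ?mul1r ?mul0r ?nm0 // !nmM.
  have h1 : nm (ft G a) * nm (ft H b) <= 2^-1 * (x a + z b).
    have := sqr_ge0 (nm (ft G a) - nm (ft H b)); rewrite /x /z sqrrB -mulr_natr.
    by move: (nm (ft G a) * nm (ft H b)) (nm _ ^+ 2) (nm _ ^+ 2); clear; move=> ? ? ? ?; lra.
  have -> : M / 2 * (x a + z b) = 2^-1 * (x a + z b) * M by ring.
  by apply: ler_pM; rewrite ?mulr_ge0 ?nm_ge0 //; exact: Hxi.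
have -> : \sum_a \sum_b (a *~ p + b *~ r == 0)%:R * (M / 2 * (x a + z b)) =
  M / 2 * (\sum_a x a * (\sum_b (b *~ r == - (a *~ p))%:R) + \sum_b z b * (\sum_a (a *~ p == - (b *~ r))%:R)).
  have -> : \sum_b z b * (\sum_a (a *~ p == - (b *~ r))%:R) = \sum_a \sum_b z b * (a *~ p == - (b *~ r))%:R.
    by rewrite exchange_big; apply: eq_bigr => b _; rewrite mulr_sumr.
  rewrite -big_split mulr_sumr; apply: eq_bigr => a _ /=; rewrite mulr_sumr -big_split mulr_sumr.
  apply: eq_bigr => b _ /=; have -> : (b *~ r == - (a *~ p)) = (a *~ p + b *~ r == 0) by rewrite addrC addr_eq0.
  by rewrite -addr_eq0; ring.
have M0 : 0 <= M by exact: nm_ge0.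
apply: (@le_trans _ _ (M / 2 * (q * q + q * q))); last by have -> : q * (q * M) = M / 2 * (q * q + q * q) by field.
apply: ler_wpM2l; first by rewrite divr_ge0.
apply: lerD.
  by apply: le_trans (bx G G1); apply: ler_sum => a _; rewrite ler_piMr ?sqr_ge0 ?count_mulz.
by apply: le_trans (bx H H1); apply: ler_sum => a _; rewrite ler_piMr ?sqr_ge0 ?count_mulz.
Qed.

Lemma CS_const (F : X -> R) : (\sum_x F x) ^+ 2 <= q * \sum_x F x ^+ 2.
Proof.
have := CS_real xpredT (fun _ : X => 1) F; under eq_bigr do rewrite mul1r.
by rewrite expr1n sumr_const.
Qed.

(* One Cauchy-Schwarz removes the factor e; for each difference h of the step what remains
   is a three-term count, controlled by one Fourier coefficient of f (. + t) * conj f. *)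
Lemma four_term_U3 (e f g h : X -> C) (a b c : int) : (0 < `|a| <= 3)%N ->
  (0 < `|b - a| <= 3)%N -> (0 < `|c - a| <= 3)%N ->
  (forall x, nm (e x) <= 1) -> (forall x, nm (f x) <= 1) -> (forall x, nm (g x) <= 1) -> (forall x, nm (h x) <= 1) ->
  nm (\sum_y \sum_d e y * (f (y + d *~ a) * (g (y + d *~ b) * h (y + d *~ c)))) ^+ 8 <= q ^+ 16 * U3 f.
Proof.
move=> ha hb hc e1 f1 g1 h1; have q0 := q_gt0 X.
pose W y := \sum_d f (y + d *~ a) * (g (y + d *~ b) * h (y + d *~ c)).
pose D (u : X -> C) t n := u (n + t) * cj (u n).
have D1 u t n : (forall x, nm (u x) <= 1) -> nm (D u t n) <= 1.
  by move=> u1; apply: nm_le1M; rewrite ?nm_cj.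
have K1 k : exists xi, nm (\sum_y \sum_d D f (k *~ a) y *
    (D g (k *~ b) (y + d *~ (b - a)) * D h (k *~ c) (y + d *~ (c - a)))) <= q * nm (ft (D f (k *~ a)) xi).
  by apply: three_term => // x; exact: D1.
have [xi Hxi] := choice K1.
have A1 k : nm (ft (D f (k *~ a)) (xi k)) = q * nm (Af f (k *~ a, xi k)).
  have -> : Af f (k *~ a, xi k) = (q^-1)%:C * ft (D f (k *~ a)) (xi k) by [].
  by rewrite nmM nmR ger0_norm ?invr_ge0 ?(ltW q0) // mulVKf // gt_eqF.
pose m k := nm (Af f (k *~ a, xi k)).
have m0 k : 0 <= m k by exact: nm_ge0.
set S := \sum_y _.
have S2 : nm S ^+ 2 <= q * \sum_y nm (W y) ^+ 2.
  have -> : S = \sum_y e y * W y by apply: eq_bigr => y _; rewrite /W mulr_sumr.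
  apply: (le_trans (CS_complex _ _ _)); apply: ler_wpM2r; first by apply: sumr_ge0 => y _; exact: sqr_ge0.
  apply: (@le_trans _ _ (\sum_(x : X) 1)); last by rewrite sumr_const.
  by apply: ler_sum => x _; rewrite expr_le1 ?nm_ge0.
(* Squaring W and writing the two steps as d and d + k leaves, for each k, a three-term count in the
   derivatives of f, g and h. *)
have W2 : \sum_y nm (W y) ^+ 2 <= q ^+ 2 * \sum_k m k.
  have E : (\sum_y nm (W y) ^+ 2)%:C = \sum_k \sum_y \sum_d D f (k *~ a) y *
    (D g (k *~ b) (y + d *~ (b - a)) * D h (k *~ c) (y + d *~ (c - a))).
    rewrite rmorph_sum /=; transitivity (\sum_y \sum_k \sum_d D f (k *~ a) (y + d *~ a) *
      (D g (k *~ b) (y + d *~ b) * D h (k *~ c) (y + d *~ c))).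
      apply: eq_bigr => y _; rewrite nm_sqr /W cj_sum mulr_sumr exchange_big /=.
      transitivity (\sum_d \sum_k D f (k *~ a) (y + d *~ a) * (D g (k *~ b) (y + d *~ b) * D h (k *~ c) (y + d *~ c))).
        apply: eq_bigr => d _; rewrite -[X in X * _](sum_shift d) mulr_suml; apply: eq_bigr => k _.
        by rewrite /D !mulrzDl ![k *~ _ + _]addrC !addrA !cjM; ring.
      by rewrite exchange_big.
    rewrite exchange_big /=; apply: eq_bigr => k _; rewrite exchange_big /= [RHS]exchange_big /=.
    apply: eq_bigr => d _; rewrite -[RHS](sum_shift (d *~ a)); apply: eq_bigr => y _.
    by rewrite -!addrA -!mulrzDr !(addrC a) !subrK.
  have : nm (\sum_y nm (W y) ^+ 2)%:C <= q ^+ 2 * \sum_k m k.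
    rewrite E; apply: (le_trans (nm_sum _ _ _)); rewrite mulr_sumr; apply: ler_sum => k _.
    by apply: (le_trans (Hxi k)); rewrite A1 expr2 mulrA.
  by rewrite nmR; apply: le_trans; exact: ler_norm.
have S2' : nm S ^+ 2 <= q ^+ 3 * \sum_k m k.
  by apply: (le_trans S2); rewrite [q ^+ 3]exprS -mulrA ler_pM2l.
have m4 : \sum_k m k ^+ 4 <= q * U3 f.
  rewrite /U3 mulVKf ?gt_eqF // sum_pair.
  rewrite [leRHS](reindex_inj (mulz_inj ha)) /=; apply: ler_sum => k _; rewrite (bigD1 (xi k)) //=.
  rewrite /gf -exprM /m lerDl; apply: sumr_ge0 => x _; exact: sqr_ge0.
have s0 : 0 <= \sum_k m k by apply: sumr_ge0.
(* Two Cauchy-Schwarz steps pass to fourth powers, whose sum is part of the sum defining U3 f. *)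
have ms : (\sum_k m k) ^+ 4 <= q ^+ 3 * \sum_k m k ^+ 4.
  have h2 := CS_const m; have h4 := CS_const (fun k => m k ^+ 2).
  have -> : (\sum_k m k) ^+ 4 = ((\sum_k m k) ^+ 2) ^+ 2 by rewrite -exprM.
  apply: (@le_trans _ _ ((q * \sum_k m k ^+ 2) ^+ 2)).
    by rewrite lerXn2r ?nnegrE ?sqr_ge0 // mulr_ge0 ?(ltW q0) // sumr_ge0 // => k _; exact: sqr_ge0.
  rewrite exprMn [q ^+ 3]exprSr -mulrA ler_pM2l ?exprn_gt0 //.
  by under [X in _ * X]eq_bigr do rewrite (exprM _ 2 2).
have -> : nm S ^+ 8 = (nm S ^+ 2) ^+ 4 by rewrite -exprM.
apply: (@le_trans _ _ ((q ^+ 3 * \sum_k m k) ^+ 4)).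
  by rewrite lerXn2r ?nnegrE ?sqr_ge0 // mulr_ge0 // exprn_ge0 // ltW.
rewrite exprMn -exprM; apply: (@le_trans _ _ (q ^+ 12 * (q ^+ 3 * (q * U3 f)))).
  rewrite ler_pM2l ?exprn_gt0 //; apply: (le_trans ms); rewrite ler_pM2l ?exprn_gt0 //.
by rewrite le_eqVlt; apply/orP; left; apply/eqP; ring.
Qed.
End VonNeumann.

Section WeightedCount.
Variables (R : realType) (X : env R).
Local Notation C := R[i].
Local Notation q := (q X).

Definition apn (mu : X -> R) (f : nat -> X -> C) : C :=
  (q^-1)%:C * \sum_x \sum_d (mu d)%:C * \prod_(j < 4) f j (x + d *+ j).

Lemma prod4 (f : nat -> X -> C) x d : \prod_(j < 4) f j (x + d *+ j) =
  f 0%N x * f 1%N (x + d) * f 2%N (x + d *+ 2) * f 3%N (x + d *+ 3).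
Proof. by rewrite !big_ord_recl big_ord0 /bump /= mulr1 mulr0n addr0 mulr1n !mulrA. Qed.

(** The derivative in direction t changes only by the unimodular constant ch xi t. *)
Lemma U3_ch (f : X -> C) xi : U3 (fun x => f x * ch xi x) = U3 f.
Proof.
rewrite /U3; congr (_ * _); apply: eq_bigr => -[t et] _; congr (_ ^+ 2); rewrite /gf; congr (_ ^+ 2).
rewrite -[RHS]mul1r -(ch_nm xi t) -nmM /Af /=; congr nm; rewrite [RHS]mulrCA; congr (_ * _).
rewrite mulr_sumr; apply: eq_bigr => n _; rewrite chDr cjM.
transitivity (ch xi n * cj (ch xi n) * (ch xi t * (f (n + t) * cj (f n) * cj (ch et n)))); first by ring.
by rewrite ch_unit mul1r.
Qed.

Lemma U3_chN (f : X -> C) xi : U3 (fun x => f x * cj (ch xi x)) = U3 f.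
Proof. by rewrite -(U3_ch f (- xi)); congr U3; apply: funext => x; rewrite chNl. Qed.

Hypothesis tf : torsion_free 3 X.

(** Substituting x + k d for x moves another factor to the base point, so each of the four functions
    can take the role of f in [four_term_U3]. *)
Lemma four_point_U3 (f : nat -> X -> C) j : (j < 4)%N -> (forall i x, nm (f i x) <= 1) ->
  nm (\sum_x \sum_d \prod_(i < 4) f i (x + d *+ i)) ^+ 8 <= q ^+ 16 * U3 (f j).
Proof.
move=> j4 f1.
have -> : \sum_x \sum_d \prod_(i < 4) f i (x + d *+ i) = \sum_d \sum_x \prod_(i < 4) f i (x + d *+ i).
  by rewrite exchange_big.
have sh (k : int) : \sum_d \sum_x \prod_(i < 4) f i (x + d *+ i) = \sum_x \sum_d \prod_(i < 4) f i (x + d *~ (i%:Z + k)).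
  rewrite exchange_big /= exchange_big /= [RHS]exchange_big; apply: eq_bigr => d _ /=.
  rewrite -[LHS](sum_shift (d *~ k)); apply: eq_bigr => x _; apply: eq_bigr => i _.
  by rewrite mulrzDr -pmulrn -!addrA [d *~ k + _]addrC.
case: j j4 => [|[|[|[|//]]]] _.
- have T := @four_term_U3 _ _ tf (f 1%N) (f 0%N) (f 2%N) (f 3%N) (-1) (1) (2) isT isT isT (f1 _) (f1 _) (f1 _) (f1 _); apply: le_trans T.
  rewrite (sh (-1)) le_eqVlt; apply/orP; left; apply/eqP; congr (nm _ ^+ 8); apply: eq_bigr => x _; apply: eq_bigr => d _.
  by rewrite !big_ord_recl big_ord0 /bump /= mulr0z addr0; ring.
- have T := @four_term_U3 _ _ tf (f 0%N) (f 1%N) (f 2%N) (f 3%N) (1) (2) (3) isT isT isT (f1 _) (f1 _) (f1 _) (f1 _); apply: le_trans T.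
  rewrite (sh 0) le_eqVlt; apply/orP; left; apply/eqP; congr (nm _ ^+ 8); apply: eq_bigr => x _; apply: eq_bigr => d _.
  by rewrite !big_ord_recl big_ord0 /bump /= mulr0z addr0; ring.
- have T := @four_term_U3 _ _ tf (f 3%N) (f 2%N) (f 0%N) (f 1%N) (-1) (-3) (-2) isT isT isT (f1 _) (f1 _) (f1 _) (f1 _); apply: le_trans T.
  rewrite (sh (-3)) le_eqVlt; apply/orP; left; apply/eqP; congr (nm _ ^+ 8); apply: eq_bigr => x _; apply: eq_bigr => d _.
  by rewrite !big_ord_recl big_ord0 /bump /= mulr0z addr0; ring.
have T := @four_term_U3 _ _ tf (f 2%N) (f 3%N) (f 0%N) (f 1%N) (1) (-2) (-1) isT isT isT (f1 _) (f1 _) (f1 _) (f1 _); apply: le_trans T.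
rewrite (sh (-2)) le_eqVlt; apply/orP; left; apply/eqP; congr (nm _ ^+ 8); apply: eq_bigr => x _; apply: eq_bigr => d _.
by rewrite !big_ord_recl big_ord0 /bump /= mulr0z addr0; ring.
Qed.

(** Expand mu in characters and write ch xi d as the conjugate of ch xi x times ch xi (x + d). These
    factors are absorbed into f 0 and f 1 without changing U^3 norms, so the total cost is the l^1
    norm of the transform of mu. *)
Lemma weighted_U3 (mu : X -> R) (f : nat -> X -> C) K j : (j < 4)%N -> (forall i x, nm (f i x) <= 1) -> 
  \sum_xi nm (ft (fun d => (mu d)%:C) xi) <= K -> nm (apn mu f) ^+ 8 <= K ^+ 8 * U3 (f j).
Proof.
move=> j4 f1 HK; have q0 := q_gt0 X.
pose g xi (i : nat) x := match i with 0%N => f 0%N x * cj (ch xi x) | 1%N => f 1%N x * ch xi x | _ => f i x end.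
pose S xi := \sum_x \sum_d \prod_(i < 4) g xi i (x + d *+ i).
have K0 : 0 <= K by apply: le_trans HK; apply: sumr_ge0 => xi _; exact: nm_ge0.
have g1 xi i x : nm (g xi i x) <= 1.
  by case: i => [|[|i]] //=; apply: nm_le1M; rewrite ?nm_cj ?ch_nm.
have Sb xi : nm (S xi) ^+ 8 <= q ^+ 16 * U3 (f j).
  apply: (le_trans (four_point_U3 j4 (g1 xi))); rewrite le_eqVlt; apply/orP; left; apply/eqP; congr (_ * _).
  by case: j j4 => [|[|j]] _ //=; [rewrite -(U3_chN (f 0%N) xi)|rewrite -(U3_ch (f 1%N) xi)].
have [xi0 _ Hxi0] := @arg_maxP _ _ _ (0 : X) xpredT (fun xi => nm (S xi)) isT.
have E : q%:C * (q%:C * apn mu f) = \sum_xi ft (fun d => (mu d)%:C) xi * S xi.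
  have qq : q%:C * (q^-1)%:C = 1 by rewrite -rmorphM /= mulfV ?gt_eqF.
  rewrite /apn; set T := \sum_x _.
  have -> : q%:C * (q%:C * ((q^-1)%:C * T)) = q%:C * (q%:C * (q^-1)%:C) * T by ring.
  rewrite qq mulr1 /T mulr_sumr.
  under [RHS]eq_bigr do rewrite /S mulr_sumr; rewrite exchange_big /=; apply: eq_bigr => x _.
  under [RHS]eq_bigr do rewrite mulr_sumr; rewrite mulr_sumr exchange_big /=; apply: eq_bigr => d _.
  rewrite mulrA -(ft_inv (fun d => (mu d)%:C) d) mulr_suml; apply: eq_bigr => xi _; rewrite !prod4 /= chDr.
  set Y := ft _ _; transitivity (Y * (ch xi d * (f 0%N x * f 1%N (x + d) * f 2%N (x + d *+ 2) * f 3%N (x + d *+ 3)))); first by ring.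
  rewrite -[in LHS](mul1r (ch xi d)) -(ch_unit xi x); ring.
have B : q ^+ 2 * nm (apn mu f) <= K * nm (S xi0).
  have -> : q ^+ 2 * nm (apn mu f) = nm (q%:C * (q%:C * apn mu f)).
    by rewrite !(nmM q%:C) nmR gtr0_norm // expr2 mulrA.
  rewrite E; apply: (le_trans (nm_sum _ _ _)); apply: (@le_trans _ _ ((\sum_xi nm (ft (fun d => (mu d)%:C) xi)) * nm (S xi0))); last by apply: ler_wpM2r; rewrite ?nm_ge0.
  by rewrite mulr_suml; apply: ler_sum => xi _; rewrite (nmM _ (S xi)); apply: ler_wpM2l; [exact: nm_ge0|exact: Hxi0].
have q16 : 0 < q ^+ 16 by rewrite exprn_gt0.
rewrite -(ler_pM2l q16).
have -> : q ^+ 16 * nm (apn mu f) ^+ 8 = (q ^+ 2 * nm (apn mu f)) ^+ 8 by rewrite exprMn -exprM.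
apply: (@le_trans _ _ ((K * nm (S xi0)) ^+ 8)).
  by rewrite lerXn2r ?nnegrE ?mulr_ge0 ?nm_ge0 // ?sqr_ge0.
by rewrite exprMn [leRHS]mulrCA; apply: ler_wpM2l; [rewrite exprn_ge0|exact: Sb].
Qed.

Definition hybrid (f g : nat -> X -> C) (j i : nat) : X -> C :=
  if (i < j)%N then f i else if i == j then (fun x => f j x - g j x) else g i.

Lemma apn_telescope mu (f g : nat -> X -> C) :
  apn mu f - apn mu g = \sum_(j < 4) apn mu (hybrid f g j).
Proof.
rewrite !big_ord_recl big_ord0 /bump /= addr0 /apn -mulrBr -!mulrDr; congr (_ * _).
rewrite -sumrB -!big_split; apply: eq_bigr => x _ /=; rewrite -sumrB -!big_split /=; apply: eq_bigr => d _.
by rewrite !prod4 /hybrid /=; ring.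
Qed.

Lemma apn_scale mu (a : C) (f : nat -> X -> C) : apn mu (fun i x => a * f i x) = a ^+ 4 * apn mu f.
Proof.
rewrite /apn mulrCA; congr (_ * _); rewrite mulr_sumr; apply: eq_bigr => x _; rewrite mulr_sumr.
by apply: eq_bigr => d _; rewrite (prod4 (fun i x => a * f i x)) prod4; ring.
Qed.

Lemma apn_L1 mu (f : nat -> X -> C) j (M : R) : prob mu -> (j < 4)%N -> 
  (forall i x, i != j -> nm (f i x) <= M) -> nm (apn mu f) <= M ^+ 3 * (q^-1 * \sum_x nm (f j x)).
Proof.
move=> [mu0 mu1] j4 fM; have q0 := q_gt0 X.
rewrite nmM nmR ger0_norm ?invr_ge0 ?(ltW q0) // mulrCA ler_pM2l ?invr_gt0 //.
rewrite exchange_big /=; apply: (le_trans (nm_sum _ _ _)).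
apply: (@le_trans _ _ (\sum_d mu d * (M ^+ 3 * \sum_x nm (f j x)))); last by rewrite -mulr_suml mu1 mul1r.
apply: ler_sum => d _; rewrite -mulr_sumr nmM nmR ger0_norm //; apply: ler_wpM2l => //.
apply: (le_trans (nm_sum _ _ _)); rewrite -(sum_shift (d *+ j) (fun x => nm (f j x))) mulr_sumr.
apply: ler_sum => x _; rewrite nm_prod (bigD1 (Ordinal j4)) //= mulrC; apply: ler_wpM2r; first exact: nm_ge0.
apply: (@le_trans _ _ (\prod_(i < 4 | i != Ordinal j4) M)).
  by apply: ler_prod => i hi; rewrite nm_ge0 fM.
by rewrite prodr_const cardC1 card_ord.
Qed.

Lemma avg_sqr (h : X -> R) : (q^-1 * \sum_x h x) ^+ 2 <= q^-1 * \sum_x h x ^+ 2.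
Proof.
have q0 := q_gt0 X; rewrite -(ler_pM2l (exprn_gt0 2 q0)) exprMn exprVn mulVKf ?expf_neq0 ?gt_eqF //.
by rewrite expr2 -mulrA mulVKf ?gt_eqF //; exact: CS_const.
Qed.

(** Shorter progressions are four-term ones whose last factors are 1, so one argument covers all
    k. *)
Definition pad k (u : X -> R) (j : nat) (x : X) : C := if (j < k)%N then (u x)%:C else 1.

Lemma apn_pad_L2 mu k (u v : X -> R) (e : R) : prob mu -> 0 <= e ->
  (forall x, `|u x| <= 2) -> (forall x, `|v x| <= 2) -> energy u v <= e ^+ 2 ->
  nm (apn mu (pad k u) - apn mu (pad k v)) <= 32 * e.
Proof.
move=> pm e0 u2 v2 He; have q0 := q_gt0 X; rewrite apn_telescope.
apply: (le_trans (nm_sum _ _ _)); apply: (@le_trans _ _ (\sum_(j < 4) 2 ^+ 3 * e)); last first.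
  by rewrite sumr_const card_ord -[_ *+ 4]mulr_natr; move: e0; clear; lra.
apply: ler_sum => j _.
have b2 (w : X -> R) i x : (forall x, `|w x| <= 2) -> nm (pad k w i x) <= 2.
  by move=> h; rewrite /pad; case: ifP => _; [rewrite nmR|rewrite nm1 ler1n].
apply: (le_trans (apn_L1 (j := j) (M := 2) pm _ _)) => //.
  move=> i x hi; rewrite /hybrid; case: ltnP => _; first exact: b2.
  by rewrite (negbTE hi); exact: b2.
apply: ler_wpM2l; first by rewrite exprn_ge0.
have -> : \sum_x nm (hybrid (pad k u) (pad k v) j j x) = \sum_x (if (j < k)%N then `|u x - v x| else 0).
  apply: eq_bigr => x _; rewrite /hybrid ltnn eqxx /pad; case: ifP => _; first by rewrite -rmorphB nmR.
  by rewrite subrr nm0.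
case: (j < k)%N; last by rewrite big1 // mulr0.
rewrite -(@ler_pXn2r _ 2%N) ?nnegrE //; last by rewrite mulr_ge0 ?invr_ge0 ?(ltW q0) // sumr_ge0.
apply: (le_trans (avg_sqr _)); apply: le_trans He; rewrite /energy.
by under eq_bigr do rewrite real_normK ?num_real //.
Qed.

(** Each factor is divided by 3 to become 1-bounded, costing 3^4 in each of the four telescoping
    terms; hence 324. *)
Lemma apn_pad_U3 mu k (f v : X -> R) (K t : R) : 0 <= t ->
  \sum_xi nm (ft (fun d => (mu d)%:C) xi) <= K ->
  (forall x, `|f x| <= 2) -> (forall x, `|v x| <= 2) -> (forall x, `|f x - v x| <= 3) ->
  U3dist f v <= t ^+ 8 -> nm (apn mu (pad k f) - apn mu (pad k v)) <= 324 * (K * t).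
Proof.
move=> t0 HK f2 v2 fv Hu; rewrite apn_telescope.
have K0 : 0 <= K by apply: le_trans HK; apply: sumr_ge0 => xi _; exact: nm_ge0.
apply: (le_trans (nm_sum _ _ _)); apply: (@le_trans _ _ (\sum_(j < 4) 81 * (K * t))); last first.
  by rewrite sumr_const card_ord -[_ *+ 4]mulr_natr; move: (mulr_ge0 K0 t0); clear; lra.
apply: ler_sum => j _.
pose h i x := (3^-1)%:C * hybrid (pad k f) (pad k v) j i x.
have E : apn mu (hybrid (pad k f) (pad k v) j) = 3 ^+ 4 * apn mu h.
  rewrite -apn_scale; congr apn; apply: funext => i; apply: funext => x.
  rewrite /h mulrA (_ : 3 = (3 : R)%:C); last by rewrite rmorph_nat.
  by rewrite -rmorphM /= mulfV ?mul1r // pnatr_eq0.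
have i3 : 0 < 3^-1 :> R by rewrite invr_gt0 ltr0n.
have sc (z : C) : nm z <= 3 -> nm ((3^-1)%:C * z) <= 1.
  by move=> hz; rewrite nmM nmR gtr0_norm // mulrC ler_pdivrMr // mul1r.
have h1 i x : nm (h i x) <= 1.
  apply: sc.
  have b2 (w : X -> R) i' : (forall x, `|w x| <= 2) -> nm (pad k w i' x) <= 3.
    move=> hw; rewrite /pad; case: ifP => _; [rewrite nmR|by rewrite nm1 ler1n].
    by apply: (le_trans (hw x)); rewrite ler_nat.
  rewrite /hybrid; case: ifP => _; first exact: b2.
  case: ifP => _; last exact: b2.
  by rewrite /pad; case: ifP => _; [rewrite -rmorphB nmR|rewrite subrr nm0 ler0n].
have W := weighted_U3 (ltn_ord j) h1 HK.
have U : U3 (h j) <= t ^+ 8.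
  rewrite /h /hybrid ltnn eqxx /pad; case: (j < k)%N.
    apply: le_trans Hu; rewrite /U3dist le_eqVlt; apply/orP; left; apply/eqP; congr U3; apply: funext => x.
    by rewrite -rmorphB -rmorphM /= mulrC.
  have -> : (fun x : X => (3^-1)%:C * (1 - 1)) = (fun _ : X => 0 : C) by apply: funext => x; rewrite subrr mulr0.
  rewrite /U3 big1 ?mulr0 ?exprn_ge0 // => p _; rewrite /gf /Af.
  by under eq_bigr do rewrite !mul0r; rewrite big1 // mulr0 nm0 !expr0n.
rewrite E nmM nmX (_ : 3 = (3 : R)%:C); last by rewrite rmorph_nat.
rewrite nmR ger0_norm ?ler0n // (_ : 3 ^+ 4 = 81 :> R); last by ring.
apply: ler_wpM2l; first by rewrite ler0n.
rewrite -(@ler_pXn2r _ 8%N) ?nnegrE ?nm_ge0 ?mulr_ge0 //.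
by apply: (le_trans W); rewrite exprMn; apply: ler_wpM2l => //; rewrite exprn_ge0.
Qed.

(** Take the other three functions equal to 1 in [four_point_U3]. This transfers the density of the
    set to its approximation. *)
Lemma mean_U3 (h : X -> C) : (forall x, nm (h x) <= 1) -> (q^-1 * nm (\sum_x h x)) ^+ 8 <= U3 h.
Proof.
move=> h1; have q0 := q_gt0 X.
have f1 i x : nm ((if i == 0%N then h else fun _ => 1) x) <= 1 by case: i => [|i] //=; rewrite nm1.
have := @four_point_U3 (fun i => if i == 0%N then h else fun _ => 1) 0%N isT f1.
have -> : \sum_x \sum_d \prod_(i < 4) (if i == 0%N :> nat then h else fun _ => 1) (x + d *+ i) = q%:C * \sum_x h x.
  rewrite mulr_sumr; apply: eq_bigr => x _.
  under eq_bigr do rewrite (prod4 (fun i => if i == 0%N then h else fun _ => 1)) /= !mulr1.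
  by rewrite sumr_const -[LHS]mulr_natl rmorph_nat.
rewrite nmM nmR gtr0_norm // => H.
rewrite -(ler_pM2l (exprn_gt0 16 q0)); apply: le_trans H.
rewrite le_eqVlt; apply/orP; left; apply/eqP.
by move: (nm _) q0 => z; clear => q0; field; rewrite gt_eqF.
Qed.
End WeightedCount.

(** * Trivial and uniformly distributed phases *)

Section Dichotomy.
Variable R : realType.
Local Notation C := R[i].

(** Points are coloured by the cells of their character values; one representative per colour
    suffices, and the number of colours does not depend on the group. *)
Lemma covering (D : nat) (r : R) : 0 < r -> exists N : nat, forall (X : env R) (G : seq X), (size G <= D)%N ->
  exists l : seq X, (size l <= N)%N /\ forall x, exists2 y, y \in l & nB G (x - y) <= r.
Proof.
move=> r0; have [U [f Hf]] := cells_r r0; exists #|{ffun 'I_D -> U}| => X G sG.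
pose col (x : X) : {ffun 'I_D -> U} := [ffun i : 'I_D => f (ch (nth 0 G i) x)].
pose rep c := odflt 0 [pick x | col x == c].
exists [seq rep c | c <- enum {ffun 'I_D -> U}]; split; first by rewrite size_map -cardE.
move=> x; exists (rep (col x)); first by apply: map_f; rewrite mem_enum.
have E : col (rep (col x)) = col x by rewrite /rep; case: pickP => [y /eqP //|/(_ x)]; rewrite eqxx.
apply/nB_leP; first exact: ltW.
move=> xi xG; have hi : (index xi G < D)%N by apply: leq_trans sG; rewrite index_mem.
have := congr1 (fun g : {ffun 'I_D -> U} => g (Ordinal hi)) E; rewrite !ffunE /= nth_index // => Ef.
have c1 z : nm (ch xi z) <= 1 by rewrite ch_nm.
have := Hf _ _ (c1 _) (c1 _) Ef.
have -> : 1 - ch xi (x - rep (col x)) = cj (ch xi (rep (col x))) * (ch xi (rep (col x)) - ch xi x).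
  by rewrite chBr mulrBr [cj _ * ch xi (rep _)]mulrC ch_unit mulrC.
by rewrite nmM nm_cj ch_nm mul1r.
Qed.

(** Comes from th (a + b) = th (b + a) after cancelling th a and th b. *)
Lemma quad_sym (X : env R) (G : seq X) L w B a b : quad G L w B -> nB G a <= L^-1 -> nB G b <= L^-1 ->
  B a b = B b a.
Proof.
move=> [_ _ /(_ 0) [c [th [_ th1 thD _]]]] ha hb.
have : th (a + b) = th (b + a) by rewrite addrC.
rewrite !thD // [th b * th a]mulrC; apply: mulfI.
by rewrite -nm_eq0 nmM !th1 mulr1 oner_eq0.
Qed.

(** At m = 0 the error bound is 0, which identifies the constant c with w x. *)
Lemma quad_local (X : env R) (G : seq X) L w B x : 0 < L -> quad G L w B -> exists th : X -> C,
  [/\ forall m, nm (th m) = 1, 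
      forall a b, nB G a <= L^-1 -> nB G b <= L^-1 -> th (a + b) = th a * th b * B a b,
      forall m, nB G m <= L^-1 -> nm (w (x + m) - w x * th m) <= L * nB G m & th 0 = 1].
Proof.
move=> L0 [[B1 Bl Br] _ /(_ x) [c [th [_ th1 thD Hx]]]]; exists th.
have z0 : nB G 0 <= L^-1 by rewrite nB0 invr_ge0 ltW.
have B00 : B 0 0 = 1.
  have nz : B 0 0 != 0 by rewrite -nm_eq0 B1 oner_eq0.
  by apply: (mulfI nz); rewrite -Bl // addr0 mulr1.
have t0 : th 0 = 1.
  have nz : th 0 != 0 by rewrite -nm_eq0 th1 oner_eq0.
  by apply: (mulfI nz); have := thD 0 0 z0 z0; rewrite addr0 B00 !mulr1.
have wc : w x = c.
  have := Hx 0 z0; rewrite nB0 mulr0 addr0 t0 mulr1 => h; apply/eqP; rewrite -subr_eq0 -nm_eq0.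
  by rewrite eq_le h nm_ge0.
by split => // m hm; rewrite wc; exact: Hx.
Qed.

(** An almost trivial second order part makes each local phase almost additive, and
    [approx_hom_kill] finds frequencies that kill it. One list of frequencies serves all base points
    because it is enough to treat the boundedly many centres of a covering. *)
Lemma quad_trivial (D : nat) (L r d : R) : 0 < L -> 0 < r -> 0 < d -> exists (D' : nat) (r' : R), 0 < r' /\
  forall (X : env R) (G : seq X) V B, (size G <= D)%N -> quad G L V B ->
  (forall a b, nB G a <= r -> nB G b <= r -> nm (B a b - 1) <= d / 12) ->
  exists G' : seq X, [/\ {subset G <= G'}, (size G' <= D')%N & forall x m, nB G' m <= r' -> nm (V (x + m) - V x) <= d].
Proof.
move=> L0 r0 d0; have d12 : 0 < d / 12 by rewrite divr_gt0.
pose rho := Num.min r (Num.min (L^-1 / 2) (d / (6 * L))).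
have rho0 : 0 < rho by rewrite !lt_min r0 !divr_gt0 ?invr_gt0 ?mulr_gt0.
have [N HN] := covering D rho0; have [D1 HD1] := approx_hom_kill D rho0 d12.
exists (D + N * D1)%N, (Num.min rho (1 / 2)); split; first by rewrite lt_min rho0 divr_gt0.
move=> X G V B sG qV HB; have [l [sl Hl]] := HN X G sG.
have rr : rho <= r by rewrite ge_min lexx.
have rL : rho <= L^-1 / 2 by rewrite !ge_min lexx orbT.
have rd : rho <= d / (6 * L) by rewrite !ge_min lexx !orbT.
have iL : 0 < L^-1 by rewrite invr_gt0.
have rL1 : rho <= L^-1 by move: rL iL; clear; lra.
have K1 y : exists p : (X -> C) * seq X, [/\ (size p.2 <= D1)%N, forall m, nm (p.1 m) = 1,
    forall a b, nB G a <= L^-1 -> nB G b <= L^-1 -> p.1 (a + b) = p.1 a * p.1 b * B a b,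
    forall m, nB G m <= L^-1 -> nm (V (y + m) - V y * p.1 m) <= L * nB G m &
    forall m, nB p.2 m <= 1 / 2 -> nm (p.1 m - 1) <= 5 * (d / 12)].
  have [th [th1 thD Hx _]] := quad_local y L0 qV.
  have [|G' [sG' HG']] := HD1 X G th sG th1.
    move=> a b ha hb; rewrite thD ?(le_trans ha) ?(le_trans hb) //.
    rewrite -[X in nm (_ - X)]mulr1 -mulrBr nmM nmM !th1 !mul1r.
    by apply: HB; [apply: le_trans rr|apply: le_trans rr].
  by exists (th, G').
have [P HP] := choice K1.
pose G' := G ++ flatten [seq (P y).2 | y <- l]; exists G'; split.
- by move=> z zG; rewrite mem_cat zG.
- rewrite size_cat leq_add // size_flatten /shape -map_comp sumnE big_map.
  apply: (@leq_trans (\sum_(y <- l) D1)); first by apply: leq_sum => y _ /=; case: (HP y).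
  by rewrite big_const_seq count_predT iter_addn_0 mulnC leq_mul2r sl orbT.
move=> x m hm.
have [y yl hy] := Hl x; have [_ th1 thD HV Hth] := HP y; move: (P y).1 th1 thD HV Hth => th th1 thD HV Hth.
set h := x - y in hy.
have hm1 : nB G m <= rho.
  apply: (le_trans _ (le_trans hm _)); last by rewrite ge_min lexx.
  by apply: nB_sub => z zG; rewrite mem_cat zG.
have hm2 : nB (P y).2 m <= 1 / 2.
  apply: (le_trans _ (le_trans hm _)); last by rewrite ge_min lexx orbT.
  apply: nB_sub => z zG; rewrite mem_cat; apply/orP; right; apply/flattenP; exists (P y).2 => //.
  by apply/mapP; exists y.
have xE : x = y + h by rewrite /h addrC subrK.
have hhm : nB G (h + m) <= 2 * rho by apply: (le_trans (nBD _ _ _)); move: hy hm1; clear; lra.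
have h2 : 2 * rho <= L^-1 by move: rL; clear; lra.
have e1 := HV (h + m) (le_trans hhm h2); have e2 := HV h (le_trans hy rL1).
have e3 := Hth m hm2; have e4 := HB h m (le_trans hy rr) (le_trans hm1 rr).
rewrite xE -addrA.
have V1 : nm (V y) <= 1 by case: qV.
(* The phase costs 5 d / 12 + d / 12; the two Lipschitz errors below add d / 3 and d / 6. *)
have e5 : nm (V y * th (h + m) - V y * th h) <= d / 2.
  rewrite thD ?(le_trans hy) ?(le_trans hm1) // -mulrBr nmM.
  have -> : th h * th m * B h m - th h = th h * (th m * B h m - 1 * 1) by ring.
  rewrite (nmM (th h)) th1 mul1r; apply: (@le_trans _ _ (1 * (d / 2))); last by rewrite mul1r.
  apply: ler_pM; rewrite ?nm_ge0 //; apply: (le_trans (nm_mul_dist _ _ _ _)); rewrite ?th1 ?nm1 //.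
  by move: e3 e4; clear; lra.
have Lr : L * rho <= d / 6.
  apply: (le_trans (ler_wpM2l (ltW L0) rd)); rewrite le_eqVlt; apply/orP; left; apply/eqP.
  by field; rewrite gt_eqF.
have e1' : L * nB G (h + m) <= d / 3.
  by apply: (le_trans (ler_wpM2l (ltW L0) hhm)); move: Lr; rewrite mulrCA; clear; lra.
have e2' : L * nB G h <= d / 6 by apply: (le_trans (ler_wpM2l (ltW L0) hy)).
apply: (le_trans (nm_dist _ (V y * th (h + m)) _)).
have e6 := nm_dist (V y * th (h + m)) (V y * th h) (V (y + h)).
rewrite (nmBC (V y * th h)) in e6.
by move: e1 e2 e5 e1' e2' e6; clear; lra.
Qed.

Definition triv (X : env R) (G : seq X) (r d : R) (V : X -> C) (F : X -> X -> C) :=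
  (forall a b, nB G a <= r -> nB G b <= r -> nm (F a b - 1) <= d) /\
  forall x m, nB G m <= r -> nm (V (x + m) - V x) <= d.

(** No function of the second variable correlates with the slices of F; failure of this is the
    hypothesis of [trivialise]. *)
Definition unif (X : env R) (s : X -> R) (d : R) (F : X -> X -> C) :=
  forall psi : X -> C, (forall x, nm (psi x) <= 1) -> \sum_m s m * nm (\sum_d (s d)%:C * (psi d * F m d)) <= d.

Lemma triv_mono (X : env R) (G G' : seq X) r r' d V F : {subset G <= G'} -> r' <= r ->
  triv G r d V F -> triv G' r' d V F.
Proof.
move=> sG rr [h1 h2].
have le u : nB G' u <= r' -> nB G u <= r by move=> h; apply: (le_trans (nB_sub u sG)); apply: (le_trans h).
by split => [a b ha hb|x m hm]; [apply: h1|apply: h2]; exact: le.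
Qed.

Lemma bim_mono (X : env R) (G : seq X) r r' B : r' <= r -> bim G r B -> bim G r' B.
Proof.
move=> rr [B1 Bl Br]; split => // a b c ha hb hc; [apply: Bl|apply: Br]; exact: le_trans rr.
Qed.

(** The square of F is tested as well because it is the cross term in the expansion of F (a + b) (a
    + b). If the square is the nonuniform one, halving the first argument recovers F from it. *)
Lemma not_unif_triv (D : nat) (K L r d : R) : 0 < K -> 0 < L -> 0 < r -> r <= L^-1 -> 0 < d -> 
  exists (D' : nat) (r' : R), 0 < r' /\ forall (X : env R) (G : seq X) V F s, torsion_free 2 X ->
  (size G <= D)%N -> quad G L V F -> wt K G (r / 8) s ->
  ~ (unif s d F /\ unif s d (fun a b => F a b ^+ 2)) ->
  exists G' : seq X, [/\ {subset G <= G'}, (size G' <= D')%N & triv G' r' d V F].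
Proof.
move=> K0 L0 r0 rL d0; have d12 : 0 < d / 12 by rewrite divr_gt0.
have [D1 [r1 [r10 H1]]] := trivialise D K0 r0 d0 d12.
pose rho := Num.min r1 r; have rho0 : 0 < rho by rewrite lt_min r10.
have [D2 [r2 [r20 H2]]] := quad_trivial (D1 + D1)%N L0 rho0 d0.
exists D2, (Num.min r2 rho); split; first by rewrite lt_min r20.
move=> X G V F s tf sG qV ws Hn; have [ps ss sK sL] := ws.
have bF : bim G r F by case: qV => h _ _; exact: bim_mono h.
have [F1 Fl Fr] := bF.
have bF2 : bim G r (fun a b => F a b ^+ 2).
  split; first by move=> a b; exact: nm_unitX.
    by move=> a b c ha hb hc; rewrite Fl // exprMn.
  by move=> a b c ha hb hc; rewrite Fr // exprMn.
have [h [hh hD]] := half_ex (isT : (1 < 2)%N) tf.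
suff [G1 [sG1 sz1 HG1]] : exists G1 : seq X, [/\ {subset G <= G1}, (size G1 <= D1 + D1)%N &
    forall a b, nB G1 a <= rho -> nB G1 b <= rho -> nm (F a b - 1) <= d / 12].
  have qV1 : quad G1 L V F by exact: quad_mono qV.
  have [G2 [sG2 sz2 HG2]] := H2 X G1 V F sz1 qV1 HG1.
  exists G2; split => //; first by move=> z /sG1 /sG2.
  split.
    move=> a b ha hb; apply: (@le_trans _ _ (d / 12)); last by move: d0; clear; lra.
    by apply: HG1; (apply: (le_trans (nB_sub _ sG2)); apply: le_trans (_ : _ <= Num.min r2 rho) _ => //; rewrite ge_min lexx orbT).
  by move=> x m hm; apply: HG2; apply: (le_trans hm); rewrite ge_min lexx.
have rr1 : rho <= r1 by rewrite ge_min lexx.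
have rr : rho <= r by rewrite ge_min lexx orbT.
have [hu|hu] := pselect (unif s d F); last first.
  have [psi hpsi] : exists psi : X -> C, ~ ((forall x, nm (psi x) <= 1) -> \sum_m s m * nm (\sum_d (s d)%:C * (psi d * F m d)) <= d).
    by apply/existsNP.
  have [psi1 /negP] := (not_implyP _ _).1 hpsi; rewrite -ltNge => Hd.
  have [G1 [s1 s2 s3]] := H1 X G F s s psi sG bF ws ps sK ss psi1 (ltW Hd).
  exists G1; split => //; first by apply: (leq_trans s2); rewrite leq_addr.
  by move=> a b ha hb; apply: s3; [apply: le_trans rr1|apply: le_trans rr1].
have {Hn hu} hu : ~ unif s d (fun a b => F a b ^+ 2) by move=> h'; apply: Hn.
have [psi hpsi] : exists psi : X -> C, ~ ((forall x, nm (psi x) <= 1) -> \sum_m s m * nm (\sum_d (s d)%:C * (psi d * F m d ^+ 2)) <= d).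
  by apply/existsNP.
have [psi1 /negP] := (not_implyP _ _).1 hpsi; rewrite -ltNge => Hd.
have [G1 [s1 s2 s3]] := H1 X G _ s s psi sG bF2 ws ps sK ss psi1 (ltW Hd).
exists (G1 ++ [seq h z | z <- G1]); split.
- by move=> z /s1; rewrite mem_cat => ->.
- by rewrite size_cat size_map leq_add.
move=> a b ha hb.
have ha2 : nB G1 (h a) <= rho.
  apply/nB_leP; first exact: ltW.
  move=> xi xG; rewrite -{1}(hh xi) chDl -chDr hh; apply: le_trans ha; apply: nB_mem.
  by rewrite mem_cat map_f // orbT.
have hb2 : nB G1 b <= rho by apply: le_trans hb; apply: nB_sub => z zG; rewrite mem_cat zG.
have le u : nB G1 u <= rho -> nB G u <= r.
  by move=> hx; apply: (le_trans (nB_sub u s1)); apply: (le_trans hx).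
have -> : F a b = F (h a) b ^+ 2 by rewrite -{1}(hh a) Fl ?le // expr2.
by apply: s3; apply: le_trans rr1.
Qed.

(** Whenever some phase is not uniform, the Bohr set is shrunk to make it trivial, a property that
    survives further shrinking. At most k such rounds occur, each with a weight built on the current
    Bohr set, and K bounds the weights of all rounds. *)
Lemma dichotomy (k D : nat) (L r d : R) : 0 < L -> 0 < r -> r <= L^-1 -> 0 < d -> 
  exists K : R, 1 <= K /\ forall (X : env R) (G : seq X) (I : finType) (V : I -> X -> C) (F : I -> X -> X -> C)
    (T : {set I}), torsion_free 2 X -> (size G <= D)%N -> (forall i, quad G L (V i) (F i)) -> (#|T| <= k)%N ->
  exists (G' : seq X) (r' : R) (s : X -> R), [/\ {subset G <= G'}, 0 < r' <= r,
    [/\ prob s, forall x, s x <= K / q X & forall x, s x != 0 -> nB G' x <= r' / 8] &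
    forall i, i \in T -> triv G' r' d (V i) (F i) \/ (unif s d (F i) /\ unif s d (fun a b => F i a b ^+ 2))].
Proof.
move=> L0 r0 rL d0; have [m] := ubnP k; elim: m k D r r0 rL => [//|m IH] k D r r0 rL; rewrite ltnS => km.
have r80 : 0 < r / 8 by rewrite divr_gt0.
have [K [K1 HK]] := bump_ex D r80; have K0 : 0 < K by apply: lt_le_trans K1.
have [D1 [r1 [r10 H1]]] := not_unif_triv D K0 L0 r0 rL d0.
pose r2 := Num.min r1 r; have r20 : 0 < r2 by rewrite lt_min r10.
have r2r : r2 <= r by rewrite ge_min lexx orbT.
have [K2 [K21 H2]] : exists K : R, 1 <= K /\ ((0 < k)%N -> forall (X : env R) (G : seq X) (I : finType)
    (V : I -> X -> C) (F : I -> X -> X -> C) (T : {set I}), torsion_free 2 X -> (size G <= D1)%N ->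
    (forall i, quad G L (V i) (F i)) -> (#|T| <= k.-1)%N ->
  exists (G' : seq X) (r' : R) (s : X -> R), [/\ {subset G <= G'}, 0 < r' <= r2,
    [/\ prob s, forall x, s x <= K / q X & forall x, s x != 0 -> nB G' x <= r' / 8] &
    forall i, i \in T -> triv G' r' d (V i) (F i) \/ (unif s d (F i) /\ unif s d (fun a b => F i a b ^+ 2))]).
  case: k km => [|k] km; first by exists 1.
  have [K' [K'1 H']] := IH k D1 r2 r20 (le_trans r2r rL) km.
  by exists K'; split => // _; exact: H'.
exists (K + K2); split; first by apply: (le_trans K1); rewrite lerDl (le_trans ler01).
move=> X G I V F T tf sG qV cT; have q0 := q_gt0 X.
have [s ws] := HK X G sG; have [ps ss sK sL] := ws.
have iq : 0 < (q X)^-1 by rewrite invr_gt0.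
have [Hall|Hno] := pselect (forall i, i \in T -> unif s d (F i) /\ unif s d (fun a b => F i a b ^+ 2)).
  exists G, r, s; split => //; first by rewrite r0 lexx.
    split => // x; apply: (le_trans (sK x)); rewrite ler_pM2r // lerDl (le_trans ler01) //.
  by move=> i iT; right; exact: Hall.
have [i0 Hi0] := (existsNP _).2 Hno.
have [i0T Hu] := (not_implyP _ _).1 Hi0.
have [G1 [s1 sz1 t1]] := H1 X G (V i0) (F i0) s tf sG (qV i0) ws Hu.
have k0 : (0 < k)%N by apply: leq_trans cT; apply/card_gt0P; exists i0.
have qV1 i : quad G1 L (V i) (F i) by apply: quad_mono (qV i).
have cT1 : (#|T :\ i0| <= k.-1)%N by rewrite -ltnS prednK // (leq_trans _ cT) // (cardsD1 i0 T) i0T.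
have [G' [r' [s' [h1 /andP [h2 h2'] [h3 h4 h5] h6]]]] := H2 k0 X G1 I V F (T :\ i0) tf sz1 qV1 cT1.
exists G', r', s'; split.
- by move=> z /s1 /h1.
- by rewrite h2 (le_trans h2').
- split => // x; apply: (le_trans (h4 x)); rewrite ler_pM2r // lerDr (le_trans ler01) //.
move=> i iT; have [->|ni] := eqVneq i i0; last by apply: h6; rewrite !inE ni.
by left; apply: triv_mono t1 => //; apply: (le_trans h2'); rewrite ge_min lexx.
Qed.
End Dichotomy.

(** * Counting progressions in structured functions *)

Lemma ler_divn (R : realFieldType) (r y : R) n : 0 < r -> y <= r / n.+1%:R -> y <= r.
Proof. by move=> r0 h; apply: (le_trans h); rewrite ler_pdivrMr ?ltr0n // ler_peMr ?ler1n // ltW. Qed.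
Lemma ler_quarterD (R : realFieldType) (r y z : R) : y <= r / 4 -> z <= 3 / 4 * r -> y + z <= r.
Proof. by lra. Qed.
Lemma ler_quarter (R : realFieldType) (r y : R) : 0 < r -> y <= r / 4 -> y <= 3 / 4 * r.
Proof. by lra. Qed.
Lemma ler_quarter2 (R : realFieldType) (r y : R) : 0 < r -> y <= r / 4 -> y + y <= 3 / 4 * r.
Proof. by lra. Qed.

(** Since (c z)^3 = z^2 (c^3 z) and z <= 2. In [good_count] it recovers the first power of a product
    of phases where only a bound with its cube is available. *)
Lemma cube_cancel (R : realDomainType) (c z nu : R) : 0 <= c -> 0 <= z -> z <= 2 -> 0 <= nu ->
  4 * (c ^+ 3 * z) <= nu ^+ 3 -> c * z <= nu.
Proof.
move=> c0 z0 z2 n0 h; rewrite -(@ler_pXn2r _ 3%N) ?nnegrE ?mulr_ge0 //.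
apply: le_trans h; have -> : (c * z) ^+ 3 = z ^+ 2 * (c ^+ 3 * z) by ring.
apply: ler_wpM2r; first by rewrite mulr_ge0 // exprn_ge0.
by have -> : 4 = 2 ^+ 2 :> R by [ring]; rewrite lerXn2r ?nnegrE.
Qed.

Section Monomials.
Variables (R : realType) (X : env R) (I : finType).
Local Notation C := R[i].
Variables (w : I -> X -> C) (B : I -> X -> X -> C).
Definition monV (s : seq I) x := \prod_(i <- s) w i x.
Definition monF (s : seq I) a b := \prod_(i <- s) B i a b.

Lemma mon_quad G L s : 0 < L -> (forall i, quad G L (w i) (B i)) -> quad G ((size s).+1%:R * L) (monV s) (monF s).
Proof.
move=> L0 qw; elim: s => [|i s IH].
  rewrite mul1r; have -> : monV [::] = fun _ => 1 by apply: funext => x; rewrite /monV big_nil.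
  have -> : monF [::] = fun _ _ => 1 by apply: funext => a; apply: funext => b; rewrite /monF big_nil.
  exact: quad_one.
have -> : monV (i :: s) = fun x => w i x * monV s x by apply: funext => x; rewrite /monV big_cons.
have -> : monF (i :: s) = fun a b => B i a b * monF s a b.
  by apply: funext => a; apply: funext => b; rewrite /monF big_cons.
have -> : (size (i :: s)).+1%:R * L = L + (size s).+1%:R * L by rewrite /= -[in LHS]natr1 mulrDl mul1r addrC.
by apply: quad_mul => //; rewrite mulr_gt0 ?ltr0n.
Qed.
End Monomials.

Section Local.
Variables (R : realType) (X : env R) (I : finType).
Local Notation C := R[i].
Local Notation q := (q X).
Variables (w : I -> X -> C) (B : I -> X -> X -> C) (G : seq X) (L r d nu : R) (s : X -> R).
Hypothesis (qw : forall i, quad G L (w i) (B i)) (L0 : 0 < L) (r0 : 0 < r) (rL : r <= L^-1).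
Hypothesis (ps : prob s) (ss : forall x, s x != 0 -> nB G x <= r / 8).
Hypothesis (nu0 : 0 < nu) (nu1 : nu <= 1) (Lr32 : 32 * (L * r) <= nu ^+ 3) (d0 : 0 < d) (d32 : 32 * d <= nu ^+ 3).
Local Notation V := (monV w).
Local Notation F := (monF B).
Definition Tr (z : seq I) := triv G r d (V z) (F z).
Hypothesis Dich : forall z : seq I, (size z <= 6)%N ->
  Tr z \/ (unif s d (F z) /\ unif s d (fun a b => F z a b ^+ 2)).

Let Lr : 16 * (L * r) <= nu ^+ 3.
Proof. by apply: le_trans Lr32; rewrite ler_pM2r ?mulr_gt0 // ler_nat. Qed.
Let dnu : 16 * d <= nu ^+ 3.
Proof. by apply: le_trans d32; rewrite ler_pM2r // ler_nat. Qed.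
Let nu3 : nu ^+ 3 <= nu.
Proof. by rewrite exprS ler_piMr ?(ltW nu0) // expr_le1 // ltW. Qed.
Let w1 i x : nm (w i x) <= 1. Proof. by case: (qw i). Qed.
Let B1 i a b : nm (B i a b) = 1. Proof. by case: (qw i) => -[]. Qed.
Let V1 z x : nm (V z x) <= 1.
Proof.
rewrite /monV; elim: z => [|i z IH]; rewrite ?big_nil ?big_cons ?nm1 //.
by apply: nm_le1M.
Qed.
Let F1 z a b : nm (F z a b) = 1.
Proof. by rewrite /monF nm_prod big1. Qed.

(** A phase near 1 correlates with psi = 1, so it cannot be uniform, and the dichotomy makes it
    trivial with the original tolerance d. Errors thus do not accumulate along chains of
    manipulations. *)
Lemma triv_rule z : (size z <= 6)%N ->
  (forall a b, nB G a <= r -> nB G b <= r -> nm (F z a b - 1) <= 6 * d) -> Tr z.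
Proof.
move=> sz H; case: (Dich sz) => // -[U _]; exfalso.
have s1 x : s x != 0 -> nB G x <= r by move/ss; exact: ler_divn.
have n1 (x : X) : nm (1 : C) <= 1 by rewrite nm1.
have U1 := U (fun _ => 1) n1.
have h (m : X) : s m != 0 -> 1 - 6 * d <= nm (\sum_d0 (s d0)%:C * (1 * F z m d0)).
  move=> sm; have E : \sum_d0 (s d0)%:C * (1 : C) = 1.
    by rewrite -mulr_suml -rmorph_sum ps.2 mulr1.
  have D : nm (\sum_d0 (s d0)%:C * (1 * F z m d0) - \sum_d0 (s d0)%:C * (1 : C)) <= 6 * d.
    by apply: wnm_dist => // x sx; rewrite mul1r; apply: H; exact: s1.
  rewrite E in D; set Y := \sum_d0 _ in D *.
  by have := nm_tri 1 Y; rewrite nmBC nm1 lerBlDr => h1; apply: (le_trans h1); rewrite lerD2l.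
have h7 : 7 * d < 1.
  apply: (@lt_le_trans _ _ (16 * d)); first by rewrite ltr_pM2r // ltr_nat.
  by apply: (le_trans dnu); apply: (le_trans nu3).
have : 1 - 6 * d <= d.
  apply: le_trans U1; apply: (@le_trans _ _ (\sum_m s m * (1 - 6 * d))); first by rewrite -mulr_suml ps.2 mul1r.
  apply: ler_sum => m _; have [->|sm] := eqVneq (s m) 0; first by rewrite !mul0r.
  by apply: ler_wpM2l; [exact: ps.1|exact: h].
by rewrite leNgt lterBDr -{1}(mul1r d) -mulrDl (_ : 1 + 6 = 7) ?h7 //; ring.
Qed.

Definition local_model (x : X) (th : I -> X -> C) := forall i,
  [/\ forall m, nm (th i m) = 1, th i 0 = 1,
      forall a b, nB G a <= r -> nB G b <= r -> th i (a + b) = th i a * th i b * B i a b &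
      forall m, nB G m <= r -> nm (w i (x + m) - w i x * th i m) <= L * r].

Lemma local_model_ex x : exists th, local_model x th.
Proof.
have H i := quad_local x L0 (qw i).
have [th Hth] := choice H; exists th => i; have [h1 h2 h3 h4] := Hth i; split => //.
  by move=> a b ha hb; apply: h2; exact: le_trans rL.
move=> m hm; apply: (le_trans (h3 m (le_trans hm rL))); exact: ler_wpM2l (ltW L0) _ _ hm.
Qed.

Let BDl i a b c : nB G a <= r -> nB G b <= r -> nB G c <= r -> B i (a + b) c = B i a c * B i b c.
Proof. by case: (qw i) => -[_ H _] _ _ ha hb hc; apply: H; exact: le_trans rL. Qed.
Let BDr i a b c : nB G a <= r -> nB G b <= r -> nB G c <= r -> B i c (a + b) = B i c a * B i c b.
Proof. by case: (qw i) => -[_ _ H] _ _ ha hb hc; apply: H; exact: le_trans rL. Qed.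
Let Bsym i a b : nB G a <= r -> nB G b <= r -> B i a b = B i b a.
Proof. by move=> ha hb; apply: (quad_sym (qw i)); exact: le_trans rL. Qed.

Lemma FDl z a b c : nB G a <= r -> nB G b <= r -> nB G c <= r -> F z (a + b) c = F z a c * F z b c.
Proof. by move=> ha hb hc; rewrite /monF -big_split /=; apply: eq_bigr => i _; exact: BDl. Qed.
Lemma FDr z a b c : nB G a <= r -> nB G b <= r -> nB G c <= r -> F z c (a + b) = F z c a * F z c b.
Proof. by move=> ha hb hc; rewrite /monF -big_split /=; apply: eq_bigr => i _; exact: BDr. Qed.
Lemma Fsym z a b : nB G a <= r -> nB G b <= r -> F z a b = F z b a.
Proof. by move=> ha hb; rewrite /monF; apply: eq_bigr => i _; exact: Bsym. Qed.
Lemma thMD x th z a b : local_model x th -> nB G a <= r -> nB G b <= r -> 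
  monV th z (a + b) = monV th z a * monV th z b * F z a b.
Proof.
move=> lm ha hb; rewrite /monV /monF -!big_split /=; apply: eq_bigr => i _.
by have [_ _ h _] := lm i; exact: h.
Qed.
Lemma thM1 x th z a : local_model x th -> nm (monV th z a) = 1.
Proof. by move=> lm; rewrite /monV nm_prod big1 // => i _; case: (lm i). Qed.

(* The four linear forms x + j d give rise to three monomials: kappa carries the dependence
   on the base point, alpha the cross terms and gamma the quadratic terms in d. *)
Definition kappa (t : nat -> I) := [:: t 0%N; t 1%N; t 2%N; t 3%N].
Definition alpha (t : nat -> I) := [:: t 1%N; t 2%N; t 2%N; t 3%N; t 3%N; t 3%N].
Definition gamma (t : nat -> I) := [:: t 2%N; t 3%N; t 3%N; t 3%N].

Lemma nB_mul d' j : (j < 4)%N -> nB G d' <= r / 4 -> nB G (d' *+ j) <= 3 / 4 * r.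
Proof.
move=> j4 hd; apply: (le_trans (nBMn _ _ _)); apply: (@le_trans _ _ (3 * (r / 4))).
  by apply: ler_pM => //; rewrite ?nB_ge0 // ler_nat.
by rewrite mulrA mulrAC.
Qed.

(** Each th (m + j e) contributes th e to the power j, B e e to the power j (j - 1) / 2 and B m e to
    the power j; these exponents are the multiplicities in [alpha] and [gamma]. *)
Lemma local_step x th (t : nat -> I) m e : local_model x th -> nB G m <= r / 4 -> nB G e <= r / 4 ->
  \prod_(j < 4) th (t j) (m + e *+ j) =
  monV th (kappa t) m * (monV th (alpha t) e * F (gamma t) e e) * F (alpha t) m e.
Proof.
move=> lm hm he.
have m1 : nB G m <= r by exact: ler_divn hm.
have e1 : nB G e <= r by exact: ler_divn he.
have e2 : nB G (e + e) <= r by apply: (le_trans (nBD _ _ _)); apply: (ler_quarterD he); exact: ler_quarter.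
have e3 : nB G (e + (e + e)) <= r.
  apply: (le_trans (nBD _ _ _)); apply: (ler_quarterD he); apply: (le_trans (nBD _ _ _)).
  exact: ler_quarter2.
have th2 i : th i (m + (e + e)) = th i m * th i e ^+ 2 * B i e e * B i m e ^+ 2.
  have [_ _ D _] := lm i; rewrite (D m) // (D e e) // (BDr _ e1 e1) //; ring.
have th3 i : th i (m + (e + (e + e))) = th i m * th i e ^+ 3 * B i e e ^+ 3 * B i m e ^+ 3.
  have [_ _ D _] := lm i; rewrite (D m) // (D e (e + e)) // (D e e) // !(BDr _ e1 e2) // !(BDr _ e1 e1) //; ring.
have th1 i : th i (m + e) = th i m * th i e * B i m e by have [_ _ D _] := lm i; exact: D.
rewrite !big_ord_recl big_ord0 /bump /= mulr0n addr0 mulr1n mulr2n !mulrS mulr0n addr0 th1 th2 th3.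
by rewrite /kappa /alpha /gamma /monV /monF !big_cons !big_nil; ring.
Qed.

Lemma local_step0 x th (t : nat -> I) e : local_model x th -> nB G e <= r / 4 ->
  \prod_(j < 4) th (t j) (e *+ j) = monV th (alpha t) e * F (gamma t) e e.
Proof.
move=> lm he; have z0 : nB G 0 <= r / 4 by rewrite nB0 divr_ge0 // ltW.
have e1 : nB G e <= r by exact: ler_divn he.
have z1 : nB G 0 <= r by rewrite nB0 ltW.
have := local_step t lm z0 he; under eq_bigr do rewrite add0r.
have -> : monV th (kappa t) 0 = 1 by rewrite /monV big1 // => i _; case: (lm i).
have -> : F (alpha t) 0 e = 1.
  have nz : F (alpha t) 0 e != 0 by rewrite -nm_eq0 F1 oner_eq0.
  by apply: (mulfI nz); rewrite -FDl // addr0 mulr1.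
by rewrite mul1r mulr1.
Qed.

Lemma prod_dist n (a b : 'I_n -> C) : (forall j, nm (a j) <= 1) -> (forall j, nm (b j) <= 1) ->
  nm (\prod_j a j - \prod_j b j) <= \sum_j nm (a j - b j).
Proof.
move=> a1 b1; elim: n a b a1 b1 => [|n IH] a b a1 b1.
  by rewrite !big_ord0 subrr nm0.
rewrite !big_ord_recl; apply: (le_trans (nm_mul_dist _ _ _ _)) => //.
  rewrite nm_prod; apply: (@le_trans _ _ (\prod_(i < n) 1)); last by rewrite big1.
  by apply: ler_prod => i _; rewrite nm_ge0 b1.
by rewrite lerD2l; apply: IH.
Qed.

Lemma local_error x th (t : nat -> I) m e : local_model x th -> nB G m <= r / 4 -> nB G e <= r / 4 ->
  nm (\prod_(j < 4) w (t j) (x + (m + e *+ j)) -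
      \prod_(j < 4) w (t j) x * \prod_(j < 4) th (t j) (m + e *+ j)) <= nu / 4.
Proof.
move=> lm hm he; rewrite -big_split /=.
apply: (le_trans (prod_dist _ _)) => // [j|]; first by apply: nm_le1M => //; case: (lm (t j)) => -> .
apply: (@le_trans _ _ (\sum_(j < 4) L * r)).
  apply: ler_sum => j _; have [_ _ _ H] := lm (t j); apply: H.
  apply: (le_trans (nBD _ _ _)); apply: (ler_quarterD hm); exact: nB_mul.
rewrite sumr_const card_ord -[_ *+ 4]mulr_natr; rewrite ler_pdivlMr //.
by have -> : L * r * 4 * 4 = 16 * (L * r) by [ring]; apply: (le_trans Lr).
Qed.

Lemma uavg_le (f : X -> C) c : (forall x, nm (f x) <= c) -> nm ((q^-1)%:C * \sum_x f x) <= c.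
Proof.
move=> H; have q0 := q_gt0 X; rewrite nmM nmR gtr0_norm ?invr_gt0 // mulrC ler_pdivrMr //.
apply: (le_trans (nm_sum _ _ _)); apply: (@le_trans _ _ (\sum_(x : X) c)); first by apply: ler_sum => x _.
by rewrite sumr_const -[leLHS]mulr_natr.
Qed.

(** The common end of the vanishing arguments: u and psi absorb whatever depends on one variable
    alone. *)
Lemma unif_kill (u psi : X -> C) (H : X -> X -> C) (P : X -> X -> C) e : unif s d H ->
  (forall a, nm (u a) <= 1) -> (forall b, nm (psi b) <= 1) ->
  (forall a b, nB G a <= r / 8 -> nB G b <= r / 8 -> nm (P a b - u a * (psi b * H a b)) <= e) ->
  nm (\sum_a (s a)%:C * \sum_b (s b)%:C * P a b) <= e + d.
Proof.
move=> U u1 psi1 HP.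
pose Y := \sum_a (s a)%:C * \sum_b (s b)%:C * (u a * (psi b * H a b)).
have h1 : nm (\sum_a (s a)%:C * \sum_b (s b)%:C * P a b - Y) <= e.
  apply: wnm_dist => // a sa; apply: wnm_dist => // b sb; apply: HP; exact: ss.
have h2 : nm Y <= d.
  apply: (le_trans (wnm _ ps.1)); apply: le_trans (U psi psi1); apply: ler_sum => a _.
  apply: ler_wpM2l; first exact: ps.1.
  have -> : \sum_b (s b)%:C * (u a * (psi b * H a b)) = u a * \sum_b (s b)%:C * (psi b * H a b).
    by rewrite mulr_sumr; apply: eq_bigr => b _; ring.
  by rewrite nmM ler_piMl ?nm_ge0.
by apply: (le_trans (nm_tri _ Y)); rewrite addrC lerD.
Qed.

Definition cnt (t : nat -> I) (e : X) : C := (q^-1)%:C * \sum_x \prod_(j < 4) w (t j) (x + e *+ j).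
(** The step is drawn as a + b with a and b independent of law s, which matches the self-convolution
    in [apn_conv]. *)
Definition dcnt (t : nat -> I) : C := \sum_a (s a)%:C * \sum_b (s b)%:C * cnt t (a + b).

Lemma cnt_shift t e m : cnt t e = (q^-1)%:C * \sum_x \prod_(j < 4) w (t j) (x + (m + e *+ j)).
Proof.
rewrite /cnt -(sum_shift m); congr (_ * _); apply: eq_bigr => x _; apply: eq_bigr => j _.
by rewrite addrA.
Qed.

Lemma wavg_cst (c : C) : \sum_a (s a)%:C * c = c.
Proof. by rewrite -mulr_suml -rmorph_sum ps.2 mul1r. Qed.

Let nu4d : nu / 4 + d + d <= nu.
Proof.
have h : d <= nu / 4.
  rewrite ler_pdivlMr //; apply: le_trans nu3; apply: le_trans dnu.
  by rewrite [d * 4]mulrC ler_pM2r // ler_nat.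
apply: (@le_trans _ _ (nu / 4 + nu / 4 + nu / 4)); first by rewrite !lerD.
have -> : nu / 4 + nu / 4 + nu / 4 = nu * (3 / 4) by field.
by rewrite ler_piMr ?(ltW nu0) // ler_pdivrMr // mul1r ler_nat.
Qed.
Let nu4d1 : nu / 4 + d <= nu.
Proof. by apply: le_trans nu4d; rewrite lerDl ltW. Qed.

Let sum_small a b : nB G a <= r / 8 -> nB G b <= r / 8 -> nB G (a + b) <= r / 4.
Proof.
move=> ha hb; apply: (le_trans (nBD _ _ _)); apply: (le_trans (lerD ha hb)).
by rewrite le_eqVlt; apply/orP; left; apply/eqP; field.
Qed.

(** Smoothing the base point by a + b with a, b independent produces the cross term F (kappa t) a b;
    the other factors involve a alone or b alone. *)
Lemma bad_kappa t : ~ Tr (kappa t) -> nm (dcnt t) <= nu.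
Proof.
move=> hT; have U : unif s d (F (kappa t)) by case: (Dich (isT : (size (kappa t) <= 6)%N)) => // -[].
apply: wnm_le => // a0 sa; apply: wnm_le => // b0 sb; set e := a0 + b0.
have he : nB G e <= r / 4 by apply: sum_small; exact: ss.
have e1 : nB G e <= r by exact: ler_divn he.
have -> : cnt t e = (q^-1)%:C * \sum_x \sum_a (s a)%:C * \sum_b (s b)%:C * \prod_(j < 4) w (t j) (x + (a + b + e *+ j)).
  have -> : \sum_x \sum_a (s a)%:C * \sum_b (s b)%:C * \prod_(j < 4) w (t j) (x + (a + b + e *+ j)) =
     \sum_a (s a)%:C * \sum_b (s b)%:C * \sum_x \prod_(j < 4) w (t j) (x + (a + b + e *+ j)).
    rewrite exchange_big; apply: eq_bigr => a _; rewrite -mulr_sumr; congr (_ * _).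
    by rewrite exchange_big; apply: eq_bigr => b _; rewrite mulr_sumr.
  rewrite mulr_sumr -[LHS]wavg_cst; apply: eq_bigr => a _; rewrite [RHS]mulrCA; congr (_ * _).
  rewrite mulr_sumr -[LHS]wavg_cst; apply: eq_bigr => b _; rewrite [RHS]mulrCA; congr (_ * _).
  exact: cnt_shift.
apply: uavg_le => x; have [th lm] := local_model_ex x.
apply: (le_trans _ nu4d1).
apply: (@unif_kill (fun a => \prod_(j < 4) w (t j) x * monV th (kappa t) a * (monV th (alpha t) e * F (gamma t) e e) * F (alpha t) a e)
  (fun b => monV th (kappa t) b * F (alpha t) b e) (F (kappa t))) => //.
- move=> a; rewrite !nmM (thM1 _ _ lm) (thM1 _ _ lm) !F1 !mulr1 nm_prod.
  apply: (@le_trans _ _ (\prod_(i < 4) 1)); last by rewrite big1.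
  by apply: ler_prod => i _; rewrite nm_ge0 w1.
- by move=> b; rewrite nmM (thM1 _ _ lm) F1 mulr1.
move=> a b ha hb; have hab := sum_small ha hb.
have a1 : nB G a <= r by exact: ler_divn ha.
have b1 : nB G b <= r by exact: ler_divn hb.
apply: le_trans (local_error t lm hab he); rewrite (local_step t lm hab he).
rewrite (thMD _ lm a1 b1) (FDl _ a1 b1 e1) le_eqVlt; apply/orP; left; apply/eqP; congr nm; ring.
Qed.

(** Here the cross term is F (alpha t) m a, between the smoothing m of the base point and one
    summand a of the step. *)
Lemma bad_alpha t : ~ Tr (alpha t) -> nm (dcnt t) <= nu.
Proof.
move=> hT; have U : unif s d (F (alpha t)) by case: (Dich (isT : (size (alpha t) <= 6)%N)) => // -[].
have -> : dcnt t = \sum_b (s b)%:C * \sum_a (s a)%:C * cnt t (a + b).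
  rewrite /dcnt; under eq_bigr do rewrite mulr_sumr; rewrite exchange_big /=; apply: eq_bigr => b _.
  by rewrite mulr_sumr; apply: eq_bigr => a _; rewrite mulrCA.
apply: wnm_le => // b sb; have hb := ss sb.
have -> : \sum_a (s a)%:C * cnt t (a + b) = (q^-1)%:C * \sum_x \sum_m (s m)%:C * \sum_a (s a)%:C *
    \prod_(j < 4) w (t j) (x + (m + (a + b) *+ j)).
  have -> : \sum_x \sum_m (s m)%:C * \sum_a (s a)%:C * \prod_(j < 4) w (t j) (x + (m + (a + b) *+ j)) =
     \sum_m (s m)%:C * \sum_a (s a)%:C * \sum_x \prod_(j < 4) w (t j) (x + (m + (a + b) *+ j)).
    rewrite exchange_big; apply: eq_bigr => m _; rewrite -mulr_sumr; congr (_ * _).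
    by rewrite exchange_big; apply: eq_bigr => a _; rewrite mulr_sumr.
  rewrite mulr_sumr -[LHS]wavg_cst; apply: eq_bigr => m _; rewrite [RHS]mulrCA; congr (_ * _).
  rewrite mulr_sumr; apply: eq_bigr => a _; rewrite [RHS]mulrCA; congr (_ * _).
  exact: cnt_shift.
apply: uavg_le => x; have [th lm] := local_model_ex x.
apply: (le_trans _ nu4d1).
apply: (@unif_kill (fun m => \prod_(j < 4) w (t j) x * monV th (kappa t) m * F (alpha t) m b)
  (fun a => monV th (alpha t) (a + b) * F (gamma t) (a + b) (a + b)) (F (alpha t))) => //.
- move=> m; rewrite !nmM (thM1 _ _ lm) !F1 !mulr1 nm_prod.
  apply: (@le_trans _ _ (\prod_(i < 4) 1)); last by rewrite big1.
  by apply: ler_prod => i _; rewrite nm_ge0 w1.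
- by move=> a; rewrite nmM (thM1 _ _ lm) F1 mulr1.
move=> m a hm ha; have hab := sum_small ha hb.
have hm4 : nB G m <= r / 4 by have := sum_small hm (_ : nB G 0 <= r / 8); rewrite addr0 nB0; apply; rewrite divr_ge0 // ltW.
have a1 : nB G a <= r by exact: ler_divn ha.
have b1 : nB G b <= r by exact: ler_divn hb.
have m1 : nB G m <= r by exact: ler_divn hm.
apply: le_trans (local_error t lm hm4 hab); rewrite (local_step t lm hm4 hab).
rewrite (FDr _ a1 b1 m1) le_eqVlt; apply/orP; left; apply/eqP; congr nm; ring.
Qed.

(** Expanding F (gamma t) (a + b) (a + b) gives the square of F (gamma t) a b as cross term. The
    linear part contributes F (alpha t) a b as well, which is why alpha must already be trivial. *)
Lemma bad_gamma t : Tr (alpha t) -> ~ Tr (gamma t) -> nm (dcnt t) <= nu.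
Proof.
move=> [Ta _] hT; have U : unif s d (fun a b => F (gamma t) a b ^+ 2) by case: (Dich (isT : (size (gamma t) <= 6)%N)) => // -[].
have -> : dcnt t = (q^-1)%:C * \sum_x \sum_a (s a)%:C * \sum_b (s b)%:C * \prod_(j < 4) w (t j) (x + (a + b) *+ j).
  have -> : \sum_x \sum_a (s a)%:C * \sum_b (s b)%:C * \prod_(j < 4) w (t j) (x + (a + b) *+ j) =
     \sum_a (s a)%:C * \sum_b (s b)%:C * \sum_x \prod_(j < 4) w (t j) (x + (a + b) *+ j).
    rewrite exchange_big; apply: eq_bigr => m _; rewrite -mulr_sumr; congr (_ * _).
    by rewrite exchange_big; apply: eq_bigr => a _; rewrite mulr_sumr.
  rewrite mulr_sumr; apply: eq_bigr => a _; rewrite [RHS]mulrCA; congr (_ * _).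
  by rewrite mulr_sumr; apply: eq_bigr => b _; rewrite mulrCA.
apply: uavg_le => x; have [th lm] := local_model_ex x.
apply: (le_trans _ nu4d).
apply: (@unif_kill (fun a => \prod_(j < 4) w (t j) x * monV th (alpha t) a * F (gamma t) a a)
  (fun b => monV th (alpha t) b * F (gamma t) b b) (fun a b => F (gamma t) a b ^+ 2)) => //.
- move=> m; rewrite !nmM (thM1 _ _ lm) !F1 !mulr1 nm_prod.
  apply: (@le_trans _ _ (\prod_(i < 4) 1)); last by rewrite big1.
  by apply: ler_prod => i _; rewrite nm_ge0 w1.
- by move=> a; rewrite nmM (thM1 _ _ lm) F1 mulr1.
move=> a b ha hb; have hab := sum_small ha hb.
have z4 : nB G 0 <= r / 4 by rewrite nB0 divr_ge0 // ltW.
have a1 : nB G a <= r by exact: ler_divn ha.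
have b1 : nB G b <= r by exact: ler_divn hb.
have ab1 : nB G (a + b) <= r by exact: ler_divn hab.
have := local_error t lm z4 hab.
under eq_bigr do rewrite add0r; under [X in _ - _ * X]eq_bigr do rewrite add0r.
rewrite (local_step0 t lm hab) (thMD _ lm a1 b1) (FDr _ a1 b1 ab1) (FDl _ a1 b1 a1) (FDl _ a1 b1 b1) (Fsym _ b1 a1).
set W := \prod_(j < 4) w (t j) x; set P := \prod_(j < 4) _ => h.
set Y := W * _ in h.
apply: (le_trans (nm_dist _ Y _)); apply: (lerD h).
apply: le_trans (Ta a b a1 b1).
have -> : Y - W * monV th (alpha t) a * F (gamma t) a a * (monV th (alpha t) b * F (gamma t) b b * F (gamma t) a b ^+ 2) =
  W * (monV th (alpha t) a * monV th (alpha t) b * F (gamma t) a a * F (gamma t) b b * F (gamma t) a b ^+ 2) * (F (alpha t) a b - 1).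
  by rewrite /Y; ring.
rewrite nmM ler_piMl ?nm_ge0 //; apply: nm_le1M; last by rewrite !nmM !(thM1 _ _ lm) !F1 !mulr1.
rewrite nm_prod; apply: (@le_trans _ _ (\prod_(i < 4) 1)); last by rewrite big1.
by apply: ler_prod => i _; rewrite nm_ge0 w1.
Qed.

Lemma mon_local_error x th z m : local_model x th -> nB G m <= r ->
  nm (V z (x + m) - V z x * monV th z m) <= (size z)%:R * (L * r).
Proof.
move=> lm hm; rewrite /monV; elim: z => [|i z IH]; first by rewrite !big_nil mulr1 subrr nm0 mul0r.
rewrite !big_cons; have -> : w i x * \prod_(j <- z) w j x * (th i m * \prod_(j <- z) th j m) =
  (w i x * th i m) * (\prod_(j <- z) w j x * \prod_(j <- z) th j m) by ring.
have [t1 _ _ H] := lm i.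
apply: (le_trans (nm_mul_dist _ _ _ _)) => //.
  apply: nm_le1M; first exact: (V1 z x).
  by have := thM1 z m lm; rewrite /monV => ->.
by rewrite /= -[leRHS](_ : L * r + (size z)%:R * (L * r) = _) ?lerD ?H // -natr1 mulrDl mul1r addrC.
Qed.

(** The linear phase of alpha at e need not be near 1, but V (alpha t) hardly changes under a shift
    by e, so its modulus times the deviation of that phase from 1 is small. As the cube of |W| is at
    most |V (alpha t) x|, [cube_cancel] transfers this to W, the product that actually occurs. *)
Lemma good_count t : Tr (alpha t) -> Tr (gamma t) ->
  nm (dcnt t - (q^-1)%:C * \sum_x \prod_(j < 4) w (t j) x) <= nu + nu.
Proof.
move=> [Fa Va] [Fg _].
have K a b : nB G a <= r / 8 -> nB G b <= r / 8 ->
  nm (cnt t (a + b) - (q^-1)%:C * \sum_x \prod_(j < 4) w (t j) x) <= nu + nu.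
  move=> ha hb; have he := sum_small ha hb; set e := a + b in he *.
  have e1 : nB G e <= r by exact: ler_divn he.
  have z4 : nB G 0 <= r / 4 by rewrite nB0 divr_ge0 // ltW.
  rewrite /cnt -mulrBr -sumrB; apply: uavg_le => x; have [th lm] := local_model_ex x.
  have := local_error t lm z4 he.
  under eq_bigr do rewrite add0r; under [X in _ - _ * X]eq_bigr do rewrite add0r.
  rewrite (local_step0 t lm he).
  set W := \prod_(j < 4) w (t j) x; set P := \prod_(j < 4) _ => h.
  have W1 : nm W <= 1.
    rewrite nm_prod; apply: (@le_trans _ _ (\prod_(i < 4) 1)); last by rewrite big1.
    by apply: ler_prod => i _; rewrite nm_ge0 w1.
  set A := monV th (alpha t) e in h *; have A1 : nm A = 1 by exact: thM1 lm.
  have WA : nm W * nm (A - 1) <= nu.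
    have VW : nm W ^+ 3 <= nm (V (alpha t) x).
      have -> : nm W ^+ 3 = (nm (w (t 0%N) x) ^+ 3 * nm (w (t 1%N) x) ^+ 2 * nm (w (t 2%N) x)) * nm (V (alpha t) x).
        rewrite /W /monV /alpha !big_ord_recl big_ord0 !big_cons big_nil /bump /= !nmM nm1; ring.
      by rewrite ler_piMl ?nm_ge0 // !mulr_ile1 ?mulr_ge0 ?exprn_ge0 ?nm_ge0 // expr_le1 ?nm_ge0.
    apply: cube_cancel; rewrite ?nm_ge0 ?(ltW nu0) //.
      by apply: (le_trans (nmD _ _)); rewrite nmN nm1 A1.
    have h1 := mon_local_error (alpha t) lm e1; have h2 := Va x e e1.
    have h3 : nm (V (alpha t) x) * nm (A - 1) <= 6 * (L * r) + d.
      rewrite -nmM mulrBr mulr1; apply: (le_trans (nm_dist _ (V (alpha t) (x + e)) _)).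
      by rewrite lerD // nmBC.
    apply: (@le_trans _ _ (4 * (6 * (L * r) + d))).
      rewrite ler_pM2l //; apply: le_trans h3; apply: ler_wpM2r => //; exact: nm_ge0.
    move: Lr32 d32 (exprn_gt0 3 nu0); move: (L * r) (nu ^+ 3) (d) => y1 y2 y3 y4 y5 y6.
    rewrite mulrDr -(ler_pM2l (_ : 0 < 8)) // mulrDr.
    have -> : 8 * (4 * (6 * y1)) = 6 * (32 * y1) by ring.
    have -> : 8 * (4 * y3) = 32 * y3 by ring.
    apply: (@le_trans _ _ (6 * y2 + y2)); first by rewrite lerD // ler_pM2l.
    by have -> : 8 * y2 = 6 * y2 + y2 + y2 by [ring]; rewrite lerDl ltW.
  have h4 : nm (W * (A * F (gamma t) e e) - W) <= nu + d.
    have -> : W * (A * F (gamma t) e e) - W = W * (A - 1) * F (gamma t) e e + W * (F (gamma t) e e - 1) by ring.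
    apply: (le_trans (nmD _ _)); apply: lerD; first by rewrite (nmM (_ * _)) F1 mulr1 nmM.
    by rewrite nmM -[d]mul1r; apply: ler_pM; rewrite ?nm_ge0 ?Fg.
  apply: (le_trans (nm_dist _ (W * (A * F (gamma t) e e)) _)); apply: (le_trans (lerD h h4)).
  by rewrite addrCA lerD2l nu4d1.
have E : (q^-1)%:C * (\sum_x \prod_(j < 4) w (t j) x) = \sum_a (s a)%:C * \sum_b (s b)%:C * ((q^-1)%:C * \sum_x \prod_(j < 4) w (t j) x).
  by rewrite [in RHS]wavg_cst [in RHS]wavg_cst.
rewrite E; apply: wnm_dist => // a sa; apply: wnm_dist => // b sb; apply: K; exact: ss.
Qed.
End Local.

(** * Algebra of classes of second order parts *)

Section ClassAlgebra.
Variables (R : realType) (I : finType) (e g : rel I) (bar : I -> I) (o : I).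
Local Notation C := R[i].
Hypothesis (e_refl : reflexive e) (e_sym : symmetric e) (e_trans : transitive e).
Hypothesis (barK : involutive bar) (e_bar : forall i j, e (bar i) (bar j) = e i j).
Hypothesis (g_e : forall i i' j j', e i i' -> e j j' -> g i j = g i' j').

(** [pick] sees i only through its class, so equivalent indices have equal representatives. *)
Let rho (i : I) : I := odflt i [pick j | e i j].
Let e_rho i : e i (rho i).
Proof. by rewrite /rho; case: pickP => [j //|_]; exact: e_refl. Qed.
Let rho_eq i j : (rho i == rho j) = e i j.
Proof.
apply/eqP/idP => [E|h].
  by apply: (e_trans (e_rho i)); rewrite E e_sym.
have E : e i =1 e j.
  by move=> k; apply/idP/idP; [apply: e_trans; rewrite e_sym|exact: e_trans].
rewrite /rho (eq_pick E); case: pickP => // /(_ j); by rewrite e_refl.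
Qed.

(* For classes of second order parts this says that the quadruple is (b^-1, b^3, b^-3, b). *)
Definition good4 (p : (I * I) * (I * I)) :=
  [&& e p.1.1 (bar p.2.2), e p.1.2 (bar p.2.1) & g p.2.1 p.2.2].
Definition cls (z : I -> C) := \sum_(i | e i o) z i.

Lemma sum_good4 (z0 z1 z2 z3 : I -> C) :
  \sum_(p | good4 p) z0 p.1.1 * z1 p.1.2 * z2 p.2.1 * z3 p.2.2 =
  \sum_i2 \sum_i3 (g i2 i3)%:R * ((\sum_(i0 | e i0 (bar i3)) z0 i0) * (\sum_(i1 | e i1 (bar i2)) z1 i1) * z2 i2 * z3 i3).
Proof.
rewrite big_mkcond /= -(pair_bigA _ (fun a b => if good4 (a, b) then z0 a.1 * z1 a.2 * z2 b.1 * z3 b.2 else 0)) /=.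
rewrite exchange_big /= -(pair_bigA _ (fun i2 i3 => \sum_a if good4 (a, (i2, i3)) then z0 a.1 * z1 a.2 * z2 i2 * z3 i3 else 0)) /=.
apply: eq_bigr => i2 _; apply: eq_bigr => i3 _; rewrite /good4 /=; case: (g i2 i3); last first.
  by rewrite mul0r big1 // => a _; rewrite !andbF.
symmetry; rewrite mul1r -[LHS]mulrA big_distrlr /= pair_big_dep /= mulr_suml [LHS]big_mkcond; apply: eq_bigr => a _ /=.
by rewrite andbT; case: ifP => // _; rewrite !mulrA.
Qed.

(* Grouping the indices into classes turns the sum over good quadruples into a sum of
   |T c2|^2 |T c3|^2, so dropping all but the trivial class only decreases it. *)
Lemma class_sum_ge (z : I -> C) : (forall i, z (bar i) = cj (z i)) -> g o o ->
  nm (cls z) ^+ 4 <= Re (\sum_(p | good4 p) z p.1.1 * z p.1.2 * z p.2.1 * z p.2.2).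
Proof.
move=> zbar goo; pose T c := \sum_(i | rho i == c) z i.
have Tbar i : \sum_(i0 | e i0 (bar i)) z i0 = cj (T (rho i)).
  rewrite (reindex_inj (inv_inj barK)) cj_sum /T; apply: eq_big => j; first by rewrite e_bar rho_eq.
  by move=> _; rewrite zbar.
have part (H : I -> C) : \sum_i z i * H (rho i) = \sum_c T c * H c.
  rewrite (partition_big rho xpredT) //=; apply: eq_bigr => c _.
  by rewrite /T mulr_suml; apply: eq_bigr => i /eqP ->.
have grho i j : g i j = g (rho i) (rho j) by apply: g_e; exact: e_rho.
have E : \sum_(p | good4 p) z p.1.1 * z p.1.2 * z p.2.1 * z p.2.2 =
    (\sum_c \sum_c' (g c c')%:R * (nm (T c) ^+ 2 * nm (T c') ^+ 2))%:C.
  rewrite sum_good4 rmorph_sum /=.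
  transitivity (\sum_i2 z i2 * (cj (T (rho i2)) * \sum_c' T c' * ((g (rho i2) c')%:R * cj (T c')))).
    apply: eq_bigr => i2 _; rewrite -(part (fun c' => (g (rho i2) c')%:R * cj (T c'))) mulrA mulr_sumr.
    by apply: eq_bigr => i3 _; rewrite !Tbar (grho i2 i3); ring.
  rewrite (part (fun c => cj (T c) * \sum_c' T c' * ((g c c')%:R * cj (T c')))).
  apply: eq_bigr => c _; rewrite rmorph_sum mulr_sumr mulr_sumr; apply: eq_bigr => c' _ /=.
  have -> (b : bool) (x y : R) : (b%:R * (x * y))%:C = b%:R * (x%:C * y%:C).
    by case: b; rewrite ?mul1r ?mul0r // rmorphM.
  rewrite !nm_sqr; ring.
have -> : cls z = T (rho o) by apply: eq_bigl => i; rewrite rho_eq.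
have t0 c c' : 0 <= (g c c')%:R * (nm (T c) ^+ 2 * nm (T c') ^+ 2) by rewrite !mulr_ge0 ?ler0n ?exprn_ge0 ?nm_ge0.
rewrite E /= (bigD1 (rho o)) //= (bigD1 (rho o)) //= -grho goo mul1r -exprD -addrA lerDl addr_ge0 ?sumr_ge0 //.
by move=> c _; rewrite sumr_ge0.
Qed.

Hypothesis (bar_o : e (bar o) o) (g_o : forall i, g i o = e i o).
(** With the last index equal to o, [good4] forces the other three into the class of o, so the sum
    factors. This is the padded situation of fewer than four terms. *)
Lemma class_sum_low (z0 z1 z2 : I -> C) :
  \sum_(p | good4 p) z0 p.1.1 * z1 p.1.2 * z2 p.2.1 * (p.2.2 == o)%:R = cls z0 * cls z1 * cls z2.
Proof.
rewrite (sum_good4 z0 z1 z2 (fun i => (i == o)%:R)) {3}/cls mulr_sumr [RHS]big_mkcond /=; apply: eq_bigr => i2 _.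
rewrite (bigD1 o) //= [X in _ + X]big1 ?addr0; last by move=> i /negbTE ->; rewrite !mulr0.
rewrite eqxx mulr1 g_o; case: ifP => h; last by rewrite mul0r.
have r3 i j : e j o -> e i j = e i o.
  by move=> hj; apply/idP/idP => hi; apply: (e_trans hi) => //; rewrite e_sym.
have hb : e (bar i2) o by apply: e_trans bar_o; rewrite e_bar.
rewrite mul1r /cls; congr (_ * _ * _); apply: eq_bigl => i; exact: r3.
Qed.
End ClassAlgebra.

(** The tangent line inequality behind Jensen. Only the cube fails to be convex below 0; there the
    range down to -2 e gives an excess of at most 6 e (b - m)^2 <= 150 e. *)
Lemma power_tangent (R : realFieldType) (k : nat) (b m e : R) : (0 < k <= 4)%N -> 0 <= e -> e <= 1 ->
  - (2 * e) <= b -> b <= 3 -> - (2 * e) <= m -> m <= 3 ->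
  m ^+ k + k%:R * m ^+ k.-1 * (b - m) - 150 * e <= b ^+ k.
Proof.
move=> hk e0 e1 b0 b3 m0 m3; rewrite -subr_ge0.
have s0 : 0 <= (b - m) ^+ 2 by exact: sqr_ge0.
have s25 : (b - m) ^+ 2 <= 25.
  rewrite -(real_normK (num_real _)); have -> : 25 = 5 ^+ 2 :> R by ring.
  by rewrite lerXn2r ?nnegrE ?normr_ge0 // ler_norml; apply/andP; split; lra.
have e150 : 0 <= 150 * e by rewrite mulr_ge0.
case: k hk => [//|[|[|[|[|//]]]]] _ /=.
- have -> : b ^+ 1 - (m ^+ 1 + 1%:R * m ^+ 0 * (b - m) - 150 * e) = 150 * e by rewrite expr0; ring.
  by [].
- have -> : b ^+ 2 - (m ^+ 2 + 2%:R * m ^+ 1 * (b - m) - 150 * e) = (b - m) ^+ 2 + 150 * e by ring.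
  by rewrite addr_ge0.
- have -> : b ^+ 3 - (m ^+ 3 + 3%:R * m ^+ 2 * (b - m) - 150 * e) = 
    (b - m) ^+ 2 * (b + 2 * m + 6 * e) + 6 * e * (25 - (b - m) ^+ 2) by ring.
  apply: addr_ge0; apply: mulr_ge0 => //; [lra|exact: mulr_ge0|by rewrite subr_ge0].
have -> : b ^+ 4 - (m ^+ 4 + 4%:R * m ^+ 3 * (b - m) - 150 * e) = 
    (b - m) ^+ 2 * ((b + m) ^+ 2 + 2 * m ^+ 2) + 150 * e by ring.
apply: addr_ge0 => //; apply: mulr_ge0 => //; apply: addr_ge0; first exact: sqr_ge0.
by apply: mulr_ge0 => //; exact: sqr_ge0.
Qed.

(** The constant is 4 times 3 cubed, the largest bound for the derivative of a power up to 4 on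
    [-3, 3]. *)
Lemma power_close (R : realFieldType) (k : nat) (a m e : R) : (k <= 4)%N -> 
  `|a| <= 3 -> `|m| <= 3 -> `|a - m| <= e -> a ^+ k - 108 * e <= m ^+ k.
Proof.
move=> k4 a3 m3 h; have e0 : 0 <= e by apply: le_trans h.
have H j : `|a ^+ j.+1 - m ^+ j.+1| <= j.+1%:R * 3 ^+ j * e.
  elim: j => [|j IH]; first by rewrite !expr1 expr0 !mul1r.
  have -> : a ^+ j.+2 - m ^+ j.+2 = a ^+ j.+1 * (a - m) + (a ^+ j.+1 - m ^+ j.+1) * m.
    by rewrite !(exprSr _ j.+1); ring.
  apply: (le_trans (ler_normD _ _)); rewrite !normrM.
  have -> : j.+2%:R * 3 ^+ j.+1 * e = 3 ^+ j.+1 * e + j.+1%:R * 3 ^+ j * e * 3.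
    by rewrite -[j.+2]addn1 natrD exprS; ring.
  apply: lerD; apply: ler_pM => //.
  by rewrite normrX lerXn2r ?nnegrE.
have {}H : `|a ^+ k - m ^+ k| <= 108 * e.
  case: k k4 => [|j] j3; first by rewrite !expr0 subrr normr0 mulr_ge0.
  apply: (le_trans (H j)); apply: ler_wpM2r => //; rewrite -natrX -natrM ler_nat.
  by case: j j3 => [|[|[|[|//]]]].
by move: H; rewrite ler_norml => /andP [_]; rewrite !lerBlDr addrC.
Qed.

(** * Which quadruples of phases survive *)

Section Count.
Variables (R : realType) (X : env R) (I : finType).
Local Notation C := R[i].
Local Notation q := (q X).
Variables (w : I -> X -> C) (B : I -> X -> X -> C) (G : seq X) (L r d nu : R) (s : X -> R).
Hypothesis (qw : forall i, quad G L (w i) (B i)) (L0 : 0 < L) (r0 : 0 < r) (rL : r <= L^-1).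
Hypothesis (ps : prob s) (ss : forall x, s x != 0 -> nB G x <= r / 8).
Hypothesis (nu0 : 0 < nu) (nu1 : nu <= 1) (Lr32 : 32 * (L * r) <= nu ^+ 3) (d0 : 0 < d) (d32 : 32 * d <= nu ^+ 3).
Local Notation V := (monV w).
Local Notation F := (monF B).
Local Notation Tr := (Tr w B G r d).
Hypothesis Dich : forall z : seq I, (size z <= 6)%N ->
  Tr z \/ (unif s d (F z) /\ unif s d (fun a b => F z a b ^+ 2)).
Variables (o : I) (bar : I -> I).
Hypothesis (wo : forall x, w o x = 1) (Bo : forall a b, B o a b = 1) (barK : involutive bar).
Hypothesis (wbar : forall i x, w (bar i) x = cj (w i x)) (Bbar : forall i a b, B (bar i) a b = cj (B i a b)).

Let w1 i x : nm (w i x) <= 1. Proof. by case: (qw i). Qed.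
Let uB i a b : B i a b * cj (B i a b) = 1. Proof. by apply: unit_cj; case: (qw i) => -[]. Qed.
Let F1 z a b : nm (F z a b) = 1.
Proof. by rewrite /monF nm_prod big1 // => i _; case: (qw i) => -[]. Qed.

(** A counter of errors in units of d. Products add counters, and [near_Tr] resets a counter of at
    most 6 through [triv_rule]; this makes the relations below exact. *)
Definition near (k : nat) (u : X -> X -> C) := forall a b, nB G a <= r -> nB G b <= r ->
  nm (u a b) = 1 /\ nm (u a b - 1) <= k%:R * d.
Lemma near_mul k l u v : near k u -> near l v -> near (k + l) (fun a b => u a b * v a b).
Proof.
move=> hu hv a b ha hb; have [u1 u2] := hu a b ha hb; have [v1 v2] := hv a b ha hb.
split; first by rewrite nmM u1 v1 mulr1.
rewrite -[X in _ - X](mulr1 1) natrD mulrDl; apply: (le_trans (nm_mul_dist _ _ _ _)); rewrite ?u1 ?nm1 //.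
exact: lerD.
Qed.
Lemma near_cj k u : near k u -> near k (fun a b => cj (u a b)).
Proof.
move=> hu a b ha hb; have [u1 u2] := hu a b ha hb; rewrite nm_cj; split => //.
by rewrite -cj1 -cjB nm_cj.
Qed.
Lemma near1 : near 0 (fun _ _ => 1).
Proof. by move=> a b _ _; rewrite nm1 subrr nm0 mul0r. Qed.
Lemma near_F z : Tr z -> near 1 (F z).
Proof. by move=> [h _] a b ha hb; rewrite F1 mul1r; split => //; exact: h. Qed.
Lemma near_Tr z k u : (size z <= 6)%N -> (k <= 6)%N -> near k u -> (forall a b, F z a b = u a b) -> Tr z.
Proof.
move=> sz k6 hu E; apply: (triv_rule r0 ps ss nu0 nu1 d0 d32 Dich sz) => a b ha hb; rewrite E.
by apply: (le_trans (hu a b ha hb).2); rewrite ler_pM2r // ler_nat.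
Qed.

Let F2 i j a b : F [:: i; j] a b = B i a b * B j a b.
Proof. by rewrite /monF !big_cons big_nil mulr1. Qed.
Let F4 i j k l a b : F [:: i; j; k; l] a b = B i a b * B j a b * B k a b * B l a b.
Proof. by rewrite /monF !big_cons big_nil mulr1 !mulrA. Qed.

(** Equality of second order parts modulo trivial phases and, in [gam], being the inverse cube
    modulo trivial phases. Transitivity of the first depends on the error reset. *)
Definition eqc i j := `[< Tr [:: i; bar j] >].
Definition gam i j := `[< Tr [:: i; j; j; j] >].

Lemma eqc_refl : reflexive eqc.
Proof. by move=> i; apply/asboolP; apply: (near_Tr _ _ near1) => // a b; rewrite F2 Bbar uB. Qed.
Lemma eqc_sym : symmetric eqc.
Proof.
have H i j : eqc i j -> eqc j i.
  move=> /asboolP /near_F /near_cj h; apply/asboolP; apply: near_Tr h _ => // a b.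
  by rewrite !F2 !Bbar cjM cjK mulrC.
by move=> i j; apply/idP/idP; exact: H.
Qed.
Lemma eqc_trans : transitive eqc.
Proof.
move=> j i k /asboolP /near_F h1 /asboolP /near_F h2; apply/asboolP; apply: near_Tr (near_mul h1 h2) _ => // a b.
rewrite !F2 !Bbar.
transitivity (B i a b * cj (B k a b) * (B j a b * cj (B j a b))); first by rewrite uB mulr1.
ring.
Qed.
Lemma eqc_bar i j : eqc (bar i) (bar j) = eqc i j.
Proof.
have H k l : eqc k l -> eqc (bar k) (bar l).
  move=> /asboolP /near_F /near_cj h; apply/asboolP; apply: near_Tr h _ => // a b.
  by rewrite !F2 !Bbar cjM.
by apply/idP/idP; [move/H; rewrite !barK|exact: H].
Qed.
Lemma gam_eqc i i' j j' : eqc i i' -> eqc j j' -> gam i j = gam i' j'.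
Proof.
have H k k' l l' : eqc k k' -> eqc l l' -> gam k l -> gam k' l'.
  rewrite eqc_sym => /asboolP /near_F h1; rewrite eqc_sym => /asboolP /near_F h2 /asboolP /near_F h3.
  apply/asboolP; apply: near_Tr (near_mul (near_mul h3 h1) (near_mul h2 (near_mul h2 h2))) _ => // a b.
  rewrite !F4 !F2 !Bbar.
  transitivity (B k' a b * B l' a b * B l' a b * B l' a b * (B k a b * cj (B k a b)) * (B l a b * cj (B l a b)) *
    (B l a b * cj (B l a b)) * (B l a b * cj (B l a b))); first by rewrite !uB !mulr1.
  ring.
move=> h1 h2; have h1' : eqc i' i by rewrite eqc_sym.
have h2' : eqc j' j by rewrite eqc_sym.
by apply/idP/idP; [exact: H h1 h2|exact: H h1' h2'].
Qed.
Lemma gam_o i : gam i o = eqc i o.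
Proof.
have E a b : F [:: i; o; o; o] a b = F [:: i; bar o] a b by rewrite F4 F2 Bbar !Bo cj1 !mulr1.
by apply/asboolP/asboolP => /near_F h; apply: near_Tr h _.
Qed.
Lemma gam_oo : gam o o. Proof. by rewrite gam_o eqc_refl. Qed.
Lemma eqc_bar_o : eqc (bar o) o.
Proof. by apply/asboolP; apply: (near_Tr _ _ near1) => // a b; rewrite F2 !Bbar !Bo cj1 mulr1. Qed.
Lemma eqc_o i : eqc i o <-> Tr [:: i].
Proof.
have E a b : F [:: i] a b = F [:: i; bar o] a b by rewrite F2 Bbar Bo cj1 /monF big_cons big_nil.
by split => [/asboolP /near_F h|/near_F h]; [|apply/asboolP]; apply: near_Tr h _.
Qed.

Local Notation good := (good4 eqc gam bar).
Definition quadruple (p : (I * I) * (I * I)) (n : nat) : I := nth o [:: p.1.1; p.1.2; p.2.1; p.2.2] n.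

(** In exponents, alpha is the sum of t1 + t2 and t2 + 3 t3, and both are trivial for a good
    quadruple. *)
Lemma good_Tr p : good p -> Tr (alpha (quadruple p)) /\ Tr (gamma (quadruple p)).
Proof.
case: p => -[i0 i1] [i2 i3] /and3P [/= /asboolP _ /asboolP]; rewrite barK => /near_F h1 /asboolP h2.
split => //; have h3 := near_F h2; apply: near_Tr (near_mul h1 h3) _ => // a b.
rewrite F2 F4 /alpha /quadruple /monF !big_cons big_nil /=; ring.
Qed.

(** In exponents, kappa - alpha + gamma leaves t0 + t3, and alpha - gamma leaves t1 + t2. *)
Lemma Tr_good p : Tr (kappa (quadruple p)) -> Tr (alpha (quadruple p)) -> Tr (gamma (quadruple p)) -> good p.
Proof.
case: p => -[i0 i1] [i2 i3]; rewrite /kappa /gamma /quadruple /= => /near_F hk /near_F ha hg0.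
have hg := near_F hg0; apply/and3P; split; apply/asboolP => //=; rewrite ?barK.
  apply: near_Tr (near_mul (near_mul hk (near_cj ha)) hg) _ => // a b.
  rewrite F2 !F4 /alpha /monF !big_cons big_nil /= mulr1 !cjM.
  transitivity (B i0 a b * B i3 a b * (B i1 a b * cj (B i1 a b)) * (B i2 a b * cj (B i2 a b)) * (B i2 a b * cj (B i2 a b)) *
    (B i3 a b * cj (B i3 a b)) * (B i3 a b * cj (B i3 a b)) * (B i3 a b * cj (B i3 a b))); first by rewrite !uB !mulr1.
  ring.
apply: near_Tr (near_mul ha (near_cj hg)) _ => // a b.
rewrite F2 !F4 /alpha /monF !big_cons big_nil /= mulr1 !cjM.
transitivity (B i1 a b * B i2 a b * (B i2 a b * cj (B i2 a b)) *
    (B i3 a b * cj (B i3 a b)) * (B i3 a b * cj (B i3 a b)) * (B i3 a b * cj (B i3 a b))); first by rewrite !uB !mulr1.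
ring.
Qed.

Lemma quadruple_count p : nm (dcnt w s (quadruple p) -
  (if good p then (q^-1)%:C * \sum_x \prod_(j < 4) w (quadruple p j) x else 0)) <= nu + nu.
Proof.
case: ifP => hp.
  have [h1 h2] := good_Tr hp; exact: (good_count qw L0 r0 rL ps ss nu0 nu1 Lr32 d0 d32).
have nn : nu <= nu + nu by rewrite lerDl ltW.
rewrite subr0; apply: le_trans nn.
have [hk|hk] := pselect (Tr (kappa (quadruple p))); last first.
  exact: (bad_kappa qw L0 r0 rL ps ss nu0 nu1 Lr32 d0 d32 Dich).
have [ha|ha] := pselect (Tr (alpha (quadruple p))); last first.
  exact: (bad_alpha qw L0 r0 rL ps ss nu0 nu1 Lr32 d0 d32 Dich).
have [hg|hg] := pselect (Tr (gamma (quadruple p))); last first.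
  exact: (bad_gamma qw L0 r0 rL ps ss nu0 nu1 Lr32 d0 d32 Dich).
by rewrite Tr_good in hp.
Qed.

Definition conv (a : X -> R) (x : X) := \sum_y a y * a (x - y).

Lemma apn_conv (f : nat -> X -> C) : apn (conv s) f =
  \sum_a (s a)%:C * \sum_b (s b)%:C * ((q^-1)%:C * \sum_x \prod_(j < 4) f j (x + (a + b) *+ j)).
Proof.
rewrite /apn exchange_big mulr_sumr /=.
transitivity (\sum_e \sum_a (s a)%:C * ((s (e - a))%:C * ((q^-1)%:C * \sum_x \prod_(j < 4) f j (x + e *+ j)))).
  apply: eq_bigr => e _; rewrite -mulr_sumr /conv rmorph_sum /= mulrCA mulr_suml; apply: eq_bigr => a _.
  by rewrite [RHS]mulrA -rmorphM.
rewrite exchange_big; apply: eq_bigr => a _; rewrite mulr_sumr -(sum_shift a); apply: eq_bigr => b _.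
by rewrite addrK [b + a]addrC.
Qed.

(** Expanding the four sums produces |I|^4 quadruples with coefficients at most A^4, each counted
    within 2 nu by [quadruple_count]. *)
Lemma count_approx (y : nat -> I -> C) (A : R) : (forall j i, nm (y j i) <= A) ->
  nm (apn (conv s) (fun j x => \sum_i y j i * w i x) -
      (q^-1)%:C * \sum_x \sum_(p | good p) \prod_(j < 4) (y j (quadruple p j) * w (quadruple p j) x)) <=
  (#|I|%:R * A) ^+ 4 * (nu + nu).
Proof.
move=> yA; pose Y (p : (I * I) * (I * I)) := \prod_(j < 4) y j (quadruple p j).
have Y1 p : nm (Y p) <= A ^+ 4.
  rewrite /Y nm_prod; apply: (@le_trans _ _ (\prod_(j < 4) A)); last by rewrite prodr_const card_ord.
  by apply: ler_prod => j _; rewrite nm_ge0 yA.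
have E1 : apn (conv s) (fun j x => \sum_i y j i * w i x) = \sum_p Y p * dcnt w s (quadruple p).
  rewrite apn_conv.
  transitivity (\sum_a \sum_b \sum_p Y p * ((s a)%:C * ((s b)%:C * cnt w (quadruple p) (a + b)))).
    apply: eq_bigr => a _; rewrite mulr_sumr; apply: eq_bigr => b _; rewrite !mulr_sumr.
    transitivity (\sum_x \sum_p Y p * ((s a)%:C * ((s b)%:C * ((q^-1)%:C * \prod_(j < 4) w (quadruple p j) (x + (a + b) *+ j))))).
      apply: eq_bigr => x _; rewrite (prod4 (fun j x => \sum_i y j i * w i x)).
      rewrite -mulrA big_distrlr big_distrlr /= !pair_bigA /= big_distrlr pair_bigA /= !mulr_sumr.
      apply: eq_bigr => p _; rewrite /Y !big_ord_recl !big_ord0 /quadruple /bump /= mulr0n addr0 mulr1n; ring.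
    rewrite exchange_big; apply: eq_bigr => p _; rewrite /cnt !mulr_sumr.
    by apply: eq_bigr => x _.
  rewrite /dcnt.
  under eq_bigr do rewrite exchange_big /=.
  rewrite exchange_big; apply: eq_bigr => p _ /=; rewrite mulr_sumr; apply: eq_bigr => a _.
  by rewrite mulr_sumr mulr_sumr.
have E2 : (q^-1)%:C * \sum_x \sum_(p | good p) \prod_(j < 4) (y j (quadruple p j) * w (quadruple p j) x) =
  \sum_p Y p * (if good p then (q^-1)%:C * \sum_x \prod_(j < 4) w (quadruple p j) x else 0).
  rewrite exchange_big mulr_sumr /= big_mkcond; apply: eq_bigr => p _.
  case: ifP => _; rewrite ?mulr0 // mulrCA; congr (_ * _); rewrite mulr_sumr; apply: eq_bigr => x _.
  by rewrite big_split.
rewrite E1 E2 -sumrB; apply: (le_trans (nm_sum _ _ _)).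
apply: (@le_trans _ _ (\sum_(p : (I * I) * (I * I)) A ^+ 4 * (nu + nu))).
  apply: ler_sum => p _; rewrite -mulrBr nmM; apply: ler_pM; rewrite ?nm_ge0 //; exact: quadruple_count.
rewrite sumr_const !card_prod -[leLHS]mulr_natl !natrM le_eqVlt; apply/orP; left; apply/eqP; ring.
Qed.
End Count.

Lemma Re_close (R : realType) (x y : R[i]) (e : R) : nm (x - y) <= e -> Re y - e <= Re x.
Proof. by move=> h; have := Re_ge (x - y); rewrite ReD ReN => h2; lra. Qed.

Lemma lower_arith (R : realFieldType) (p p' t t' e : R) : 0 <= e ->
  p - 108 * e <= p' -> p' - 150 * e <= t -> t - e <= t' -> p - 300 * e <= t'.
Proof. by lra. Qed.

Lemma bounds_arith (R : realFieldType) (y t f : R) : 0 <= f -> f <= 1 -> - f <= t <= 2 -> `|y - t| <= f ->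
  - (2 * f) <= y /\ y <= 3.
Proof. by rewrite ler_norml => h0 h1 /andP [h2 h3] /andP [h4 h5]; split; lra. Qed.

Lemma abs_le3 (R : realFieldType) (y f : R) : f <= 1 -> - (2 * f) <= y -> y <= 3 -> `|y| <= 3.
Proof. by rewrite ler_norml => *; apply/andP; split; lra. Qed.

(** * Lower bound for the count of a structured function *)

Section Lower.
Variables (R : realType) (X : env R) (I : finType).
Local Notation C := R[i].
Local Notation q := (q X).
Variables (w : I -> X -> C) (B : I -> X -> X -> C) (G : seq X) (L r d nu : R) (s : X -> R).
Hypothesis (qw : forall i, quad G L (w i) (B i)) (L0 : 0 < L) (r0 : 0 < r) (rL : r <= L^-1).
Hypothesis (ps : prob s) (ss : forall x, s x != 0 -> nB G x <= r / 8).
Hypothesis (nu0 : 0 < nu) (nu1 : nu <= 1) (Lr32 : 32 * (L * r) <= nu ^+ 3) (d0 : 0 < d) (d32 : 32 * d <= nu ^+ 3).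
Local Notation V := (monV w).
Local Notation F := (monF B).
Local Notation Tr := (Tr w B G r d).
Hypothesis Dich : forall z : seq I, (size z <= 6)%N ->
  Tr z \/ (unif s d (F z) /\ unif s d (fun a b => F z a b ^+ 2)).
Variables (o : I) (bar : I -> I).
Hypothesis (wo : forall x, w o x = 1) (Bo : forall a b, B o a b = 1) (barK : involutive bar).
Hypothesis (wbar : forall i x, w (bar i) x = cj (w i x)) (Bbar : forall i a b, B (bar i) a b = cj (B i a b)).

Let w1 i x : nm (w i x) <= 1. Proof. by case: (qw i). Qed.
Local Notation eqc := (eqc w B G r d bar).
Local Notation gam := (gam w B G r d).
Local Notation good := (good4 eqc gam bar).
Local Notation cls := (cls eqc o).
Local Notation quadruple := (quadruple o).
Let e_refl := eqc_refl qw r0 ps ss nu0 nu1 d0 d32 Dich Bbar.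
Let e_sym := eqc_sym qw r0 ps ss nu0 nu1 d0 d32 Dich Bbar.
Let e_trans := eqc_trans qw r0 ps ss nu0 nu1 d0 d32 Dich Bbar.
Let e_bar := eqc_bar qw r0 ps ss nu0 nu1 d0 d32 Dich barK Bbar.
Let g_e := gam_eqc qw r0 ps ss nu0 nu1 d0 d32 Dich Bbar.
Let g_o := gam_o qw r0 ps ss nu0 nu1 d0 d32 Dich Bo Bbar.
Let bar_o := eqc_bar_o r0 ps ss nu0 nu1 d0 d32 Dich Bo Bbar.

Let small : 32 * d <= nu /\ 32 * (L * r) <= nu.
Proof.
have nu3 : nu ^+ 3 <= nu by rewrite exprS ler_piMr ?(ltW nu0) // expr_le1 // ltW.
by split; [apply: le_trans nu3|apply: le_trans nu3].
Qed.
Let d_nu : d <= nu.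
Proof. by apply: le_trans small.1; rewrite ler_peMl ?(ltW d0) // ler1n. Qed.
Let Lr_nu : L * r <= nu.
Proof. by apply: le_trans small.2; rewrite ler_peMl ?ler1n // mulr_ge0 // ltW. Qed.
Let sum_small a b : nB G a <= r / 8 -> nB G b <= r / 8 -> nB G (a + b) <= r.
Proof.
move=> ha hb; apply: (le_trans (nBD _ _ _)); apply: (le_trans (lerD ha hb)).
have -> : r / 8 + r / 8 = r / 4 by field.
by rewrite ler_pdivrMr // ler_peMr ?ler1n // ltW.
Qed.

(** Averaging over the Bohr set keeps w i when its second order part is trivial and kills it
    otherwise. So the trivial class of u is, up to a small error, the smoothing of u and inherits
    its bounds and its mean. *)
Lemma trivial_part i x : nm ((if eqc i o then w i x else 0) -
  \sum_a (s a)%:C * \sum_b (s b)%:C * w i (x + (a + b))) <= nu + nu.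
Proof.
have nn : nu <= nu + nu by rewrite lerDl ltW.
case: ifP => h.
  have [_ h2] := (eqc_o qw r0 ps ss nu0 nu1 d0 d32 Dich Bo Bbar i).1 h.
  have E : w i x = \sum_a (s a)%:C * \sum_b (s b)%:C * w i x by rewrite (wavg_cst ps) (wavg_cst ps).
  rewrite {1}E nmBC; apply: (le_trans _ nn); apply: (le_trans _ d_nu).
  apply: wnm_dist => // a sa; apply: wnm_dist => // b sb.
  have := h2 x (a + b) (sum_small (ss sa) (ss sb)); by rewrite /monV !big_cons !big_nil !mulr1.
rewrite sub0r nmN; have [th lm] := local_model_ex qw L0 rL x; have [t1 t0 tD tE] := lm i.
have U : unif s d (F [:: i]).
  case: (Dich (isT : (size [:: i] <= 6)%N)) => [T|[] //].
  by have := (eqc_o qw r0 ps ss nu0 nu1 d0 d32 Dich Bo Bbar i).2 T; rewrite h.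
apply: (le_trans _ (lerD Lr_nu d_nu)).
apply: (unif_kill ps ss (u := fun a => w i x * th i a) (psi := th i) U).
- by move=> a; rewrite nmM t1 mulr1.
- by move=> b; rewrite t1.
move=> a b ha hb; have hab := sum_small ha hb.
have a1 : nB G a <= r by exact: ler_divn ha.
have b1 : nB G b <= r by exact: ler_divn hb.
apply: le_trans (tE _ hab); rewrite le_eqVlt; apply/orP; left; apply/eqP; congr (nm (_ - _)).
by rewrite tD // /monF big_cons big_nil mulr1; ring.
Qed.

Variables (k : nat) (A e : R) (a : I -> C) (u : X -> R).
Hypothesis (hk : (0 < k <= 4)%N) (aA : forall i, nm (a i) <= A) (A1 : 1 <= A) (abar : forall i, a (bar i) = cj (a i)).
Hypothesis (uE : forall x, (u x)%:C = \sum_i a i * w i x) (e0 : 0 <= e) (e1 : e <= 1).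
Hypothesis (u2 : forall x, - e <= u x <= 2) (He : (#|I|%:R * A) ^+ 4 * (nu + nu) <= e).

Let z (x : X) i := a i * w i x.
Let b x := Re (cls (z x)).
Let v x := \sum_c s c * \sum_c' s c' * u (x + (c + c')).

(** The trivial class is closed under [bar], which pairs conjugate terms. *)
Lemma cls_real x : cls (z x) = (b x)%:C.
Proof.
have E : cj (cls (z x)) = cls (z x).
  rewrite /cls cj_sum (reindex_inj (inv_inj barK)); apply: eq_big => i.
    apply/idP/idP => h.
      by rewrite -e_bar; apply: (e_trans h); rewrite e_sym.
    by apply: e_trans bar_o; rewrite e_bar.
  by rewrite /z abar wbar -cjM cjK.
have h := add_cj_Re (cls (z x)); rewrite E in h.
have n2 : (2 : C) != 0 by rewrite pnatr_eq0.
by apply: (mulfI n2); rewrite mulr_natl mulr2n h rmorphM /= rmorph_nat.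
Qed.

Let N1 : 1 <= #|I|%:R * A.
Proof.
rewrite -[X in X <= _](mulr1 1); apply: ler_pM => //; rewrite ler1n; apply/card_gt0P; by exists o.
Qed.

Lemma cls_close x : `|b x - v x| <= e.
Proof.
have Ev : (v x)%:C = \sum_i a i * \sum_c (s c)%:C * \sum_c' (s c')%:C * w i (x + (c + c')).
  rewrite /v rmorph_sum; under [RHS]eq_bigr do rewrite mulr_sumr; rewrite exchange_big /=; apply: eq_bigr => c _.
  rewrite rmorphM rmorph_sum mulr_sumr /=; under [RHS]eq_bigr do rewrite mulr_sumr mulr_sumr.
  rewrite exchange_big /=; apply: eq_bigr => c' _; rewrite rmorphM /= uE !mulr_sumr; apply: eq_bigr => i _; ring.
rewrite -nmR rmorphB /= -cls_real Ev /cls big_mkcond /= -sumrB.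
apply: le_trans He; apply: (le_trans (nm_sum _ _ _)).
apply: (@le_trans _ _ (\sum_(i : I) A * (nu + nu))).
  apply: ler_sum => i _.
  have -> : (if eqc i o then z x i else 0) = a i * (if eqc i o then w i x else 0) by case: ifP => _; rewrite ?mulr0.
  by rewrite -mulrBr nmM; apply: ler_pM; rewrite ?nm_ge0 // trivial_part.
rewrite sumr_const -[leLHS]mulr_natl mulrA; apply: ler_wpM2r; first by rewrite addr_ge0 // ltW.
by rewrite ler_eXnr.
Qed.

Let Eu := q^-1 * \sum_x u x.
Let m := q^-1 * \sum_x b x.

Let q0 : 0 < q := q_gt0 X.

Lemma v_bounds x : - e <= v x <= 2.
Proof.
have K1 (c : R) : \sum_x s x * c = c by rewrite -mulr_suml ps.2 mul1r.
apply/andP; split.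
  rewrite -(K1 (- e)); apply: ler_sum => c _; apply: ler_wpM2l; first exact: ps.1.
  by rewrite -(K1 (- e)); apply: ler_sum => c' _; apply: ler_wpM2l; [exact: ps.1|case/andP: (u2 (x + (c + c')))].
rewrite -(K1 2); apply: ler_sum => c _; apply: ler_wpM2l; first exact: ps.1.
by rewrite -(K1 2); apply: ler_sum => c' _; apply: ler_wpM2l; [exact: ps.1|case/andP: (u2 (x + (c + c')))].
Qed.

Lemma v_mean : q^-1 * \sum_x v x = Eu.
Proof.
have K1 (c : R) : \sum_x s x * c = c by rewrite -mulr_suml ps.2 mul1r.
rewrite /Eu; congr (_ * _); rewrite exchange_big /= -[RHS]K1; apply: eq_bigr => c _.
rewrite -mulr_sumr; congr (_ * _); rewrite exchange_big /= -[RHS]K1; apply: eq_bigr => c' _.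
by rewrite -mulr_sumr sum_shift.
Qed.

Lemma avg_le (f g : X -> R) : (forall x, f x <= g x) -> q^-1 * \sum_x f x <= q^-1 * \sum_x g x.
Proof. by move=> h; rewrite ler_pM2l ?invr_gt0 //; apply: ler_sum. Qed.
Lemma avg_cst (c : R) : q^-1 * \sum_(x : X) c = c.
Proof. by rewrite sumr_const -[c *+ _]mulr_natl mulKf // gt_eqF. Qed.

Lemma b_bounds x : - (2 * e) <= b x /\ b x <= 3.
Proof. exact: (bounds_arith e0 e1 (v_bounds x) (cls_close x)). Qed.

Lemma m_close : `|m - Eu| <= e.
Proof.
rewrite -v_mean /m -mulrBr -sumrB normrM gtr0_norm ?invr_gt0 // -[leRHS](avg_cst e) ler_pM2l ?invr_gt0 //.
apply: (le_trans (ler_norm_sum _ _ _)); apply: ler_sum => x _; exact: cls_close.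
Qed.

(** Padding factors equal to 1 are expanded as the phase w o with coefficient 1. *)
Definition coef (j : nat) (i : I) : C := if (j < k)%N then a i else (i == o)%:R.

Lemma pad_coef : pad k u = fun j x => \sum_i coef j i * w i x.
Proof.
apply: funext => j; apply: funext => x; rewrite /pad /coef; case: (j < k)%N; first exact: uE.
by rewrite (bigD1 o) //= eqxx mul1r wo big1 ?addr0 // => i /negbTE ->; rewrite mul0r.
Qed.

(** For k < 4 the sum equals the power of b x by [class_sum_low]; for k = 4 the other classes only
    add nonnegative terms. *)
Lemma good_sum_ge x : b x ^+ k <= Re (\sum_(p | good p) \prod_(j < 4) (coef j (quadruple p j) * w (quadruple p j) x)).
Proof.
have E p : \prod_(j < 4) (coef j (quadruple p j) * w (quadruple p j) x) =
    (coef 0%N p.1.1 * w p.1.1 x) * (coef 1%N p.1.2 * w p.1.2 x) * (coef 2%N p.2.1 * w p.2.1 x) * (coef 3%N p.2.2 * w p.2.2 x).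
  by rewrite !big_ord_recl big_ord0 /quadruple /bump /= mulr1 !mulrA.
under [X in Re X]eq_bigr do rewrite E.
have Tc : cls (fun i => (i == o)%:R * w i x) = 1.
  rewrite /cls big_mkcond (bigD1 o) //= e_refl eqxx mul1r wo big1 ?addr0 // => i /negbTE ->.
  by rewrite mul0r; case: ifP.
have low (z0 z1 z2 : I -> C) : \sum_(p | good p) z0 p.1.1 * z1 p.1.2 * z2 p.2.1 * ((p.2.2 == o)%:R * w p.2.2 x) = cls z0 * cls z1 * cls z2.
  rewrite -(class_sum_low e_sym e_trans e_bar bar_o g_o z0 z1 z2); apply: eq_bigr => p _; congr (_ * _).
  by case: eqP => [->|_]; rewrite ?wo ?mulr1 ?mul0r.
have Rx (y : R) n : Re (y%:C ^+ n) = y ^+ n by rewrite -rmorphXn.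
rewrite /coef; case: k hk => [//|[|[|[|[|//]]]]] _ /=.
- rewrite (low (z x) (fun i => (i == o)%:R * w i x) (fun i => (i == o)%:R * w i x)) Tc !mulr1 cls_real.
  by rewrite expr1.
- rewrite (low (z x) (z x) (fun i => (i == o)%:R * w i x)) Tc !mulr1 cls_real.
  by rewrite -expr2 Rx.
- rewrite (low (z x) (z x) (z x)) cls_real.
  have -> : (b x)%:C * (b x)%:C * (b x)%:C = (b x)%:C ^+ 3 by ring.
  by rewrite Rx.
have zbar i : z x (bar i) = cj (z x i) by rewrite /z abar wbar cjM.
have := class_sum_ge e_refl e_sym e_trans barK e_bar g_e zbar (gam_oo qw r0 ps ss nu0 nu1 d0 d32 Dich Bo Bbar).
apply: le_trans; rewrite cls_real nmR -normrX; exact: ler_norm.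
Qed.

(** The power of b is averaged by its tangent line at the mean of b, whose linear term averages to
    0, and the mean of b is that of u up to e. The errors 1, 150 and 108 stay below 300. *)
Lemma count_lower : Eu ^+ k - 300 * e <= Re (apn (conv s) (pad k u)).
Proof.
have cA j i : nm (coef j i) <= A.
  rewrite /coef; case: ifP => _; first exact: aA.
  by case: eqP => _; rewrite ?nm1 ?nm0 // (le_trans ler01).
have := count_approx qw L0 r0 rL ps ss nu0 nu1 Lr32 d0 d32 Dich o barK cA.
rewrite -pad_coef; set T := apn _ _; set W := (q^-1)%:C * _ => h1.
have {h1} h1 : nm (T - W) <= e by exact: le_trans He.
have h2 := Re_close h1.
have [mlo mhi] : - (2 * e) <= m /\ m <= 3.
  by split; [rewrite -(avg_cst (- (2 * e)))|rewrite -(avg_cst 3)]; apply: avg_le => x; case: (b_bounds x).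
have [Elo Ehi] : - e <= Eu /\ Eu <= 2.
  by split; [rewrite -(avg_cst (- e))|rewrite -(avg_cst 2)]; apply: avg_le => x; case/andP: (u2 x).
have h3 : m ^+ k - 150 * e <= Re W.
  rewrite /W ReZ Re_sum; apply: (le_trans _ (avg_le good_sum_ge)).
  have -> : m ^+ k - 150 * e = q^-1 * \sum_x (m ^+ k + k%:R * m ^+ k.-1 * (b x - m) - 150 * e).
    have lin (c1 c2 c3 : R) : q^-1 * \sum_x (c1 + c2 * (b x - m) - c3) = c1 + c2 * (m - m) - c3.
      have Cst (c : R) : \sum_(x : X) c = q * c by rewrite sumr_const -[c *+ _]mulr_natl.
      have Sb : \sum_x b x = q * m by rewrite /m mulVKf // gt_eqF.
      rewrite sumrB big_split /= -mulr_sumr sumrB !Cst Sb.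
      by move: q0; move: (q) (m) => n m' n0; field; rewrite gt_eqF.
    by rewrite lin subrr mulr0 addr0.
  by apply: avg_le => x; have [b1 b2] := b_bounds x; exact: power_tangent.
have h4 : Eu ^+ k - 108 * e <= m ^+ k.
  apply: power_close; first by case/andP: hk.
  - apply: (abs_le3 e1); last by apply: (le_trans Ehi); rewrite ler_nat.
    by apply: le_trans Elo; rewrite lerN2 ler_peMl // ler1n.
  - exact: (abs_le3 e1 mlo mhi).
  - by rewrite distrC; exact: m_close.
exact: lower_arith e0 h4 h3 h2.
Qed.
End Lower.

(** * Self-convolution of the weight *)

Section Conv.
Variables (R : realType) (X : env R).
Local Notation C := R[i].
Local Notation q := (q X).
Variables (s : X -> R) (K : R).
Hypothesis (ps : prob s) (sK : forall x, s x <= K / q).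

Lemma conv_prob : prob (conv s).
Proof.
split; first by move=> x; apply: sumr_ge0 => y _; apply: mulr_ge0; exact: ps.1.
rewrite exchange_big /= -[RHS]ps.2; apply: eq_bigr => y _; rewrite -mulr_sumr.
by rewrite (sum_shift (- y) s) ps.2 mulr1.
Qed.

Lemma conv_le x : conv s x <= K / q.
Proof.
apply: (@le_trans _ _ (\sum_y s y * (K / q))); last by rewrite -mulr_suml ps.2 mul1r.
by apply: ler_sum => y _; apply: ler_wpM2l; [exact: ps.1|exact: sK].
Qed.

Lemma conv_supp G rho x : (forall y, s y != 0 -> nB G y <= rho) -> conv s x != 0 -> nB G x <= rho + rho.
Proof.
move=> H hx; have [y hy] : exists y, s y * s (x - y) != 0.
  apply: contrapT => /forallNP h; case/eqP: hx; apply: big1 => y _; apply/eqP.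
  by move/negP: (h y); rewrite negbK.
have [h1 h2] : s y != 0 /\ s (x - y) != 0 by apply/andP; rewrite -negb_or -mulf_eq0.
rewrite -[x](subrK y); apply: (le_trans (nBD _ _ _)); apply: lerD; exact: H.
Qed.

(** The transform of a self-convolution is a square, so its l^1 norm is a sum of squares evaluated
    by Parseval. *)
Lemma conv_ft : \sum_xi nm (ft (fun x => (conv s x)%:C) xi) <= K.
Proof.
have E xi : ft (fun x => (conv s x)%:C) xi = ft (fun x => (s x)%:C) xi ^+ 2.
  rewrite expr2 /ft; transitivity (\sum_x \sum_y (s y)%:C * (s (x - y))%:C * cj (ch xi x)).
    apply: eq_bigr => x _; rewrite /conv rmorph_sum mulr_suml; apply: eq_bigr => y _.
    by rewrite rmorphM.
  rewrite exchange_big mulr_suml; apply: eq_bigr => y _; rewrite mulr_sumr -(sum_shift y); apply: eq_bigr => x _.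
  by rewrite addrK chDr cjM; ring.
under eq_bigr do rewrite E nmX.
have q0 := q_gt0 X; rewrite parseval mulrC -ler_pdivlMr //.
apply: (@le_trans _ _ (\sum_x s x * (K / q))); last by rewrite -mulr_suml ps.2 mul1r.
apply: ler_sum => x _; rewrite nmR ger0_norm ?ps.1 // expr2.
by apply: ler_wpM2l; [exact: ps.1|exact: sK].
Qed.
End Conv.

Section Structured.
Variable R : realType.
Local Notation C := R[i].

(** The dichotomy treats finitely many phases at once; appending the constant phase o turns
    monomials of length at most 6 into 6-tuples. *)
Lemma mon_pad (X : env R) (I : finType) (w : I -> X -> C) (B : I -> X -> X -> C) (o : I) (z : seq I) :
  (forall x, w o x = 1) -> (forall a b, B o a b = 1) -> (size z <= 6)%N ->
  exists t : 6.-tuple I, monV w t = monV w z /\ monF B t = monF B z.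
Proof.
move=> wo Bo sz; have st : size (z ++ nseq (6 - size z) o) == 6%N by rewrite size_cat size_nseq subnKC.
exists (Tuple st); split.
  apply: funext => x; rewrite /monV big_cat /= [X in _ * X]big1_seq ?mulr1 //.
  by move=> i /andP [_]; rewrite mem_nseq => /andP [_ /eqP ->].
apply: funext => a; apply: funext => b; rewrite /monF big_cat /= [X in _ * X]big1_seq ?mulr1 //.
by move=> i /andP [_]; rewrite mem_nseq => /andP [_ /eqP ->].
Qed.

Lemma structured_count (n k D : nat) (e rho : R) : (0 < k <= 4)%N -> 0 < e -> e <= 1 -> 0 < rho ->
  exists K : R, 1 <= K /\ forall (X : env R) (G0 : seq X) (u : X -> R), torsion_free 2 X -> (size G0 <= D)%N ->
  admissible e n u -> exists mu : X -> R, [/\ prob mu, forall x, mu x <= K / q X,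
    forall x, mu x != 0 -> nB G0 x <= rho, \sum_xi nm (ft (fun x => (mu x)%:C) xi) <= K &
    ((q X)^-1 * \sum_x u x) ^+ k - 300 * e <= Re (apn mu (pad k u))].
Proof.
move=> hk e0 e1 rho0; pose n1 : R := n.+1%:R; have n10 : 0 < n1 by rewrite ltr0n.
have n11 : 1 <= n1 by rewrite ler1n.
(* At most n + 1 phases, their conjugates, and the constant 1. *)
pose N := (2 * n.+1).+1; have N0 : 0 < N%:R :> R by rewrite ltr0n.
pose c := 2 * (N%:R * n1) ^+ 4; have c0 : 0 < c by rewrite mulr_gt0 // exprn_gt0 // mulr_gt0.
pose nu := Num.min 1 (e / c); have nu0 : 0 < nu by rewrite lt_min ltr01 divr_gt0.
have nu1 : nu <= 1 by rewrite ge_min lexx.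
have nue : nu <= e / c by rewrite ge_min lexx orbT.
have nu30 : 0 < nu ^+ 3 by rewrite exprn_gt0.
pose d := nu ^+ 3 / 32; have d0 : 0 < d by rewrite divr_gt0.
(* The constant that [mon_quad] gives for a product of six phases. *)
pose L := 7 * n1; have L0 : 0 < L by rewrite mulr_gt0.
pose r := Num.min (L^-1) (Num.min (nu ^+ 3 / (32 * n1)) rho).
have r0 : 0 < r by rewrite !lt_min invr_gt0 L0 divr_gt0 // mulr_gt0.
have rL : r <= L^-1 by rewrite ge_min lexx.
have rn : r <= nu ^+ 3 / (32 * n1) by rewrite !ge_min lexx orbT.
have rr : r <= rho by rewrite !ge_min lexx !orbT.
have [K [K1 HK]] := dichotomy (N ^ 6) (D + n.+1) L0 r0 rL d0.
exists K; split => // X G0 u tf sG0 [su ub].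
have [_ [G [I0 [a0 [w0 [B0 [h1 h2 h3 h4 h5]]]]]]] : cstr n.+1 (fun x => (u x)%:C) by exact: cstr_mono su.
pose I : finType := option (I0 * bool).
pose w (i : I) x := match i with Some (j, false) => w0 j x | Some (j, true) => cj (w0 j x) | None => 1 end.
pose B (i : I) x y := match i with Some (j, false) => B0 j x y | Some (j, true) => cj (B0 j x y) | None => 1 end.
(* As u is real, it is half the sum of its expansion and the conjugate expansion; this makes the
   coefficients compatible with [bar]. *)
pose a (i : I) : C := match i with Some (j, false) => (2^-1)%:C * a0 j | Some (j, true) => (2^-1)%:C * cj (a0 j) | None => 0 end.
pose bar (i : I) : I := match i with Some (j, b) => Some (j, ~~ b) | None => None end.
pose G1 := G0 ++ G.
have qw i : quad G1 n1 (w i) (B i).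
  have sub : {subset G <= G1} by move=> y yG; rewrite mem_cat yG orbT.
  case: i => [[j []]|]; last exact: quad_one.
    by apply: quad_conj; exact: quad_mono (h4 j).
  exact: quad_mono (h4 j).
have cI : (#|I| <= N)%N by rewrite card_option card_prod card_bool mulnC ltnS leq_mul2l h2.
have [|||G' [r' [s [sG' /andP [r'0 r'r] [ps sK ss] Hd]]]] :=
  HK X G1 {: 6.-tuple I} (fun t => monV w t) (fun t => monF B t) [set: 6.-tuple I] tf.
- by rewrite size_cat leq_add.
- move=> t; have := mon_quad t n10 qw; by rewrite size_tuple.
- by rewrite cardsT card_tuple leq_exp2r.
have Dich (z : seq I) : (size z <= 6)%N ->
    Tr w B G' r' d z \/ (unif s d (monF B z) /\ unif s d (fun a b => monF B z a b ^+ 2)).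
  move=> sz; have [t [E1 E2]] := mon_pad (o := None) (fun x => erefl (w None x)) (fun a b => erefl (B None a b)) sz.
  by have := Hd t (in_setT t); rewrite E1 E2.
have sub0 : {subset G0 <= G'} by move=> y yG; apply: sG'; rewrite mem_cat yG.
exists (conv s); split.
- exact: conv_prob.
- exact: conv_le.
- move=> x hx; apply: (le_trans (nB_sub x sub0)); apply: (le_trans (conv_supp ss hx)).
  apply: (le_trans _ (le_trans r'r rr)); move: r'0; clear; lra.
- exact: conv_ft.
have qw' i : quad G' n1 (w i) (B i) by apply: quad_mono (qw i).
have r'L : r' <= n1^-1.
  by apply: (le_trans r'r); apply: (le_trans rL); rewrite lef_pV2 ?posrE // ler_peMl ?ler1n // ltW.
have Lr : 32 * (n1 * r') <= nu ^+ 3.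
  by rewrite mulrA mulrC -ler_pdivlMr ?mulr_gt0 //; apply: (le_trans r'r).
have d32 : 32 * d <= nu ^+ 3 by rewrite /d mulrC divfK ?lexx // pnatr_eq0.
have aA i : nm (a i) <= n1.
  have n0 : (2 : R)^-1 <= 1 by rewrite invf_le1 // ler1n.
  have i0 : 0 <= (2 : R)^-1 by rewrite invr_ge0.
  case: i => [[j []]|]; rewrite /= ?nm0 ?(ltW n10) // nmM ?nm_cj nmR ger0_norm // -[n1]mul1r; apply: ler_pM; rewrite ?nm_ge0 ?h3 //.
have abar i : a (bar i) = cj (a i).
  by case: i => [[j []]|] /=; rewrite ?cjM ?cjR ?cjK ?cj0.
have uE x : (u x)%:C = \sum_i a i * w i x.
  rewrite (bigD1 None) //= mul0r add0r.
  have -> : \sum_(i : I | i != None) a i * w i x = \sum_(p : I0 * bool) a (Some p) * w (Some p) x.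
    rewrite (reindex_omap Some id) /=; last by case.
    by apply: eq_bigl => p; rewrite eqxx.
  have -> : \sum_(p : I0 * bool) a (Some p) * w (Some p) x = \sum_j \sum_(b : bool) a (Some (j, b)) * w (Some (j, b)) x.
    by rewrite pair_bigA; apply: eq_bigr => -[].
  have Ex := h5 x; have Ex' : (u x)%:C = \sum_i cj (a0 i) * cj (w0 i x).
    by rewrite -[LHS]cjR Ex cj_sum; apply: eq_bigr => i _; rewrite cjM.
  transitivity ((2^-1)%:C * ((u x)%:C + (u x)%:C)).
    by rewrite -rmorphD -rmorphM /=; congr (_%:C); field.
  rewrite {1}Ex Ex' -big_split mulr_sumr; apply: eq_bigr => j _ /=.
  by rewrite big_bool /=; ring.
apply: (count_lower (o := None) (bar := bar) qw' n10 r'0 r'L ps ss nu0 nu1 Lr d0 d32 Dich) => //.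
- by case=> [[j []]|].
- by move=> i x; case: i => [[j []]|] //=; rewrite ?cjK ?cj1.
- by move=> i x y; case: i => [[j []]|] //=; rewrite ?cjK ?cj1.
- exact: ltW.
apply: (@le_trans _ _ ((N%:R * n1) ^+ 4 * (nu + nu))).
  apply: ler_wpM2r; first by rewrite addr_ge0 // ltW.
  by rewrite lerXn2r ?nnegrE ?mulr_ge0 ?ler0n ?(ltW n10) // ler_pM2r // ler_nat.
have -> : (N%:R * n1) ^+ 4 * (nu + nu) = nu * c by rewrite /c; ring.
by rewrite -ler_pdivlMr.
Qed.
End Structured.

(** * Popular differences in finite abelian groups *)

Lemma popular_arith (R : realFieldType) (pf pu ru rv rf e : R) :
  pf - 108 * (4 * e) <= pu -> pu - 300 * e <= ru -> ru - 32 * e <= rv -> rv - e <= rf -> 0 <= e ->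
  pf - 800 * e <= rf.
Proof. by lra. Qed.

Section Popular.
Variable R : realType.
Local Notation C := R[i].

Theorem popular_difference (k D : nat) (e rho : R) : (0 < k <= 4)%N -> 0 < e -> e <= 1 -> 0 < rho ->
  exists (K : R) (J : nat), 0 < K /\ forall (X : env R) (G0 : seq X) (f : X -> R), torsion_free J X ->
  (size G0 <= D)%N -> (forall x, 0 <= f x <= 1) ->
  exists mu : X -> R, [/\ prob mu, forall x, mu x <= K / q X, forall x, mu x != 0 -> nB G0 x <= rho &
    ((q X)^-1 * \sum_x f x) ^+ k - 800 * e <= Re (apn mu (pad k f))].
Proof.
move=> hk e0 e1 rho0.
have [K HK] := choice (fun n => structured_count n D hk e0 e1 rho0).
have K0 n : 0 < K n by apply: lt_le_trans (HK n).1.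
(* The growth function: uniformity below t n ^ 8 beats the constant K n of the weight built later
   from a function of complexity n. *)
pose t n := Num.min e (e / (324 * K n)).
have t0 n : 0 < t n by rewrite lt_min e0 divr_gt0 // mulr_gt0.
have F0 n : 0 < t n ^+ 8 by rewrite exprn_gt0.
have e20 : 0 < e ^+ 2 by rewrite exprn_gt0.
have e2e : e ^+ 2 <= e by rewrite expr2 ler_piMl // ltW.
(* The accuracy is e^2 because [energy] is a squared L^2 norm. *)
have [N [J HJ]] := regularity e20 (le_trans e2e e1) F0.
(* The complexity n is known only to be at most N, so K is summed over all its possible values. *)
exists (\sum_(n < N.+1) K n), (J + 3)%N; split.
  by rewrite big_ord_recl ltr_pwDl // sumr_ge0 // => i _; rewrite ltW.
move=> X G0 f tf sG f01; have q0 := q_gt0 X.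
have tf3 : torsion_free 3 X by apply: torsion_free_leq tf; rewrite leq_addl.
have tf2 : torsion_free 2 X by apply: torsion_free_leq tf3.
have tfJ : torsion_free J X by apply: torsion_free_leq tf; rewrite leq_addr.
have [n [u [v [nN [su u2] v2 Euv Ufv]]]] := HJ X tfJ f f01.
have au : admissible e n u.
  split => // x; have /andP [h1 h2] := u2 x; rewrite h2 andbT.
  by apply: le_trans h1; rewrite lerN2.
have [K1 HKn] := HK n; have [mu [pm muK mus muF Hmu]] := HKn X G0 u tf2 sG au.
exists mu; split => //.
  move=> x; apply: (le_trans (muK x)); rewrite ler_pM2r ?invr_gt0 //.
  have nN1 : (n < N.+1)%N by [].
  rewrite (bigD1 (Ordinal nN1)) //= lerDl sumr_ge0 // => i _; exact: ltW.
have b2 (h : X -> R) : (forall x, - e ^+ 2 <= h x <= 2) -> forall x, `|h x| <= 2.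
  move=> hh x; have /andP [h1 h2] := hh x; rewrite ler_norml h2 andbT.
  by apply: le_trans h1; rewrite lerN2 (le_trans e2e) // (le_trans e1) // ler1n.
have f2 x : `|f x| <= 2.
  by have /andP [h1 h2] := f01 x; rewrite ger0_norm // (le_trans h2) // ler1n.
have fv3 x : `|f x - v x| <= 3.
  have /andP [h1 h2] := f01 x; have /andP [h3 h4] := v2 x.
  have : - e ^+ 2 >= - 1 by rewrite lerN2 (le_trans e2e).
  move=> h5; have h6 := le_trans h5 h3; move: h1 h2 h4 h6; move: (f x) (v x); clear => y z *.
  by rewrite ler_norml; apply/andP; split; lra.
have te : t n <= e by rewrite ge_min lexx.
have tK : 324 * (K n * t n) <= e.
  rewrite mulrA mulrC -ler_pdivlMr ?mulr_gt0 //; by rewrite ge_min lexx orbT.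
have D1 : nm (apn mu (pad k f) - apn mu (pad k v)) <= e.
  apply: le_trans tK; apply: (apn_pad_U3 tf3 k (ltW (t0 n)) muF f2 (b2 _ v2) fv3); exact: ltW.
have D2 : nm (apn mu (pad k v) - apn mu (pad k u)) <= 32 * e.
  by rewrite nmBC; apply: apn_pad_L2 => //; [exact: ltW|exact: b2|exact: b2].
have M1 : `|(q X)^-1 * \sum_x u x - (q X)^-1 * \sum_x v x| <= e.
  rewrite -mulrBr -sumrB -(@ler_pXn2r _ 2%N) ?nnegrE ?normr_ge0 ?(ltW e0) // real_normK ?num_real //.
  by apply: le_trans (avg_sqr (fun x => u x - v x)) _.
have M2 : `|(q X)^-1 * \sum_x v x - (q X)^-1 * \sum_x f x| <= 3 * e.
  have h1 (x : X) : nm ((f x - v x) / 3)%:C <= 1.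
    by rewrite nmR normrM (ger0_norm (_ : 0 <= 3^-1)) ?invr_ge0 // ler_pdivrMr // mul1r.
  have := mean_U3 tf3 h1.
  have -> : \sum_x ((f x - v x) / 3)%:C = ((\sum_x f x - \sum_x v x) / 3)%:C.
    by rewrite -rmorph_sum /= -mulr_suml sumrB.
  rewrite nmR normrM (ger0_norm (_ : 0 <= 3^-1)) ?invr_ge0 // => h2.
  have h3 : (q X)^-1 * (`|\sum_x f x - \sum_x v x| / 3) <= e.
    rewrite -(@ler_pXn2r _ 8%N) ?nnegrE ?(ltW e0) //; last by rewrite !mulr_ge0 ?invr_ge0 // ltW.
    apply: (le_trans h2); apply: (le_trans (ltW Ufv)).
    by rewrite lerXn2r ?nnegrE ?(ltW e0) ?(ltW (t0 n)).
  rewrite distrC -mulrBr normrM (gtr0_norm (_ : 0 < (q X)^-1)) ?invr_gt0 //.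
  by rewrite [3 * e]mulrC -ler_pdivrMr // -mulrA.
have Ef x : (q X)^-1 * \sum_(y : X) x = x :> R.
  by rewrite sumr_const -[x *+ _]mulr_natl mulKf // gt_eqF.
have qi : 0 < (q X)^-1 by rewrite invr_gt0.
have A1 : `|(q X)^-1 * \sum_x f x| <= 3.
  rewrite ger0_norm; last by rewrite mulr_ge0 ?(ltW qi) // sumr_ge0 // => x _; case/andP: (f01 x).
  apply: (@le_trans _ _ ((q X)^-1 * \sum_(x : X) 3)); last by rewrite Ef.
  rewrite ler_pM2l //; apply: ler_sum => x _; case/andP: (f01 x) => _ h; by rewrite (le_trans h) // ler1n.
have A2 : `|(q X)^-1 * \sum_x u x| <= 3.
  rewrite normrM gtr0_norm //; apply: (@le_trans _ _ ((q X)^-1 * \sum_(x : X) 3)); last by rewrite Ef.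
  rewrite ler_pM2l //; apply: (le_trans (ler_norm_sum _ _ _)); apply: ler_sum => x _.
  by apply: (le_trans (b2 _ u2 x)); rewrite ler_nat.
have A3 : `|(q X)^-1 * \sum_x f x - (q X)^-1 * \sum_x u x| <= 4 * e.
  rewrite distrC; apply: (le_trans (ler_distD ((q X)^-1 * \sum_x v x) _ _)).
  by apply: (le_trans (lerD M1 M2)); clear; lra.
have k4 : (k <= 4)%N by case/andP: hk.
(* The losses 4 * 108, 300, 32 and 1 add up to 765, below 800. *)
exact: popular_arith (power_close k4 A1 A2 A3) Hmu (Re_close D2) (Re_close D1) (ltW e0).
Qed.
End Popular.

(** * Cyclic groups and intervals *)





Section Cyclic.
Variable m : nat.
Local Notation M := m.+1.
Local Notation C := R[i].

Definition cis (n : nat) : C := ecos M n +i* esin M n.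

Lemma cis_add a b : cis (a + b) = cis a * cis b.
Proof. by rewrite /cis ecos_add esin_add; congr (_ +i* _); rewrite ?RealsE //= addrC. Qed.
Lemma cis_mulM j : cis (j * M) = 1.
Proof. by rewrite /cis ecos_period ?esin_period //; exact: Nat.lt_0_succ. Qed.
Lemma cis_mod n : cis (n %% M) = cis n.
Proof. by rewrite {2}(divn_eq n M) cis_add cis_mulM mul1r. Qed.
Lemma cis_nm n : nm (cis n) = 1.
Proof.
have H : ecos M n ^+ 2 + esin M n ^+ 2 = 1 by have := esin_cos M n; rewrite !RealsE !expr2.
by rewrite /nm /cis /= H Num.Theory.sqrtr1.
Qed.

(** The pairing exp (2 pi i x y / M), under which a cyclic group is its own dual. *)
Definition cych (x y : 'I_M) : C := cis (x * y).
Lemma cychDl x y z : cych (x + y) z = cych x z * cych y z.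
Proof. by rewrite /cych -cis_add -mulnDl -(cis_mod ((x + y)%R * z)) -(cis_mod ((x + y)%N * z)) modnMml. Qed.
Lemma cychC x y : cych x y = cych y x. Proof. by rewrite /cych mulnC. Qed.
Lemma cych_nm x y : nm (cych x y) = 1. Proof. exact: cis_nm. Qed.

Lemma far_norm (y : nat) (d : R) : (Rlt 0 d) -> (Rle d (1 / 2)%R) ->
  Rle (Rmult d (INR M)) (INR y) -> Rle (INR y) (Rmult (Rminus 1 d) (INR M)) ->
  1 - cos (Rmult (Rmult 2 PI) d) <= nm (1 - cis y).
Proof.
move=> d0 d1 h1 h2; have := ecos_far m.+1 y d (Nat.lt_0_succ m) (conj d0 d1) (conj h1 h2) => h.
have h3 : Re (1 - cis y) <= nm (1 - cis y) by exact: Re_le.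
by apply: le_trans h3; rewrite ReD ReN /= lerD2l lerN2; apply/RleP.
Qed.

Lemma cych_orth0 (y : 'I_M) : y != 0 -> \sum_x cych x y = 0.
Proof.
move=> y0; pose x0 : 'I_M := inord 1.
have m0 : (0 < m)%N.
  by case: (posnP m) => // E; case/eqP: y0; apply: val_inj => /=; move: (ltn_ord y); rewrite {2}E; case: (val y).
have x1 : x0 = 1%N :> nat by rewrite inordK.
have S1 : \sum_x cych x y = cych x0 y * \sum_x cych x y.
  rewrite mulr_sumr (reindex_inj (addIr x0)) /=; apply: eq_bigr => x _.
  by rewrite cychDl mulrC.
have ne : cych x0 y != 1.
  rewrite /cych x1 mul1n; apply/eqP => E.
  have y1 : (0 < y)%N by rewrite lt0n; apply: contra y0 => /eqP h; apply/eqP; exact: val_inj.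
  have [[d0 d1] [h1 h2]] := middle_bounds M y (ssrnat.ltP y1) (ssrnat.ltP (ltn_ord y)).
  have := far_norm d0 d1 h1 h2; rewrite E subrr nm0 subr_le0 => /RleP h.
  by have := cos_lt1 _ (conj d0 d1); apply: Rle_not_lt.
have : (1 - cych x0 y) * \sum_x cych x y == 0 by rewrite mulrBl mul1r -S1 subrr.
by rewrite mulf_eq0 subr_eq0 eq_sym (negbTE ne) /= => /eqP.
Qed.

Definition cyclic_env : env R := @Env R 'I_M cych cychDl cychC cych_nm cych_orth0.

Lemma q_cyclic : q cyclic_env = M%:R. Proof. by rewrite /q card_ord. Qed.

Lemma cyclic_torsion_free J : (forall j, (0 < j <= J)%N -> coprime M j) -> torsion_free J cyclic_env.
Proof.
move=> cop x j hj; have := Zp_mulrn (x : 'I_M) j; rewrite /= => -> E.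
have := congr1 (@nat_of_ord _) E => /= /eqP; rewrite -/(dvdn M _) Gauss_dvdl ?cop // => h.
by apply: val_inj => /=; apply/eqP; rewrite -leqn0 leqNgt; apply/negP => x0; have := dvdn_leq x0 h; rewrite leqNgt ltn_ord.
Qed.

(** A Bohr set with the single frequency 1 is an arc around 0; this is how the steps are forced to
    be short. Halving the radius makes the inequality strict. *)
Lemma bohr_cyclic (d : R) (x : cyclic_env) : Rlt 0 d -> Rle d (1 / 2)%R ->
  nB [:: (inord 1 : 'I_M) : cyclic_env] x <= (1 - cos (Rmult (Rmult 2 PI) d)) / 2 -> 
  Rle (Rmult d (INR M)) (INR (x : 'I_M)) -> Rle (INR (x : 'I_M)) (Rmult (Rminus 1 d) (INR M)) -> False.
Proof.
move=> d0 d1 hx h1 h2; have := far_norm d0 d1 h1 h2.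
have c1 : 0 < 1 - cos (Rmult (Rmult 2 PI) d) by rewrite subr_gt0; apply/RltP; exact: cos_lt1.
have m0 : (0 < m)%N.
  case: (posnP m) => // E; exfalso.
  have x0 : (x : 'I_M) = 0%N :> nat by move: (ltn_ord (x : 'I_M)); rewrite {2}E ltnS leqn0 => /eqP.
  move: h1; rewrite x0; apply: Rlt_not_le; apply: Rmult_lt_0_compat => //; apply: lt_0_INR; exact: Nat.lt_0_succ.
have := nB_mem x (mem_head (inord 1 : cyclic_env) [::]).
have -> : ch (inord 1 : cyclic_env) x = cis (x : 'I_M) by rewrite /= /cych inordK ?mul1n.
move=> h3 h4; have := le_trans h4 (le_trans h3 hx).
by rewrite ler_pdivlMr // mulr_natr mulr2n gerDl leNgt c1.
Qed.
End Cyclic.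

Lemma sumZ_fromE a n (f : Z -> R) : sumZ_from a n f = \sum_(i < n) f (Z.add a (Z.of_nat i)).
Proof.
elim: n a => [|n IH] a; first by rewrite big_ord0.
rewrite big_ord_recl /= IH RplusE Z.add_0_r; congr (_ + _); apply: eq_bigr => i _.
by congr f; rewrite /bump /=; lia.
Qed.

Lemma approdE A n d k : approd A n d k = \prod_(j < k) ind A (Z.add n (Z.mul (Z.of_nat j) d)).
Proof.
elim: k => [|k IH]; first by rewrite big_ord0.
by rewrite big_ord_recr /= -IH RmultE.
Qed.

Lemma ind01 A n : 0 <= ind A n <= 1.
Proof. by rewrite /ind R0E R1E; case: (A n); rewrite ?ler01 ?lexx. Qed.

Lemma approd01 A n d k : 0 <= approd A n d k <= 1.
Proof.
rewrite approdE; apply/andP; split; first by apply: prodr_ge0 => j _; case/andP: (ind01 A (Z.add n (Z.mul (Z.of_nat j) d))).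
apply: (@le_trans _ _ (\prod_(j < k) 1)); last by rewrite big1.
by apply: ler_prod => j _; exact: ind01.
Qed.

Lemma sum_lt_ord (M c : nat) : \sum_(y < M) ((y < c)%N%:R : R) <= c%:R.
Proof.
elim: M => [|M IH]; first by rewrite big_ord0 ler0n.
case: (leqP c M) => h; first by rewrite big_ord_recr /= ltnNge h addr0.
apply: (@le_trans _ _ (\sum_(y < M.+1) (1 : R))); first by apply: ler_sum => y _; rewrite lern1 leq_b1.
by rewrite sumr_const card_ord ler_nat.
Qed.

Lemma sum_ge_ord (M c : nat) : \sum_(y < M) ((M <= y + c)%N%:R : R) <= c%:R.
Proof.
rewrite (reindex_inj rev_ord_inj) /=; apply: le_trans (sum_lt_ord M c); apply: ler_sum => y _.
by rewrite ler_nat; have := ltn_ord y; case: leqP => //= h hy; case: ltnP => //; lia.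
Qed.

(** * Transfer from the cyclic group to the interval *)

Section Transfer.
Variables (m N : nat).
Local Notation M := m.+1.
Hypothesis (N0 : (0 < N)%N) (NM : (N < M)%N) (MN : (M <= 2 * N)%N).

Definition res (d : Z) : 'I_M := inord (Z.to_nat (Z.modulo d (Z.of_nat M))).
(** The representative of least absolute value; it lies in [-N, N] because M <= 2 N. *)
Definition rep (x : 'I_M) : Z := if (2 * x < M)%N then Z.of_nat x else Z.sub (Z.of_nat x) (Z.of_nat M).

Lemma resE d : Z.of_nat (res d) = Z.modulo d (Z.of_nat M).
Proof.
have h := Z.mod_pos_bound d (Z.of_nat M) (ltac:(lia)).
by rewrite /res inordK; lia.
Qed.
Lemma rep_res x : res (rep x) = x.
Proof.
apply: val_inj; apply: Nat2Z.inj => /=; rewrite resE /rep; have hx := ltn_ord x.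
case: ifP => _; first by rewrite Z.mod_small //; lia.
by rewrite -(Z_mod_plus_full _ 1) Z.mod_small; lia.
Qed.
Lemma rep_bound x : Z.le (Z.opp (Z.of_nat N)) (rep x) /\ Z.le (rep x) (Z.of_nat N).
Proof. by rewrite /rep; have hx := ltn_ord x; case: ifP => h; lia. Qed.

(** Integers other than the chosen representatives get weight 0, so that each residue is counted
    once; the factor 2 N + 1 converts a sum into the average over [-N, N]. *)
Definition lift_weight (mu : 'I_M -> R) (d : Z) : R :=
  if Z.eqb (rep (res d)) d then (2 * N).+1%:R * mu (res d) else 0.

Lemma sum_lift_weight mu (g : Z -> R) :
  \sum_(i < (2 * N).+1) g (Z.add (Z.opp (Z.of_nat N)) (Z.of_nat i)) * lift_weight mu (Z.add (Z.opp (Z.of_nat N)) (Z.of_nat i)) =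
  (2 * N).+1%:R * \sum_x mu x * g (rep x).
Proof.
pose h (i : 'I_(2 * N).+1) : 'I_M := res (Z.add (Z.opp (Z.of_nat N)) (Z.of_nat i)).
pose h' (x : 'I_M) : 'I_(2 * N).+1 := inord (Z.to_nat (Z.add (rep x) (Z.of_nat N))).
have hE x : Z.of_nat (h' x) = Z.add (rep x) (Z.of_nat N).
  by rewrite /h'; move: (rep_bound x); move: (rep x) => z [z1 z2]; rewrite inordK; lia.
rewrite [in RHS](reindex_onto h h') /=; last first.
  by move=> x _; rewrite /h hE -{2}(rep_res x); congr res; lia.
rewrite mulr_sumr [RHS]big_mkcond; apply: eq_bigr => i _ /=; rewrite /lift_weight -/(h i).
have -> : (h' (h i) == i) = Z.eqb (rep (h i)) (Z.add (Z.opp (Z.of_nat N)) (Z.of_nat i)).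
  apply/eqP/idP => [E|/Z.eqb_eq E]; first by apply/Z.eqb_eq; have := hE (h i); rewrite E; lia.
  by apply: val_inj; apply: Nat2Z.inj => /=; rewrite hE E; lia.
by case: Z.eqb_spec => [->|_]; rewrite ?mulr0 //; ring.
Qed.

Lemma lift_weight_ge0 mu d : (forall x, 0 <= mu x) -> 0 <= lift_weight mu d.
Proof. by move=> h; rewrite /lift_weight; case: ifP => _ //; rewrite mulr_ge0 ?ler0n. Qed.

Lemma modnZ n : Z.of_nat (n %% M) = Z.modulo (Z.of_nat n) (Z.of_nat M).
Proof.
apply: (Z.mod_unique_pos _ _ (Z.of_nat (n %/ M))); first by have := ltn_pmod n (ltn0Sn m); lia.
by rewrite {1}(divn_eq n M); lia.
Qed.
Lemma res_add a b : res (Z.add a b) = res a + res b.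
Proof.
apply: val_inj; apply: Nat2Z.inj; rewrite resE /= modnZ Nat2Z.inj_add !resE.
by rewrite -Z.add_mod.
Qed.
Lemma res_mul (x : 'I_M) j : res (Z.mul (Z.of_nat j) (rep x)) = x *+ j.
Proof.
elim: j => [|j IH]; first by apply: val_inj; apply: Nat2Z.inj; rewrite resE.
rewrite mulrSr -IH -{3}(rep_res x) -res_add; congr res; lia.
Qed.
Lemma res_nat (x : 'I_M) : res (Z.of_nat x) = x.
Proof. by apply: val_inj; apply: Nat2Z.inj; rewrite resE; apply: Z.mod_small; have := ltn_ord x; lia. Qed.

Variables (A : Z -> bool) (k : nat).
Hypothesis (k4 : (0 < k <= 4)%N) (AN : forall n, A n = true -> Z.le 1 n /\ Z.le n (Z.of_nat N)).
Let f (x : 'I_M) : R := ind A (Z.of_nat x).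
Let P (y x : 'I_M) : R := \prod_(j < 4) (if (j < k)%N then f (y + x *+ j) else 1).

Lemma f01 x : 0 <= f x <= 1. Proof. exact: ind01. Qed.

Lemma P01 y x : 0 <= P y x <= 1.
Proof.
apply/andP; split; first by apply: prodr_ge0 => j _; case: ifP => _; rewrite ?ler01 //; case/andP: (f01 (y + x *+ j)).
apply: (@le_trans _ _ (\prod_(j < 4) 1)); last by rewrite big1.
by apply: ler_prod => j _; case: ifP => _; rewrite ?ler01 ?lexx //; exact: f01.
Qed.

Lemma step_val (y x : 'I_M) j : (3 * Z.abs_nat (rep x) <= y)%N -> (y + 3 * Z.abs_nat (rep x) < M)%N -> (j < 4)%N ->
  Z.of_nat (y + x *+ j)%R = Z.add (Z.of_nat y) (Z.mul (Z.of_nat j) (rep x)).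
Proof.
move=> h1 h2 hj; rewrite -res_mul -{1}(res_nat y) -res_add resE Z.mod_small //.
move: h1 h2; move: (rep x) (nat_of_ord y) => D y' h1 h2.
by case: j hj => [|[|[|[|//]]]] _; lia.
Qed.

(** Away from the two ends the progression does not wrap around and the two counts agree. Within c
    of an end the left side is at most 1, which the indicators absorb. *)
Lemma point_count (y x : 'I_M) c : c = (3 * Z.abs_nat (rep x))%N ->
  P y x <= approd A (Z.of_nat y) (rep x) k + (y < c)%N%:R + (M <= y + c)%N%:R.
Proof.
move=> cE; have [ap0 _] := andP (approd01 A (Z.of_nat y) (rep x) k); have [_ P1] := andP (P01 y x).
case: (ltnP y c) => h1.
  by apply: (le_trans P1); rewrite [_ + 1]addrC -addrA lerDl addr_ge0 // ler0n.
case: (leqP M (y + c)) => h2; first by apply: (le_trans P1); rewrite lerDr addr0.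
rewrite !addr0 le_eqVlt; apply/orP; left; apply/eqP; rewrite approdE /P.
have kk : (k <= 4)%N by case/andP: k4.
rewrite (big_ord_widen 4 (fun j => ind A (Z.add (Z.of_nat y) (Z.mul (Z.of_nat j) (rep x)))) kk) [RHS]big_mkcond.
by apply: eq_bigr => j _; case: ifP => // _; rewrite /f step_val -?cE.
Qed.

Lemma interval_sum (g : Z -> R) : (forall z, Z.le 1 z /\ Z.le z (Z.of_nat N) \/ g z = 0) ->
  \sum_(y < M) g (Z.of_nat y) = \sum_(i < N) g (Z.add 1 (Z.of_nat i)).
Proof.
move=> hg; rewrite big_ord_recl; have -> : g (Z.of_nat (@ord0 m)) = 0 by case: (hg Z0) => //; lia.
rewrite add0r (big_ord_widen m (fun i => g (Z.add 1 (Z.of_nat i)))) // [RHS]big_mkcond; apply: eq_bigr => i _.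
have -> : Z.of_nat (lift ord0 i) = Z.add 1 (Z.of_nat i) by rewrite lift0; lia.
by case: ltnP => // h; case: (hg (Z.add 1 (Z.of_nat i))) => //; lia.
Qed.

Lemma fibre_count x : \sum_y P y x <= \sum_(i < N) approd A (Z.add 1 (Z.of_nat i)) (rep x) k + 6 * (Z.abs_nat (rep x))%:R.
Proof.
set c := (3 * Z.abs_nat (rep x))%N.
have -> : 6 * (Z.abs_nat (rep x))%:R = c%:R + c%:R :> R by rewrite /c natrM; ring.
apply: (@le_trans _ _ (\sum_(y < M) (approd A (Z.of_nat y) (rep x) k + (y < c)%N%:R + (M <= y + c)%N%:R))).
  by apply: ler_sum => y _; exact: (point_count y (erefl c)).
rewrite !big_split /= -addrA; apply: lerD; last by apply: lerD; [exact: sum_lt_ord|exact: sum_ge_ord].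
rewrite (interval_sum (g := fun z => approd A z (rep x) k)) // => z.
case E : (A z); first by left; exact: AN.
right; rewrite approdE; case: k k4 => [//|k' _].
by rewrite big_ord_recl /= Z.add_0_r /ind E R0E mul0r.
Qed.

Variables (mu : 'I_M -> R) (d : R).
Hypothesis (mu0 : forall x, 0 <= mu x) (mu1 : \sum_x mu x = 1).
Hypothesis (mud : forall x, mu x != 0 -> (Z.abs_nat (rep x))%:R <= d * M%:R).

Lemma apn_re : Re (apn (X := cyclic_env m) mu (pad (X := cyclic_env m) k f)) = M%:R^-1 * \sum_y \sum_x mu x * P y x.
Proof.
rewrite /apn q_cyclic ReZ Re_sum; congr (_ * _); apply: eq_bigr => y _.
rewrite Re_sum; apply: eq_bigr => x _; rewrite ReZ; congr (_ * _).
have -> : \prod_(j < 4) pad (X := cyclic_env m) k f j (y + x *+ j) = (P y x)%:C.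
  by rewrite /P rmorph_prod; apply: eq_bigr => j _; rewrite /pad; case: ifP.
by [].
Qed.

(** Wrap-around affects at most 6 |rep x| base points, and the support of mu keeps |rep x| <= d
    M. *)
Lemma transfer_count : M%:R * (Re (apn (X := cyclic_env m) mu (pad (X := cyclic_env m) k f)) - 6 * d) <=
  \sum_(n < N) ((2 * N).+1%:R^-1 * \sum_(i < (2 * N).+1)
    approd A (Z.add 1 (Z.of_nat n)) (Z.add (Z.opp (Z.of_nat N)) (Z.of_nat i)) k *
    lift_weight mu (Z.add (Z.opp (Z.of_nat N)) (Z.of_nat i))).
Proof.
have N20 : (2 * N).+1%:R != 0 :> R by rewrite pnatr_eq0.
have -> : \sum_(n < N) ((2 * N).+1%:R^-1 * \sum_(i < (2 * N).+1)
    approd A (Z.add 1 (Z.of_nat n)) (Z.add (Z.opp (Z.of_nat N)) (Z.of_nat i)) k *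
    lift_weight mu (Z.add (Z.opp (Z.of_nat N)) (Z.of_nat i))) =
    \sum_x mu x * \sum_(n < N) approd A (Z.add 1 (Z.of_nat n)) (rep x) k.
  under [RHS]eq_bigr do rewrite mulr_sumr; rewrite exchange_big /=; apply: eq_bigr => n _.
  by rewrite (sum_lift_weight mu (fun z => approd A (Z.add 1 (Z.of_nat n)) z k)) mulKf.
rewrite apn_re mulrBr mulVKf ?pnatr_eq0 // exchange_big /=.
have -> : M%:R * (6 * d) = \sum_x mu x * (6 * (d * M%:R)) by rewrite -mulr_suml mu1; ring.
rewrite -sumrB; apply: ler_sum => x _; rewrite -mulr_sumr -mulrBr.
have [->|hx] := eqVneq (mu x) 0; first by rewrite !mul0r.
apply: ler_wpM2l => //; rewrite lerBlDr; apply: (le_trans (fibre_count x)); rewrite lerD2l ler_pM2l //.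
exact: mud.
Qed.

Lemma lift_weight_mean : \sum_(i < (2 * N).+1) lift_weight mu (Z.add (Z.opp (Z.of_nat N)) (Z.of_nat i)) = (2 * N).+1%:R.
Proof.
have := sum_lift_weight mu (fun _ => 1); under eq_bigr do rewrite mul1r; move=> ->.
by under eq_bigr do rewrite mulr1; rewrite mu1 mulr1.
Qed.
End Transfer.

Lemma IZR_of_nat n : IZR (Z.of_nat n) = n%:R.
Proof. by rewrite -INR_IZR_INZ INRE. Qed.

Lemma avgZE a b n (f : Z -> R) : Z.add (Z.sub b a) 1 = Z.of_nat n ->
  avgZ a b f = n%:R^-1 * \sum_(i < n) f (Z.add a (Z.of_nat i)).
Proof. by move=> E; rewrite /avgZ /sumZ E Nat2Z.id sumZ_fromE IZR_of_nat RdivE mulrC. Qed.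

Lemma coprime_fact_succ J c j : (0 < j <= J)%N -> coprime (c * J`!).+1 j.
Proof.
move=> hj; have dj : (j %| c * J`!)%N by rewrite dvdn_mull // dvdn_fact.
by rewrite -addn1 coprime_sym -(divnK dj) /coprime gcdnMDl gcdn1.
Qed.

Lemma abs_nat_sub a b : (a < b)%N -> Z.abs_nat (Z.sub (Z.of_nat a) (Z.of_nat b)) = (b - a)%N.
Proof. by lia. Qed.

Lemma interval_width n : Z.add (Z.sub (Z.of_nat n) 1) 1 = Z.of_nat n.
Proof. by lia. Qed.
Lemma symmetric_width n : Z.add (Z.sub (Z.of_nat n) (Z.opp (Z.of_nat n))) 1 = Z.of_nat (2 * n).+1.
Proof. by lia. Qed.
Lemma of_nat_pos n : Z.le 1 (Z.of_nat n) -> (0 < n)%N.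
Proof. by lia. Qed.

Definition popular (A : Z -> bool) (k N : nat) (mu : Z -> R) : R :=
  N%:R^-1 * \sum_(n < N) ((2 * N).+1%:R^-1 * \sum_(i < (2 * N).+1)
    approd A (Z.add 1 (Z.of_nat n)) (Z.add (Z.opp (Z.of_nat N)) (Z.of_nat i)) k *
    mu (Z.add (Z.opp (Z.of_nat N)) (Z.of_nat i))).

Definition weight_mean (N : nat) (mu : Z -> R) : R :=
  (2 * N).+1%:R^-1 * \sum_(i < (2 * N).+1) mu (Z.add (Z.opp (Z.of_nat N)) (Z.of_nat i)).

Lemma popular_ge0 A k N mu : (forall d, 0 <= mu d) -> 0 <= popular A k N mu.
Proof.
move=> h; rewrite mulr_ge0 ?invr_ge0 ?ler0n // sumr_ge0 // => n _; rewrite mulr_ge0 ?invr_ge0 ?ler0n // sumr_ge0 // => i _.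
by rewrite mulr_ge0 //; case/andP: (approd01 A (Z.add 1 (Z.of_nat n)) (Z.add (Z.opp (Z.of_nat N)) (Z.of_nat i)) k).
Qed.

(** For bounded N the point mass at d = 0 is a weight of bounded height. It counts A itself, and
    alpha is at least its k-th power. *)
Lemma small_case (A : Z -> bool) (k N : nat) (al : R) : (0 < k)%N -> (0 < N)%N -> 0 < al -> al < 1 ->
  al * N%:R <= \sum_(i < N) ind A (Z.add 1 (Z.of_nat i)) ->
  exists mu : Z -> R, [/\ forall d, 0 <= mu d, weight_mean N mu = 1, forall d, mu d <= (2 * N).+1%:R & al ^+ k <= popular A k N mu].
Proof.
move=> k0 N0 al0 al1 hA; pose mu d : R := if Z.eqb d 0 then (2 * N).+1%:R else 0.
have NN : (N < (2 * N).+1)%N by lia.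
have nz : (2 * N).+1%:R != 0 :> R by rewrite pnatr_eq0.
have S (g : Z -> R) : \sum_(i < (2 * N).+1) g (Z.add (Z.opp (Z.of_nat N)) (Z.of_nat i)) * mu (Z.add (Z.opp (Z.of_nat N)) (Z.of_nat i)) = g Z0 * (2 * N).+1%:R.
  rewrite (bigD1 (Ordinal NN)) //= big1 ?addr0; first by rewrite Z.add_opp_diag_l /mu.
  move=> i hi; rewrite /mu; case: Z.eqb_spec => h; rewrite ?mulr0 //.
  by case/eqP: hi; apply: val_inj => /=; lia.
exists mu; split.
- by move=> d; rewrite /mu; case: ifP => _; rewrite ?ler0n.
- have := S (fun _ => 1); under eq_bigr do rewrite mul1r; rewrite /weight_mean => ->.
  by rewrite mul1r; exact: mulVf.
- by move=> d; rewrite /mu; case: ifP => _; rewrite ?ler0n.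
have NR : 0 < N%:R :> R by rewrite ltr0n.
rewrite /popular -ler_pdivrMl ?invr_gt0 // invrK; apply: (@le_trans _ _ (al * N%:R)).
  by rewrite mulrC ler_pM2r //; case: k k0 => [//|k' _]; rewrite exprS ler_piMr ?(ltW al0) // exprn_ile1 // ltW.
apply: (le_trans hA); apply: ler_sum => n _.
rewrite (S (fun d => approd A (Z.add 1 (Z.of_nat n)) d k)) mulrC mulfK // approdE.
under eq_bigr do rewrite Z.mul_0_r Z.add_0_r.
rewrite prodr_const card_ord /ind R0E R1E; case: (A _); rewrite ?expr1n //.
by rewrite expr0n; case: k k0.
Qed.

(** [power_close] needs a point within e of alpha; the maximum of 0 and alpha - e is one that lies
    below p in the range where powers are monotone. *)
Lemma density_arith (al p e : R) k : (k <= 4)%N -> 0 < al -> al < 1 -> 0 < e -> e <= 1 -> al - e <= p -> 0 <= p -> 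
  al ^+ k - 108 * e <= p ^+ k.
Proof.
move=> k4 al0 al1 e0 e1 h p0; pose t := Num.max 0 (al - e).
have tp : t <= p by rewrite ge_max p0.
have t0 : 0 <= t by rewrite le_max lexx.
have ta : t <= al by rewrite ge_max (ltW al0) gerBl ltW.
have at1 : al - e <= t by rewrite le_max lexx orbT.
apply: (@le_trans _ _ (t ^+ k)); last by rewrite lerXn2r.
apply: power_close => //.
- by rewrite gtr0_norm //; move: al1; clear; lra.
- by rewrite ger0_norm //; move: ta al1; clear; lra.
by rewrite ger0_norm ?subr_ge0 // lerBlDr -lerBlDl.
Qed.

Lemma large_case (k : nat) (e : R) : (0 < k <= 4)%N -> 0 < e -> e <= 1 -> exists (K : R) (N0 : nat),
  0 < K /\ forall (N : nat) (A : Z -> bool) (al : R), (0 < N)%N -> (N0 <= N)%N -> 0 < al -> al < 1 ->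
  (forall n, A n = true -> Z.le 1 n /\ Z.le n (Z.of_nat N)) ->
  al * N%:R <= \sum_(i < N) ind A (Z.add 1 (Z.of_nat i)) ->
  exists mu : Z -> R, [/\ forall d, 0 <= mu d, weight_mean N mu = 1, forall d, mu d <= K & al ^+ k - 1000 * e <= popular A k N mu].
Proof.
(* Makes the wrap-around loss 6 d at most e. *)
move=> hk e0 e1; pose d := e / 12.
have d0 : 0 < d by rewrite divr_gt0.
have d2 : d <= 1 / 2 by rewrite /d; move: e1; clear; lra.
have D0 : Rlt 0 d by apply/RltP.
have D2 : Rle d (Rdiv 1 2) by apply/RleP; rewrite RdivE.
pose rho := (1 - cos (Rmult (Rmult 2 PI) d)) / 2.
have rho0 : 0 < rho by rewrite divr_gt0 // subr_gt0; apply/RltP; exact: cos_lt1.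
have [K [J [K0 HK]]] := popular_difference 1 hk e0 e1 rho0.
(* From here on J! + 1 <= e N, so passing to the cyclic group loses at most e in density. *)
pose N0 := (Num.truncn ((J`!).+1%:R / e)).+1.
(* The factor 3 comes from 2 N + 1 <= 3 M. *)
exists (3 * K), (N0 + (J`!).+1)%N; split; first by rewrite mulr_gt0.
move=> N A al N1 hN al0 al1 AN hA.
have JN : (J`!.+1 <= N)%N by apply: leq_trans hN; rewrite leq_addl.
have eN : (J`!).+1%:R <= e * N%:R.
  rewrite mulrC -ler_pdivrMr //; apply: (le_trans (ltW (truncnS_gt _))); rewrite ler_nat.
  by apply: leq_trans hN; rewrite leq_addr.
(* The order m + 1 is one more than a multiple of J!, hence coprime to 1, ..., J, and it exceeds N
   by at most J! + 1. *)
pose m := ((N %/ J`!).+1 * J`!)%N.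
have J0 : (0 < J`!)%N by exact: fact_gt0.
have NM : (N < m.+1)%N by rewrite ltnS ltnW // ltn_ceil.
have mN : (m.+1 <= N + (J`!).+1)%N by rewrite addnS ltnS /m mulSn addnC leq_add2r leq_trunc_div.
have MN : (m.+1 <= 2 * N)%N by rewrite (leq_trans mN) // mul2n -addnn leq_add2l.
have tf : torsion_free J (cyclic_env m) by apply: cyclic_torsion_free => j hj; exact: coprime_fact_succ.
pose f (x : cyclic_env m) : R := ind A (Z.of_nat (x : 'I_m.+1)).
have [mu [pm muK mus Hmu]] := HK (cyclic_env m) [:: inord 1 : 'I_m.+1] f tf isT (fun x => ind01 A _).
have mud (x : 'I_m.+1) : mu x != 0 -> (Z.abs_nat (rep x))%:R <= d * m.+1%:R.
  move=> /mus hx; have hM := ltn_ord x.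
  rewrite leNgt; apply/negP => hlt.
  have [h1 h2] : d * m.+1%:R <= x%:R /\ x%:R <= (1 - d) * m.+1%:R :> R.
    have dM : d * m.+1%:R <= 1 / 2 * m.+1%:R by rewrite ler_pM2r ?ltr0n.
    move: hlt; rewrite /rep; case: ltnP => h.
      rewrite Zabs2Nat.id => hlt; split; first exact: ltW.
      have : (2 * x)%:R <= m.+1%:R :> R by rewrite ler_nat ltnW.
      by rewrite natrM mulrBl mul1r; move: dM; move: (m.+1%:R) (x%:R) (d * m.+1%:R) => a b c; clear; lra.
    have -> : Z.abs_nat (Z.sub (Z.of_nat x) (Z.of_nat m.+1)) = (m.+1 - x)%N.
      exact: abs_nat_sub.
    rewrite natrB ?(ltnW hM) // => hlt.
    have : m.+1%:R <= (2 * x)%:R :> R by rewrite ler_nat.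
    by rewrite natrM mulrBl mul1r; move: hlt dM; move: (m.+1%:R) (x%:R) (d * m.+1%:R) => a b c; clear; split; lra.
  apply: (@bohr_cyclic m d x D0 D2 hx); apply/RleP; rewrite !RealsE //.
have q0 : 0 < m.+1%:R :> R by rewrite ltr0n.
have NR : 0 < N%:R :> R by rewrite ltr0n.
have T := transfer_count N1 NM MN hk AN pm.1 pm.2 mud.
exists (lift_weight N mu); split.
- by move=> z; apply: lift_weight_ge0; exact: pm.1.
- by rewrite /weight_mean (lift_weight_mean N1 NM MN pm.2); apply: mulVf; rewrite pnatr_eq0.
- move=> z; rewrite /lift_weight; case: ifP => _; last by rewrite mulr_ge0 // ltW.
  apply: (@le_trans _ _ ((2 * N).+1%:R * (K / m.+1%:R))).
    by apply: ler_wpM2l; [rewrite ler0n|have := muK (res m z); rewrite q_cyclic].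
  rewrite mulrA ler_pdivrMr // [3 * K]mulrC -mulrA [leLHS]mulrC ler_pM2l // -natrM ler_nat.
  by apply: (@leq_trans (3 * N)); [rewrite -(addn1 (2 * N)) (mulSn 2) addnC leq_add2r|rewrite leq_mul2l ltnW].
have Ef : (q (cyclic_env m))^-1 * \sum_x f x = m.+1%:R^-1 * \sum_(i < N) ind A (Z.add 1 (Z.of_nat i)).
  rewrite q_cyclic; congr (_ * _); apply: (interval_sum N1 NM MN hk (g := ind A)) => z.
  by rewrite /ind; case E : (A z); [left; exact: AN|right].
have p0 : 0 <= (q (cyclic_env m))^-1 * \sum_x f x.
  by rewrite Ef mulr_ge0 ?invr_ge0 ?ler0n // sumr_ge0 // => i _; case/andP: (ind01 A (Z.add 1 (Z.of_nat i))).
have k4 : (k <= 4)%N by case/andP: hk.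
have D1 : al ^+ k - 108 * e <= ((q (cyclic_env m))^-1 * \sum_x f x) ^+ k.
  apply: density_arith => //; rewrite Ef; apply: (@le_trans _ _ (m.+1%:R^-1 * (al * N%:R))); last by rewrite ler_pM2l ?invr_gt0.
  rewrite mulrC ler_pdivlMr // mulrBl lerBlDr.
  have h1 : m.+1%:R <= N%:R + (J`!).+1%:R :> R by rewrite -natrD ler_nat.
  have h2 : al * m.+1%:R <= al * (N%:R + (J`!).+1%:R) by rewrite ler_pM2l.
  apply: (le_trans h2); rewrite mulrDr lerD2l; apply: (@le_trans _ _ (J`!).+1%:R); first by rewrite ler_piMl ?ler0n // ltW.
  apply: (le_trans eN); rewrite ler_pM2l // ler_nat; exact: ltnW.
have D3 : al ^+ k - 908 * e <= Re (apn (X := cyclic_env m) mu (pad (X := cyclic_env m) k f)).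
  by apply: (le_trans _ Hmu); move: D1; move: (al ^+ k) ((_ * _) ^+ k) => a b; clear; lra.
have e2 : 6 * d <= e by rewrite /d; move: e0; clear; lra.
move: T D3; set T := Re _ => T1 D3.
have {}T1 : m.+1%:R * (T - 6 * d) <= N%:R * popular A k N (lift_weight N mu).
  by rewrite /popular mulVKf ?gt_eqF.
(* Normalising by N instead of M raises the count only if T - 6 d is nonnegative; otherwise the
   claimed lower bound is negative. *)
have [h|h] := lerP 0 (T - 6 * d); last first.
  apply: (le_trans _ (popular_ge0 A k N (fun z => lift_weight_ge0 N z pm.1))).
  by move: h D3 e2 e0; clear; lra.
have h3 : N%:R * (T - 6 * d) <= m.+1%:R * (T - 6 * d) by rewrite ler_wpM2r // ler_nat ltnW.
have h4 : T - 6 * d <= popular A k N (lift_weight N mu) by rewrite -(ler_pM2l NR) (le_trans h3).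
by apply: (le_trans _ h4); move: D3 e2 e0; clear; lra.
Qed.

Theorem main : exists C : R, forall (k : nat) (alpha eps : R),
    (le 1 k /\ le k 4) -> (Rlt 0 alpha /\ Rlt alpha 1) -> Rlt 0 eps ->
    exists K : R, forall (N : Z) (A : Z -> bool), Z.le 1 N ->
      (forall n : Z, A n = true -> Z.le 1 n /\ Z.le n N) ->
      Rge (cardN A N) (Rmult alpha (IZR N)) ->
      exists mu : Z -> R,
        (forall d : Z, Rle 0 (mu d)) /\
        Rle (Rabs (Rminus (avgZ (Z.opp N) N mu) 1)) (Rmult C eps) /\
        (forall d : Z, (Z.le (Z.opp N) d /\ Z.le d N) -> Rle (mu d) K) /\
        Rge (avgZ 1 N (fun n => avgZ (Z.opp N) N (fun d => Rmult (approd A n d k) (mu d))))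
          (Rminus (pow alpha k) (Rmult C eps)).
Proof.
have [C CE] : exists C : R, C = (GRing.one R) *+ 1000 by eexists.
exists C => k al eps [k1 k4] [/RltP al0 /RltP al1] /RltP eps0.
rewrite R0E in al0 eps0; rewrite R1E in al1.
(* The counting argument assumes e <= 1; taking the minimum with 1 only strengthens the claim. *)
pose e : R := Num.min eps (GRing.one R).
have e0 : 0 < e by rewrite lt_min eps0 ltr01.
have e1 : e <= 1 by rewrite ge_min lexx orbT.
have ee : e <= eps by rewrite ge_min lexx.
have hk : (0 < k <= 4)%N by apply/andP; split; apply/ssrnat.leP.
have [K [N0 [K0 HK]]] := large_case hk e0 e1.
(* The second summand covers the point mass used when N < N0. *)
exists (K + (2 * N0).+1%:R) => N A N1 AN /Rge_le /RleP hA.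
have NE : N = Z.of_nat (Z.to_nat N) by rewrite Z2Nat.id //; apply: Z.le_trans N1.
move: (Z.to_nat N) NE N1 AN hA => n -> /of_nat_pos n0 AN hA.
have cE : cardN A (Z.of_nat n) = \sum_(i < n) ind A (Z.add 1 (Z.of_nat i)).
  by rewrite /cardN /sumZ sumZ_fromE interval_width Nat2Z.id.
have hA' : al * n%:R <= \sum_(i < n) ind A (Z.add 1 (Z.of_nat i)) by rewrite -cE -IZR_of_nat.
have [mu [h1 h2 h3 h4]] : exists mu : Z -> R, [/\ forall d, 0 <= mu d, weight_mean n mu = 1,
    forall d, mu d <= K + (2 * N0).+1%:R & al ^+ k - 1000 * e <= popular A k n mu].
  case: (leqP N0 n) => hN.
    have [mu [h1 h2 h3 h4]] := HK n A al n0 hN al0 al1 AN hA'.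
    by exists mu; split => // d; apply: (le_trans (h3 d)); rewrite lerDl ler0n.
  have [mu [h1 h2 h3 h4]] := small_case (proj1 (andP hk)) n0 al0 al1 hA'.
  exists mu; split => //.
    move=> d; apply: (le_trans (h3 d)); rewrite -[leLHS]add0r; apply: lerD; first exact: ltW.
    by rewrite ler_nat ltnS leq_mul2l /= ltnW.
  by apply: le_trans h4; rewrite gerBl mulr_ge0 // ltW.
have E1 (g : Z -> R) : avgZ (Z.opp (Z.of_nat n)) (Z.of_nat n) g = (2 * n).+1%:R^-1 * \sum_(i < (2 * n).+1) g (Z.add (Z.opp (Z.of_nat n)) (Z.of_nat i)).
  exact: avgZE (symmetric_width n).
exists mu; split; [|split; [|split]].
- by move=> d; apply/RleP; exact: h1.
- have -> : avgZ (Z.opp (Z.of_nat n)) (Z.of_nat n) mu = GRing.one R by rewrite E1; exact: h2.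
  apply/RleP; rewrite R1E RminusE subrr RabsE normr0 RmultE; apply: mulr_ge0; last exact: ltW.
  by rewrite CE; exact: ler0n.
- by move=> d _; apply/RleP; exact: h3.
have E2 : avgZ 1 (Z.of_nat n) (fun n' => avgZ (Z.opp (Z.of_nat n)) (Z.of_nat n) (fun d => Rmult (approd A n' d k) (mu d))) = popular A k n mu.
  by rewrite (avgZE _ (interval_width n)) /popular; congr (_ * _); apply: eq_bigr => i _; rewrite E1.
rewrite E2; apply: Rle_ge; apply/RleP; apply: le_trans h4; rewrite RminusE RpowE RmultE CE lerD2l lerN2.
by apply: ler_wpM2l => //; exact: ler0n.
Qed.

End PopularDifferences.

Theorem mainTheorem4 :
  exists C : R,
  forall (k : nat) (alpha eps : R),
    (1 <= k <= 4)%nat -> 0 < alpha < 1 -> 0 < eps ->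
    exists K : R,
    forall (N : Z) (A : Z -> bool),
      (1 <= N)%Z ->
      (forall n : Z, A n = true -> (1 <= n <= N)%Z) ->
      cardN A N >= alpha * IZR N ->
      exists mu : Z -> R,
        (forall d : Z, 0 <= mu d) /\
        Rabs (avgZ (- N) N mu - 1) <= C * eps /\
        (forall d : Z, (- N <= d <= N)%Z -> mu d <= K) /\
        avgZ 1 N (fun n => avgZ (- N) N (fun d => approd A n d k * mu d))
          >= alpha ^ k - C * eps.
Proof. exact PopularDifferences.main. Qed.
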